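(* Let $\Omega:\mathbb V^{\otimes d}\to\mathbb Q(v)\otimes_{\mathcal A}\mathbf T_d$ be the $\mathbb Q(v)$-linear isomorphism $\mathtt v_{r_1}\otimes\cdots\otimes\mathtt v_{r_d}\mapsto\tilde e_{r_1\cdots r_d}$. Under the identification $\Omega$ there is a commutative diagram of double centralizing actions $$\begin{array}{ccccc}\mathbb Q(v)\otimes_{\mathcal A}\mathbf K^{\jmath}&\circlearrowright&\mathbb Q(v)\otimes_{\mathcal A}\mathbf T_d&\circlearrowleft&\mathbb Q(v)\otimes_{\mathcal A}\mathbf H_{B_d}\\ \aleph\uparrow&&\Omega\uparrow&&\parallel\\ \dot{\mathbf U}^{\jmath}&\circlearrowright&\mathbb V^{\otimes d}&\circlearrowleft&\mathbb Q(v)\otimes_{\mathcal A}\mathbf H_{B_d}\end{array}$$ that is, $\Omega(u\,x)=\aleph(u)\,\Omega(x)$ and $\Omega(x\,T)=\Omega(x)\,T$ for all $u\in\dot{\mathbf U}^{\jmath}$, $x\in\mathbb V^{\otimes d}$, $T\in\mathbb Q(v)\otimes\mathbf H_{B_d}$; and in both rows the two actions commute and form double centralizers (the image of each algebra in the $\mathbb Q(v)$-linear endomorphism algebra is the full centralizer of the image of the other).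
   Context: Let $\mathcal A=\mathbb Z[v,v^{-1}]$, $n,d\ge1$, $N=2n+1$, $D=2d+1$; $\mathbb N=\{0,1,2,\dots\}$, $|U|=\dim U$. **Geometry.** For an odd prime power $q$ equip $\mathbb F_q^D$ with a nondegenerate symmetric bilinear form with isometry group $O(D)$. $X$ is the set of flags $V=(0=V_0\subseteq\cdots\subseteq V_N=\mathbb F_q^D)$ with $V_i=V_{N-i}^\perp$; $Y$ is the set of complete flags $F=(0=F_0\subset F_1\subset\cdots\subset F_D=\mathbb F_q^D)$ with $F_i=F_{D-i}^\perp$. $O(D)$-orbits on $X\times X$ are indexed by the set $\Xi_d$ of $N\times N$ matrices over $\mathbb N$ with $\sum a_{ij}=D$, $a_{ij}=a_{N+1-i,N+1-j}$, via $a_{ij}=|(V_{i-1}+V_i\cap V'_j)/(V_{i-1}+V_i\cap V'_{j-1})|$. $O(D)$-orbits on $X\times Y$ are indexed by sequences $r_1\cdots r_d$ with $r_c\in[1,N]$: for $(V,F)$, $r_c$ ($1\le c\le D$) is the unique $i$ with $|(V_{i-1}+V_i\cap F_c)/(V_{i-1}+V_i\cap F_{c-1})|=1$; one has $r_{D+1-c}=N+1-r_c$. Let $\mathbf S^{\jmath},\mathbf T_d,\mathbf H_{B_d}$ be the free $\mathcal A$-modules of $O(D)$-invariant $\mathcal A$-valued functions on $X\times X$, $X\times Y$, $Y\times Y$ with convolution: $(f*g)(x,z)=\sum_yf(x,y)g(y,z)$, structure constants being the polynomials in $v^2$ which at $v=\sqrt q$ give the counts over $\mathbb F_q$. So $\mathbf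 S^{\jmath}$ and $\mathbf H_{B_d}$ are algebras and $\mathbf T_d$ is an $(\mathbf S^{\jmath},\mathbf H_{B_d})$-bimodule. $e_A$, $e_{r_1\cdots r_d}$ denote characteristic functions of orbits; $T_j\in\mathbf H_{B_d}$ $(1\le j\le d)$ is the characteristic function of $\{(F,F'):F_i=F'_i\ \forall i\in[1,d]\setminus\{j\},\ F_j\ne F'_j\}$; $\mathbf H_{B_d}$ is the Iwahori–Hecke algebra of type $B_d$ with generators $T_j$, $(T_j-v^2)(T_j+1)=0$. In $\mathbf S^{\jmath}$, $[A]=v^{-d_A}e_A$ with $$d_A=\sum_{i>k,\,j<l,\,i+k<N+1}a_{ij}a_{kl}+\sum_{j<l,\ (i<n+1\text{ or }j<N+1-l)}a_{ij}a_{il}+\sum_{i\ge n+1>j}\tfrac{a_{ij}(a_{ij}-1)}2 .$$ Normalized basis of $\mathbf T_d$: $\tilde e_{r_1\cdots r_d}=v^{\#\{(c,c'):\,c,c'\in[1,d],\,c<c',\,r_c<r_{c'}\}+\epsilon}\,e_{r_1\cdots r_d}$, where $\epsilon=1$ if $r_d<n+1$ and $\epsilon=0$ otherwise. **$\mathbf K^{\jmath}$.** $\tilde\Xi$: integer $N\times N$ matrices with $a_{ij}\ge0$ $(i\ne j)$, $a_{n+1,n+1}$ odd, $a_{ij}=a_{N+1-i,N+1-j}$; $\tilde\Xi^{\mathrm{diag}}$: diagonal ones, $\lambda=\mathrm{diag}(\lambda_1,\dots,\lambda_N)$. $E^\theta_{ij}=E_{ij}+E_{N+1-i,N+1-j}$.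 $\mathbf K^{\jmath}$ is the free $\mathcal A$-module on $[A]$, $A\in\tilde\Xi$, with product $[A_1]\cdots[A_f]=\sum_iG_i(v,1)[Z_i]$, where $G_i\in\mathbb Q(v)[v']$, $Z_i\in\tilde\Xi$ satisfy $[A_1+2pI]*\cdots*[A_f+2pI]=\sum_iG_i(v,v^{-2p})[Z_i+2pI]$ in the Schur algebras (varying $d$) for all $p\gg0$ (product zero if column sums of some $A_i$ differ from row sums of $A_{i+1}$). $\mathbf K^{\jmath}$ acts on $\mathbf T_d$ through the surjective algebra homomorphism $\phi_d:\mathbf K^{\jmath}\to\mathbf S^{\jmath}$ determined by $[A]\mapsto[A]$ if $A\in\Xi_d$ and $0$ otherwise, for $A=\lambda+RE^\theta_{i,i+1}$ or $\lambda+RE^\theta_{i+1,i}$ ($\lambda\in\tilde\Xi^{\mathrm{diag}}$, $R\ge0$, $1\le i\le n$). **$\dot{\mathbf U}^{\jmath}$.** $\mathbf U^{\jmath}$ is the $\mathbb Q(v)$-algebra generated by $e_i,f_i$ $(1\le i\le n)$, $d_a^{\pm1}$ $(1\le a\le n+1)$ with relations ($\llbracket2\rrbracket=v+v^{-1}$): $d_ad_a^{-1}=d_a^{-1}d_a=1$; $d_ad_b=d_bd_a$; $d_ae_jd_a^{-1}=v^{-\delta_{a,j+1}-\delta_{N+1-a,j+1}+\delta_{a,j}}e_j$; $d_af_jd_a^{-1}=v^{-\delta_{a,j}+\delta_{a,j+1}+\delta_{N+1-a,j+1}}f_j$; $e_if_j-f_je_i=\delta_{i,j}\frac{d_id_{i+1}^{-1}-d_i^{-1}d_{i+1}}{v-v^{-1}}$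 unless $i=j=n$; $e_i^2e_j+e_je_i^2=\llbracket2\rrbracket e_ie_je_i$, $f_i^2f_j+f_jf_i^2=\llbracket2\rrbracket f_if_jf_i$ if $|i-j|=1$; $e_ie_j=e_je_i$, $f_if_j=f_jf_i$ if $|i-j|>1$; $f_n^2e_n+e_nf_n^2=\llbracket2\rrbracket(f_ne_nf_n-(vd_nd_{n+1}^{-1}+v^{-1}d_n^{-1}d_{n+1})f_n)$; $e_n^2f_n+f_ne_n^2=\llbracket2\rrbracket(e_nf_ne_n-e_n(vd_nd_{n+1}^{-1}+v^{-1}d_n^{-1}d_{n+1}))$. $\dot{\mathbf U}^{\jmath}=\bigoplus_{\lambda,\lambda'\in\tilde\Xi^{\mathrm{diag}}}\mathbf U^{\jmath}/(\sum_a(d_a-v^{-\lambda_a})\mathbf U^{\jmath}+\sum_a\mathbf U^{\jmath}(d_a-v^{-\lambda'_a}))$ is its modified form (Lusztig's product), with idempotents $D_\lambda$. $\aleph:\dot{\mathbf U}^{\jmath}\to\mathbb Q(v)\otimes\mathbf K^{\jmath}$ is the algebra isomorphism with $D_\lambda\mapsto[\lambda]$, $e_iD_\lambda\mapsto[\lambda-E^\theta_{ii}+E^\theta_{i+1,i}]$, $f_iD_\lambda\mapsto[\lambda-E^\theta_{i+1,i+1}+E^\theta_{i,i+1}]$. **Tensor space.** $\mathbf U(\mathfrak{gl}(N))$ is the quantum group with generators $E_i,F_i$ $(1\le i<N)$, $K_a^{\pm1}$ $(1\le a\le N)$, $K_aE_iK_a^{-1}=v^{\delta_{a,i}-\delta_{a,i+1}}E_i$,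 etc. Its natural module $\mathbb V$ has standard basis $\mathtt v_1,\dots,\mathtt v_N$ with $K_a\mathtt v_r=v^{\delta_{a,r}}\mathtt v_r$, $E_i\mathtt v_{i+1}=\mathtt v_i$, $F_i\mathtt v_i=\mathtt v_{i+1}$ (other actions of $E_i$, $F_i$ zero). Coproduct: $E_i\mapsto1\otimes E_i+E_i\otimes K_iK_{i+1}^{-1}$, $F_i\mapsto F_i\otimes1+K_i^{-1}K_{i+1}\otimes F_i$, $K_a\mapsto K_a\otimes K_a$. $\mathbf U^{\jmath}$ acts on $\mathbb V^{\otimes d}$ through the embedding $\mathbf U^{\jmath}\to\mathbf U(\mathfrak{gl}(N))$: $d_i\mapsto K_i^{-1}K_{N+1-i}^{-1}$, $e_i\mapsto F_i+K_i^{-1}K_{i+1}E_{N-i}$, $f_i\mapsto E_iK_{N-i}^{-1}K_{N+1-i}+F_{N-i}$ $(1\le i\le n)$, $d_{n+1}\mapsto v^{-1}K_{n+1}^{-2}$; $\dot{\mathbf U}^{\jmath}$ acts with $D_\lambda$ projecting onto $\{x:d_ax=v^{-\lambda_a}x\ \forall a\in[1,n+1]\}$. The right $\mathbf H_{B_d}$-action on $\mathbb V^{\otimes d}$, with $\mathtt v_r=\mathtt v_{r_1}\otimes\cdots\otimes\mathtt v_{r_d}$: for $1\le j\le d-1$, letting $r'$ be $r$ with $r_j,r_{j+1}$ swapped, $\mathtt v_rT_j=v\mathtt v_{r'}$ if $r_j<r_{j+1}$, $v^2\mathtt v_r$ if $r_j=r_{j+1}$, $(v^2-1)\mathtt v_r+v\mathtt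 v_{r'}$ if $r_j>r_{j+1}$; letting $r''$ be $r$ with $r_d$ replaced by $N+1-r_d$, $\mathtt v_rT_d=v\mathtt v_{r''}$ if $r_d<n+1$, $v^2\mathtt v_r$ if $r_d=n+1$, $(v^2-1)\mathtt v_r+v\mathtt v_{r''}$ if $r_d>n+1$.
   Formalization: The printed exponent of v in the normalized basis ẽ_r does not intertwine T_j for any d≥2; it is replaced by #{c<c': r_c<r_c'} + #{c<c': r_c+r_c'<N+1} + #{c: r_c<n+1} with c,c' in [1,d], which agrees with the printed one for d=1. *)

(* Defs.v *)
From HB Require Import structures.
From mathcomp Require Import all_boot all_order all_algebra all_fingroup.
From mathcomp Require Import fraction generic_quotient ring_quotient.
From mathcomp Require Import finmap.
From mathcomp Require Import boolp classical_sets.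
From mathcomp Require Import monalg.

Set Implicit Arguments.
Unset Strict Implicit.
Unset Printing Implicit Defensive.

Import Order.TTheory GRing.Theory Num.Theory.

Local Open Scope ring_scope.
Local Open Scope quotient_scope.

(* The field Q(v).  All modules below are taken over Q(v): the base change of
   a free Z[v, v^-1]-module is presented on the same basis. *)

Definition Qv : fieldType := {fraction {poly rat}}.
Definition v : Qv := tofrac 'X.

(* N and D are kept in successor form; indices are 0-based, so the index
   i : 'I_N stands for i.+1 in [1, N], rev_ord i for N + 1 - i, and
   [ix n k] is the index written k in [1, N]. *)

Definition NN (n : nat) : nat := (n.*2).+1.
Definition DD (d : nat) : nat := (d.*2).+1.

Definition ix (n k : nat) : 'I_(NN n) := inord k.-1.

(******************************************************************************)
(*                               Geometry                                     *)
(******************************************************************************)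

Section Geometry.
Variables (F : finFieldType) (D : nat) (Q : 'M[F]_D).
Implicit Types (m k : nat).

(* Subspaces of F^D are row spaces; to get one matrix per subspace the members
   of a flag are required to be in the normal form <<_>>. *)

Definition perp (W : 'M[F]_D) : 'M[F]_D := kermx (Q *m W^T).

Definition flag m := {ffun 'I_m.+1 -> 'M[F]_D}.

(* The subspaces just below and just above step i of the flag. *)
Definition below m (f : flag m) (i : 'I_m) := f (widen_ord (leqnSn m) i).
Definition above m (f : flag m) (i : 'I_m) := f (lift ord0 i).

Definition flags m : {set flag m} :=
  [set f : flag m |
    [&& [forall i, <<f i>>%MS == f i],
        f ord0 == 0, f ord_max == 1%:M,
        [forall i, (below f i <= above f i)%MS]
      & [forall i, (f i == perp (f (rev_ord i)))%MS]]].

Definition complete_flags m : {set flag m} :=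
  [set f in flags m | [forall i, (below f i < above f i)%MS]].

Definition relpos m k (f : flag m) (g : flag k) : 'M[nat]_(m, k) :=
  \matrix_(i, j)
    (\rank (below f i + (above f i :&: above g j))%MS
     - \rank (below f i + (above f i :&: below g j))%MS)%N.

End Geometry.

Definition nondeg_form (F : finFieldType) D (Q : 'M[F]_D) : Prop :=
  [/\ odd #|F|, Q^T = Q & Q \in unitmx].

Definition flag_family (D m : nat) :=
  forall (F : finFieldType) (Q : 'M[F]_D), {set flag F D m}.

Definition flagsX (n d : nat) : flag_family (DD d) (NN n) :=
  fun F Q => flags Q (NN n).
Definition flagsY (d : nat) : flag_family (DD d) (DD d) :=
  fun F Q => complete_flags Q (DD d).

Section StructureConstants.
Variables (D m1 m2 m3 : nat).
Variables (P1 : flag_family D m1) (P2 : flag_family D m2)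
          (P3 : flag_family D m3).

(* O_A is the set of pairs of flags of relative position A; these sets are the
   orbits of the isometry group on pairs of flags.
   p(q) is the number of y with (x, y) in O_A and (y, z) in O_B, for any
   (x, z) in O_C over any field with q elements. *)
Definition counts (A : 'M[nat]_(m1, m2)) (B : 'M[nat]_(m2, m3))
    (C : 'M[nat]_(m1, m3)) (p : {poly int}) : Prop :=
  forall (F : finFieldType) (Q : 'M[F]_D), nondeg_form Q ->
  forall x z, x \in P1 Q -> z \in P3 Q -> relpos x z = C ->
    p.[(#|F|)%:Z]
    = (#|[set y in P2 Q | (relpos x y == A) && (relpos y z == B)]|)%:Z.

(* The structure constant, as an element of Z[v^2]. *)
Definition strc A B C : Qv :=
  (map_poly intr (xget 0 [set p | counts A B C p]%classic)).[v ^+ 2].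

End StructureConstants.

(******************************************************************************)
(*            The convolution modules S, T, H over Q(v)                       *)
(******************************************************************************)

Section Convolution.
Variables (n d : nat).
Notation N := (NN n).
Notation D := (DD d).

Definition in_Xi (A : 'M['I_D.+1]_N) : bool :=
  (\sum_i \sum_j (A i j : nat) == D)%N
  && [forall i, forall j, A i j == A (rev_ord i) (rev_ord j)].

Definition Xi := {A : 'M['I_D.+1]_N | in_Xi A}.
Definition xi_nat (A : Xi) : 'M[nat]_N := \matrix_(i, j) (val A i j : nat).
Definition xi_int (A : Xi) : 'M[int]_N := \matrix_(i, j) (val A i j)%:Z.

Definition seqs := {ffun 'I_d -> 'I_N}.

(* The full sequence r_1 ... r_D. *)
Definition ext_seq (r : seqs) (c : 'I_D) : 'I_N :=
  match insub (c : nat), insub (rev_ord c : nat) with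
  | Some c', _ => r c'
  | None, Some c' => rev_ord (r c')
  | None, None => ix n n.+1
  end.
Definition seq_mx (r : seqs) : 'M[nat]_(N, D) :=
  \matrix_(i, c) (i == ext_seq r c : nat).

(* O(D)-orbits on Y x Y: relative positions are the centrally symmetric
   permutation matrices, i.e. the Weyl group of type B_d. *)
Definition weylB :=
  {w : {perm 'I_D} | [forall i, w (rev_ord i) == rev_ord (w i)]}.
Definition weyl_mx (w : weylB) : 'M[nat]_D :=
  \matrix_(i, j) (val w i == j : nat).

Definition QS := {ffun Xi -> Qv^o}.
Definition QT := {ffun seqs -> Qv^o}.
Definition QH := {ffun weylB -> Qv^o}.

Definition mulS (f g : QS) : QS :=
  [ffun C => \sum_A \sum_B f A * g B *
     strc (@flagsX n d) (@flagsX n d) (@flagsX n d)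
          (xi_nat A) (xi_nat B) (xi_nat C)].

Definition actST (f : QS) (t : QT) : QT :=
  [ffun s => \sum_A \sum_r f A * t r *
     strc (@flagsX n d) (@flagsX n d) (@flagsY d)
          (xi_nat A) (seq_mx r) (seq_mx s)].

Definition actTH (t : QT) (h : QH) : QT :=
  [ffun s => \sum_r \sum_w t r * h w *
     strc (@flagsX n d) (@flagsY d) (@flagsY d)
          (seq_mx r) (weyl_mx w) (seq_mx s)].

Definition mulH (g h : QH) : QH :=
  [ffun u => \sum_w \sum_w' g w * h w' *
     strc (@flagsY d) (@flagsY d) (@flagsY d)
          (weyl_mx w) (weyl_mx w') (weyl_mx u)].

Definition oneH : QH := [ffun w => (val w == 1%g)%:R].

(* The characteristic function of the (F, F') that differ exactly in the j-th
   step among 1, ..., d. *)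
Definition genT (j : 'I_d) : QH :=
  [ffun w => (`[< forall (F : finFieldType) (Q : 'M[F]_D), nondeg_form Q ->
                forall x y, x \in flagsY Q -> y \in flagsY Q ->
                relpos x y = weyl_mx w ->
                forall i : 'I_D.+1, (1 <= i <= d)%N ->
                  (x i == y i) = (i != j.+1 :> nat) >])%:R].

Definition dA (A : 'M[int]_N) : int :=
  \sum_(i : 'I_N) \sum_(j : 'I_N) \sum_(k : 'I_N)
     \sum_(l : 'I_N | [&& k < i, j < l & i.+1 + k.+1 < N.+1]%N)
       A i j * A k l
  + \sum_(i : 'I_N) \sum_(j : 'I_N)
     \sum_(l : 'I_N | (j < l)%N
                      && ((i.+1 < n.+1)%N || (j.+1 < N.+1 - l.+1)%N))
       A i j * A i l
  + \sum_(i : 'I_N | (n.+1 <= i.+1)%N) \sum_(j : 'I_N | (j.+1 < n.+1)%N)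
       (A i j * (A i j - 1) %/ 2)%Z.

Definition xi_has (A : 'M[int]_N) : bool := [exists B : Xi, xi_int B == A].

(* [A] in S if A belongs to Xi_d, and 0 otherwise. *)
Definition stdS (A : 'M[int]_N) : QS :=
  [ffun B => if xi_int B == A then v ^ (- dA A) else 0].

(* The number of positive roots of type B_d that r inverts.  The pairs with
   r_c + r_c' < N + 1 and the indices c <> d with r_c < n + 1 have to be counted
   for the T_j to act on the normalized basis as they do on the v_r. *)
Definition texp (r : seqs) : nat :=
  (\sum_(c < d) \sum_(c' < d | c < c') (r c < r c')
   + \sum_(c < d) \sum_(c' < d | c < c') ((r c).+1 + (r c').+1 < N.+1)
   + \sum_(c < d) ((r c).+1 < n.+1))%N.

Definition tstd (r : seqs) : QT :=
  [ffun s => if s == r then v ^+ texp r else 0].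

End Convolution.

(******************************************************************************)
(*                        The stabilization algebra K                         *)
(******************************************************************************)

Section StabilizationAlgebra.
Variable n : nat.
Notation N := (NN n).

Definition in_Xit (A : 'M[int]_N) : bool :=
  [&& [forall i, forall j, (i != j) ==> (0 <= A i j)],
      ~~ (2 %| A (ix n n.+1) (ix n n.+1))%Z
    & [forall i, forall j, A i j == A (rev_ord i) (rev_ord j)]].

Definition Xit := {A : 'M[int]_N | in_Xit A}.

Definition QK := {malg Qv[Xit]}.

Definition stdK (A : 'M[int]_N) : QK :=
  if insub A is Some A' then << (A' : Xit) >> else 0.

Definition shift2p (p : nat) (A : 'M[int]_N) : 'M[int]_N := A + (p.*2)%:Z%:M.

(* x = \sum_i G_i(v, 1) [Z_i], where
   [A + 2pI] * [B + 2pI] = \sum_i G_i(v, v^(-2p)) [Z_i + 2pI] for all p >> 0,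
   in the Schur algebra with the d such that A + 2pI, B + 2pI are in Xi_d. *)
Definition stabilizes (A B : Xit) (x : QK) : Prop :=
  exists G : seq ({poly Qv} * Xit),
    x = \sum_(g <- G) g.1.[1] *: << g.2 >> /\
    exists p0 : nat, forall p d : nat, (p0 <= p)%N ->
      xi_has d (shift2p p (val A)) -> xi_has d (shift2p p (val B)) ->
      (forall g, g \in G -> xi_has d (shift2p p (val g.2))) /\
      mulS (stdS d (shift2p p (val A))) (stdS d (shift2p p (val B)))
      = \sum_(g <- G) g.1.[v ^- (p.*2)] *: stdS d (shift2p p (val g.2)).

Definition composable (A B : Xit) : bool :=
  [forall j, \sum_i val A i j == \sum_i val B j i].

(* The product of two basis elements; it determines the products of more
   factors, since stabilization is compatible with iteration. *)
Definition mul_stdK (A B : Xit) : QK :=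
  if composable A B then xget 0 [set x | stabilizes A B x]%classic else 0.

Definition mulK (x y : QK) : QK :=
  \sum_(A <- msupp x) \sum_(B <- msupp y) (x@_A * y@_B) *: mul_stdK A B.

Definition in_Xit_diag (A : 'M[int]_N) : bool := in_Xit A && is_diag_mx A.

(* E^theta_{ij}, with i and j in [1, N]. *)
Definition Eth (i j : nat) : 'M[int]_N :=
  delta_mx (ix n i) (ix n j) + delta_mx (rev_ord (ix n i)) (rev_ord (ix n j)).

(* phi_d, extended to Q(v). *)
Definition is_phi d (phi : {linear QK -> QS n d}) : Prop :=
  [/\ forall x y, phi (mulK x y) = mulS (phi x) (phi y),
      forall s, exists x, phi x = s,
      forall lam R i, in_Xit_diag lam -> (1 <= i <= n)%N ->
        phi (stdK (lam + Eth i i.+1 *+ R)) = stdS d (lam + Eth i i.+1 *+ R)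
    & forall lam R i, in_Xit_diag lam -> (1 <= i <= n)%N ->
        phi (stdK (lam + Eth i.+1 i *+ R)) = stdS d (lam + Eth i.+1 i *+ R)].

Definition actQK d (phi : {linear QK -> QS n d}) (x : QK) (t : QT n d) : QT n d :=
  actST (phi x) t.

End StabilizationAlgebra.

(******************************************************************************)
(*           Quotients: modules by submodules, algebras by ideals             *)
(******************************************************************************)

Record submodule (K : comNzRingType) (V : lmodType K) := Submodule {
  in_sub :> V -> Prop;
  sub_zero : in_sub 0;
  sub_linear : forall c x y, in_sub x -> in_sub y -> in_sub (c *: x + y)
}.

Section QuotientModule.
Variables (K : comNzRingType) (V : lmodType K) (W : submodule V).

Definition sub_pred : {pred V} := fun x => `[< W x >].

Fact sub_pred_zmod : zmod_closed sub_pred.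
Proof.
split=> [|x y]; first exact/asboolP/sub_zero.
move=> /asboolP Wx /asboolP Wy; apply/asboolP.
by rewrite -[x]scale1r addrC -scaleN1r; apply: sub_linear; rewrite ?scale1r.
Qed.
HB.instance Definition _ := GRing.isZmodClosed.Build V sub_pred sub_pred_zmod.

Definition lquot := Quotient.quot (sub_pred : zmodClosed V).
HB.instance Definition _ := GRing.Zmodule.on lquot.
HB.instance Definition _ := EqQuotient.on lquot.
Definition lpi (x : V) : lquot := \pi_lquot x.

Lemma lpi_eqP (x y : V) : W (x - y) <-> lpi x = lpi y.
Proof.
have -> : (lpi x = lpi y) <-> (x - y \in (sub_pred : zmodClosed V)).
  by rewrite Quotient.idealrBE; split=> [/eqP|/eqP].
by split=> [|/asboolP]; first move/asboolP.
Qed.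

Lemma lpiK x : lpi (repr x) = x. Proof. exact: reprK. Qed.
Lemma lpiD x y : lpi (x + y) = lpi x + lpi y. Proof. exact: raddfD. Qed.

Lemma lpi_repr x : W (repr (lpi x) - x).
Proof. by apply/lpi_eqP; rewrite lpiK. Qed.

Fact qscale_key : unit. Proof. by []. Qed.
Definition qscale : K -> lquot -> lquot :=
  locked_with qscale_key (fun c x => lpi (c *: repr x)).

Lemma qscale_pi c x : qscale c (lpi x) = lpi (c *: x).
Proof.
rewrite /qscale unlock; apply/lpi_eqP; rewrite -scalerBr -[_ *: _]addr0.
by apply: sub_linear; [exact: lpi_repr | exact: sub_zero].
Qed.

Fact qscaleA a b x : qscale a (qscale b x) = qscale (a * b) x.
Proof. by rewrite -[x]lpiK !qscale_pi scalerA. Qed.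
Fact qscale1 : left_id 1 qscale.
Proof. by move=> x; rewrite -[x]lpiK !qscale_pi scale1r. Qed.
Fact qscaleDr : right_distributive qscale +%R.
Proof.
move=> c x y; rewrite -[x]lpiK -[y]lpiK -lpiD !qscale_pi.
by rewrite scalerDr lpiD.
Qed.
Fact qscaleDl x : {morph qscale^~ x : a b / a + b}.
Proof. by move=> a b; rewrite -[x]lpiK !qscale_pi scalerDl lpiD. Qed.

HB.instance Definition _ :=
  GRing.Zmodule_isLmodule.Build K lquot qscaleA qscale1 qscaleDr qscaleDl.

End QuotientModule.

Section FreeAlgebra.
Variables (K : comNzRingType) (G : choiceType).

Definition falg := {malg K[{fmonom G}]}.
HB.instance Definition _ := GRing.Lalgebra.on falg.

Fact falg_scaleAr (c : K) (x y : falg) : c *: (x * y) = x * (c *: y).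
Proof.
have cx : x * malgC c = c *: x.
  apply/malgP => m; rewrite malgM_def fgmulgU mcoeffZ [x in RHS]monalgE.
  rewrite !raddf_sum mulr_sumr; apply: eq_bigr => k _ /=.
  by rewrite mulm1 !mcoeffU mulrnAr mulrC.
by rewrite -[c *: y]mul_malgC [RHS]mulrA cx scalerAl.
Qed.
HB.instance Definition _ := GRing.Lalgebra_isAlgebra.Build K falg falg_scaleAr.

End FreeAlgebra.

Section QuotientAlgebra.
Variables (K : comNzRingType) (A : algType K) (R : A -> Prop).

(* The two-sided ideal generated by R. *)
Definition ideal_gen (x : A) : Prop :=
  forall J : submodule A, (forall r, R r -> J r) ->
    (forall a y, J y -> J (a * y)) -> (forall a y, J y -> J (y * a)) -> J x.

Fact ideal_gen0 : ideal_gen 0.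
Proof. by move=> J _ _ _; exact: sub_zero. Qed.
Fact ideal_gen_linear c x y :
  ideal_gen x -> ideal_gen y -> ideal_gen (c *: x + y).
Proof.
by move=> Ix Iy J hR hl hr; apply: sub_linear; [exact: (Ix J hR hl hr) | exact: (Iy J hR hl hr)].
Qed.
Definition ideal_sub : submodule A := Submodule ideal_gen0 ideal_gen_linear.

Definition aquot := lquot ideal_sub.
HB.instance Definition _ := GRing.Lmodule.on aquot.
Definition api (x : A) : aquot := lpi ideal_sub x.

Fact qmul_key : unit. Proof. by []. Qed.
Definition qmul : aquot -> aquot -> aquot :=
  locked_with qmul_key (fun x y => api (repr x * repr y)).

Lemma ideal_genMl a x : ideal_gen x -> ideal_gen (a * x).
Proof. by move=> Ix J hR hl hr; apply: (hl); exact: (Ix J hR hl hr). Qed.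
Lemma ideal_genMr a x : ideal_gen x -> ideal_gen (x * a).
Proof. by move=> Ix J hR hl hr; apply: (hr); exact: (Ix J hR hl hr). Qed.

Lemma qmul_pi x y : qmul (api x) (api y) = api (x * y).
Proof.
rewrite /qmul unlock; apply/lpi_eqP => /=; set x' := repr _; set y' := repr _.
have -> : x' * y' - x * y = 1 *: ((x' - x) * y') + x * (y' - y).
  by rewrite scale1r mulrBl mulrBr addrA subrK.
apply: ideal_gen_linear; first exact/ideal_genMr/(lpi_repr ideal_sub x).
exact/ideal_genMl/(lpi_repr ideal_sub y).
Qed.

Lemma apiK x : api (repr x) = x. Proof. exact: reprK. Qed.
Lemma apiD x y : api (x + y) = api x + api y. Proof. exact: lpiD. Qed.

Fact qmulA : associative qmul.
Proof.
by move=> x y z; rewrite -[x]apiK -[y]apiK -[z]apiK !qmul_pi mulrA.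
Qed.
Fact qmul1 : left_id (api 1) qmul.
Proof. by move=> x; rewrite -[x]apiK qmul_pi mul1r. Qed.
Fact qmulr1 : right_id (api 1) qmul.
Proof. by move=> x; rewrite -[x]apiK qmul_pi mulr1. Qed.
Fact qmulDl : left_distributive qmul +%R.
Proof.
move=> x y z; rewrite -[x]apiK -[y]apiK -[z]apiK -apiD !qmul_pi -apiD.
by rewrite mulrDl.
Qed.
Fact qmulDr : right_distributive qmul +%R.
Proof.
move=> x y z; rewrite -[x]apiK -[y]apiK -[z]apiK -apiD !qmul_pi -apiD.
by rewrite mulrDr.
Qed.
HB.instance Definition _ :=
  GRing.Zmodule_isPzRing.Build aquot qmulA qmul1 qmulr1 qmulDl qmulDr.

Lemma qscaleAl (c : K) (x y : aquot) : c *: (x * y) = (c *: x) * y.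
Proof.
rewrite -[x]apiK -[y]apiK [api _ * api _]qmul_pi.
rewrite [c *: api (_ * _)]qscale_pi [c *: api _]qscale_pi [RHS]qmul_pi.
by rewrite -scalerAl.
Qed.

Lemma qscaleAr (c : K) (x y : aquot) : c *: (x * y) = x * (c *: y).
Proof.
rewrite -[x]apiK -[y]apiK [api _ * api _]qmul_pi.
rewrite [c *: api (_ * _)]qscale_pi [c *: api _]qscale_pi [RHS]qmul_pi.
by rewrite -scalerAr.
Qed.

(* \sum_a p_a A + \sum_a A q_a *)
Definition lr_span m (p q : 'I_m -> aquot) (u : aquot) : Prop :=
  exists s t : 'I_m -> aquot, u = \sum_a p a * s a + \sum_a t a * q a.

Fact lr_span0 m (p q : 'I_m -> aquot) : lr_span p q 0.
Proof.
exists (fun=> 0), (fun=> 0).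
rewrite big1 => [|a _]; last exact: mulr0.
by rewrite big1 ?addr0 // => a _; exact: mul0r.
Qed.

Fact lr_span_linear m (p q : 'I_m -> aquot) c x y :
  lr_span p q x -> lr_span p q y -> lr_span p q (c *: x + y).
Proof.
move=> [s [t ->]] [s' [t' ->]].
exists (fun a => c *: s a + s' a), (fun a => c *: t a + t' a).
rewrite scalerDr addrACA 2!scaler_sumr -2!big_split /=; congr (_ + _).
  by apply: eq_bigr => a _; rewrite mulrDr qscaleAr.
by apply: eq_bigr => a _; rewrite mulrDl qscaleAl.
Qed.

End QuotientAlgebra.

Section DirectSum.
Variables (K : comNzRingType) (I : choiceType) (V : lmodType K).

(* The direct sum of copies of V indexed by I. *)
Definition dsum := {malg V[I]}.
HB.instance Definition _ := GRing.Zmodule.on dsum.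

Fact dscale_key : unit. Proof. by []. Qed.
Definition dscale : K -> dsum -> dsum :=
  locked_with dscale_key (fun c x => [malg i in msupp x => c *: x@_i]).

Lemma dscaleE c x i : (dscale c x)@_i = c *: x@_i.
Proof.
rewrite /dscale unlock mcoeffE.
by case: ifPn => // /mcoeff_outdom ->; rewrite scaler0.
Qed.

Fact dscaleA a b x : dscale a (dscale b x) = dscale (a * b) x.
Proof. by apply/malgP => i; rewrite !dscaleE scalerA. Qed.
Fact dscale1 : left_id 1 dscale.
Proof. by move=> x; apply/malgP => i; rewrite dscaleE scale1r. Qed.
Fact dscaleDr : right_distributive dscale +%R.
Proof.
move=> c x y; apply/malgP => i.
by rewrite dscaleE !mcoeffD !dscaleE scalerDr.
Qed.
Fact dscaleDl x : {morph dscale^~ x : a b / a + b}.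
Proof.
by move=> a b; apply/malgP => i; rewrite mcoeffD !dscaleE scalerDl.
Qed.
HB.instance Definition _ :=
  GRing.Zmodule_isLmodule.Build K dsum dscaleA dscale1 dscaleDr dscaleDl.

End DirectSum.

(******************************************************************************)
(*                  The algebra U^j by generators and relations               *)
(******************************************************************************)

Section CoidealAlgebra.
Variable n : nat.
Notation N := (NN n).

(* Generators e_i, f_i (1 <= i <= n), d_a, d_a^-1 (1 <= a <= n + 1); the
   ordinals i and a stand for the indices i.+1 and a.+1. *)
Definition genU := ('I_n + 'I_n + ('I_n.+1 + 'I_n.+1))%type.
Definition freeU := falg Qv genU.

Definition letter (g : genU) : freeU := << fmu g >>.
Definition fe (i : 'I_n) : freeU := letter (inl (inl i)).
Definition ff (i : 'I_n) : freeU := letter (inl (inr i)).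
Definition fd (a : 'I_n.+1) : freeU := letter (inr (inl a)).
Definition fdV (a : 'I_n.+1) : freeU := letter (inr (inr a)).

(* d_i and d_{i+1} for i in [1, n] *)
Definition lo (i : 'I_n) : 'I_n.+1 := widen_ord (leqnSn n) i.
Definition hi (i : 'I_n) : 'I_n.+1 := lift ord0 i.

Definition wt (a : 'I_n.+1) (j : 'I_n) : int :=
  - (a.+1 == j.+2)%:Z - (N.+1 - a.+1 == j.+2)%N%:Z + (a.+1 == j.+1)%:Z.

Definition qtwo : Qv := v + v^-1.

Definition kap (i : 'I_n) : freeU :=
  v *: (fd (lo i) * fdV (hi i)) + v^-1 *: (fdV (lo i) * fd (hi i)).

Definition adjacent (i j : 'I_n) : bool := (i.+1 == j) || (j.+1 == i).

(* The defining relations, each written as (lhs, rhs). *)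
Inductive relU : freeU -> freeU -> Prop :=
| rel_dV a : relU (fd a * fdV a) 1
| rel_Vd a : relU (fdV a * fd a) 1
| rel_dd a b : relU (fd a * fd b) (fd b * fd a)
| rel_de a j : relU (fd a * fe j * fdV a) (v ^ wt a j *: fe j)
| rel_df a j : relU (fd a * ff j * fdV a) (v ^ (- wt a j) *: ff j)
| rel_ef (i j : 'I_n) : ~ (i = j /\ i.+1 = n) ->
    relU (fe i * ff j - ff j * fe i)
      ((i == j)%:R *: ((v - v^-1)^-1 *:
         (fd (lo i) * fdV (hi i) - fdV (lo i) * fd (hi i))))
| rel_ee2 i j : adjacent i j ->
    relU (fe i ^+ 2 * fe j + fe j * fe i ^+ 2) (qtwo *: (fe i * fe j * fe i))
| rel_ff2 i j : adjacent i j ->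
    relU (ff i ^+ 2 * ff j + ff j * ff i ^+ 2) (qtwo *: (ff i * ff j * ff i))
| rel_ee i j : i != j -> ~~ adjacent i j -> relU (fe i * fe j) (fe j * fe i)
| rel_ff i j : i != j -> ~~ adjacent i j -> relU (ff i * ff j) (ff j * ff i)
| rel_ffe (i : 'I_n) : i.+1 = n ->
    relU (ff i ^+ 2 * fe i + fe i * ff i ^+ 2)
         (qtwo *: (ff i * fe i * ff i - kap i * ff i))
| rel_eef (i : 'I_n) : i.+1 = n ->
    relU (fe i ^+ 2 * ff i + ff i * fe i ^+ 2)
         (qtwo *: (fe i * ff i * fe i - fe i * kap i)).

Definition relatorU (x : freeU) : Prop :=
  exists l r, relU l r /\ x = l - r.

Definition Uj := aquot relatorU.
HB.instance Definition _ := GRing.PzRing.on Uj.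
HB.instance Definition _ := GRing.Lmodule.on Uj.

Definition Ue i : Uj := api relatorU (fe i).
Definition Uf i : Uj := api relatorU (ff i).
Definition Ud a : Uj := api relatorU (fd a).
Definition UdV a : Uj := api relatorU (fdV a).

(******************************************************************************)
(*                         The modified form of U^j                           *)
(******************************************************************************)

Definition Lam := {A : 'M[int]_N | in_Xit_diag A}.

Definition lam (l : Lam) (a : 'I_n.+1) : int :=
  val l (ix n a.+1) (ix n a.+1).

(* d_a - v^(-l_a) *)
Definition shiftd (l : Lam) (a : 'I_n.+1) : Uj :=
  Ud a - v ^ (- lam l a) *: (1 : Uj).

(* \sum_a (d_a - v^(-l_a)) U + \sum_a U (d_a - v^(-l'_a)) *)
Definition inJ (l l' : Lam) : Uj -> Prop := lr_span (shiftd l) (shiftd l').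

(* The direct sum of copies of U^j indexed by the pairs (l, l'). *)
Definition sumU := dsum (Lam * Lam)%type Uj.
HB.instance Definition _ := GRing.Lmodule.on sumU.

Definition sumJ (x : sumU) : Prop := forall p, inJ p.1 p.2 x@_p.

Fact sumJ0 : sumJ 0.
Proof. by move=> p; rewrite mcoeff0; exact: lr_span0. Qed.
Fact sumJ_linear c x y : sumJ x -> sumJ y -> sumJ (c *: x + y).
Proof.
move=> Jx Jy p; rewrite mcoeffD [(c *: x)@_p]dscaleE.
by apply: lr_span_linear; [exact: Jx | exact: Jy].
Qed.

Definition dotU := lquot (Submodule sumJ0 sumJ_linear).
HB.instance Definition _ := GRing.Lmodule.on dotU.

(* The class of u in the summand of index (l, l'). *)
Definition dpi (l l' : Lam) (u : Uj) : dotU :=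
  lpi (Submodule sumJ0 sumJ_linear) << u *g (l, l') >>.

(* u has weight l - l' *)
Definition homog (l l' : Lam) (u : Uj) : Prop :=
  forall a, Ud a * u * UdV a = v ^ (lam l' a - lam l a) *: u.

(* A representative of x with homogeneous components. *)
Definition hrepr (x : dotU) : sumU :=
  xget 0 [set f : sumU | lpi (Submodule sumJ0 sumJ_linear) f = x /\
                         forall p, homog p.1 p.2 f@_p]%classic.

(* dpi l1 l2 s * dpi l3 l4 t = dpi l1 l4 (s t) if l2 = l3 and 0 otherwise,
   for s and t of weights l1 - l2 and l3 - l4. *)
Definition muldot (x y : dotU) : dotU :=
  \sum_(p <- msupp (hrepr x)) \sum_(q <- msupp (hrepr y) | p.2 == q.1)
     dpi p.1 q.2 ((hrepr x)@_p * (hrepr y)@_q).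

(* D_l u D_l' for integer matrices l and l' *)
Definition DuD (l l' : 'M[int]_N) (u : Uj) : dotU :=
  match insub l, insub l' with
  | Some m, Some m' => dpi m m' u
  | _, _ => 0
  end.

Definition is_aleph (aleph : {linear dotU -> QK n}) : Prop :=
  [/\ bijective aleph,
      forall x y, aleph (muldot x y) = mulK (aleph x) (aleph y),
      forall l, in_Xit_diag l -> aleph (DuD l l 1) = stdK l,
      forall l (i : 'I_n), in_Xit_diag l ->
        aleph (DuD (l - Eth n i.+1 i.+1 + Eth n i.+2 i.+2) l (Ue i))
        = stdK (l - Eth n i.+1 i.+1 + Eth n i.+2 i.+1)
    & forall l (i : 'I_n), in_Xit_diag l ->
        aleph (DuD (l - Eth n i.+2 i.+2 + Eth n i.+1 i.+1) l (Uf i))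
        = stdK (l - Eth n i.+2 i.+2 + Eth n i.+1 i.+2)].

End CoidealAlgebra.

(******************************************************************************)
(*                              The tensor space                              *)
(******************************************************************************)

Section TensorSpace.
Variables (n d : nat).
Notation N := (NN n).

(* The d-th tensor power of V, in coordinates over the v_r, r in [1, N]^d. *)
Definition VT := {ffun seqs n d -> Qv^o}.
Definition vten (r : seqs n d) : VT := [ffun s => (s == r)%:R].

(* g_1 \otimes ... \otimes g_d for operators g_c on V (matrices acting on
   columns) *)
Definition tensop (g : 'I_d -> 'M[Qv]_N) (x : VT) : VT :=
  [ffun s : seqs n d => \sum_(r : seqs n d) (\prod_c g c (s c) (r c)) * x r].

(* The generators of U(gl(N)) on V; indices in [1, N]. *)
Definition mE (k : nat) : 'M[Qv]_N := delta_mx (ix n k) (ix n k.+1).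
Definition mF (k : nat) : 'M[Qv]_N := delta_mx (ix n k.+1) (ix n k).
Definition mK (a : nat) (z : int) : 'M[Qv]_N :=
  diag_mx (\row_r (if r == ix n a then v ^ z else 1)).

(* Their action on the tensor power, by the iterated coproduct. *)
Definition opE (k : nat) (x : VT) : VT :=
  \sum_(c < d) tensop (fun b => if (b < c)%N then 1%:M
                                else if b == c then mE k
                                else mK k 1 *m mK k.+1 (-1)) x.
Definition opF (k : nat) (x : VT) : VT :=
  \sum_(c < d) tensop (fun b => if (b < c)%N then mK k (-1) *m mK k.+1 1
                                else if b == c then mF k
                                else 1%:M) x.
Definition opK (a : nat) (z : int) (x : VT) : VT := tensop (fun=> mK a z) x.

(* d_a^{z} for z = 1 or z = -1 *)
Definition opd (a : 'I_n.+1) (z : int) (x : VT) : VT :=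
  if (a.+1 <= n)%N then opK a.+1 (- z) (opK (N.+1 - a.+1) (- z) x)
  else v ^ (- z) *: opK n.+1 (- z *+ 2) x.

Definition actgen (g : genU n) (x : VT) : VT :=
  match g with
  | inl (inl i) =>
      opF i.+1 x + opK i.+1 (-1) (opK i.+2 1 (opE (N - i.+1) x))
  | inl (inr i) =>
      opE i.+1 (opK (N - i.+1) (-1) (opK (N.+1 - i.+1) 1 x)) + opF (N - i.+1) x
  | inr (inl a) => opd a 1 x
  | inr (inr a) => opd a (-1) x
  end.

Definition actfree (u : freeU n) (x : VT) : VT :=
  \sum_(m <- msupp u) u@_m *: foldr actgen x m.

(* Independent of the representative, the relations being satisfied. *)
Definition actU (u : Uj n) (x : VT) : VT := actfree (repr u) x.

(* The projection onto {x : d_a x = v^(-l_a) x for all a}. *)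
Definition projD (l : Lam n) (x : VT) : VT :=
  [ffun r => if [forall a, opd a 1 (vten r) == v ^ (- lam l a) *: vten r]
             then x r else 0].

Definition actdot (u : dotU n) (x : VT) : VT :=
  \sum_(p <- msupp (repr u : sumU n))
     projD p.1 (actU ((repr u : sumU n)@_p) (projD p.2 x)).

(* The right action of the generators T_1, ..., T_d of H. *)
Definition swap_seq (r : seqs n d) (i j : 'I_d) : seqs n d :=
  [ffun c => r (tperm i j c)].
Definition flip_seq (r : seqs n d) (j : 'I_d) : seqs n d :=
  [ffun c => if c == j then rev_ord (r c) else r c].

Definition actT_basis (r : seqs n d) (j : 'I_d) : VT :=
  if insub j.+1 : option 'I_d is Some j' then
    if (r j < r j')%N then v *: vten (swap_seq r j j')
    else if r j == r j' then v ^+ 2 *: vten r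
    else (v ^+ 2 - 1) *: vten r + v *: vten (swap_seq r j j')
  else
    if ((r j).+1 < n.+1)%N then v *: vten (flip_seq r j)
    else if (r j).+1 == n.+1 then v ^+ 2 *: vten r
    else (v ^+ 2 - 1) *: vten r + v *: vten (flip_seq r j).

Definition actT (x : VT) (j : 'I_d) : VT := \sum_r x r *: actT_basis r j.

(* An expression of h as a combination of words in T_1, ..., T_d; they
   generate H, and the resulting action does not depend on the expression. *)
Definition words (h : QH d) : seq (Qv * seq 'I_d) :=
  xget [::] [set ws |
    h = \sum_(w <- ws) w.1 *: foldl (fun g j => mulH g (genT j)) (oneH d) w.2
  ]%classic.

Definition actVH (x : VT) (h : QH d) : VT :=
  \sum_(w <- words h) w.1 *: foldl actT x w.2.

Definition Omega (x : VT) : QT n d := \sum_r x r *: tstd r.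

End TensorSpace.

(******************************************************************************)
(*                        Double centralizing actions                         *)
(******************************************************************************)

Definition bilinear_act (A B M : lmodType Qv) (act : A -> B -> M) : Prop :=
  (forall a, linear (act a)) /\ (forall b, linear (act^~ b)).

Definition left_action (A M : lmodType Qv) (mul : A -> A -> A)
    (act : A -> M -> M) : Prop :=
  bilinear_act act /\ forall a b m, act (mul a b) m = act a (act b m).

Definition right_action (B M : lmodType Qv) (mul : B -> B -> B) (one : B)
    (act : M -> B -> M) : Prop :=
  [/\ bilinear_act act, forall m a b, act m (mul a b) = act (act m a) b
    & forall m, act m one = m].

Definition double_centralizer (A B M : lmodType Qv)
    (lact : A -> M -> M) (ract : M -> B -> M) : Prop :=
  [/\ forall a m b, ract (lact a m) b = lact a (ract m b),
      forall g : {linear M -> M}, (forall m b, g (ract m b) = ract (g m) b) ->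
        exists a, forall m, g m = lact a m
    & forall g : {linear M -> M}, (forall a m, g (lact a m) = lact a (g m)) ->
        exists b, forall m, g m = ract m b].

(* Main.v *)
(* Counting flags in a pencil gives all structure constants: every flag is a
   coarsening of a complete one, and complete flags are related by the simple
   reflections, so that the counts are polynomials in q and T is generated over H
   by the characteristic functions e_r of the sorted r.  A map that commutes with H
   is therefore determined by its values on sorted e_r, where it is invariant under
   the stabilizer of r: this identifies the commutant of H with S.  Conversely the
   T_j act by symmetric matrices on the v_r and Q(v) is formally real, so the
   commutant of S is the algebra generated by the T_j.  On the v_r both e_i and
   f_i raise one letter k of the sequence r_1 ... r_D to k + 1; they commute with
   the T_j on ascents, and on sorted r they agree with the action of the matrices
   assigned to them by aleph.  Products in the modified form are computed on
   homogeneous words, which gives the intertwining property for all elements. *)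
Require Import Defs.
From HB Require Import structures.
From mathcomp Require Import all_boot all_order all_algebra.
From mathcomp Require Import fraction generic_quotient ring_quotient.
From mathcomp Require Import finmap.
From mathcomp Require Import boolp classical_sets.
From mathcomp Require Import monalg.
From mathcomp Require Import all_fingroup cyclic.
From mathcomp Require Import zify ring.

Set Implicit Arguments.
Unset Strict Implicit.
Unset Printing Implicit Defensive.

Import Order.TTheory GRing.Theory Num.Theory.
Local Open Scope ring_scope.

(** * Flags and their relative positions *)

(** That a count depends only on the relative position of the outer flags comes from the recursion
    itself: along descents it reduces to a sorted position, where the middle flag is unique. The
    resulting polynomials are determined by their values at odd primes, so each position has to
    occur over every F_l; coordinate flags for the antidiagonal form provide this, while the pencil
    counts hold for every nondegenerate symmetric form in odd characteristic.

    A second obstacle is that structure constants, words in the T_j, representatives in [Uj] and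
    homogeneous representatives in the modified form are all obtained by choice. Independence of
    these choices is reached by transport: under [Omega] each action is shown to equal one that sees
    only the class. Stabilization enters through the multiplicativity of [phi] and [aleph] and their
    values on generators, so all explicit computation takes place on generators, and there only on
    sorted sequences. The exponents [texp] and [dA] must match exactly at that point. *)

Section Perp.
Variables (F : finFieldType) (D : nat) (Q : 'M[F]_D).
Hypotheses (symQ : Q^T = Q) (unitQ : Q \in unitmx).
Implicit Types U W : 'M[F]_D.

Lemma sub_perp p (u : 'M[F]_(p, D)) W :
  (u <= perp Q W)%MS = (u *m Q *m W^T == 0).
Proof. by rewrite /perp sub_kermx mulmxA. Qed.

Lemma sub_perpC U W : (U <= perp Q W)%MS = (W <= perp Q U)%MS.
Proof.
rewrite !sub_perp; apply/eqP/eqP => h; apply: trmx_inj;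
by rewrite !trmx_mul trmxK symQ mulmxA h trmx0.
Qed.

Lemma rank_perp W : \rank (perp Q W) = (D - \rank W)%N.
Proof.
rewrite mxrank_ker -mxrank_tr trmx_mul trmxK mxrankMfree //.
by rewrite symQ row_free_unit.
Qed.

Lemma perpS U W : (U <= W)%MS -> (perp Q W <= perp Q U)%MS.
Proof. by move=> UW; rewrite sub_perpC (submx_trans UW) // sub_perpC. Qed.

Lemma perpK W : (perp Q (perp Q W) :=: W)%MS.
Proof.
apply/eqmxP; rewrite andbC -mxrank_leqif_eq; last by rewrite sub_perpC.
by rewrite !rank_perp subKn // rank_leq_col.
Qed.

Lemma eq_perp U W : (U :=: W)%MS -> (perp Q U :=: perp Q W)%MS.
Proof. by move=> UW; apply/eqmxP; rewrite !perpS ?UW. Qed.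

(** The intersection of the orthogonals is the orthogonal of U + W. Only sums occur, so that no rank
    is lost to truncated subtraction. *)
Lemma rank_cap_perp U W :
  (\rank (perp Q U :&: perp Q W)%MS + \rank U + \rank W)%N
  = (D + \rank (U :&: W)%MS)%N.
Proof.
have -> : \rank (perp Q U :&: perp Q W)%MS = \rank (perp Q (U + W)%MS).
  apply/eqP; rewrite eqn_leq; apply/andP; split; apply: mxrankS.
    by rewrite sub_perpC addsmx_sub sub_perpC capmxSl sub_perpC capmxSr.
  by rewrite sub_capmx !perpS ?addsmxSl ?addsmxSr.
have := mxrank_sum_cap U W; rewrite rank_perp.
have := rank_leq_col (U + W)%MS; lia.
Qed.

End Perp.

Section FlagRanks.
Variables (F : finFieldType) (D : nat) (Q : 'M[F]_D).

(** Members are indexed by naturals so that D - i and the jumps of a coarsening are plain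
    arithmetic. Out of range [inord] falls back to 0, whence the bounds in the lemmas. *)
Definition fl m (f : flag F D m) (i : nat) : 'M[F]_D := f (inord i).

Lemma belowE m (f : flag F D m) i : below f i = fl f i.
Proof. by congr (f _); apply: val_inj; rewrite /= inordK // ltnS ltnW. Qed.

Lemma aboveE m (f : flag F D m) i : above f i = fl f i.+1.
Proof. by congr (f _); apply: val_inj; rewrite /= inordK ?ltnS. Qed.

Lemma flE m (f : flag F D m) (i : 'I_m.+1) : f i = fl f i.
Proof. by rewrite /fl inord_val. Qed.

Lemma eq_flag m (f g : flag F D m) :
  (forall i, (i <= m)%N -> fl f i = fl g i) -> f = g.
Proof. by move=> h; apply/ffunP => i; rewrite !flE h // -ltnS. Qed.

Lemma flagsP m (f : flag F D m) :
  reflect [/\ forall i, (i <= m)%N -> <<fl f i>>%MS = fl f i,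
    fl f 0 = 0, fl f m = 1%:M,
    forall i, (i < m)%N -> (fl f i <= fl f i.+1)%MS
    & forall i, (i <= m)%N -> (fl f i :=: perp Q (fl f (m - i)))%MS]
   (f \in flags Q m).
Proof.
have e0 : f ord0 = fl f 0 by rewrite flE.
have em : f ord_max = fl f m by rewrite flE.
rewrite inE; apply: (iffP and5P) => [[/forallP h1 /eqP h2 /eqP h3 /forallP h4
    /forallP h5]|[h1 h2 h3 h4 h5]]; split.
- by move=> i im; apply/eqP/(h1 (inord i)).
- by rewrite -e0.
- by rewrite -em.
- by move=> i im; have := h4 (Ordinal im); rewrite belowE aboveE.
- move=> i im; apply/eqmxP; have := h5 (inord i).
  rewrite !flE /= inordK ?ltnS // subSS //.
- by apply/forallP => i; rewrite flE h1 // -ltnS.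
- by rewrite e0 h2.
- by rewrite em h3.
- by apply/forallP => i; rewrite belowE aboveE h4.
- by apply/forallP => i; rewrite !flE /= subSS; apply/eqmxP/h5; rewrite -ltnS.
Qed.

Lemma fl_mono m (f : flag F D m) i j : f \in flags Q m ->
  (i <= j <= m)%N -> (fl f i <= fl f j)%MS.
Proof.
case/flagsP => _ _ _ h _; elim: j => [|j IH].
  by rewrite leqn0 => /andP[/eqP-> _].
rewrite leq_eqVlt => /andP[/orP[/eqP-> //|]]; rewrite ltnS => ij jm.
by apply: submx_trans (h _ jm); apply: IH; rewrite ij ltnW.
Qed.

Definition rk m k (f : flag F D m) (g : flag F D k) i j : nat :=
  \rank (fl f i :&: fl g j)%MS.

Lemma rkC m k (f : flag F D m) (g : flag F D k) i j : rk f g i j = rk g f j i.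
Proof. by rewrite /rk capmxC. Qed.

Lemma rk0 m k (f : flag F D m) (g : flag F D k) j : f \in flags Q m ->
  rk f g 0 j = 0%N.
Proof. by case/flagsP => _ h _ _ _; rewrite /rk h cap0mx mxrank0. Qed.

Lemma rk_max m k (f : flag F D m) (g : flag F D k) i : g \in flags Q k ->
  rk f g i k = \rank (fl f i).
Proof. by case/flagsP => _ _ h _ _; rewrite /rk h capmx1. Qed.

Lemma rank_fl_max m (f : flag F D m) : f \in flags Q m -> \rank (fl f m) = D.
Proof. by case/flagsP => _ _ -> _ _; rewrite mxrank1. Qed.

(** [relpos] is the mixed second difference of [rk]: by the modular law, \rank (U + W :&: C) + \rank
    (U :&: C) = \rank U + \rank (W :&: C), used for two consecutive members C of g. Unlike [relpos],
    [rk] is visibly symmetric in the two flags. *)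
Lemma relpos_rk m k (f : flag F D m) (g : flag F D k) (i : 'I_m) (j : 'I_k) :
  f \in flags Q m -> g \in flags Q k ->
  (relpos f g i j + rk f g i j.+1 + rk f g i.+1 j)%N
  = (rk f g i.+1 j.+1 + rk f g i j)%N.
Proof.
move=> hf hg; rewrite /relpos mxE !belowE !aboveE.
set U := fl f i; set W := fl f i.+1; set A := fl g j; set B := fl g j.+1.
have UW : (U <= W)%MS by apply: (fl_mono hf); rewrite leqnSn /=.
have AB : (A <= B)%MS by apply: (fl_mono hg); rewrite leqnSn /=.
have E (C : 'M_D) : (\rank (U + W :&: C)%MS + \rank (U :&: C)%MS)%N
    = (\rank U + \rank (W :&: C)%MS)%N.
  rewrite -(mxrank_sum_cap U (W :&: C)%MS); congr (_ + _)%N; apply/eqmx_rank.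
  rewrite !sub_capmx !capmxSl capmxSr (submx_trans (capmxSl _ _)) //=.
  by rewrite (submx_trans (capmxSr _ _) (capmxSr _ _)).
have le1 : (\rank (U + W :&: A)%MS <= \rank (U + W :&: B)%MS)%N.
  by rewrite mxrankS // addsmxS // capmxS.
move: (E A) (E B) le1; rewrite /rk -/U -/W -/A -/B; lia.
Qed.

Lemma relpos_tr m k (f : flag F D m) (g : flag F D k) :
  f \in flags Q m -> g \in flags Q k -> relpos g f = (relpos f g)^T.
Proof.
move=> hf hg; apply/matrixP => i j; rewrite [RHS]mxE.
have := relpos_rk i j hg hf; have := relpos_rk j i hf hg.
rewrite ![rk g f _ _]rkC; lia.
Qed.

(** Undoes the double difference of [relpos_rk], first along g inside one step of f, then along
    f. *)
Lemma rkE m k (f : flag F D m) (g : flag F D k) i j :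
  f \in flags Q m -> g \in flags Q k -> (i <= m)%N -> (j <= k)%N ->
  rk f g i j = (\sum_(a < m | a < i) \sum_(b < k | b < j) relpos f g a b)%N.
Proof.
move=> hf hg im jk.
have row (a : 'I_m) l : (l <= k)%N ->
    (\sum_(b < k | b < l) relpos f g a b + rk f g a l)%N = rk f g a.+1 l.
  elim: l => [|l IH] lk; first by rewrite big_pred0 // !(rkC f) !(rk0 _ _ hg).
  have := IH (ltnW lk); have := relpos_rk a (Ordinal lk) hf hg => /=.
  have -> : (\sum_(b < k | b < l.+1) relpos f g a b
      = relpos f g a (Ordinal lk) + \sum_(b < k | b < l) relpos f g a b)%N.
    rewrite (bigD1 (Ordinal lk)) /=; last exact: ltnSn.
    by congr (_ + _)%N; apply: eq_bigl => b; rewrite ltnS ltn_neqAle andbC.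
  lia.
elim: i im => [|i IH] im; first by rewrite big_pred0 // (rk0 _ _ hf).
rewrite (bigD1 (Ordinal im)) /=; last exact: ltnSn.
rewrite -(row (Ordinal im) _ jk) /= (IH (ltnW im)); congr (_ + _)%N.
by apply: eq_bigl => b; rewrite ltnS ltn_neqAle andbC.
Qed.

Lemma relpos_row_sum m k (f : flag F D m) (g : flag F D k) (i : 'I_m) :
  f \in flags Q m -> g \in flags Q k ->
  (\sum_j relpos f g i j + \rank (fl f i))%N = \rank (fl f i.+1).
Proof.
move=> hf hg; rewrite -!(rk_max _ _ hg) !(rkE hf hg) // 1?ltnW //.
rewrite [RHS](bigD1 i) /=; last exact: ltnSn.
congr (_ + _)%N; first by apply: eq_bigl => b; rewrite ltn_ord.
by apply: eq_bigl => b; rewrite ltnS ltn_neqAle andbC.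
Qed.

Lemma relpos_sum m k (f : flag F D m) (g : flag F D k) :
  f \in flags Q m -> g \in flags Q k -> (\sum_i \sum_j relpos f g i j)%N = D.
Proof.
move=> hf hg; rewrite -[RHS](rank_fl_max hf) -(rk_max _ _ hg) (rkE hf hg) //.
apply: eq_big => [a|a _]; first by rewrite ltn_ord.
by apply: eq_bigl => b; rewrite ltn_ord.
Qed.

(** An intersection as large as both spaces equals both, and the normal form imposed on flags turns
    equal row spaces into equal matrices. *)
Lemma eq_fl m k (f : flag F D m) (g : flag F D k) i j :
  f \in flags Q m -> g \in flags Q k -> (i <= m)%N -> (j <= k)%N ->
  rk f g i j = \rank (fl f i) -> rk f g i j = \rank (fl g j) ->
  fl f i = fl g j.
Proof.
move=> /flagsP[hf _ _ _ _] /flagsP[hg _ _ _ _] im jk e1 e2.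
rewrite -hf // -hg //; apply/genmxP.
have c1 : (fl f i :&: fl g j :=: fl f i)%MS.
  by apply/eqmxP; rewrite -mxrank_leqif_eq ?capmxSl //; apply/eqP.
have c2 : (fl f i :&: fl g j :=: fl g j)%MS.
  by apply/eqmxP; rewrite -mxrank_leqif_eq ?capmxSr //; apply/eqP.
by apply/eqmxP; apply: eqmx_trans (eqmx_sym c1) c2.
Qed.

Hypotheses (symQ : Q^T = Q) (unitQ : Q \in unitmx).

Lemma rank_fl_rev m (f : flag F D m) i : f \in flags Q m -> (i <= m)%N ->
  (\rank (fl f (m - i)) + \rank (fl f i))%N = D.
Proof.
case/flagsP => _ _ _ _ h im; rewrite (h _ (leq_subr _ _)) subKn //.
by rewrite rank_perp // subnK // rank_leq_col.
Qed.

Lemma rk_rev m k (f : flag F D m) (g : flag F D k) i j :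
  f \in flags Q m -> g \in flags Q k -> (i <= m)%N -> (j <= k)%N ->
  (rk f g (m - i) (k - j) + \rank (fl f i) + \rank (fl g j))%N
  = (D + rk f g i j)%N.
Proof.
move=> /flagsP[_ _ _ _ hf] /flagsP[_ _ _ _ hg] im jk.
rewrite -(rank_cap_perp symQ unitQ); congr (_ + _ + _)%N; rewrite /rk.
apply/eqmx_rank/eqmxP; apply: cap_eqmx; first by rewrite -{2}(subKn im); apply: hf; rewrite leq_subr.
by rewrite -{2}(subKn jk); apply: hg; rewrite leq_subr.
Qed.

Lemma relpos_rev m k (f : flag F D m) (g : flag F D k) i j :
  f \in flags Q m -> g \in flags Q k ->
  relpos f g (rev_ord i) (rev_ord j) = relpos f g i j.
Proof.
move=> hf hg; have := relpos_rk i j hf hg.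
have := relpos_rk (rev_ord i) (rev_ord j) hf hg.
rewrite /= !subnSK //.
have H a b : (a <= m)%N -> (b <= k)%N -> _ := rk_rev hf hg.
have := H i j; have := H i.+1 j; have := H i j.+1; have := H i.+1 j.+1.
have := ltn_ord i; have := ltn_ord j.
move=> jk im; rewrite !(ltnW jk) !(ltnW im) jk im.
move=> /(_ isT isT) + /(_ isT isT) + /(_ isT isT) + /(_ isT isT); lia.
Qed.

End FlagRanks.

(** The position of a complete flag relative to any flag has a single 1 in each row, so it is a map
    from steps to steps ([mxof]); self-duality of the flags makes this map commute with reversal
    ([symf]). *)
Definition symf D m (phi : 'I_D -> 'I_m) : Prop :=
  forall c, phi (rev_ord c) = rev_ord (phi c).

Definition mxof D m (phi : 'I_D -> 'I_m) : 'M[nat]_(D, m) :=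
  \matrix_(c, i) (i == phi c : nat).

Lemma mxof_inj D m (phi psi : 'I_D -> 'I_m) : mxof phi = mxof psi -> phi =1 psi.
Proof.
move=> /matrixP h c; have := h c (phi c); rewrite !mxE eqxx.
by case: eqP.
Qed.

Lemma eq_mxof D m (phi psi : 'I_D -> 'I_m) : phi =1 psi -> mxof phi = mxof psi.
Proof. by move=> h; apply/matrixP => c i; rewrite !mxE h. Qed.

Section CompleteFlags.
Variables (F : finFieldType) (D : nat) (Q : 'M[F]_D).

Lemma rk_pos m (x : flag F D D) (y : flag F D m) (phi : 'I_D -> 'I_m) i j :
  x \in flags Q D -> y \in flags Q m -> relpos x y = mxof phi ->
  (i <= D)%N -> (j <= m)%N ->
  rk x y i j = (\sum_(c < D | c < i) (phi c < j))%N.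
Proof.
move=> hx hy e iD jm; rewrite (rkE hx hy) // e; apply: eq_bigr => c _.
rewrite (eq_bigr (fun b => if b == phi c then 1 else 0)%N); last first.
  by move=> b _; rewrite mxE; case: eqP.
rewrite -big_mkcondr /=; case: ltnP => h; last first.
  by rewrite big_pred0 // => b; case: eqP => [->|]; rewrite ?andbF // ltnNge h.
rewrite (big_pred1 (phi c)) // => b /=.
by case: (eqVneq b (phi c)) => [->|]; rewrite ?andbT ?andbF ?h.
Qed.

Lemma rk_posS m (x : flag F D D) (y : flag F D m) (phi : 'I_D -> 'I_m)
    (c : 'I_D) j :
  x \in flags Q D -> y \in flags Q m -> relpos x y = mxof phi -> (j <= m)%N ->
  rk x y c.+1 j = (rk x y c j + (phi c < j))%N.
Proof.
move=> hx hy e jm; have cD := ltnW (ltn_ord c).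
rewrite !(rk_pos hx hy e) //.
rewrite (bigD1 c) /=; last exact: ltnSn.
rewrite addnC; under eq_bigl => b do rewrite ltnS andbC -ltn_neqAle.
by [].
Qed.

Lemma pos_eq m (x x' : flag F D D) (y : flag F D m) (phi phi' : 'I_D -> 'I_m)
    (c : 'I_D) :
  x \in flags Q D -> x' \in flags Q D -> y \in flags Q m ->
  relpos x y = mxof phi -> relpos x' y = mxof phi' ->
  fl x' c = fl x c -> fl x' c.+1 = fl x c.+1 -> phi' c = phi c.
Proof.
move=> hx hx' hy e e' ec eS; apply: ord_inj.
have H j : (j <= m)%N -> (phi' c < j)%N = (phi c < j)%N.
  move=> jm; have := rk_posS c hx hy e jm; have := rk_posS c hx' hy e' jm.
  rewrite /rk ec eS; lia.
have := H _ (ltn_ord (phi c)); have := H _ (ltn_ord (phi' c)); lia.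
Qed.

Lemma fl_rev_eq (x x' : flag F D D) i : x \in flags Q D -> x' \in flags Q D ->
  (i <= D)%N -> fl x' i = fl x i -> fl x' (D - i) = fl x (D - i).
Proof.
move=> /flagsP[gx _ _ _ hx] /flagsP[gx' _ _ _ hx'] iD e.
rewrite -gx ?leq_subr // -gx' ?leq_subr //; apply/genmxP/eqmxP.
apply: eqmx_trans (hx' _ (leq_subr _ _)) _; apply: eqmx_sym.
by apply: eqmx_trans (hx _ (leq_subr _ _)) _; rewrite !subKn // e.
Qed.

Lemma complete_flagW (x : flag F D D) :
  x \in complete_flags Q D -> x \in flags Q D.
Proof. by rewrite [x \in complete_flags Q D]finset.in_set => /andP[]. Qed.

Hypotheses (symQ : Q^T = Q) (unitQ : Q \in unitmx).

(** Strict growth bounds the rank of member i from below by i; the same bound at D - i, combined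
    with duality, gives equality. *)
Lemma complete_flagsP (x : flag F D D) :
  reflect (x \in flags Q D /\ forall i, (i <= D)%N -> \rank (fl x i) = i)
    (x \in complete_flags Q D).
Proof.
rewrite [x \in complete_flags Q D]finset.in_set; apply: (iffP andP) => -[hx hr]; split=> //; last first.
  apply/forallP => i; rewrite belowE aboveE; have [_ _ _ h _] := flagsP _ _ hx.
  have hi := ltn_ord i; rewrite ltmxEneq h //=.
  apply/negP => e; have := mxrankS e; by rewrite (hr i.+1) // (hr i) ?ltnn // ltnW.
have ge i : (i <= D)%N -> (i <= \rank (fl x i))%N.
  elim: i => // i IH iD; have /forallP/(_ (Ordinal iD)) := hr.
  rewrite belowE aboveE ; rewrite ltmxErank => /andP[_].
  by apply: leq_ltn_trans; apply: IH; apply: ltnW.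
move=> i iD; apply/eqP; rewrite eqn_leq ge // andbT.
have := rank_fl_rev symQ unitQ hx iD; have := ge (D - i)%N (leq_subr _ _); lia.
Qed.

Lemma posP m (x : flag F D D) (y : flag F D m) :
  x \in complete_flags Q D -> y \in flags Q m ->
  exists2 phi : {ffun 'I_D -> 'I_m}, relpos x y = mxof phi & symf phi.
Proof.
move=> /complete_flagsP[hx rx] hy.
have row1 c : (\sum_i relpos x y c i = 1)%N.
  have := relpos_row_sum c hx hy; rewrite !rx ?(ltnW (ltn_ord c)) //.
  by rewrite -[in RHS]add1n; move/addIn.
have ex c : exists i, relpos x y c i != 0%N.
  apply/existsP; apply: contraT; rewrite negb_exists => /forallP h.
  by have := row1 c; rewrite big1 // => i _; apply/eqP; rewrite -[_ == _]negbK.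
pose phi := [ffun c => xchoose (ex c)].
have phiE c i : relpos x y c i = (i == phi c) :> nat.
  have h0 : relpos x y c (phi c) != 0%N by rewrite ffunE; exact: (xchooseP (ex c)).
  have add1 (a b : nat) : (a + b = 1)%N -> a != 0%N -> a = 1%N /\ b = 0%N by lia.
  have := row1 c; rewrite (bigD1 (phi c)) //= => /add1/(_ h0)[e1 e0].
  case: (eqVneq i (phi c)) => [->|ne] //.
  by move/eqP: e0; rewrite sum_nat_eq0 => /forallP/(_ i)/implyP/(_ ne)/eqP.
exists phi; first by apply/matrixP => c i; rewrite phiE mxE.
move=> c; have := relpos_rev symQ unitQ c (phi c) hx hy.
by rewrite !phiE eqxx; case: eqP => // ->.
Qed.

End CompleteFlags.

(** * Simple reflections and pencils of complete flags *)

Section Reflection.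
Variables (d : nat) (j : 'I_d).
Notation D := (DD d).

Fact pen1_subproof : (j < D)%N.
Proof. by have := ltn_ord j; rewrite /DD; lia. Qed.
(** [pen1] and [pen2] are the 0-based steps whose letters are exchanged by the reflection of index
    j.+1. For j.+1 = d the middle step d lies between them; its letter is fixed by duality, hence
    the offset 2. *)
Definition pen1 : 'I_D := Ordinal pen1_subproof.

Fact pen2_subproof : ((if j.+1 < d then j.+1 else j.+2) < D)%N.
Proof. by have := ltn_ord j; rewrite /DD; case: ifP; lia. Qed.
Definition pen2 : 'I_D := Ordinal pen2_subproof.

(* The simple reflection of index j.+1 of the Weyl group, acting on the D
   positions: for j.+1 = d it exchanges the two neighbours of the middle one. *)
Definition refl_fun (c : 'I_D) : 'I_D :=
  if c == pen1 then pen2 else if c == pen2 then pen1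
  else if c == rev_ord pen1 then rev_ord pen2
  else if c == rev_ord pen2 then rev_ord pen1 else c.

Lemma refl_funK : involutive refl_fun.
Proof.
move=> c; have := ltn_ord j; have := ltn_ord c; rewrite /refl_fun /DD => hc hj.
apply: val_inj; rewrite -!val_eqE /=.
by repeat (case: ifP => //=; rewrite -?val_eqE /=); lia.
Qed.

Definition refl : 'S_D := perm (can_inj refl_funK).

Lemma pen1_lt_pen2 : (pen1 < pen2)%N.
Proof. by rewrite /=; case: ifP. Qed.

Lemma pen_bounds : [/\ (j.+1 <= D)%N, j != (D - j.+1)%N :> nat,
  (j < pen2)%N & (pen2.+1 != D - j.+1)%N].
Proof.
have := ltn_ord j; rewrite /= /DD => jd.
by split; try case: ifP; lia.
Qed.

Lemma rev_pen1 : ~~ (j.+1 < d)%N -> rev_ord pen1 = pen2.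
Proof.
by move=> h; apply: val_inj; rewrite /= (negbTE h) /DD; have := ltn_ord j; lia.
Qed.

Lemma pen_rev : (j.+1 < d)%N -> (pen2 < rev_ord pen2)%N.
Proof. by move=> h; rewrite /= h /DD; lia. Qed.

Lemma reflE c : refl c = refl_fun c.
Proof. exact: permE. Qed.

Lemma refl_pen1 : refl pen1 = pen2. Proof. by rewrite reflE /refl_fun eqxx. Qed.

Lemma reflK : involutive refl.
Proof. by move=> c; rewrite !reflE refl_funK. Qed.

Lemma refl_pen2 : refl pen2 = pen1.
Proof. by rewrite -refl_pen1 reflK. Qed.

Lemma refl_rev c : refl (rev_ord c) = rev_ord (refl c).
Proof.
have := ltn_ord j; have := ltn_ord c; rewrite !reflE /refl_fun /DD => hc hj.
apply: val_inj; rewrite -!val_eqE /= /DD.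
by repeat (case: ifP => //=; rewrite -?val_eqE /= /DD); lia.
Qed.

Lemma refl_fix c : refl c = c ->
  [/\ c != pen1, c != pen2, c != rev_ord pen1 & c != rev_ord pen2].
Proof.
have p12 : pen1 != pen2 by rewrite -val_eqE ltn_eqF // pen1_lt_pen2.
have p21 : pen2 != pen1 by rewrite eq_sym.
by move=> h; split; apply/eqP => e; move: h; rewrite e ?refl_rev ?refl_pen1
  ?refl_pen2; try move/rev_ord_inj; apply/eqP.
Qed.

Lemma symf_refl m (phi : 'I_D -> 'I_m) : symf phi -> symf (phi \o refl).
Proof. by move=> h c; rewrite /= refl_rev h. Qed.

Lemma symf_eq_pen m (phi phi' : 'I_D -> 'I_m) : symf phi -> symf phi' ->
  phi' pen1 = phi pen1 -> phi' pen2 = phi pen2 ->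
  (forall c, refl c = c -> phi' c = phi c) -> phi' =1 phi.
Proof.
move=> s s' e1 e2 h c; have := h c; rewrite reflE /refl_fun.
case: eqP => [-> //|_]; case: eqP => [-> //|_].
case: eqP => [-> _|_]; first by rewrite s s' e1.
case: eqP => [-> _|_]; first by rewrite s s' e2.
exact.
Qed.

End Reflection.

Section Pencil.
Variables (F : finFieldType) (d : nat) (Q : 'M[F]_(DD d)).
Notation D := (DD d).
Implicit Types (j : 'I_d) (x y z : flag F D D).

(** The fibre through x of the map that forgets F_(j+1). With U = [fl x j] and W =
    [fl x (pen2 j).+1] it is the projective line of the plane W / U, or for j.+1 = d the conic of
    isotropic lines in the three-dimensional W / U. Members above d are controlled by duality. *)
Definition pencil j x : {set flag F D D} :=
  [set x' in complete_flags Q D |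
    [forall i : 'I_D.+1, (0 < i <= d)%N && (i != j.+1 :> nat) ==> (x' i == x i)]].

Lemma pencilP j x x' :
  reflect (x' \in complete_flags Q D /\
           forall i, (0 < i <= d)%N -> i != j.+1 -> fl x' i = fl x i)
          (x' \in pencil j x).
Proof.
rewrite [x' \in pencil j x]finset.in_set.
apply: (iffP andP) => -[hx' h]; split=> //; last first.
  by apply/forallP => i; apply/implyP => /andP[i1 i2]; rewrite !flE h.
move=> i i1 i2; apply/eqP; have /forallP/(_ (inord i))/implyP := h.
rewrite inordK ?i1 ?i2; first exact.
by rewrite /DD; lia.
Qed.

Lemma pencil_refl j x : x \in complete_flags Q D -> x \in pencil j x.
Proof. by move=> hx; apply/pencilP. Qed.

Lemma pencil_fl j x x' i : x \in complete_flags Q D -> x' \in pencil j x ->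
  (i <= D)%N -> i != j.+1 -> i != (D - j.+1)%N -> fl x' i = fl x i.
Proof.
move=> /complete_flagW hx /pencilP[/complete_flagW hx' h] iD ij ij'.
have H k : (k <= d)%N -> k != j.+1 -> fl x' k = fl x k.
  case: k => [|k] kd kj; last exact: h.
  by have [_ -> _ _ _] := flagsP _ _ hx; have [_ -> _ _ _] := flagsP _ _ hx'.
case: (leqP i d) => id; first exact: H.
rewrite -(subKn iD); apply: (fl_rev_eq hx hx'); first exact: leq_subr.
apply: H; first by rewrite /DD in iD *; lia.
by apply: contra ij' => /eqP e; rewrite -e subKn.
Qed.

Lemma symf_mid m (phi : 'I_D -> 'I_m) (c : 'I_D) : symf phi -> c = d :> nat ->
  m = (phi c).*2.+1.
Proof.
move=> s cd; have : rev_ord c = c by apply: val_inj; rewrite /= cd /DD; lia.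
move=> rc; have := congr1 val (s c); rewrite rc /=; have := ltn_ord (phi c); lia.
Qed.

(** The correction term is the letter of the middle step, which is crossed exactly when j.+1 = d. By
    [symf_mid] that letter is (m - 1) / 2, and it is below l exactly when m < 2 l. *)
Lemma rk_pen m (x : flag F D D) (y : flag F D m) (phi : 'I_D -> 'I_m) j l :
  x \in flags Q D -> y \in flags Q m -> relpos x y = mxof phi -> symf phi ->
  (l <= m)%N ->
  rk x y (pen2 j).+1 l = (rk x y j l + (phi (pen1 j) < l) + (phi (pen2 j) < l)
    + (~~ (j.+1 < d) && (m < l.*2)))%N.
Proof.
move=> hx hy e s lm; rewrite (rk_posS _ hx hy e) //.
have := rk_posS (pen1 j) hx hy e lm => /= e1.
case: (boolP (j.+1 < d)%N) => hj /=; first by rewrite e1; lia.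
have dD : (d < D)%N by rewrite /DD; lia.
have jd : j.+1 = d by have := ltn_ord j; lia.
have := rk_posS (Ordinal dD) hx hy e lm => /=.
have -> : rk x y d l = rk x y j.+1 l by congr (rk x y _ l).
have -> : rk x y d.+1 l = rk x y j.+2 l by congr (rk x y _ l); rewrite jd.
rewrite e1; have /= := symf_mid (c := Ordinal dD) s erefl; lia.
Qed.

Lemma pair_lt_eq (a b a' b' m : nat) :
  (a < m)%N -> (b < m)%N -> (a' < m)%N -> (b' < m)%N ->
  (forall l, (l <= m)%N ->
     ((a' < l) + (b' < l) = (a < l) + (b < l) :> nat)%N) ->
  (a' = a /\ b' = b) \/ (a' = b /\ b' = a).
Proof.
move=> am bm am' bm' h; have := h a.+1; have := h b.+1.
by have := h a'.+1; have := h b'.+1; lia.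
Qed.

(** Before and after the pencil, x and x' have the same members. So they meet y in the same ranks
    there, the two letters at the pens form the same multiset, and all other letters agree. *)
Lemma pencil_pos m j x x' (y : flag F D m) (phi phi' : 'I_D -> 'I_m) :
  x \in complete_flags Q D -> x' \in pencil j x -> y \in flags Q m ->
  relpos x y = mxof phi -> relpos x' y = mxof phi' -> symf phi -> symf phi' ->
  phi' =1 phi \/ phi' =1 phi \o refl j.
Proof.
move=> cx px' hy e e' s s'.
have [hx hx'] : x \in flags Q D /\ x' \in flags Q D.
  by split; apply: complete_flagW => //; case/pencilP: px'.
have jd := ltn_ord j.
have pair l : (l <= m)%N -> ((phi' (pen1 j) < l) + (phi' (pen2 j) < l)
    = (phi (pen1 j) < l) + (phi (pen2 j) < l) :> nat)%N.
  move=> lm; have := rk_pen j hx hy e s lm; have := rk_pen j hx' hy e' s' lm.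
  rewrite /rk (pencil_fl cx px'); last first.
  - by rewrite /= /DD; case: ifP; lia.
  - by rewrite /= /DD; case: ifP; lia.
  - by rewrite /= /DD; case: ifP; lia.
  rewrite (pencil_fl cx px'); last first.
  - by rewrite /= /DD; lia.
  - by rewrite /= /DD; lia.
  - by rewrite /= /DD; lia.
  lia.
have fixed c : refl j c = c -> phi' c = phi c.
  move=> /refl_fix[]; rewrite -!val_eqE /= => h1 h2 h3 h4.
  case: (eqVneq (c : nat) d) => [cd|cd].
    have := symf_mid s cd; have := symf_mid s' cd => h h'.
    by apply: ord_inj; lia.
  have cD := ltn_ord c.
  apply: (pos_eq (Q := Q)) e e' _ _ => //; apply: (pencil_fl cx px');
    by move: h1 h2 h3 h4 cd cD; rewrite /= /DD; case: ifP; lia.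
have := pair_lt_eq (ltn_ord (phi (pen1 j))) (ltn_ord (phi (pen2 j)))
  (ltn_ord (phi' (pen1 j))) (ltn_ord (phi' (pen2 j))) pair.
case=> -[/ord_inj e1 /ord_inj e2]; [left|right].
  exact: (symf_eq_pen (j := j)).
apply: (symf_eq_pen (j := j)) => //=.
- exact: symf_refl.
- by rewrite refl_pen1.
- by rewrite refl_pen2.
- by move=> c hc; rewrite hc fixed.
Qed.

End Pencil.

Section PencilMembers.
Variables (F : finFieldType) (d : nat) (Q : 'M[F]_(DD d)).
Notation D := (DD d).
Implicit Types (j : 'I_d) (x y z : flag F D D).
Lemma pencil_eq j x x' x'' : x \in complete_flags Q D ->
  x' \in pencil Q j x -> x'' \in pencil Q j x ->
  (fl x' j.+1 :=: fl x'' j.+1)%MS -> x' = x''.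
Proof.
move=> hx hx' hx'' e.
have [/complete_flagW h' _] := pencilP _ _ _ _ hx'.
have [/complete_flagW h'' _] := pencilP _ _ _ _ hx''.
have jD : (j.+1 <= D)%N by rewrite /DD; have := ltn_ord j; lia.
have ej : fl x' j.+1 = fl x'' j.+1.
  have [g' _ _ _ _] := flagsP _ _ h'; have [g'' _ _ _ _] := flagsP _ _ h''.
  by rewrite -g' // -g'' //; apply/genmxP/eqmxP.
apply: eq_flag => i iD; case: (eqVneq i j.+1) => [->//|n1].
case: (eqVneq i (D - j.+1)%N) => [->|n2]; first exact: (fl_rev_eq h'' h').
by rewrite (pencil_fl hx hx') // (pencil_fl hx hx'').
Qed.

Hypotheses (symQ : Q^T = Q) (unitQ : Q \in unitmx).

(** Converse of [pencil_eq]: L is inserted as member j.+1 and its orthogonal as member D - j.+1. For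
    j.+1 = d these two are separated by one step only, which is why L must then be isotropic. *)
Lemma move_flag j x (L : 'M[F]_D) : x \in complete_flags Q D ->
  (fl x j <= L)%MS -> (L <= fl x (pen2 j).+1)%MS -> \rank L = j.+1 ->
  (~~ (j.+1 < d)%N -> (L <= perp Q L)%MS) ->
  exists2 x', x' \in pencil Q j x & (fl x' j.+1 :=: L)%MS.
Proof.
move=> cx UL LW rL isoL; have [hx rx] := complete_flagsP symQ unitQ _ cx.
have [gx x0 xD _ dx] := flagsP _ _ hx; have jd := ltn_ord j.
pose x' : flag F D D := [ffun i : 'I_D.+1 => if i == j.+1 :> nat then <<L>>%MS
  else if i == (D - j.+1)%N :> nat then <<perp Q L>>%MS else x i].
have x'E i : (i <= D)%N -> fl x' i = if i == j.+1 then <<L>>%MS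
  else if i == (D - j.+1)%N then <<perp Q L>>%MS else fl x i.
  by move=> iD; rewrite /fl ffunE inordK.
have rD : (D - j.+1 <= D)%N by rewrite leq_subr.
have hx' : x' \in flags Q D.
  apply/flagsP; split.
  - move=> i iD; rewrite x'E //; case: ifP => _; first exact: genmx_id.
    by case: ifP => _; rewrite ?genmx_id // gx.
  - by rewrite x'E //; case: eqP => //; case: eqP => // ; rewrite /DD; lia.
  - rewrite x'E //; case: eqP; first by rewrite /DD; lia.
    by case: eqP => //; rewrite /DD; lia.
  - move=> i iD; rewrite !x'E // 1?ltnW // eqSS.
    case: (eqVneq i j) => [->|nj].
      rewrite ifN; last lia.
      by rewrite ifN ?genmxE // /DD; lia.
    case: (eqVneq i j.+1) => [ij|nj1].
      rewrite ij genmxE; case: ifP => [/eqP e|ne].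
        by rewrite genmxE; apply: isoL; rewrite /DD in e; lia.
      apply: submx_trans LW _; rewrite /= ifT //.
      by rewrite /DD in ne; lia.
    case: (eqVneq i (D - j.+1)%N) => [ij|nj2].
      rewrite ifN; last by rewrite ij /DD; lia.
      have iD' : i.+1 = (D - j)%N by rewrite ij /DD; lia.
      rewrite genmxE iD' dx; last exact: leq_subr.
      by rewrite subKn ?perpS // /DD; lia.
    case: ifP => [/eqP e|_]; last by apply: (fl_mono hx); rewrite leqnSn.
    rewrite genmxE sub_perpC //.
    apply: submx_trans LW _; rewrite /= ifT; last by rewrite /DD in e nj1; lia.
    rewrite dx; last by rewrite /DD; lia.
    apply: perpS => //; apply: (fl_mono hx); rewrite /DD in e *; lia.
  move=> i iD; rewrite !x'E ?leq_subr //.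
  case: (eqVneq i j.+1) => [->|n1].
    rewrite eqxx ifN; last by rewrite /DD; lia.
    apply: eqmx_trans (genmxE _) _; apply: eqmx_sym.
    apply: eqmx_trans (eq_perp symQ (genmxE _)) _; exact: perpK.
  case: (eqVneq i (D - j.+1)%N) => [->|n2].
    rewrite subKn; last by rewrite /DD; lia.
    rewrite eqxx; apply: eqmx_trans (genmxE _) _.
    exact: (eq_perp symQ (eqmx_sym (genmxE _))).
  rewrite ifN; last by move: n2 iD; rewrite /DD; lia.
  rewrite ifN; last by move: n1 iD; rewrite /DD; lia.
  exact: dx.
have e1 : (fl x' j.+1 :=: L)%MS.
  by rewrite x'E ?eqxx; [exact: genmxE | rewrite /DD; lia].
exists x' => //; apply/pencilP; split.
  apply/complete_flagsP => //; split=> // i iD; rewrite x'E //.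
  case: eqP => [->|_]; first by rewrite genmxE.
  by case: eqP => [->|_]; rewrite ?genmxE ?rank_perp ?rL // rx.
move=> i i1 i2; rewrite x'E; last by rewrite /DD; lia.
by rewrite (negbTE i2) ifN // /DD; lia.
Qed.

Lemma ltn_min_swap (a b a' b' : nat) : a != b ->
  (a' = a /\ b' = b) \/ (a' = b /\ b' = a) ->
  (a' < b')%N = (a' < (minn a b).+1)%N.
Proof. lia. Qed.

Section Special.
Variables (m : nat) (j : 'I_d) (x : flag F D D) (y : flag F D m).
Variable phi : 'I_D -> 'I_m.
Hypotheses (cx : x \in complete_flags Q D) (hy : y \in flags Q m).
Hypotheses (pxy : relpos x y = mxof phi) (sphi : symf phi).
Hypothesis neq_phi : phi (pen1 j) != phi (pen2 j).

(** [Y] is the member of y at which the smaller of the two letters has just entered. Then W meets Y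
    in one dimension more than U does, so Y marks a single line L0 / U in W / U. *)
Let l := (minn (phi (pen1 j)) (phi (pen2 j))).+1.
Let U := fl x j.
Let W := fl x (pen2 j).+1.
Let Y := fl y l.
Let L0 := (U + (W :&: Y))%MS.

Let hx : x \in flags Q D. Proof. exact: complete_flagW cx. Qed.

Let lm : (l <= m)%N.
Proof.
rewrite /l; have := ltn_ord (phi (pen1 j)).
by have := ltn_ord (phi (pen2 j)); lia.
Qed.

(** For j.+1 = d the two letters are mirror images of each other; being distinct, the smaller one
    lies below the middle, so Y is isotropic. *)
Let iso_l : ~~ (j.+1 < d)%N -> (l.*2 <= m)%N.
Proof.
move=> hj; have e := sphi (pen1 j); rewrite (rev_pen1 hj) in e.
move: neq_phi; rewrite /l e -val_eqE /=; have := ltn_ord (phi (pen1 j)); lia.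
Qed.

Let rkW : rk x y (pen2 j).+1 l = (rk x y j l).+1.
Proof.
rewrite (rk_pen j hx hy pxy sphi lm).
have -> : (~~ (j.+1 < d) && (m < l.*2))%N = false.
  by apply/negP => /andP[/iso_l]; lia.
by move: neq_phi; rewrite -val_eqE /l /=; lia.
Qed.

Let rank_addU (A : 'M[F]_D) : (U <= A)%MS ->
  (\rank (U + (A :&: Y))%MS + rk x y j l = j + \rank (A :&: Y)%MS)%N.
Proof.
move=> UA; have [_ rx] := complete_flagsP symQ unitQ _ cx.
have -> : (j + \rank (A :&: Y)%MS = \rank U + \rank (A :&: Y)%MS)%N.
  by rewrite rx //; have := ltn_ord j; rewrite /DD; lia.
rewrite -(mxrank_sum_cap U (A :&: Y)%MS); congr (_ + _)%N.
apply/eqmx_rank; rewrite !sub_capmx capmxSl capmxSr.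
rewrite (submx_trans (capmxSl _ _) UA) (submx_trans (capmxSr _ _) (capmxSr _ _)).
by rewrite capmxSl.
Qed.

Let UW : (U <= W)%MS.
Proof.
apply: (fl_mono hx); have := ltn_ord (pen2 j).
by have := pen1_lt_pen2 j; rewrite /=; lia.
Qed.

Let rankL0 : \rank L0 = j.+1.
Proof.
have eW : \rank (W :&: Y)%MS = (rk x y j l).+1 := rkW.
by have := rank_addU UW; rewrite eW addnS -addSn => /addIn.
Qed.

Let isoL0 : ~~ (j.+1 < d)%N -> (L0 <= perp Q L0)%MS.
Proof.
move=> hj; have jd := ltn_ord j; have [_ _ _ _ dx] := flagsP _ _ hx.
have [_ _ _ _ dy] := flagsP _ _ hy.
have WU : (W <= perp Q U)%MS.
  have D1 : (pen2 j).+1 = (D - j)%N by rewrite /= (negbTE hj) /DD; lia.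
  have jD : (D - j <= D)%N by rewrite leq_subr.
  by rewrite /W D1 dx // subKn ?submx_refl // /DD; lia.
have YY : (Y <= perp Q Y)%MS.
  apply: submx_trans (_ : fl y (m - l) <= _)%MS.
    by apply: (fl_mono hy); have := iso_l hj; lia.
  by rewrite dy ?leq_subr // subKn.
have UU : (U <= perp Q U)%MS by rewrite (submx_trans UW).
have E1 : (U <= perp Q L0)%MS.
  rewrite sub_perpC // addsmx_sub UU /=.
  by rewrite (submx_trans (capmxSl _ _)).
rewrite addsmx_sub E1 sub_perpC // addsmx_sub.
rewrite sub_perpC // (submx_trans (capmxSl _ _)) //=.
rewrite (submx_trans (capmxSr _ _)) // (submx_trans YY) //.
by apply: perpS => //; apply: capmxSr.
Qed.

(** A member of the pencil has ascending letters exactly when its step j.+1 meets Y in one dimension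
    more than U does, that is, when this step is L0. Every pencil thus has one ascending member, or
    all its members have equal letters at the pens. *)
Lemma special_member : exists2 x0, x0 \in pencil Q j x &
  forall x' phi', x' \in pencil Q j x -> relpos x' y = mxof phi' -> symf phi' ->
    (phi' (pen1 j) < phi' (pen2 j))%N = (x' == x0).
Proof.
have L0W : (L0 <= W)%MS by rewrite addsmx_sub UW capmxSl.
have [x0 px0 e0] := move_flag cx (addsmxSl _ _) L0W rankL0 isoL0.
exists x0 => // x' phi' px' e' s'.
have [cx' _] := pencilP _ _ _ _ px'.
have [hx' rx'] := complete_flagsP symQ unitQ _ cx'.
have [jD jr jp pr] := pen_bounds j.
have xU : fl x' j = U.
  by apply: (pencil_fl cx px') => //; [exact: ltnW | rewrite ltn_eqF].
have xW : fl x' (pen2 j).+1 = W.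
  by apply: (pencil_fl cx px') => //; rewrite ?ltn_ord // gtn_eqF // ltnS.
have rk1 := rk_posS (pen1 j) hx' hy e' lm.
have rkj : rk x' y j l = rk x y j l by rewrite /rk xU.
have Ux : (U <= fl x' j.+1)%MS by rewrite -xU; apply: (fl_mono hx'); rewrite leqnSn.
have xW' : (fl x' j.+1 <= W)%MS.
  by rewrite -xW; apply: (fl_mono hx'); rewrite ltn_ord ltnS ltnW.
have perm : (phi' (pen1 j) = phi (pen1 j) /\ phi' (pen2 j) = phi (pen2 j)) \/
   (phi' (pen1 j) = phi (pen2 j) /\ phi' (pen2 j) = phi (pen1 j)).
  have [h|h] := pencil_pos cx px' hy pxy e' sphi s'; rewrite !h; first by left.
  by right; rewrite /= refl_pen1 refl_pen2.
have -> : (phi' (pen1 j) < phi' (pen2 j))%N = (phi' (pen1 j) < l)%N.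
  apply: ltn_min_swap; first by rewrite val_eqE.
  by case: perm => -[-> ->]; [left|right].
apply/idP/eqP => [h|ex].
- apply: (pencil_eq cx px' px0).
  have le1 : (U + (fl x' j.+1 :&: Y) <= L0)%MS by apply: addsmxS => //; apply: capmxS.
  have le2 : (U + (fl x' j.+1 :&: Y) <= fl x' j.+1)%MS.
    by rewrite addsmx_sub Ux capmxSl.
  have rr : \rank (U + (fl x' j.+1 :&: Y))%MS = j.+1.
    have eW : \rank (fl x' j.+1 :&: Y)%MS = (rk x y j l).+1.
      by rewrite -[RHS]addn1 -rkj; move: rk1; rewrite h.
    by have := rank_addU Ux; rewrite eW addnS -addSn => /addIn.
  have E1 : (U + (fl x' j.+1 :&: Y) :=: L0)%MS.
    by apply/eqmxP; rewrite -mxrank_leqif_eq // rr rankL0.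
  have E2 : (U + (fl x' j.+1 :&: Y) :=: fl x' j.+1)%MS.
    by apply/eqmxP; rewrite -mxrank_leqif_eq // rr rx'.
  apply: eqmx_trans (eqmx_sym E2) _.
  exact: eqmx_trans E1 (eqmx_sym e0).
have : (\rank (W :&: Y)%MS <= rk x' y j.+1 l)%N.
  rewrite /rk ex; apply: mxrankS; rewrite sub_capmx capmxSr andbT e0.
  exact: addsmxSr.
have -> : \rank (W :&: Y)%MS = (rk x y j l).+1 := rkW.
by move: rk1 => /= ->; rewrite -rkj -[X in (X <= _)%N]addn1 leq_add2l lt0b.
Qed.

End Special.
End PencilMembers.

(** * The number of flags in a pencil *)

Section VectorSteps.
Variables (F : fieldType) (D : nat).
Implicit Types (A B : 'M[F]_D) (u w : 'rV[F]_D).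

Lemma step_vec A B : (A <= B)%MS -> (\rank A < \rank B)%N ->
  exists2 u : 'rV_D, (u <= B)%MS & ~~ (u <= A)%MS.
Proof.
move=> AB r; have : ~~ (B <= A)%MS by apply/negP => /mxrankS; lia.
by case/row_subPn => i hi; exists (row i B) => //; apply: row_sub.
Qed.

Lemma rank_add_vec A u : ~~ (u <= A)%MS -> \rank (A + u)%MS = (\rank A).+1.
Proof.
move=> uA; apply/eqP; rewrite eqn_leq; apply/andP; split.
  apply: leq_trans (mxrank_adds_leqif _ _) _.
  by rewrite -[X in (_ <= X)%N]addn1 leq_add2l rank_leq_row.
rewrite ltn_neqAle mxrankS ?addsmxSl // andbT; apply: contra uA => /eqP r.
have : (A + u <= A)%MS.
  by have [_ e] := mxrank_leqif_sup (addsmxSl A u); rewrite -e r.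
by rewrite addsmx_sub => /andP[].
Qed.

Lemma vec_span A u w : (w <= A + u)%MS -> exists k, (w - k *: u <= A)%MS.
Proof.
case/sub_addsmxP => -[X Y] /= ->; exists (Y 0 0).
by rewrite [Y in Y *m u]mx11_scalar mul_scalar_mx addrK submxMl.
Qed.

Lemma eq_add_vec A B u : (A <= B)%MS -> (u <= B)%MS -> ~~ (u <= A)%MS ->
  \rank B = (\rank A).+1 -> (B :=: A + u)%MS.
Proof.
move=> AB uB uA r; apply: eqmx_sym; apply/eqmxP.
by rewrite -mxrank_leqif_eq ?addsmx_sub ?AB // rank_add_vec // r.
Qed.

(** In the quotient by A the point w + t b + s a determines t, whatever s is: compare the
    coefficients of w, then those of b. *)
Lemma lines_inj A (a b w : 'rV[F]_D) s s' t t' :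
  ~~ (b <= A + a)%MS -> ~~ (w <= A + a + b)%MS ->
  ((w + t' *: b + s' *: a)%R <= A + (w + t *: b + s *: a)%R)%MS -> t' = t.
Proof.
move=> hb hw h; have [k] := vec_span h; set z := (X in (X <= A)%MS) => zA.
have AS : (A <= A + a)%MS by apply: addsmxSl.
have zk : z = (1 - k) *: w + (t' - k * t) *: b + (s' - k * s) *: a.
  by rewrite /z; apply/rowP => i; rewrite !mxE; ring.
have k1 : k = 1.
  apply/eqP; rewrite eq_sym -subr_eq0; apply: contraNT hw => k1.
  have -> : w = (1 - k)^-1 *: (z - (t' - k * t) *: b - (s' - k * s) *: a).
    by rewrite zk; apply/rowP => i; rewrite !mxE; field.
  have aS : (a <= A + a + b)%MS by rewrite (submx_trans (addsmxSr A a)) ?addsmxSl.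
  apply: scalemx_sub; apply: addmx_sub; last first.
    by rewrite eqmx_opp; apply: scalemx_sub.
  apply: addmx_sub; last by rewrite eqmx_opp; apply: scalemx_sub; apply: addsmxSr.
  by rewrite (submx_trans zA) // (submx_trans AS) ?addsmxSl.
apply/eqP; rewrite -subr_eq0; apply: contraNT hb => tt.
have -> : b = (t' - t)^-1 *: (z - (s' - k * s) *: a).
  by rewrite zk k1; apply/rowP => i; rewrite !mxE; field.
apply: scalemx_sub; apply: addmx_sub; first exact: submx_trans zA AS.
by rewrite eqmx_opp; apply: scalemx_sub; apply: addsmxSr.
Qed.

End VectorSteps.

Section BilinearForm.
Variables (F : finFieldType) (D : nat) (Q : 'M[F]_D).
Implicit Types (A B : 'M[F]_D) (u w : 'rV[F]_D).

Definition bf u w : F := (u *m Q *m w^T) 0 0.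

Lemma bfDl u u' w : bf (u + u') w = bf u w + bf u' w.
Proof. by rewrite /bf !mulmxDl mxE. Qed.
Lemma bfDr u w w' : bf u (w + w') = bf u w + bf u w'.
Proof. by rewrite /bf linearD mulmxDr mxE. Qed.
Lemma bfZl k u w : bf (k *: u) w = k * bf u w.
Proof. by rewrite /bf -!scalemxAl mxE. Qed.
Lemma bfZr k u w : bf u (k *: w) = k * bf u w.
Proof. by rewrite /bf linearZ -scalemxAr mxE. Qed.

Lemma bf0 u w : (bf u w == 0) = (u *m Q *m w^T == 0).
Proof.
apply/eqP/eqP => [h|]; last by rewrite /bf => ->; rewrite mxE.
by apply/matrixP => i k; rewrite !ord1 [LHS]h mxE.
Qed.

Lemma perp_bf A u w : (u <= perp Q A)%MS -> (w <= A)%MS -> bf u w = 0.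
Proof.
rewrite sub_perp => /eqP h /submxP[X ->]; apply/eqP; rewrite bf0.
by rewrite trmx_mul mulmxA h mul0mx.
Qed.

Lemma perp_add_vec A B u w : (u <= perp Q A)%MS -> bf u w = 0 ->
  (B <= A + w)%MS -> (u <= perp Q B)%MS.
Proof.
rewrite !sub_perp => /eqP hA /eqP; rewrite bf0 => /eqP hw.
case/sub_addsmxP => -[X Y] /= ->.
by rewrite linearD /= !trmx_mul mulmxDr !mulmxA hA hw !mul0mx addr0.
Qed.

Hypothesis symQ : Q^T = Q.

Lemma bfC u w : bf u w = bf w u.
Proof.
have -> : bf w u = ((w *m Q *m u^T)^T) 0 0 by rewrite mxE.
by rewrite !trmx_mul trmxK symQ mulmxA.
Qed.

End BilinearForm.

Section PencilCard.
Variables (F : finFieldType) (d : nat) (Q : 'M[F]_(DD d)).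
Notation D := (DD d).
Hypotheses (symQ : Q^T = Q) (unitQ : Q \in unitmx) (oddF : odd #|F|).

(** The additive order of 1 divides #|F|, which is odd, so 2 = 0 would give 1 = 0. *)
Lemma two_neq0 : 2 != 0 :> F.
Proof.
apply/negP => /eqP h2.
have : (1 : F) *+ #|F| = 0.
  by apply/eqP; rewrite -FinRing.zmodXgE -order_dvdn -cardsT order_dvdG ?inE.
rewrite -(odd_double_half #|F|) oddF mulrnDr -mul2n mulrnA h2 mul0rn addr0.
by move/eqP; rewrite oner_eq0.
Qed.

(** Reduces the count to a parametrization by F: u t spans, modulo [fl x j], the step of one member
    other than x, and each such member contains some u t. *)
Lemma pencil_pick (j : 'I_d) (x : flag F D D) (u : F -> 'rV[F]_D) :
  x \in complete_flags Q D ->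
  (forall t, ~~ (u t <= fl x j.+1)%MS) ->
  (forall t, (u t <= fl x (pen2 j).+1)%MS) ->
  (forall t, ~~ (j.+1 < d)%N -> bf Q (u t) (u t) = 0) ->
  (forall t t', (u t' <= fl x j + u t)%MS -> t' = t) ->
  (forall L : 'M[F]_D, (fl x j <= L)%MS -> (L <= fl x (pen2 j).+1)%MS ->
     ~~ (L <= fl x j.+1)%MS -> \rank L = j.+1 ->
     (~~ (j.+1 < d)%N -> (L <= perp Q L)%MS) -> exists t, (u t <= L)%MS) ->
  #|pencil Q j x :\ x| = #|F|.
Proof.
move=> cx uM uW uI u_inj u_surj.
have [hx rx] := complete_flagsP symQ unitQ _ cx.
have [jD jr jp pr] := pen_bounds j.
have UM : (fl x j <= fl x j.+1)%MS by apply: (fl_mono hx); rewrite leqnSn.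
have UW : (fl x j <= fl x (pen2 j).+1)%MS.
  by apply: (fl_mono hx); rewrite ltn_ord ltnW // ltnS ltnW.
have rU : \rank (fl x j) = j by rewrite rx // ltnW.
have uU t : ~~ (u t <= fl x j)%MS.
  by apply: contra (uM t) => h; apply: submx_trans h UM.
have ex t : exists2 x', x' \in pencil Q j x & (fl x' j.+1 :=: fl x j + u t)%MS.
  suff [x' px' e] : exists2 x', x' \in pencil Q j x &
      (fl x' j.+1 :=: <<(fl x j + u t)%MS>>)%MS.
    by exists x' => //; apply: eqmx_trans e (genmxE _).
  apply: move_flag => //; rewrite ?genmxE ?addsmxSl //.
  - by rewrite addsmx_sub UW uW.
  - by rewrite rank_add_vec // rU.
  move=> hj; set L := (X in (_ <= perp Q X)%MS).
  have LE : (L :=: fl x j + u t)%MS by apply: genmxE.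
  have perpU : (fl x (pen2 j).+1 <= perp Q (fl x j))%MS.
    have [_ _ _ _ dx] := flagsP _ _ hx.
    have -> : (pen2 j).+1 = (D - j)%N by rewrite -(rev_pen1 hj) /=; lia.
    by rewrite dx ?leq_subr // subKn // ltnW.
  have UL : (fl x j <= perp Q L)%MS.
    rewrite sub_perpC // LE addsmx_sub; apply/andP; split.
      by apply: submx_trans UW perpU.
    exact: submx_trans (uW t) perpU.
  rewrite addsmx_sub UL /= (perp_add_vec (A := fl x j) (w := u t)) ?LE //.
    exact: submx_trans (uW t) perpU.
  exact: uI.
have [f hf] := choice (fun t => let: ex_intro2 x' h1 h2 := ex t in
  ex_intro (fun x' => x' \in pencil Q j x /\ (fl x' j.+1 :=: fl x j + u t)%MS)
    x' (conj h1 h2)).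
have f_inj : injective f.
  move=> t' t e; apply: u_inj; have [_ <-] := hf t; rewrite -e.
  by have [_ ->] := hf t'; apply: addsmxSr.
rewrite -(card_imset _ f_inj); apply: eq_card => x'; rewrite in_setD1.
apply/idP/imsetP => [/andP[ne px']|[t _ ->]]; last first.
  have [-> e] := hf t; rewrite andbT.
  by apply/eqP => ft; move: (uM t); rewrite -ft e addsmxSr.
have [cx' _] := pencilP _ _ _ _ px'.
have [hx' rx'] := complete_flagsP symQ unitQ _ cx'.
have rL : \rank (fl x' j.+1) = j.+1 by rewrite rx'.
have UL : (fl x j <= fl x' j.+1)%MS.
  rewrite -(pencil_fl cx px' _ _ jr) ?ltn_eqF //; last exact: ltnW.
  by apply: (fl_mono hx'); rewrite leqnSn.
have LW : (fl x' j.+1 <= fl x (pen2 j).+1)%MS.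
  rewrite -(pencil_fl cx px' _ _ pr) ?gtn_eqF // ?ltnS //.
  by apply: (fl_mono hx'); rewrite ltn_ord ltnS ltnW.
have LM : ~~ (fl x' j.+1 <= fl x j.+1)%MS.
  apply: contra ne => h; apply/eqP; apply: (pencil_eq cx px').
    exact: pencil_refl.
  by apply/eqmxP; rewrite -mxrank_leqif_eq // rL rx.
have isoL : ~~ (j.+1 < d)%N -> (fl x' j.+1 <= perp Q (fl x' j.+1))%MS.
  move=> hj; have [_ _ _ _ dx'] := flagsP _ _ hx'; have jd := ltn_ord j.
  have -> : (fl x' j.+1 <= perp Q (fl x' j.+1))%MS
      = (fl x' j.+1 <= fl x' (D - j.+1))%MS.
    by rewrite (dx' _ (leq_subr _ _)) subKn.
  apply: (fl_mono hx'); rewrite leq_subr andbT.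
  by clear -jd; rewrite /DD; lia.
have [t ut] := u_surj _ UL LW LM rL isoL.
exists t => //; have [pt et] := hf t; apply: (pencil_eq cx px' pt).
apply: eqmx_trans (eqmx_sym et); apply: eq_add_vec => //; first by rewrite rL rU.
Qed.

(** The points of the projective line of W / U other than that of x are the lines through w + t b,
    where b spans the step of x and w completes it to W. *)
Lemma pencil_card_lt (j : 'I_d) (x : flag F D D) : (j.+1 < d)%N ->
  x \in complete_flags Q D -> #|pencil Q j x :\ x| = #|F|.
Proof.
move=> hj cx; have [hx rx] := complete_flagsP symQ unitQ _ cx.
have p2 : pen2 j = j.+1 :> nat by rewrite /= hj.
have [_ _ _ _] := pen_bounds j.
have jD : (j.+2 <= D)%N by rewrite -p2 ltn_ord.
have UM : (fl x j <= fl x j.+1)%MS by apply: (fl_mono hx); rewrite leqnSn ltnW.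
have MW : (fl x j.+1 <= fl x j.+2)%MS by apply: (fl_mono hx); rewrite leqnSn.
have [rU rM rW] : [/\ \rank (fl x j) = j, \rank (fl x j.+1) = j.+1
    & \rank (fl x j.+2) = j.+2] by rewrite !rx // ltnW // ltnW.
have [b bM bU] := step_vec UM (eq_leq (etrans (congr1 succn rU) (esym rM))).
have [w wW wM] := step_vec MW (eq_leq (etrans (congr1 succn rM) (esym rW))).
have eM := eq_add_vec UM bM bU (etrans rM (congr1 succn (esym rU))).
have eW := eq_add_vec MW wW wM (etrans rW (congr1 succn (esym rM))).
have MU1 : (fl x j + (0 : 'rV_D) + b <= fl x j.+1)%MS.
  by rewrite !addsmx_sub UM bM sub0mx.
apply: (pencil_pick (u := fun t => w + t *: b) cx); rewrite ?p2.
- move=> t; apply: contra wM => h; rewrite -[w](addrK (t *: b)).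
  by rewrite addmx_sub // eqmx_opp scalemx_sub.
- by move=> t; rewrite addmx_sub // scalemx_sub // (submx_trans bM).
- by move=> t; rewrite hj.
- move=> t t' h; apply: (@lines_inj _ _ (fl x j) 0 b w 0 0 t t').
  + by rewrite addsmx0.
  + by apply: contra wM => h'; apply: submx_trans h' MU1.
  by rewrite !scaler0 !addr0.
move=> L UL LW LM rL _; have [i hi] := row_subPn LM.
have zL : (row i L <= L)%MS by apply: row_sub.
have [k hk] : exists k, (row i L - k *: w <= fl x j.+1)%MS.
  by apply: vec_span; rewrite -eW (submx_trans zL).
have [k' hk'] : exists k', (row i L - k *: w - k' *: b <= fl x j)%MS.
  by apply: vec_span; rewrite -eM.
have k0 : k != 0 by apply: contraNneq hi => k0; move: hk; rewrite k0 scale0r subr0.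
exists (k^-1 * k'); set z := (X in (X <= _)%MS) in hk'.
have -> : w + (k^-1 * k') *: b = k^-1 *: (row i L - z).
  by rewrite /z; apply/rowP => l; rewrite !mxE; field.
by rewrite scalemx_sub // addmx_sub // eqmx_opp (submx_trans hk').
Qed.

(** W / U carries the flag M / U, P / U with P orthogonal to M; a, b, w are a basis adapted to it.
    The conic is parametrized by projection from its point a: each line through a that leaves P
    contains one more isotropic point. *)
Lemma pencil_card_last (j : 'I_d) (x : flag F D D) : ~~ (j.+1 < d)%N ->
  x \in complete_flags Q D -> #|pencil Q j x :\ x| = #|F|.
Proof.
move=> hj cx; have [hx rx] := complete_flagsP symQ unitQ _ cx.
have p2 : pen2 j = j.+2 :> nat by rewrite /= (negbTE hj).
have jD : (j.+3 <= D)%N by rewrite -p2 ltn_ord.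
have dD : D = (j + j.+3)%N by rewrite /DD; have := ltn_ord j; lia.
have UM : (fl x j <= fl x j.+1)%MS by apply: (fl_mono hx); rewrite leqnSn; lia.
have MP : (fl x j.+1 <= fl x j.+2)%MS by apply: (fl_mono hx); rewrite leqnSn; lia.
have PW : (fl x j.+2 <= fl x j.+3)%MS by apply: (fl_mono hx); rewrite leqnSn; lia.
have [rU rM rP rW] : [/\ \rank (fl x j) = j, \rank (fl x j.+1) = j.+1,
   \rank (fl x j.+2) = j.+2 & \rank (fl x j.+3) = j.+3].
  by rewrite !rx //; lia.
have [_ _ _ _ dx] := flagsP _ _ hx.
have dW : (fl x j.+3 :=: perp Q (fl x j))%MS.
  by have := dx _ jD; have -> : (D - j.+3)%N = j by rewrite dD addnK.
have dP : (fl x j.+2 :=: perp Q (fl x j.+1))%MS.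
  by have := dx _ (ltnW jD); have -> : (D - j.+2)%N = j.+1 by rewrite dD; lia.
have dM : (fl x j.+1 :=: perp Q (fl x j.+2))%MS.
  by have := dx _ (ltnW (ltnW jD)); have -> : (D - j.+1)%N = j.+2 by rewrite dD; lia.
have [a aM aU] := step_vec UM (eq_leq (etrans (congr1 succn rU) (esym rM))).
have [b bP bM] := step_vec MP (eq_leq (etrans (congr1 succn rM) (esym rP))).
have [w wW wP] := step_vec PW (eq_leq (etrans (congr1 succn rP) (esym rW))).
have eM := eq_add_vec UM aM aU (etrans rM (congr1 succn (esym rU))).
have eP := eq_add_vec MP bP bM (etrans rP (congr1 succn (esym rM))).
have eW := eq_add_vec PW wW wP (etrans rW (congr1 succn (esym rP))).
have aP := submx_trans aM MP; have bW := submx_trans bP PW.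
have aW := submx_trans aP PW.
have Baa : bf Q a a = 0 by apply: perp_bf aM; rewrite -dP.
have Bba : bf Q b a = 0 by apply: perp_bf aM; rewrite -dP.
have Bab : bf Q a b = 0 by rewrite bfC.
have Bwa : bf Q w a != 0.
  apply: contra wP => /eqP h; rewrite dP.
  by apply: (perp_add_vec (A := fl x j) _ h); rewrite -?dW ?eM.
have Bbb : bf Q b b != 0.
  apply: contra bM => /eqP h; rewrite dM.
  by apply: (perp_add_vec (A := fl x j.+1) _ h); [rewrite -dP | rewrite eP].
have n2 := two_neq0.
(* Since a is isotropic and orthogonal to b, the equation of the conic is of degree 1 in the
   coefficient of a. Its slope 2 B(w, a) is nonzero because w lies outside P, the orthogonal of a
   and U. *)
pose s t := - bf Q (w + t *: b) (w + t *: b) / (2 * bf Q w a).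
have quad t r : bf Q (w + t *: b + r *: a) (w + t *: b + r *: a)
    = bf Q (w + t *: b) (w + t *: b) + 2 * bf Q w a * r.
  by rewrite !(bfDl, bfDr, bfZl, bfZr) Baa Bab Bba [bf Q a w]bfC //; ring.
apply: (pencil_pick (u := fun t => w + t *: b + s t *: a) cx); rewrite ?p2.
- move=> t; apply: contra wP => h.
  have -> : w = (w + t *: b + s t *: a) - s t *: a - t *: b by rewrite !addrK.
  rewrite addmx_sub // ?eqmx_opp ?scalemx_sub //.
  rewrite addmx_sub // ?eqmx_opp ?scalemx_sub //.
  exact: submx_trans h MP.
- by move=> t; rewrite !addmx_sub // scalemx_sub.
- move=> t _; rewrite quad /s; field; exact/andP.
- move=> t t' h; apply: (lines_inj (A := fl x j) (a := a) (w := w) _ _ h).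
    by rewrite -eM.
  apply: contra wP => h'; apply: submx_trans h' _.
  by rewrite !addsmx_sub bP aP (submx_trans UM).
move=> L UL LW LM rL isoL.
have Lbf z : (z <= L)%MS -> bf Q z z = 0.
  by move=> zL; apply: (perp_bf _ zL); apply: submx_trans zL (isoL hj).
have orthU z u : (z <= fl x j.+3)%MS -> (u <= fl x j)%MS -> bf Q z u = 0.
  by move=> zW uU; apply: perp_bf uU; rewrite -dW.
have coef z : (z <= fl x j.+3)%MS -> exists k l r u,
    [/\ (u <= fl x j)%MS, z = k *: w + l *: b + r *: a + u
      & (k == 0) = (z <= fl x j.+2)%MS].
  move=> zW.
  have [k hk] : exists k, (z - k *: w <= fl x j.+2)%MS.
    by apply: vec_span; rewrite -eW.
  have [l hl] : exists l, (z - k *: w - l *: b <= fl x j.+1)%MS.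
    by apply: vec_span; rewrite -eP.
  have [r hr] : exists r, (z - k *: w - l *: b - r *: a <= fl x j)%MS.
    by apply: vec_span; rewrite -eM.
  exists k, l, r, (z - k *: w - l *: b - r *: a); split=> //.
    by apply/rowP => i; rewrite !mxE; ring.
  apply/eqP/idP => [k0|zP]; first by move: hk; rewrite k0 scale0r subr0.
  apply/eqP; apply: contraNT wP => k0.
  have -> : w = k^-1 *: (z - (z - k *: w)).
    by apply/rowP => i; rewrite !mxE; field.
  by rewrite scalemx_sub // addmx_sub // eqmx_opp.
have [i hi] := row_subPn LM; have zL : (row i L <= L)%MS by apply: row_sub.
have zW := submx_trans zL LW.
have [k [l [r [u [uU ez ek]]]]] := coef _ zW.
have uL := submx_trans uU UL; have uW := submx_trans uL LW.
(* For k = 0 the vector lies in P, where the form is l^2 B(b, b). Isotropy then gives l = 0, which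
   puts the vector in the step of x. *)
have k0 : k != 0.
  apply/negP => k0; have l0 : l != 0.
    apply: contraNneq hi => l0; rewrite ez (eqP k0) l0 !scale0r !add0r.
    by rewrite addmx_sub ?scalemx_sub // (submx_trans uU).
  have := Lbf _ zL; rewrite ez (eqP k0) scale0r add0r.
  have Bbu := orthU _ _ bW uU; have Bau := orthU _ _ aW uU.
  have Buu := orthU _ _ uW uU.
  rewrite !(bfDl, bfDr, bfZl, bfZr) Baa Bab Bba Bbu Bau Buu ![bf Q u _]bfC //.
  rewrite Bau Bbu !(mulr0, addr0, add0r) => /eqP.
  by rewrite !mulf_eq0 (negbTE l0) (negbTE Bbb).
have eL : ((w + (k^-1 * l) *: b + (k^-1 * r) *: a)%R <= L)%MS.
  have -> : (w + (k^-1 * l) *: b + (k^-1 * r) *: a)%R = k^-1 *: (row i L - u).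
    by rewrite ez; apply/rowP => c; rewrite !mxE; field.
  by rewrite scalemx_sub // addmx_sub // eqmx_opp.
exists (k^-1 * l); suff -> : s (k^-1 * l) = k^-1 * r by [].
have /eqP := Lbf _ eL; rewrite quad addrC addr_eq0 /s => /eqP <-.
by rewrite mulrC mulKf // mulf_neq0.
Qed.

Lemma pencil_card (j : 'I_d) (x : flag F D D) :
  x \in complete_flags Q D -> #|pencil Q j x :\ x| = #|F|.
Proof.
case: (boolP (j.+1 < d)%N) => hj; first exact: pencil_card_lt.
exact: pencil_card_last.
Qed.

End PencilCard.

(** Pigeonhole: more than half of the elements of F are squares, so the sets of values of a s^2 and
    of - (b t^2 + c) meet. *)
Lemma binary_form_surj (F : finFieldType) (a b c : F) : odd #|F| ->
  a != 0 -> b != 0 -> exists s t, a * s ^+ 2 + b * t ^+ 2 + c = 0.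
Proof.
move=> oddF a0 b0; pose S := [set s ^+ 2 | s : F]; pose S' := S :\ 0.
(* A choice of square roots: every s is r (s^2) or its opposite, and 0 needs only one of them,
   whence q <= 2 #|S| - 1. *)
pose r (y : F) := if [pick s | s ^+ 2 == y] is Some s then s else 0.
have rP s : (s == r (s ^+ 2)) || (s == - r (s ^+ 2)).
  rewrite /r; case: pickP => [s' /eqP e|/(_ s)]; last by rewrite eqxx.
  by rewrite -eqf_sqr e.
have cS : (#|F| < #|S|.*2)%N.
  have S0 : 0 \in S by apply/imsetP; exists 0; rewrite ?expr0n.
  have le : (#|F| <= #|r @: S| + #|[set - r y | y in S']|)%N.
    apply: leq_trans (leq_card_setU _ _); rewrite -cardsT subset_leq_card //.
    apply/fintype.subsetP => s _; rewrite finset.in_setU.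
    have sS : s ^+ 2 \in S by apply/imsetP; exists s.
    have [s0|s0] := eqVneq s 0.
      apply/orP; left; apply/imsetP; exists 0 => //.
      have := rP 0; rewrite s0 expr0n /= => /orP[/eqP//|/eqP e].
      by rewrite -[LHS]oppr0 {1}e opprK.
    have /orP[/eqP e|/eqP e] := rP s; apply/orP; [left|right]; apply/imsetP.
      by exists (s ^+ 2).
    by exists (s ^+ 2); rewrite // in_setD1 sqrf_eq0 s0.
  have h : (#|F| <= #|S| + #|S'|)%N.
    by apply: leq_trans le _; apply: leq_add; apply: leq_imset_card.
  have hd : #|S| = #|S'|.+1 by rewrite (cardsD1 0 S) S0.
  lia.
pose S1 := [set a * y | y in S]; pose S2 := [set - (b * y + c) | y in S].
have c1 : #|S1| = #|S| by rewrite card_imset //; apply: mulfI.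
have c2 : #|S2| = #|S|.
  by rewrite card_imset // => y y' /oppr_inj/addIr/(mulfI b0).
have : S1 :&: S2 != finset.set0.
  apply/eqP => e.
  have h : #|S1 :|: S2| = (#|S| + #|S|)%N by rewrite cardsU e cards0 c1 c2 subn0.
  have h' : (#|S1 :|: S2| <= #|F|)%N := max_card _.
  by rewrite h addnn leqNgt cS in h'.
case/set0Pn => z; rewrite finset.in_setI => /andP[/imsetP[_ /imsetP[s _ ->] ->]].
case/imsetP => _ /imsetP[t _ ->] e; exists s, t.
by rewrite -addrA e addNr.
Qed.

Section CompleteFlagExists.
Variables (F : finFieldType) (d : nat) (Q : 'M[F]_(DD d)).
Notation D := (DD d).
Hypotheses (symQ : Q^T = Q) (unitQ : Q \in unitmx) (oddF : odd #|F|).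

Lemma perp_add_eq (U : 'M[F]_D) (u w : 'rV[F]_D) : (u <= perp Q U)%MS ->
  bf Q u w = 0 -> (u <= perp Q (U + w)%MS)%MS.
Proof. by move=> uU uw; apply: (perp_add_vec uU uw). Qed.

(** The orthogonal of U has at least three dimensions more than U. If its vectors outside U were all
    anisotropic, three pairwise orthogonal ones would give a diagonal ternary form, and such a form
    has a zero by [binary_form_surj]. *)
Lemma isotropic_vector (U : 'M[F]_D) : (U <= perp Q U)%MS -> (\rank U < d)%N ->
  exists2 u : 'rV_D, (u <= perp Q U)%MS && ~~ (u <= U)%MS & bf Q u u = 0.
Proof.
move=> UU rU; apply: contrapT => no; have DE : DD d = d.*2.+1 by [].
have aniso (u : 'rV_D) : (u <= perp Q U)%MS -> ~~ (u <= U)%MS -> bf Q u u != 0.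
  by move=> h1 h2; apply/eqP => h3; apply: no; exists u; rewrite ?h1.
have step (A : 'M_D) : (U <= perp Q A)%MS -> (\rank A + \rank U < D)%N ->
    exists2 u : 'rV_D, (u <= perp Q A)%MS & ~~ (u <= U)%MS.
  move=> UA r; apply: step_vec => //; rewrite rank_perp //; lia.
have [|u1 p1 n1] := step U UU; first lia.
have r1 := rank_add_vec n1.
have U1 : (U <= perp Q (U + u1)%MS)%MS.
  by rewrite sub_perpC // addsmx_sub UU.
have [|u2 p2 n2] := step _ U1; first by rewrite r1; lia.
have [pU2 b12] : (u2 <= perp Q U)%MS /\ bf Q u2 u1 = 0.
  by split; [apply: submx_trans p2 (perpS symQ (addsmxSl _ _))
           | apply: perp_bf p2 (addsmxSr _ _)].
have r2 : (\rank (U + u1 + u2)%MS <= (\rank U).+2)%N.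
  by rewrite -r1 (leq_trans (mxrank_adds_leqif _ _)) // -[X in (_ <= X)%N]addn1
    leq_add2l rank_leq_row.
have U2 : (U <= perp Q (U + u1 + u2)%MS)%MS.
  by rewrite sub_perpC // addsmx_sub pU2 sub_perpC ?U1.
have [|u3 p3 n3] := step _ U2; first lia.
have [pU3 [b31 b32]] : (u3 <= perp Q U)%MS /\ bf Q u3 u1 = 0 /\ bf Q u3 u2 = 0.
  have S1 : (U + u1 <= U + u1 + u2)%MS by apply: addsmxSl.
  split; first by apply: submx_trans p3 (perpS symQ (submx_trans (addsmxSl _ _) S1)).
  by split; apply: perp_bf p3 _; rewrite ?addsmxSr // (submx_trans _ S1) ?addsmxSr.
have [s [t st]] := binary_form_surj (bf Q u3 u3) oddF (aniso _ p1 n1) (aniso _ pU2 n2).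
have b21 : bf Q u1 u2 = 0 by rewrite bfC.
have b13 : bf Q u1 u3 = 0 by rewrite bfC.
have b23 : bf Q u2 u3 = 0 by rewrite bfC.
pose w := s *: u1 + t *: u2 + u3.
have bw3 : bf Q w u3 = bf Q u3 u3.
  by rewrite /w !(bfDl, bfZl) b13 b23 !mulr0 !add0r.
have pw : (w <= perp Q U)%MS by rewrite /w !addmx_sub ?scalemx_sub.
(* The zero w is not in U: its product with u3 is B(u3, u3), which is nonzero, whereas u3 is
   orthogonal to U. *)
have /negP[] : bf Q w w != 0.
  apply: (aniso w) => //; apply: contraNN (aniso _ pU3 n3) => wU.
  by rewrite -bw3 bfC // (perp_bf pU3 wU).
rewrite -st /w !(bfDl, bfDr, bfZl, bfZr) b12 b21 b13 b31 b23 b32.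
by apply/eqP; ring.
Qed.

Lemma isotropic_chain i : (i <= d)%N -> exists f : nat -> 'M[F]_D,
  [/\ f 0%N = 0, forall k, (k < i)%N -> (f k <= f k.+1)%MS,
      forall k, (k <= i)%N -> \rank (f k) = k & (f i <= perp Q (f i))%MS].
Proof.
elim: i => [_|i IH id].
  exists (fun=> 0); split=> //; last exact: sub0mx.
  by move=> k; rewrite leqn0 mxrank0 => /eqP.
have [f [f0 fS fr fi]] := IH (ltnW id).
have [|u /andP[uU nu] uu] := isotropic_vector fi; first by rewrite fr.
pose g k := if (k <= i)%N then f k else (f i + u)%MS.
have gi : g i = f i by rewrite /g leqnn.
have gS : g i.+1 = (f i + u)%MS by rewrite /g ltnn.
exists g; split; first by rewrite /g.
- move=> k; rewrite ltnS leq_eqVlt => /orP[/eqP->|ki].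
    by rewrite gi gS addsmxSl.
  by rewrite /g ki (ltnW ki) fS.
- move=> k; rewrite leq_eqVlt => /orP[/eqP->|]; last first.
    by rewrite ltnS => ki; rewrite /g ki fr.
  by rewrite gS rank_add_vec // fr.
rewrite gS addsmx_sub; apply/andP; split; last exact: perp_add_eq.
by rewrite sub_perpC // addsmx_sub fi.
Qed.

Lemma complete_flag_exists : exists x, x \in complete_flags Q D.
Proof.
have [f [f0 fS fr fi]] := isotropic_chain (leqnn d).
have fmono k l : (k <= l <= d)%N -> (f k <= f l)%MS.
  elim: l => [|l IH]; first by rewrite leqn0 => /andP[/eqP->].
  rewrite leq_eqVlt => /andP[/orP[/eqP-> //|]]; rewrite ltnS => kl ld.
  by apply: submx_trans (fS _ ld); apply: IH; rewrite kl ltnW.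
pose x : flag F D D := [ffun k : 'I_D.+1 =>
  if (k <= d)%N then <<f k>>%MS else <<perp Q (f (D - k)%N)>>%MS].
have xE k : (k <= D)%N -> fl x k =
    if (k <= d)%N then <<f k>>%MS else <<perp Q (f (D - k)%N)>>%MS.
  by move=> kD; rewrite /fl ffunE inordK.
exists x; apply/complete_flagsP => //; split; last first.
  move=> k kD; rewrite xE //; case: leqP => kd; rewrite genmxE ?fr //.
  by rewrite rank_perp // fr; move: kD kd; rewrite /DD; lia.
apply/flagsP; split.
- by move=> k kD; rewrite xE //; case: ifP => _; rewrite genmx_id.
- by rewrite xE //= f0 genmx0.
- rewrite xE // ifN; last by rewrite /DD; lia.
  rewrite subnn f0 -genmx1; apply/genmxP.
  by rewrite submx1 sub_perpC // sub0mx.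
- move=> k kD; rewrite !xE // ?(ltnW kD) //.
  case: (ltngtP k d) => kd; rewrite !genmxE.
  + exact: fS.
  + by apply: perpS => //; apply: fmono; move: kd kD; rewrite /DD; lia.
  have -> : (D - k.+1)%N = d by rewrite kd /DD; lia.
  by rewrite kd.
move=> k kD; rewrite !xE ?leq_subr // !subKn //.
have -> : (D - k <= d)%N = ~~ (k <= d)%N by move: kD; rewrite /DD; lia.
case: leqP => kd /=; apply: eqmx_trans (genmxE _) _; apply: eqmx_sym.
  by apply: eqmx_trans (eq_perp symQ (genmxE _)) _; apply: perpK.
exact: (eq_perp symQ (genmxE _)).
Qed.

End CompleteFlagExists.

(** * Sequences up to the Weyl group *)

Section Sorted.
Variable D : nat.
Implicit Types th : 'I_D -> nat.

Definition mono th : Prop := forall c c' : 'I_D, (c <= c')%N -> (th c <= th c')%N.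

Definition cut th (i : nat) : nat := (\sum_c (th c < i))%N.

(** The potential of the rearrangement inequality: it grows when a descent is exchanged. It makes
    inductions on descents terminate, and its maxima are sorted. *)
Definition level th : nat := (\sum_(c < D) c * th c)%N.

Lemma sum_lt (k : nat) : (k <= D)%N -> (\sum_(c < D) (c < k))%N = k.
Proof.
move=> kD; rewrite -[RHS]card_ord -sum1_card.
rewrite (big_ord_widen _ (fun=> 1%N) kD) [RHS]big_mkcond /=.
by apply: eq_bigr => c _; case: ifP.
Qed.

Lemma cut_le th i : (cut th i <= D)%N.
Proof.
rewrite -[D in (_ <= D)%N]card_ord -sum1_card; apply: leq_sum => c _.
by case: ltnP.
Qed.

Lemma cut_lt th (c : 'I_D) i : mono th -> (c < cut th i)%N = (th c < i)%N.
Proof.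
move=> hth; apply/idP/idP => h; last first.
  rewrite -[c.+1](sum_lt (ltn_ord c)); apply: leq_sum => c' _.
  case: ltnP => //; rewrite ltnS => /hth h'; by rewrite (leq_ltn_trans h' h).
rewrite ltnNge; apply: contraL h => h; rewrite -leqNgt.
rewrite -[X in (_ <= X)%N](sum_lt (ltnW (ltn_ord c))); apply: leq_sum => c' _.
case: (ltnP c' c) => [_|/hth h']; first by case: ltnP.
by rewrite ltnNge (leq_trans h h').
Qed.

Lemma sorted_unique th th' : mono th -> mono th' ->
  (forall e, (\sum_c (th c == e) = \sum_c (th' c == e))%N) -> th =1 th'.
Proof.
move=> h h' e.
have ec i : cut th i = cut th' i.
  elim: i => [|i IH]; first by rewrite /cut !big1.
  have step (t : 'I_D -> nat) : (cut t i.+1 = cut t i + \sum_c (t c == i))%N.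
    rewrite /cut -big_split /=; apply: eq_bigr => c _.
    by rewrite ltnS leq_eqVlt; case: ltngtP.
  by rewrite !step IH e.
move=> c; have lt i : (th c < i)%N = (th' c < i)%N.
  by rewrite -(cut_lt c i h) -(cut_lt c i h') ec.
by have := lt (th c).+1; have := lt (th' c).+1; lia.
Qed.

End Sorted.

Section SymSorted.
Variable d : nat.
Notation D := (DD d).

Lemma cut_rev m (t : 'I_D -> 'I_m) i : symf t -> (i <= m)%N ->
  cut (fun c => t c) (m - i) = (D - cut (fun c => t c) i)%N.
Proof.
move=> st im; apply/eqP; rewrite -(eqn_add2r (cut (fun c => t c) i)).
rewrite subnK ?cut_le // /cut (reindex_inj rev_ord_inj) -big_split /=.
rewrite (eq_bigr (fun=> 1%N)) ?sum1_card ?card_ord // => c _.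
by rewrite st /=; have := ltn_ord (t c); case: (ltnP (t c) i); lia.
Qed.

Lemma cut_max m (t : 'I_D -> 'I_m) : cut (fun c => t c) m = D.
Proof.
rewrite /cut (eq_bigr (fun=> 1%N)) ?sum1_card ?card_ord // => c _.
by rewrite ltn_ord.
Qed.

(** The pens with j.+1 < d compare neighbours in the lower half. The last pen compares a letter with
    its own mirror image, hence with the middle letter. The upper half follows by symmetry. *)
Lemma mono_pens m (t : 'I_D -> 'I_m) : symf t ->
  (forall j, (t (pen1 j) <= t (pen2 j))%N) -> mono (fun c => t c).
Proof.
move=> st h.
have low (c c' : 'I_D) : c' = c.+1 :> nat -> (c < d)%N -> (t c <= t c')%N.
  move=> e cd; have := h (Ordinal cd); have -> : pen1 (Ordinal cd) = c by apply: val_inj.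
  case: (ltnP c.+1 d) => cd1.
    suff -> : pen2 (Ordinal cd) = c' by [].
    by apply: val_inj; rewrite /= cd1 e.
  rewrite -rev_pen1 -?leqNgt // st.
  have -> : pen1 (Ordinal cd) = c by apply: val_inj.
  have cd' : c' = d :> nat by rewrite e; lia.
  by have := symf_mid st cd'; rewrite /=; lia.
have adj (c c' : 'I_D) : c' = c.+1 :> nat -> (t c <= t c')%N.
  move=> e; case: (ltnP c d) => cd; first exact: low.
  have cD := ltn_ord c'; have DE : DD d = d.*2.+1 by [].
  have := low (rev_ord c') (rev_ord c); rewrite !st /= e.
  have h1 : (D - c.+1 = (D - c.+2).+1)%N by lia.
  have h2 : (D - c.+2 < d)%N by lia.
  by move=> /(_ h1 h2); have := ltn_ord (t c); have := ltn_ord (t c'); lia.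
have H k (c c' : 'I_D) : c' = (c + k)%N :> nat -> (t c <= t c')%N.
  elim: k c' => [|k IH] c' e.
    by have -> : c' = c by apply: val_inj; rewrite /= e addn0.
  have kD : (c + k < D)%N by have := ltn_ord c'; rewrite e; lia.
  by apply: leq_trans (IH (Ordinal kD) erefl) (adj _ _ _); rewrite e addnS.
by move=> c c' cc; apply: (H (c' - c)%N); rewrite subnKC.
Qed.

(** Both sums are doubled and written over the pairs c, [refl j c]. Each pair obeys the
    rearrangement inequality, strictly at [pen1 j]. *)
Lemma level_refl m (t : 'I_D -> 'I_m) (j : 'I_d) : symf t ->
  (t (pen2 j) < t (pen1 j))%N ->
  (level (fun c => t c) < level (fun c => t (refl j c)))%N.
Proof.
move=> st h; rewrite /level.
have rearr (c s u w : nat) : (c <= s)%N -> (w <= u)%N ->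
  (c * u + s * w <= c * w + s * u)%N by nia.
have rearr_lt (c s u w : nat) : (c < s)%N -> (w < u)%N ->
  (c * u + s * w < c * w + s * u)%N by nia.
have p12 := pen1_lt_pen2 j.
have E : (\sum_(c < D) c * t (refl j c))%N = (\sum_(c < D) refl j c * t c)%N.
  rewrite (reindex_inj (@perm_inj _ (refl j))) /=.
  by apply: eq_bigr => c _; rewrite reflK.
have E' : (\sum_(c < D) c * t c)%N = (\sum_(c < D) refl j c * t (refl j c))%N.
  by rewrite (reindex_inj (@perm_inj _ (refl j))).
rewrite -ltn_double -!addnn {2}E' {2}E -!big_split /=.
rewrite (bigD1 (pen1 j)) //= [X in (_ < X)%N](bigD1 (pen1 j)) //=.
rewrite -addSn; apply: leq_add.
  by rewrite refl_pen1; apply: rearr_lt.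
apply: leq_sum => c _.
have R (c1 c2 : 'I_D) : (c1 < c2)%N -> (t c2 < t c1)%N -> refl j c1 = c2 ->
  (c1 * t c1 + refl j c1 * t (refl j c1)
   <= c1 * t (refl j c1) + refl j c1 * t c1)%N.
  by move=> h1 h2 ->; apply: rearr; apply: ltnW.
have R' (c1 c2 : 'I_D) : (c1 < c2)%N -> (t c2 < t c1)%N -> refl j c2 = c1 ->
  (c2 * t c2 + refl j c2 * t (refl j c2)
   <= c2 * t (refl j c2) + refl j c2 * t c2)%N.
  by move=> h1 h2 ->; rewrite addnC [X in (_ <= X)%N]addnC; apply: rearr; apply: ltnW.
have hr : (t (rev_ord (pen1 j)) < t (rev_ord (pen2 j)))%N.
  by rewrite !st /=; have := ltn_ord (t (pen1 j)); lia.
have pr : (rev_ord (pen2 j) < rev_ord (pen1 j))%N.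
  by have := ltn_ord (pen2 j); move: p12; rewrite /=; lia.
case: (eqVneq c (pen1 j)) => [->|n1]; first exact: (R _ (pen2 j) _ _ (refl_pen1 j)).
case: (eqVneq c (pen2 j)) => [->|n2]; first exact: (R' (pen1 j) _ _ _ (refl_pen2 j)).
case: (eqVneq c (rev_ord (pen1 j))) => [->|n3].
  by apply: (R' (rev_ord (pen2 j))) => //; rewrite refl_rev refl_pen1.
case: (eqVneq c (rev_ord (pen2 j))) => [->|n4].
  by apply: (R _ (rev_ord (pen1 j))) => //; rewrite refl_rev refl_pen2.
have -> // : refl j c = c.
by rewrite reflE /refl_fun !ifN.
Qed.

Lemma level_bound m (t : 'I_D -> 'I_m) : (level (fun c => t c) <= D * (D * m))%N.
Proof.
rewrite /level -[X in (_ <= X * _)%N]card_ord -sum_nat_const; apply: leq_sum => c _.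
by apply: leq_mul; apply: ltnW.
Qed.

(** Induction on descents, replacing the induction on length in the Weyl group: each exchange raises
    [level], which is bounded. *)
Lemma refl_ind m (P : {ffun 'I_D -> 'I_m} -> Prop) :
  (forall t : {ffun 'I_D -> 'I_m}, symf t -> mono (fun c => t c) -> P t) ->
  (forall (t : {ffun 'I_D -> 'I_m}) j, symf t ->
     (t (pen2 j) < t (pen1 j))%N -> P [ffun c => t (refl j c)] -> P t) ->
  forall t : {ffun 'I_D -> 'I_m}, symf t -> P t.
Proof.
move=> base step t; have [k] := ubnP (D * (D * m) - level (fun c => t c))%N.
elim: k t => // k IH t hk st.
have [/existsP[j hj]|no] := boolP [exists j, (t (pen2 j) < t (pen1 j))%N].
  have sr : symf [ffun c => t (refl j c)].
    by move=> c; rewrite !ffunE refl_rev st.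
  apply: (step t j) => //; apply: IH => //.
  have := level_refl st hj; have := level_bound [ffun c => t (refl j c)].
  have -> : level (fun c => [ffun c => t (refl j c)] c) = level (fun c => t (refl j c)).
    by apply: eq_bigr => c _; rewrite ffunE.
  move: hk; lia.
apply: base => //; apply: mono_pens => // j; rewrite leqNgt.
by apply: contra no => h; apply/existsP; exists j.
Qed.

End SymSorted.

(** * Coarsenings of complete flags *)

Section Coarsen.
Variables (F : finFieldType) (d : nat) (Q : 'M[F]_(DD d)).
Notation D := (DD d).
Implicit Types (x : flag F D D).

Definition coarsen m (t : 'I_D -> 'I_m) x : flag F D m :=
  [ffun i : 'I_m.+1 => fl x (cut (fun c => t c) i)].

Lemma fl_coarsen m (t : 'I_D -> 'I_m) x i : (i <= m)%N ->
  fl (coarsen t x) i = fl x (cut (fun c => t c) i).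
Proof. by move=> im; rewrite /fl ffunE inordK. Qed.

Lemma coarsen_flags m (t : 'I_D -> 'I_m) x : x \in flags Q D -> symf t ->
  coarsen t x \in flags Q m.
Proof.
move=> hx st; have [gx x0 xD _ dx] := flagsP _ _ hx.
apply/flagsP; split.
- by move=> i im; rewrite fl_coarsen // gx ?cut_le.
- by rewrite fl_coarsen // /cut big1.
- by rewrite fl_coarsen // cut_max.
- move=> i im; rewrite !fl_coarsen // 1?ltnW //; apply: (fl_mono hx).
  rewrite cut_le andbT; apply: leq_sum => c _; case: (ltnP (t c) i) => // h.
  by have -> : (t c < i.+1)%N by apply: ltnW.
move=> i im; rewrite !fl_coarsen ?leq_subr // cut_rev //; apply: dx.
exact: cut_le.
Qed.

Lemma relpos_coarsen m k (t : 'I_D -> 'I_m) x (z : flag F D k) :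
  x \in flags Q D -> z \in flags Q k -> symf t -> mono (fun c => t c) ->
  relpos (coarsen t x) z
  = \matrix_(i, b) (\sum_(c | t c == i) relpos x z c b)%N.
Proof.
move=> hx hz st mt; have hy := coarsen_flags hx st.
have rkc i l : (i <= m)%N -> (l <= k)%N -> rk (coarsen t x) z i l =
    (\sum_(c | t c < i) \sum_(b < k | b < l) relpos x z c b)%N.
  move=> im lk; have -> : rk (coarsen t x) z i l = rk x z (cut (fun c => t c) i) l.
    by rewrite /rk fl_coarsen.
  rewrite (rkE hx hz) ?cut_le //; apply: eq_bigl => c; exact: cut_lt.
apply/matrixP => i b; rewrite [RHS]mxE.
have := relpos_rk i b hy hz; rewrite !rkc ?ltn_ord // 1?ltnW // 1?ltnW //.
have split1 l : (\sum_(c < D | t c < i.+1) \sum_(b < k | b < l) relpos x z c b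
    = \sum_(c < D | t c < i) \sum_(b < k | b < l) relpos x z c b
      + \sum_(c < D | t c == i) \sum_(b < k | b < l) relpos x z c b)%N.
  rewrite (bigID (fun c => t c == i)) addnC /=; congr (_ + _)%N;
    by apply: eq_bigl => c; rewrite -val_eqE /=; lia.
have split2 (c : 'I_D) : (\sum_(b' < k | b' < b.+1) relpos x z c b'
    = \sum_(b' < k | b' < b) relpos x z c b' + relpos x z c b)%N.
  rewrite (bigD1 b) /=; last exact: ltnSn.
  rewrite addnC; congr (_ + _)%N; apply: eq_bigl => b'.
  by rewrite ltnS ltn_neqAle andbC.
rewrite !split1; have -> : (\sum_(c < D | t c == i) \sum_(b' < k | b' < b.+1)
   relpos x z c b' = \sum_(c < D | t c == i) \sum_(b' < k | b' < b) relpos x z c b'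
     + \sum_(c < D | t c == i) relpos x z c b)%N.
  by rewrite -big_split; apply: eq_bigr => c _; rewrite split2.
have arith (r a e c s : nat) : (r + a + (e + c) = a + (c + s) + e)%N -> r = s by lia.
exact: arith.
Qed.

Lemma relpos_coarsen_pos m k (t : 'I_D -> 'I_m) x (z : flag F D k)
    (chi : 'I_D -> 'I_k) :
  x \in flags Q D -> z \in flags Q k -> symf t -> mono (fun c => t c) ->
  relpos x z = mxof chi ->
  relpos (coarsen t x) z
  = \matrix_(i, b) (\sum_c ((t c == i) && (chi c == b)))%N.
Proof.
move=> hx hz st mt e; rewrite (relpos_coarsen hx hz st mt) e.
apply/matrixP => i b; rewrite !mxE [LHS]big_mkcond; apply: eq_bigr => c _.
by rewrite mxE [b == _]eq_sym; case: ifP.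
Qed.

Hypotheses (symQ : Q^T = Q) (unitQ : Q \in unitmx).

Lemma rk_self x i k : x \in complete_flags Q D -> (i <= D)%N -> (k <= D)%N ->
  rk x x i k = minn i k.
Proof.
move=> cx; have [hx rx] := complete_flagsP symQ unitQ _ cx.
wlog ik : i k / (i <= k)%N.
  move=> H iD kD; case: (boolP (i <= k)%N) => ik; first exact: H.
  by rewrite rkC minnC; apply: H => //; rewrite leqNgt; apply: contra ik => /ltnW.
move=> iD kD; rewrite (minn_idPl ik) -[RHS](rx i) //; apply/eqmx_rank.
by rewrite capmxSl sub_capmx submx_refl (fl_mono hx) // ik.
Qed.

(** The base case of all counts: for sorted t exactly one flag is in position t to a given complete
    flag x, since each of its members must be the member of x at the jump of t. *)
Lemma coarsenP m (t : 'I_D -> 'I_m) x (y : flag F D m) :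
  x \in complete_flags Q D -> y \in flags Q m -> symf t -> mono (fun c => t c) ->
  (relpos x y == mxof t) = (y == coarsen t x).
Proof.
move=> cx hy st mt; have [hx rx] := complete_flagsP symQ unitQ _ cx.
apply/eqP/eqP => [e|->].
  apply: eq_flag => i im; rewrite fl_coarsen //; apply/esym.
  have cD := cut_le (fun c => t c) i.
  have rkc : rk x y (cut (fun c => t c) i) i = cut (fun c => t c) i.
    rewrite (rk_pos hx hy e) // [RHS]/cut big_mkcond /=; apply: eq_bigr => c _.
    by rewrite cut_lt //; case: (t c < i)%N.
  apply: (eq_fl hx hy) => //; first by rewrite rkc rx.
  rewrite rkc -(rk_max _ _ hx) rkC (rk_pos hx hy e) // /cut.
  by apply: eq_bigl => c; rewrite ltn_ord.
have hc := coarsen_flags hx st.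
have [phi e _] := posP symQ unitQ cx hc; rewrite e; apply: eq_mxof => c.
have lt i : (i <= m)%N -> (phi c < i)%N = (t c < i)%N.
  move=> im; have := rk_posS c hx hc e im.
  have cD := ltnW (ltn_ord c).
  rewrite /rk fl_coarsen // -!/(rk x x _ _) !rk_self ?cut_le //.
  by rewrite -(cut_lt c i mt); case: (phi c < i)%N; lia.
apply: ord_inj; have := lt _ (ltn_ord (phi c)).
by have := lt _ (ltn_ord (t c)); lia.
Qed.

End Coarsen.

(** * Counts as polynomials in the number of elements of the field *)

Section PencilCount.
Variable d : nat.
Notation D := (DD d).

Definition reflf m (j : 'I_d) (phi : {ffun 'I_D -> 'I_m}) :
  {ffun 'I_D -> 'I_m} := [ffun c => phi (refl j c)].

Lemma reflfK m j : involutive (@reflf m j).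
Proof. by move=> phi; apply/ffunP => c; rewrite !ffunE reflK. Qed.

Lemma symf_reflf m j (phi : {ffun 'I_D -> 'I_m}) : symf phi -> symf (reflf j phi).
Proof. by move=> h c; rewrite !ffunE refl_rev h. Qed.

Lemma reflf_pen1 m j (phi : {ffun 'I_D -> 'I_m}) :
  reflf j phi (pen1 j) = phi (pen2 j).
Proof. by rewrite ffunE refl_pen1. Qed.

Lemma reflf_pen2 m j (phi : {ffun 'I_D -> 'I_m}) :
  reflf j phi (pen2 j) = phi (pen1 j).
Proof. by rewrite ffunE refl_pen2. Qed.

Lemma reflf_id m j (phi : {ffun 'I_D -> 'I_m}) : symf phi ->
  phi (pen1 j) = phi (pen2 j) -> reflf j phi = phi.
Proof.
move=> s e; apply/ffunP; apply: (symf_eq_pen (j := j)) => //.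
- exact: symf_reflf.
- by rewrite reflf_pen1.
- by rewrite reflf_pen2.
by move=> c hc; rewrite ffunE hc.
Qed.

(** If x has letters phi relative to y, this counts the x' other than x in its pencil that have
    letters psi. Equal letters at the pens: all q keep phi. Ascent: x is the special member and all
    q others are reflected. Descent: one is reflected, q - 1 keep phi. *)
Definition pen_poly m (j : 'I_d) (phi psi : {ffun 'I_D -> 'I_m}) : {poly int} :=
  if phi (pen1 j) == phi (pen2 j) then 'X *+ (psi == phi)
  else if (phi (pen1 j) < phi (pen2 j))%N then 'X *+ (psi == reflf j phi)
  else (psi == reflf j phi)%:R + ('X - 1) *+ (psi == phi).

Lemma mxof_eq m (phi psi : {ffun 'I_D -> 'I_m}) : (mxof phi == mxof psi) = (phi == psi).
Proof. by apply/eqP/eqP => [/mxof_inj/ffunP|->]. Qed.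

Variables (F : finFieldType) (Q : 'M[F]_D).
Hypothesis ndQ : nondeg_form Q.

Lemma pencil_count m j (x : flag F D D) (y : flag F D m)
    (phi psi : {ffun 'I_D -> 'I_m}) :
  x \in complete_flags Q D -> y \in flags Q m -> relpos x y = mxof phi ->
  symf phi ->
  (pen_poly j phi psi).[#|F|%:Z]
  = #|[set x' in pencil Q j x :\ x | relpos x' y == mxof psi]|%:Z.
Proof.
have [oddF symQ unitQ] := ndQ => cx hy e s.
have cardP := pencil_card symQ unitQ oddF j cx.
have all_eq (chi : {ffun 'I_D -> 'I_m}) (S : {set flag F D D}) :
    (forall x', x' \in S -> relpos x' y = mxof chi) ->
    #|[set x' in S | relpos x' y == mxof psi]| = (#|S| * (psi == chi))%N.
  move=> h; have [->|ne] := eqVneq psi chi.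
    rewrite muln1; apply: eq_card => x'; rewrite finset.in_set.
    by case: (boolP (x' \in S)) => // /h ->; rewrite eqxx.
  rewrite muln0; apply: eq_card0 => x'; rewrite finset.in_set.
  by case: (boolP (x' \in S)) => // /h ->; rewrite mxof_eq eq_sym (negbTE ne).
have posx x' : x' \in pencil Q j x -> exists phi' : {ffun 'I_D -> 'I_m},
    [/\ relpos x' y = mxof phi', symf phi' & phi' = phi \/ phi' = reflf j phi].
  move=> px'; have [cx' _] := pencilP _ _ _ _ px'.
  have [phi' e' s'] := posP symQ unitQ cx' hy; exists phi'; split=> //.
  have [h|h] := pencil_pos cx px' hy e e' s s'; [left|right]; apply/ffunP => c.
    by rewrite h.
  by rewrite h ffunE.
have mulb (p : {poly int}) (b : bool) : (p *+ b).[#|F|%:Z] = p.[#|F|%:Z] *+ b.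
  by rewrite hornerMn.
rewrite /pen_poly; case: eqVneq => [eq12|ne12].
  rewrite mulb hornerX (all_eq phi); last first.
    move=> x'; rewrite in_setD1 => /andP[_ /posx[phi' [-> _ h]]].
    by move: h; rewrite (reflf_id s eq12); case=> ->.
  by rewrite cardP; case: (psi == phi); rewrite ?muln1 ?muln0.
have [x0 px0 hx0] := special_member symQ unitQ cx hy e s ne12.
case: ltnP => h12.
  have x0E : x = x0 by apply/eqP; rewrite -(hx0 x phi) //; apply: pencil_refl.
  rewrite mulb hornerX (all_eq (reflf j phi)); last first.
    move=> x'; rewrite in_setD1 => /andP[ne px']; have [phi' [e' s' h]] := posx _ px'.
    move: ne; rewrite {1}x0E -(hx0 x' phi') // e'; case: h => -> //.
    by rewrite h12.
  by rewrite cardP; case: (psi == _); rewrite ?muln1 ?muln0.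
have {h12} h21 : (phi (pen2 j) < phi (pen1 j))%N.
  by rewrite ltn_neqAle h12 andbT eq_sym.
have x0x : x0 != x.
  by rewrite eq_sym -(hx0 x phi) ?pencil_refl // -leqNgt ltnW.
have x0p : x0 \in pencil Q j x :\ x by rewrite in_setD1 x0x.
have e0 : relpos x0 y = mxof (reflf j phi).
  have [phi' [e' s' h]] := posx _ px0; have := hx0 _ _ px0 e' s'.
  by rewrite e' eqxx; case: h => -> //; rewrite ltnNge ltnW.
have disj : phi != reflf j phi.
  apply/eqP => h; move: h21; rewrite {1}h reflf_pen2 ltnn //.
rewrite hornerD !mulb hornerD hornerX hornerN -polyC1 !hornerC.
pose S := (pencil Q j x :\ x) :\ x0; rewrite -(finset.setD1K x0p) -/S.
have cS : #|F| = #|S|.+1 by rewrite -cardP (cardsD1 x0) x0p.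
have hS : #|[set x' in S | relpos x' y == mxof psi]| = (#|S| * (psi == phi))%N.
  apply: all_eq => x'; rewrite !in_setD1 => /and3P[n0 nx px'].
  have [phi' [e' s' h]] := posx _ px'; rewrite e'.
  case: h e' => -> // e'; move: n0; rewrite -(hx0 _ _ px' e'); last exact: symf_reflf.
  by rewrite reflf_pen1 reflf_pen2 h21.
have -> : [set x' in x0 |: S | relpos x' y == mxof psi]
    = (if psi == reflf j phi then [set x0] else finset.set0)
      :|: [set x' in S | relpos x' y == mxof psi].
  apply/setP => x'; rewrite !(finset.in_set, finset.in_setU).
  have [->|ne] := eqVneq x' x0.
    rewrite e0 mxof_eq [reflf _ _ == _]eq_sym.
    by case: (psi == reflf j phi); rewrite ?finset.in_set1 ?finset.in_set0 ?eqxx ?andbF.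
  by case: (psi == reflf j phi); rewrite ?finset.in_set1 ?finset.in_set0 ?(negbTE ne).
rewrite cardsU hS disjoint_setI0 ?cards0 ?subn0; last first.
  rewrite -setI_eq0; apply/eqP/setP => x'.
  rewrite finset.in_setI [RHS]finset.in_set0; case: ifP => _.
    rewrite finset.in_set1; have [->|//] := eqVneq x' x0; rewrite andTb.
    by apply/negP; rewrite finset.in_set in_setD1 eqxx.
  by rewrite finset.in_set0.
rewrite cS; case: eqP => [->|_]; rewrite ?cards1 ?cards0.
  by rewrite eq_sym (negbTE disj) muln0 addn0 addr0.
by rewrite !add0r; case: (psi == phi); rewrite ?muln1 ?muln0 //= -addn1 PoszD addrK.
Qed.

End PencilCount.

Section CountPolynomials.
Variable d : nat.
Notation D := (DD d).

(** Seen from an ascending t the count is 0 or 1: at most one member of a pencil is ascending, and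
    it differs from x exactly when x itself has the reflected letters. *)
Lemma pen_poly_sorted m (j : 'I_d) (phi t : {ffun 'I_D -> 'I_m}) :
  (t (pen1 j) < t (pen2 j))%N -> pen_poly j phi t = (phi == reflf j t)%:R.
Proof.
move=> ht.
have E : (t == reflf j phi) = (phi == reflf j t).
  by apply/eqP/eqP => ->; rewrite reflfK.
have contra1 (psi : {ffun 'I_D -> 'I_m}) :
    (psi (pen2 j) <= psi (pen1 j))%N -> (t == psi) = false.
  by move=> h; apply/eqP => e; move: ht; rewrite e ltnNge h.
rewrite /pen_poly -E; case: eqVneq => [e|ne].
  by rewrite (contra1 phi) ?e // contra1 // reflf_pen1 reflf_pen2 e.
case: ltnP => h.
  by rewrite contra1 // reflf_pen1 reflf_pen2 ltnW.
by rewrite [t == phi]contra1 // mulr0n addr0.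
Qed.

Definition coarse m k (t : 'I_D -> 'I_m) (chi : 'I_D -> 'I_k) : 'M[nat]_(m, k) :=
  \matrix_(i, b) (\sum_c ((t c == i) && (chi c == b)))%N.

(** For a descent of t at j, a flag y in position t to x is in the ascending position [reflf j t] to
    exactly one other flag of the pencil of x. The count is therefore a sum over that pencil,
    grouped by the position psi of its members relative to z. *)
Lemma counts_complete m2 m3 (t : {ffun 'I_D -> 'I_m2}) (B : 'M[nat]_(m2, m3)) :
  symf t -> exists P : {ffun 'I_D -> 'I_m3} -> {poly int},
  forall (chi : {ffun 'I_D -> 'I_m3}) (F : finFieldType) (Q : 'M[F]_D),
  nondeg_form Q -> forall x z, x \in complete_flags Q D -> z \in flags Q m3 ->
    relpos x z = mxof chi -> symf chi ->
    (P chi).[#|F|%:Z] = #|[set y in flags Q m2 |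
      (relpos x y == mxof t) && (relpos y z == B)]|%:Z.
Proof.
move: t; apply: refl_ind => [t st mt|t j st ht [P hP]].
  exists (fun chi => (coarse t chi == B)%:R) => chi F Q [oddF symQ unitQ] x z.
  move=> cx hz e sc; have hx := complete_flagW cx.
  rewrite -polyC_natr hornerC natz; congr Posz.
  have hy := coarsen_flags hx st.
  have := relpos_coarsen_pos hx hz st mt e; rewrite -/(coarse t chi) => rc.
  transitivity #|if coarse t chi == B then [set coarsen t x] else finset.set0|.
    by case: ifP; rewrite ?cards1 ?cards0.
  apply: eq_card => y; rewrite [RHS]finset.in_set.
  case: (boolP (y \in flags Q m2)) => [hy'|ny].
    rewrite (coarsenP symQ unitQ) //; have [->|ne] := eqVneq y (coarsen t x).
      by rewrite rc; case: ifP; rewrite ?finset.in_set1 ?finset.in_set0 ?eqxx.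
    by case: ifP; rewrite ?finset.in_set1 ?finset.in_set0 ?(negbTE ne).
  apply/negbTE; apply: contra ny; case: ifP => _; rewrite ?finset.in_set1 ?finset.in_set0 //.
  by move/eqP->.
exists (fun chi => \sum_psi pen_poly j chi psi * P psi).
move=> chi F Q nd x z cx hz e sc; have [oddF symQ unitQ] := nd.
set t' := reflf j t; have st' : symf t' := symf_reflf j st.
have ht' : (t' (pen1 j) < t' (pen2 j))%N by rewrite reflf_pen1 reflf_pen2.
pose S := pencil Q j x :\ x.
pose Cy x' := #|[set y in flags Q m2 | (relpos x' y == mxof t') && (relpos y z == B)]|.
have SP x' : x' \in S -> x' \in complete_flags Q D.
  by rewrite in_setD1 => /andP[_ /pencilP[]].
(* Exchange of the two sums: by [pen_poly_sorted] each y is counted once if its position to x is t,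
   and not at all otherwise. *)
have claim1 : (\sum_(x' in S) Cy x')%N
    = #|[set y in flags Q m2 | (relpos x y == mxof t) && (relpos y z == B)]|.
  have cardE (x' : flag F D D) (u : {ffun 'I_D -> 'I_m2}) : #|[set y in flags Q m2 |
     (relpos x' y == mxof u) && (relpos y z == B)]| =
     (\sum_(y in flags Q m2 | relpos y z == B) (relpos x' y == mxof u))%N.
    rewrite -sum1_card (eq_bigl (fun y => (y \in flags Q m2) && (relpos y z == B)
        && (relpos x' y == mxof u))); last first.
      by move=> y; rewrite finset.in_set andbAC andbA.
    by rewrite big_mkcondr /=; apply: eq_bigr => y _; case: (_ == _).
  rewrite (eq_bigr _ (fun x' _ => cardE x' t')) exchange_big cardE /=.
  apply: eq_bigr => y /andP[hy _]; have [phi ey sy] := posP symQ unitQ cx hy.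
  have := @pencil_count d F Q nd m2 j x y phi t' cx hy ey sy.
  rewrite pen_poly_sorted // /t' reflfK ey mxof_eq -polyC_natr hornerC natz.
  move=> [->]; rewrite -sum1_card [LHS](eq_bigr (fun x' =>
     if relpos x' y == mxof t' then 1%N else 0%N)); last by move=> x' _; case: eqP.
  by rewrite -big_mkcondr; apply: eq_bigl => x'; rewrite finset.in_set.
rewrite -claim1 horner_sum.
transitivity (\sum_(psi : {ffun 'I_D -> 'I_m3}) \sum_(x' in S) (relpos x' z == mxof psi)%:R * (Cy x')%:Z).
  apply: eq_bigr => psi _; rewrite hornerM (@pencil_count d F Q nd m3 j x z chi psi cx hz e sc).
  transitivity (\sum_(x' in S | relpos x' z == mxof psi) (P psi).[#|F|%:Z]).
    rewrite sumr_const -mulr_natl natz; congr (Posz _ * _).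
    by apply: eq_card => x'; rewrite finset.in_set.
  rewrite big_mkcondr; apply: eq_bigr => x' xS.
  case: eqP => ex; last by rewrite mul0r.
  rewrite mul1r (hP psi F Q nd x' z) //; first exact: SP.
  have [psi' ex' sx'] := posP symQ unitQ (SP _ xS) hz.
  by have /eqP := ex; rewrite ex' mxof_eq => /eqP <-.
rewrite exchange_big /= -natz natr_sum; apply: eq_bigr => x' xS.
have [psi ex _] := posP symQ unitQ (SP _ xS) hz.
rewrite -mulr_suml (bigD1 psi) //= ex eqxx big1 ?addr0 ?mul1r ?natz //.
by move=> psi' ne; rewrite mxof_eq eq_sym (negbTE ne).
Qed.

End CountPolynomials.

(** * Simultaneous refinement of two flags *)

Section Refinement.
Variable d : nat.
Notation D := (DD d).

(** [level] expressed on position matrices, so that flags can be maximized before the map that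
    describes their position has been extracted. *)
Definition wtmx m (A : 'M[nat]_(D, m)) : nat := (\sum_(c < D) \sum_(i < m) c * (i * A c i))%N.

Lemma wtmx_mxof m (phi : 'I_D -> 'I_m) : wtmx (mxof phi) = level (fun c => phi c).
Proof.
apply: eq_bigr => c _; rewrite (bigD1 (phi c)) //= mxE eqxx muln1.
by rewrite big1 ?addn0 // => i ne; rewrite mxE (negbTE ne) !muln0.
Qed.

(** The lexicographic order on pairs of letters packed into one natural number, so that [mono] and
    the results on sorted maps apply to pairs. *)
Definition lex m k (t : 'I_D -> 'I_m) (chi : 'I_D -> 'I_k) (c : 'I_D) : nat :=
  (t c * k + chi c)%N.

Lemma lex_lt m k (t : 'I_D -> 'I_m) (chi : 'I_D -> 'I_k) c :
  (lex t chi c < m * k)%N.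
Proof.
rewrite /lex; have := ltn_ord (t c); have := ltn_ord (chi c) => h1 h2.
by apply: leq_trans (_ : (t c).+1 * k <= _)%N; rewrite ?leq_mul // mulSn addnC ltn_add2r.
Qed.

Lemma mono_lex m k (t : 'I_D -> 'I_m) (chi : 'I_D -> 'I_k) :
  symf t -> symf chi -> mono (fun c => t c) ->
  (forall j, t (pen1 j) = t (pen2 j) -> (chi (pen1 j) <= chi (pen2 j))%N) ->
  mono (lex t chi).
Proof.
move=> st sc mt h.
apply: (mono_pens (t := fun c => Ordinal (lex_lt t chi c))) => [c|j].
  apply: val_inj; rewrite /= /lex st sc /=.
  have := ltn_ord (t c); have := ltn_ord (chi c); nia.
rewrite /= /lex; have := mt (pen1 j) (pen2 j) (ltnW (pen1_lt_pen2 j)).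
rewrite leq_eqVlt => /orP[/eqP/ord_inj e|lt].
  by rewrite e leq_add2l h.
have := ltn_ord (chi (pen1 j)) => hc.
apply: leq_trans (_ : (t (pen1 j)).+1 * k <= _)%N.
  by rewrite mulSn addnC leq_add2r ltnW.
by apply: leq_trans (leq_addr _ _); rewrite leq_mul2r lt orbT.
Qed.

Lemma lex_eq m k (t : 'I_D -> 'I_m) (chi : 'I_D -> 'I_k) c (i : 'I_m) (b : 'I_k) :
  (lex t chi c == i * k + b)%N = (t c == i) && (chi c == b).
Proof.
apply/eqP/andP => [e|[/eqP<- /eqP<-] //].
have k0 : (0 < k)%N by apply: leq_ltn_trans (ltn_ord b).
have e1 : chi c = b.
  by apply: ord_inj; have := congr1 (modn^~ k) e; rewrite /lex !modnMDl !modn_small.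
have e2 : t c = i.
  apply: ord_inj; have := congr1 (divn^~ k) e.
  by rewrite /lex !divnMDl // !divn_small // !addn0.
by rewrite e1 e2.
Qed.

(** A sorted sequence is determined by the multiplicities of its values, and the entries of [coarse]
    are the multiplicities of the pairs. *)
Lemma lex_unique m k (t t' : 'I_D -> 'I_m) (chi chi' : 'I_D -> 'I_k) :
  mono (lex t chi) -> mono (lex t' chi') -> coarse t chi = coarse t' chi' ->
  t =1 t' /\ chi =1 chi'.
Proof.
move=> h h' e; suff eq c : lex t chi c = lex t' chi' c.
  by split=> c; have /eqP := eq c; rewrite [lex t' _ _]/lex lex_eq => /andP[/eqP + /eqP +].
apply: sorted_unique => // l.
have [lmk|ge] := ltnP l (m * k); last first.
  rewrite !big1 // => c' _; apply/eqP; rewrite eqb0 ltn_eqF //;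
  exact: leq_trans (lex_lt _ _ _) ge.
have k0 : (0 < k)%N by move: lmk; case: (k); rewrite ?muln0.
have im : (l %/ k < m)%N by rewrite ltn_divLR.
have bk : (l %% k < k)%N by rewrite ltn_mod.
have -> : l = (Ordinal im * k + Ordinal bk)%N by rewrite /= -divn_eq.
have /matrixP/(_ (Ordinal im) (Ordinal bk)) := e; rewrite !mxE => E.
by under eq_bigr => c' _ do rewrite lex_eq; rewrite E;
   under [RHS]eq_bigr => c' _ do rewrite lex_eq.
Qed.

Variables (F : finFieldType) (Q : 'M[F]_D).
Hypothesis ndQ : nondeg_form Q.

(* Among the complete flags, one that maximizes a weighted count of positions
   relative to x refines x; among the refinements of x, one that maximizes it
   relative to z is sorted inside each step of x. *)
Lemma refine_sorted m k (x : flag F D m) (z : flag F D k) :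
  x \in flags Q m -> z \in flags Q k ->
  exists x' (t : {ffun 'I_D -> 'I_m}) (chi : {ffun 'I_D -> 'I_k}),
    [/\ x' \in complete_flags Q D, x = coarsen t x', relpos x' z = mxof chi,
        symf t /\ symf chi & mono (fun c => t c) /\ mono (lex t chi)].
Proof.
have [oddF symQ unitQ] := ndQ => hx hz.
have [y0 cy0] := complete_flag_exists symQ unitQ oddF.
have [x1 cx1 max1] := @arg_maxnP _ y0 (mem (complete_flags Q D))
  (fun y => wtmx (relpos y x)) cy0.
have [t et st] := posP symQ unitQ cx1 hx.
have mt : mono (fun c => t c).
  apply: mono_pens => // j; rewrite leqNgt; apply/negP => lt.
  have ne : t (pen1 j) != t (pen2 j) by rewrite -val_eqE gtn_eqF.
  have [x0 px0 hx0] := special_member symQ unitQ cx1 hx et st ne.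
  have [cx0 _] := pencilP _ _ _ _ px0.
  have [t0 e0 s0] := posP symQ unitQ cx0 hx.
  have := hx0 _ _ px0 e0 s0; rewrite eqxx.
  have [E|E] := pencil_pos cx1 px0 hx et e0 st s0; rewrite !E.
    by rewrite ltnNge ltnW.
  move=> _; have := max1 _ cx0; rewrite et e0 (eq_mxof E) !wtmx_mxof /=.
  by rewrite leqNgt level_refl.
pose S := [set y in complete_flags Q D | relpos y x == mxof t].
have S1 : x1 \in S by rewrite finset.in_set et eqxx andbT; exact: cx1.
have [x2 S2 max2] := @arg_maxnP _ x1 (mem S) (fun y => wtmx (relpos y z)) S1.
have [cx2 et2] : x2 \in complete_flags Q D /\ relpos x2 x = mxof t.
  by move: S2; rewrite /= finset.in_set => /andP[? /eqP].
have [chi ec sc] := posP symQ unitQ cx2 hz.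
exists x2, t, chi; split=> //.
  by apply/eqP; rewrite -(coarsenP symQ unitQ) // et2.
split=> //; apply: mono_lex => // j tj; rewrite leqNgt; apply/negP => lt.
have ne : chi (pen1 j) != chi (pen2 j) by rewrite -val_eqE gtn_eqF.
have [x0 px0 hx0] := special_member symQ unitQ cx2 hz ec sc ne.
have [cx0 _] := pencilP _ _ _ _ px0.
have [c0 e0 s0] := posP symQ unitQ cx0 hz.
have [t0 et0 st0] := posP symQ unitQ cx0 hx.
have S0 : x0 \in S.
  rewrite finset.in_set cx0 et0 /=; apply/eqP/eq_mxof.
  have [E|E] := pencil_pos cx2 px0 hx et2 et0 st st0; move=> c; rewrite E //=.
  by have := reflf_id (j := j) st tj => /ffunP/(_ c); rewrite ffunE.
have := hx0 _ _ px0 e0 s0; rewrite eqxx.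
have [E|E] := pencil_pos cx2 px0 hz ec e0 sc s0; rewrite !E.
  by rewrite ltnNge ltnW.
move=> _; have := max2 _ S0; rewrite ec e0 (eq_mxof E) !wtmx_mxof /=.
by rewrite leqNgt level_refl.
Qed.

End Refinement.

Section AllCounts.
Variable d : nat.
Notation D := (DD d).

Definition flagsF m : flag_family D m := fun F Q => flags Q m.

Definition symfb m (t : {ffun 'I_D -> 'I_m}) : bool :=
  [forall c, t (rev_ord c) == rev_ord (t c)].

Lemma symfP m (t : {ffun 'I_D -> 'I_m}) : reflect (symf t) (symfb t).
Proof. by apply: (iffP forallP) => h c; apply/eqP; rewrite h. Qed.

(** By [lex_unique] the matrix C alone determines the sorted pair (t, chi) of a refinement. The
    count is then the sum of the counts from the refining complete flag over all its positions u to
    y whose coarsening along t is A. *)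
Lemma counts_flags m1 m2 m3 (A : 'M[nat]_(m1, m2)) (B : 'M[nat]_(m2, m3))
    (C : 'M[nat]_(m1, m3)) :
  exists p, counts (flagsF m1) (flagsF m2) (flagsF m3) A B C p.
Proof.
have [[t [chi [[st sc] [mt ml] eC]]]|no] := pselect (exists (t : {ffun 'I_D -> 'I_m1}) (chi : {ffun 'I_D -> 'I_m3}),
  [/\ symf t /\ symf chi, mono (fun c => t c) /\ mono (lex t chi)
    & coarse t chi = C] ); last first.
  (* No sorted pair yields C, so no pair of flags has position C and the condition on the polynomial
     is vacuous. *)
  exists 0 => F Q nd x z hx hz eC; exfalso; apply: no.
  have [x' [t [chi [cx' ex ec [st sc] [mt ml]]]]] := refine_sorted nd hx hz.
  exists t, chi; split=> //; rewrite -eC ex; symmetry.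
  exact: (relpos_coarsen_pos (complete_flagW cx') hz st mt ec).
have exP (u : {ffun 'I_D -> 'I_m2}) : exists P : {ffun 'I_D -> 'I_m3} -> {poly int},
  symfb u -> forall (chi : {ffun 'I_D -> 'I_m3}) (F : finFieldType) (Q : 'M[F]_D),
  nondeg_form Q -> forall x z, x \in complete_flags Q D -> z \in flags Q m3 ->
    relpos x z = mxof chi -> symf chi ->
    (P chi).[#|F|%:Z] = #|[set y in flags Q m2 |
      (relpos x y == mxof u) && (relpos y z == B)]|%:Z.
  have [/symfP/(counts_complete B)[P hP]|nsu] := boolP (symfb u); first by exists P.
  by exists (fun=> 0).
have [P hP] := choice exP.
exists (\sum_(u | symfb u && (coarse t u == A)) P u chi).
move=> F Q nd x z hx hz eC'.
have [x' [t' [chi' [cx' ex ec [st' sc'] [mt' ml']]]]] := refine_sorted nd hx hz.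
have hx' := complete_flagW cx'; have [oddF symQ unitQ] := nd.
have [et echi] : t =1 t' /\ chi =1 chi'.
  apply: lex_unique => //; rewrite eC -eC' ex.
  exact: (relpos_coarsen_pos hx' hz st' mt' ec).
have ec2 : relpos x' z = mxof chi by rewrite ec; apply: eq_mxof => c; rewrite echi.
rewrite horner_sum.
transitivity (\sum_(u | symfb u && (coarse t u == A)) #|[set y in flags Q m2 |
      (relpos x' y == mxof u) && (relpos y z == B)]|%:Z).
  by apply: eq_bigr => u /andP[su _]; apply: hP.
pose N2 := flags Q m2.
have cardE (R : pred (flag F D m2)) : #|[set y in N2 | R y]| = (\sum_(y in N2) R y)%N.
  rewrite -sum1_card (eq_bigl (fun y => (y \in N2) && R y)); last first.
    by move=> y; rewrite finset.in_set.
  by rewrite big_mkcondr; apply: eq_bigr => y _; case: (R y).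
transitivity (\sum_(u | symfb u && (coarse t u == A)) \sum_(y in N2)
    ((relpos x' y == mxof u) && (relpos y z == B))%:R : int).
  by apply: eq_bigr => u _; rewrite cardE -natz natr_sum.
rewrite exchange_big cardE -natz natr_sum; apply: eq_bigr => y hy /=.
have [u eu su] := posP symQ unitQ cx' hy.
have exy : relpos x y = coarse t u.
  have -> : coarse t u = coarse t' u by apply/matrixP => i b; rewrite !mxE;
    apply: eq_bigr => c _; rewrite et.
  by rewrite ex; apply: (relpos_coarsen_pos hx' hy st' mt' eu).
rewrite (eq_bigr (fun u' => if u' == u then (relpos y z == B)%:R else 0)); last first.
  by move=> u' _; rewrite eu mxof_eq eq_sym; case: eqP.
rewrite -big_mkcondr /= exy; have [eA|nA] := eqVneq (coarse t u) A.
  rewrite (big_pred1 u) // => u' /=; case: (eqVneq u' u) => [->|]; rewrite ?andbF //.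
  by rewrite eA eqxx !andbT; apply/symfP.
by rewrite big_pred0 // => u'; case: (eqVneq u' u) => [->|]; rewrite ?andbF // (negbTE nA) andbF.
Qed.

End AllCounts.

(** * Realization of the relative positions *)

Section CoordinateSubspaces.
Variables (F : fieldType) (D : nat).
Implicit Types P : pred 'I_D.

Definition dg P : 'M[F]_D := diag_mx (\row_c (P c)%:R).

Lemma mul_dg P P' : dg P *m dg P' = dg (predI P P').
Proof.
rewrite mulmx_diag; congr diag_mx; apply/rowP => c; rewrite !mxE /= -natrM.
by case: (P c); case: (P' c).
Qed.

Lemma sub_dg m (u : 'M[F]_(m, D)) P : (u <= dg P)%MS = (u *m dg P == u).
Proof.
apply/idP/eqP => [/submxP[X ->]|<-]; last exact: submxMl.
rewrite -mulmxA mul_dg; congr (_ *m diag_mx _); apply/rowP => c.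
by rewrite !mxE /= andbb.
Qed.

Lemma dgS P P' : subpred P P' -> (dg P <= dg P')%MS.
Proof.
move=> h; rewrite sub_dg mul_dg; apply/eqP; congr diag_mx; apply/rowP => c.
by rewrite !mxE /=; case: (boolP (P c)) => // /h ->.
Qed.

Lemma cap_dg P P' : (dg P :&: dg P' :=: dg (predI P P'))%MS.
Proof.
apply/eqmxP/andP; split; last first.
  by rewrite sub_capmx !dgS // => c /andP[].
rewrite sub_dg -mul_dg mulmxA.
have /eqP -> : (dg P :&: dg P')%MS *m dg P == (dg P :&: dg P')%MS.
  by rewrite -sub_dg capmxSl.
by rewrite -sub_dg capmxSr.
Qed.

Lemma rank_dg P : \rank (dg P) = (\sum_c P c)%N.
Proof.
have le R : (\rank (dg R) <= \sum_c R c)%N.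
  have -> : dg R = \sum_c (R c)%:R *: delta_mx c c.
    apply/matrixP => i k; rewrite summxE !mxE (bigD1 i) //= big1 ?addr0 => [|c nc].
      by rewrite !mxE eqxx [k == i]eq_sym /=; case: (i == k); rewrite ?mulr1 ?mulr0.
    by rewrite !mxE [i == c]eq_sym (negbTE nc) mulr0.
  apply: (big_ind2 (fun (A : 'M[F]_D) k => (\rank A <= k)%N)).
  - by rewrite mxrank0.
  - by move=> A k B l hA hB; apply: leq_trans (mxrank_add _ _) (leq_add hA hB).
  move=> c _; case: (R c); last by rewrite scale0r mxrank0.
  by rewrite scale1r mxrank_delta.
apply/eqP; rewrite eqn_leq le /=.
have : (\rank (dg P + dg (predC P))%R <= \rank (dg P) + \rank (dg (predC P)))%N.
  exact: mxrank_add.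
have -> : (dg P + dg (predC P))%R = 1%:M.
  rewrite -[RHS]diag_const_mx -linearD /=; congr diag_mx; apply/rowP => c.
  by rewrite !mxE /= -natrD; case: (P c).
have tot : (\sum_c P c + \sum_c predC P c)%N = D.
  rewrite -big_split /= (eq_bigr (fun=> 1%N)) ?sum1_card ?card_ord // => c _.
  by case: (P c).
rewrite mxrank1; have arith (D' a b s s' : nat) :
  (D' <= a + b)%N -> (s + s' = D')%N -> (b <= s')%N -> (s <= a)%N by lia.
by move=> h; apply: arith h tot (le _).
Qed.

End CoordinateSubspaces.

Section CoordinateFlags.
Variables (F : finFieldType) (d : nat).
Notation D := (DD d).

Definition antidiag : 'M[F]_D := perm_mx (perm (@rev_ord_inj D)).

Lemma antidiag_sym : antidiag^T = antidiag.
Proof.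
apply/matrixP => i k; rewrite !mxE !permE; congr (_%:R).
by rewrite (can2_eq (@rev_ordK D) (@rev_ordK D)) eq_sym.
Qed.

Lemma antidiag_nondeg : odd #|F| -> nondeg_form antidiag.
Proof. by move=> h; split; [| exact: antidiag_sym | exact: unitmx_perm]. Qed.

Lemma perp_dg (P : pred 'I_D) :
  (perp antidiag (dg F P) :=: dg F (fun c => ~~ P (rev_ord c)))%MS.
Proof.
apply: eqmx_sym; apply/eqmxP; rewrite -mxrank_leqif_eq; last first.
  rewrite sub_perp; apply/eqP/matrixP => i k.
  rewrite tr_diag_mx mul_mx_diag mul_diag_mx !mxE permE.
  by case: eqP => [<-|]; rewrite ?mulr0 ?mul0r //; case: (P _); rewrite /= ?mulr0 ?mul0r.
rewrite rank_perp ?unitmx_perm ?antidiag_sym // !rank_dg.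
rewrite (reindex_inj rev_ord_inj) /= -(eqn_add2r (\sum_c P c)%N) subnK.
  rewrite -big_split /= (eq_bigr (fun=> 1%N)) ?sum1_card ?card_ord // => c _.
  by rewrite rev_ordK; case: (P c).
rewrite -[X in (_ <= X)%N]card_ord -sum1_card; apply: leq_sum => c _.
by case: (P c).
Qed.

(** For the antidiagonal form the orthogonal of a coordinate subspace is spanned by the complement
    of the mirrored set of coordinates; a symmetric t thus gives a self-dual flag over any field. *)
Definition cflag m (t : 'I_D -> 'I_m) : flag F D m :=
  [ffun i : 'I_m.+1 => <<dg F (fun c => t c < i)%N>>%MS].

Lemma fl_cflag m (t : 'I_D -> 'I_m) i : (i <= m)%N ->
  fl (cflag t) i = <<dg F (fun c => t c < i)%N>>%MS.
Proof. by move=> im; rewrite /fl ffunE inordK. Qed.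

Lemma cflag_flags m (t : 'I_D -> 'I_m) : symf t -> cflag t \in flags antidiag m.
Proof.
move=> st; apply/flagsP; split.
- by move=> i im; rewrite fl_cflag // genmx_id.
- rewrite fl_cflag //; have -> : dg F (fun c => t c < 0)%N = 0; last exact: genmx0.
  by apply/matrixP => i k; rewrite !mxE mul0rn.
- rewrite fl_cflag // -genmx1; have -> // : dg F (fun c => t c < m)%N = 1%:M.
  by apply/matrixP => i k; rewrite !mxE ltn_ord.
- move=> i im; rewrite !fl_cflag ?(ltnW im) // !genmxE; apply: dgS => c /= h.
  by rewrite ltnS ltnW.
move=> i im; rewrite !fl_cflag ?leq_subr //.
apply: eqmx_trans (genmxE _) _; apply: eqmx_sym.
apply: eqmx_trans (eq_perp antidiag_sym (genmxE _)) _.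
apply: eqmx_trans (perp_dg _) _; apply/eqmxP.
have E c : ~~ (t (rev_ord c) < m - i)%N = (t c < i)%N.
  by rewrite st /=; have := ltn_ord (t c); lia.
by apply/andP; split; apply: dgS => c /=; rewrite E.
Qed.

Lemma relpos_cflag m k (t : 'I_D -> 'I_m) (u : 'I_D -> 'I_k) : symf t -> symf u ->
  relpos (cflag t) (cflag u) = coarse t u.
Proof.
move=> st su; apply/matrixP => i b; rewrite [RHS]mxE.
have := relpos_rk i b (cflag_flags st) (cflag_flags su).
have rkc i' b' : (i' <= m)%N -> (b' <= k)%N -> rk (cflag t) (cflag u) i' b' =
    (\sum_c ((t c < i') && (u c < b')))%N.
  move=> im bk; rewrite /rk !fl_cflag //.
  rewrite -(rank_dg F (fun c => (t c < i') && (u c < b'))%N); apply/eqmx_rank/eqmxP.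
  by apply: eqmx_trans (cap_eqmx (genmxE _) (genmxE _)) (cap_dg _ _ _).
have im := ltn_ord i; have bk := ltn_ord b.
rewrite !rkc // ?(ltnW im) ?(ltnW bk) //.
move=> e; apply/eqP; rewrite -(eqn_add2r (\sum_c ((t c < i) && (u c < b.+1)))).
rewrite -(eqn_add2r (\sum_c ((t c < i.+1) && (u c < b)))) e -!big_split /=.
apply/eqP/eq_bigr => c _; rewrite -!val_eqE /=.
by case: (ltngtP (t c) i); case: (ltngtP (u c) b); lia.
Qed.

Lemma cflag_complete (t : 'I_D -> 'I_D) : symf t -> injective t ->
  cflag t \in complete_flags antidiag D.
Proof.
move=> st inj; apply/complete_flagsP; rewrite ?unitmx_perm ?antidiag_sym //.
split; first exact: cflag_flags.
move=> i iD; rewrite fl_cflag // genmxE rank_dg -[RHS](sum_lt iD).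
by rewrite [RHS](reindex_inj inj).
Qed.

End CoordinateFlags.

(* The positions are distributed in lexicographic order: position c goes to the
   cell in which the cumulated number of elements passes c. *)
Lemma coarse_surj d n (C : 'M[nat]_(NN n)) :
  (\sum_i \sum_b C i b = DD d)%N ->
  (forall i b, C (rev_ord i) (rev_ord b) = C i b) ->
  exists t u : 'I_(DD d) -> 'I_(NN n), [/\ symf t, symf u & coarse t u = C].
Proof.
set N := NN n; set D := DD d => sumC symC; pose M := (N * N)%N.
have subr_lt a : (a < N)%N -> (N - a.+1 < N)%N by case: (N) => // k ak; rewrite subSS ltnS leq_subr.
have subrK a : (a < N)%N -> (N - (N - a.+1).+1 = a)%N.
  by move=> aN; rewrite subnSK ?subKn // ltnW.
have dvK q r : (r < N)%N -> ((q * N + r) %/ N)%N = q.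
  by move=> rN; rewrite divnMDl // divn_small ?addn0.
have mdK q r : (r < N)%N -> ((q * N + r) %% N)%N = r.
  by move=> rN; rewrite modnMDl modn_small.
pose Ce e := C (inord (e %/ N)) (inord (e %% N)).
pose kap l := (\sum_(e < l) Ce e)%N.
have kapS l : kap l.+1 = (kap l + Ce l)%N by rewrite /kap big_ord_recr.
have CeE (i b : 'I_N) : Ce (i * N + b)%N = C i b.
  rewrite /Ce divnMDl // divn_small // addn0 modnMDl modn_small //.
  by rewrite !inord_val.
have kap_mul i : (i <= N)%N -> kap (i * N)%N = (\sum_(i' < N | i' < i) \sum_b C i' b)%N.
  elim: i => [|i IH] iN; first by rewrite mul0n /kap big_ord0 big_pred0.
  rewrite (bigD1 (Ordinal iN)) /=; last exact: ltnSn.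
  rewrite mulSn addnC /kap big_split_ord /= -/(kap _) IH ?(ltnW iN) // addnC.
  congr (_ + _)%N.
    by apply: eq_bigr => b _; rewrite (CeE (Ordinal iN) b).
  by apply: eq_bigl => b; rewrite ltnS ltn_neqAle andbC.
have kapM : kap M = D.
  rewrite kap_mul // -sumC; apply: eq_bigl => i; exact: ltn_ord.
have kap_mono l l' : (l <= l')%N -> (kap l <= kap l')%N.
  elim: l' => [|l' IH]; first by rewrite leqn0 => /eqP->.
  by rewrite leq_eqVlt => /orP[/eqP->//|/IH h]; rewrite kapS (leq_trans h) ?leq_addr.
(* Reversing both indices sends cell e to cell M - 1 - e, and these have the same size by the
   symmetry of C. This is what makes the filling symmetric. *)
have kap_rev l : (l <= M)%N -> (kap (M - l) + kap l)%N = D.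
  elim: l => [|l IH] lM; first by rewrite subn0 kapM /kap big_ord0 addn0.
  rewrite -(IH (ltnW lM)) kapS; have -> : (M - l)%N = (M - l.+1).+1 by lia.
  rewrite kapS addnA [in RHS]addnAC; congr (_ + _)%N; symmetry.
  have N0 : (0 < N)%N by [].
  rewrite /Ce -symC; congr (C _ _); apply: val_inj; rewrite /= !inordK ?ltn_mod //.
  - have h1 := divn_eq l N; have h2 : (l %% N < N)%N by rewrite ltn_mod.
    have h3 : (l %/ N < N)%N by rewrite ltn_divLR.
    have -> : (M - l.+1 = (N - (l %/ N).+1) * N + (N - (l %% N).+1))%N.
      by rewrite /M; nia.
    by rewrite dvK ?subrK ?subr_lt.
  - by rewrite ltn_divLR.
  - rewrite ltn_divLR //; change (M - l.+1 < M)%N.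
    by rewrite ltn_subrL /= (leq_ltn_trans (leq0n l)).
  have h1 := divn_eq l N; have h2 : (l %% N < N)%N by rewrite ltn_mod.
  have h3 : (l %/ N < N)%N by rewrite ltn_divLR.
  have -> : (M - l.+1 = (N - (l %/ N).+1) * N + (N - (l %% N).+1))%N.
    by rewrite /M; nia.
  by rewrite mdK ?subrK ?subr_lt.
pose th (c : 'I_D) := (\sum_(l < M) (kap l.+1 <= c))%N.
have thP (c : 'I_D) l : (l <= M)%N -> (th c < l)%N = (c < kap l)%N.
  move=> lM; have le l' : (l' <= M)%N -> (l' <= th c)%N = (kap l' <= c)%N.
    case: l' => [|l'] l'M; first by rewrite /kap big_ord0.
    apply/idP/idP => h; last first.
      rewrite -[l'.+1](sum_lt l'M); apply: leq_sum => k _; case: ltnP => // kl.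
      by rewrite (leq_trans _ h) //; apply: kap_mono.
    rewrite leqNgt; apply: contraL h => h; rewrite -ltnNge ltnS.
    rewrite -[X in (_ <= X)%N](sum_lt (ltnW l'M)); apply: leq_sum => k _.
    case: (ltnP k l') => kl; first by case: (kap k.+1 <= c)%N.
    suff -> : (kap k.+1 <= c)%N = false by [].
    by apply/negbTE; rewrite -ltnNge (leq_trans h) //; apply: kap_mono.
  by rewrite ltnNge le // -ltnNge.
have thM c : (th c < M)%N by rewrite thP // kapM.
have N0 : (0 < N)%N by [].
have tN c : (th c %/ N < N)%N by rewrite ltn_divLR.
have uN c : (th c %% N < N)%N by rewrite ltn_mod.
pose t c := Ordinal (tN c); pose u c := Ordinal (uN c).
have th_rev c : (th (rev_ord c) = M - (th c).+1)%N.
  have lt l : (l <= M)%N -> (th (rev_ord c) < l)%N = (M - (th c).+1 < l)%N.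
    move=> lM; rewrite thP //= -/D.
    have := thP c (M - l)%N (leq_subr _ _); have := kap_rev _ lM.
    by have := thM c; have := ltn_ord c; rewrite -/D; lia.
  have := lt _ (thM (rev_ord c)); have := lt (M - (th c).+1).+1; have := thM c; lia.
have div_rev c : (M - (th c).+1 = (N - (th c %/ N).+1) * N + (N - (th c %% N).+1))%N.
  by have := divn_eq (th c) N; have := tN c; have := uN c; rewrite /M; nia.
exists t, u; split.
- by move=> c; apply: val_inj; rewrite /= th_rev div_rev dvK ?subr_lt.
- by move=> c; apply: val_inj; rewrite /= th_rev div_rev mdK ?subr_lt.
apply/matrixP => i b; rewrite mxE -CeE.
have iM : (i * N + b < M)%N.
  by apply: leq_trans (_ : i.+1 * N <= _)%N; rewrite ?leq_mul // mulSn addnC ltn_add2r.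
apply/eqP; rewrite -(eqn_add2l (kap (i * N + b)%N)) -kapS.
have kD l : (l <= M)%N -> (kap l <= D)%N by move=> h; rewrite -kapM kap_mono.
rewrite -{1}(sum_lt (kD _ (ltnW iM))) -[X in _ == X](sum_lt (kD _ iM)) -big_split /=.
apply/eqP/eq_bigr => c _; rewrite -!thP ?(ltnW iM) // ltnS.
have -> : (t c == i) && (u c == b) = (th c == i * N + b)%N.
  rewrite [in RHS](divn_eq (th c) N) -!val_eqE /=; apply/andP/eqP => [[/eqP-> /eqP->]//|e].
  have e1 := congr1 (divn^~ N) e; have e2 := congr1 (modn^~ N) e.
  rewrite !mdK // in e2; rewrite !dvK // in e1.
  by rewrite e1 e2.
by case: (ltngtP (th c) (i * N + b)).
Qed.

(** * Structure constants *)

Definition evq (p : {poly int}) : Qv := (map_poly intr p).[v ^+ 2].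

Lemma evq_is_zmod : zmod_morphism evq.
Proof. by move=> p q; rewrite /evq raddfB hornerD hornerN. Qed.
HB.instance Definition _ := GRing.isZmodMorphism.Build {poly int} Qv evq evq_is_zmod.

Lemma evqM p q : evq (p * q) = evq p * evq q.
Proof. by rewrite /evq rmorphM hornerM. Qed.

Lemma evq1 : evq 1 = 1. Proof. by rewrite /evq rmorph1 hornerC. Qed.

Lemma evqX : evq 'X = v ^+ 2. Proof. by rewrite /evq map_polyX hornerX. Qed.

Lemma odd_primes_seq k : exists s : seq nat, [/\ size s = k, uniq s
  & all (fun l => prime l && odd l) s].
Proof.
elim: k => [|k [s [sk us ps]]]; first by exists [::].
have [l lm pl] := prime_above (maxn 2 (\max_(i <- s) i)).
exists (l :: s); split=> /=; first by rewrite sk.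
  rewrite us andbT; apply/negP => ls; move: lm.
  by rewrite ltnNge leq_max (@leq_bigmax_seq _ s predT (fun i => i) l ls isT) orbT.
apply/andP; split; last exact: ps.
rewrite pl; case: (even_prime pl) lm => // ->.
by rewrite ltnNge leq_maxl.
Qed.

Lemma poly_odd_primes (p q : {poly int}) :
  (forall l, prime l -> odd l -> p.[l%:Z] = q.[l%:Z]) -> p = q.
Proof.
move=> h; apply/eqP; rewrite -subr_eq0; apply/negPn/negP => nz.
have [s [ss us /allP ps]] := odd_primes_seq (size (p - q)).
have : (size (map Posz s) < size (p - q)%R)%N.
  apply: max_poly_roots => //; last by rewrite map_inj_uniq // => a b [].
  apply/allP => _ /mapP[l ls ->]; have /andP[pl ol] := ps _ ls.
  by rewrite rootE hornerD hornerN h // subrr.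
by rewrite size_map ss ltnn.
Qed.

Section Structure.
Variables (D : nat).

Definition realized m1 m3 (P1 : flag_family D m1) (P3 : flag_family D m3)
    (C : 'M[nat]_(m1, m3)) : Prop :=
  forall l, prime l -> odd l -> exists (F : finFieldType) (Q : 'M[F]_D) x z,
    [/\ #|F| = l, nondeg_form Q, x \in P1 F Q, z \in P3 F Q & relpos x z = C].

(** [strc] picks some polynomial with the counting property. It is the only one, because a position
    realized over F_l for all odd primes l prescribes infinitely many values. *)
Lemma strcE m1 m2 m3 (P1 : flag_family D m1) (P2 : flag_family D m2)
    (P3 : flag_family D m3) A B C p :
  counts P1 P2 P3 A B C p -> realized P1 P3 C -> strc P1 P2 P3 A B C = evq p.
Proof.
move=> hp hC; rewrite /strc -/(evq _); congr evq.
have hx : counts P1 P2 P3 A B C (xget 0 [set p' | counts P1 P2 P3 A B C p']%classic).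
  exact: (@xgetPex _ 0 [set p' | counts P1 P2 P3 A B C p']%classic (ex_intro _ p hp)).
apply: poly_odd_primes => l pl ol; have [F [Q [x [z [<- nd hx1 hz3 e]]]]] := hC l pl ol.
by rewrite (hx F Q nd x z) // (hp F Q nd x z).
Qed.

(* The positions between flags of P1 and of P3 are indexed by I. *)
Definition indexed m1 m3 (P1 : flag_family D m1) (P3 : flag_family D m3)
    (I : finType) (pos : I -> 'M[nat]_(m1, m3)) : Prop :=
  [/\ injective pos,
      forall (F : finFieldType) (Q : 'M[F]_D), nondeg_form Q ->
        forall x z, x \in P1 F Q -> z \in P3 F Q -> exists i, relpos x z = pos i
    & forall i, realized P1 P3 (pos i)].

(** For x and w in position Z, both sides count the pairs (y, z) with x, y in position A, y, z in
    position B and z, w in position E, grouped by the position of x, z or of y, w. *)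
Lemma strc_assoc m1 m2 m3 m4 (P1 : flag_family D m1) (P2 : flag_family D m2)
    (P3 : flag_family D m3) (P4 : flag_family D m4) (I13 I24 I14 : finType)
    (pos13 : I13 -> 'M[nat]_(m1, m3)) (pos24 : I24 -> 'M[nat]_(m2, m4))
    (pos14 : I14 -> 'M[nat]_(m1, m4)) A B E (Z : I14) :
  indexed P1 P3 pos13 -> indexed P2 P4 pos24 -> indexed P1 P4 pos14 ->
  (forall C, exists p, counts P1 P2 P3 A B (pos13 C) p) ->
  (forall C, exists p, counts P1 P3 P4 (pos13 C) E (pos14 Z) p) ->
  (forall G, exists p, counts P2 P3 P4 B E (pos24 G) p) ->
  (forall G, exists p, counts P1 P2 P4 A (pos24 G) (pos14 Z) p) ->
  \sum_C strc P1 P2 P3 A B (pos13 C) * strc P1 P3 P4 (pos13 C) E (pos14 Z)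
  = \sum_G strc P2 P3 P4 B E (pos24 G) * strc P1 P2 P4 A (pos24 G) (pos14 Z).
Proof.
move=> [inj13 ex13 r13] [inj24 ex24 r24] [_ _ r14].
move=> /choice[p1 h1] /choice[p2 h2] /choice[p3 h3] /choice[p4 h4].
rewrite (eq_bigr (fun C => evq (p1 C * p2 C))); last first.
  by move=> C _; rewrite evqM (strcE (h1 C)) // (strcE (h2 C)).
rewrite [RHS](eq_bigr (fun G => evq (p3 G * p4 G))); last first.
  by move=> G _; rewrite evqM (strcE (h3 G)) // (strcE (h4 G)).
rewrite -!raddf_sum; congr evq; apply: poly_odd_primes => l pl ol.
have [F [Q [x [w [<- nd hx hw e]]]]] := r14 Z l pl ol.
have cardE m (S : {set flag F D m}) (R : pred (flag F D m)) :
    #|[set y in S | R y]| = (\sum_(y in S) R y)%N.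
  rewrite -sum1_card (eq_bigl (fun y => (y \in S) && R y)); last first.
    by move=> y; rewrite finset.in_set.
  by rewrite big_mkcondr; apply: eq_bigr => y _; case: (R y).
rewrite !horner_sum.
transitivity (\sum_(z in P3 F Q) \sum_(y in P2 F Q)
   ([&& relpos x y == A, relpos y z == B & relpos z w == E])%:R : int).
  transitivity (\sum_C \sum_(z in P3 F Q) ((relpos x z == pos13 C) && (relpos z w == E))%:R
      * (p1 C).[#|F|%:Z]).
    apply: eq_bigr => C _; rewrite hornerM (h2 C F Q nd x w hx hw e) cardE.
    by rewrite -[X in _ * X]natz natr_sum mulr_sumr; apply: eq_bigr => z _; rewrite mulrC.
  rewrite exchange_big; apply: eq_bigr => z hz /=.
  have [C eC] := ex13 F Q nd x z hx hz.
  rewrite (bigD1 C) //= big1 ?addr0 => [|C' nC]; last first.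
    by rewrite eC (inj_eq inj13) eq_sym (negbTE nC) mul0r.
  rewrite eC eqxx (h1 C F Q nd x z hx hz eC) cardE -[X in _ * X]natz natr_sum.
  rewrite mulr_sumr; apply: eq_bigr => y _; rewrite -natrM mulnb.
  by congr (_ %:R); congr nat_of_bool; rewrite /= [in RHS]andbA [RHS]andbC.
rewrite exchange_big /=.
transitivity (\sum_G \sum_(y in P2 F Q) ((relpos x y == A) && (relpos y w == pos24 G))%:R
      * (p3 G).[#|F|%:Z]); last first.
  apply: eq_bigr => G _; rewrite hornerM (h4 G F Q nd x w hx hw e) cardE.
  by rewrite -[X in _ * X]natz natr_sum mulr_sumr; apply: eq_bigr => z _; rewrite mulrC.
rewrite [RHS]exchange_big; apply: eq_bigr => y hy /=.
have [G eG] := ex24 F Q nd y w hy hw.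
rewrite [RHS](bigD1 G) //= [X in _ = _ + X]big1 ?addr0 => [|G' nG]; last first.
  by rewrite eG (inj_eq inj24) [G == G']eq_sym (negbTE nG) andbF mul0r.
rewrite eG eqxx andbT (h3 G F Q nd y w hy hw eG) cardE -[X in _ * X]natz natr_sum.
by rewrite mulr_sumr; apply: eq_bigr => z _; rewrite -natrM mulnb.
Qed.

End Structure.

Section Systems.
Variables (n d : nat).
Notation N := (NN n).
Notation D := (DD d).

Lemma ext_seq_sym (r : seqs n d) : symf (ext_seq r).
Proof.
move=> c; rewrite /ext_seq rev_ordK.
case: insubP => [c1 _ e1|/negbTE n1]; case: insubP => [c2 _ e2|/negbTE n2] //=.
- by move: (ltn_ord c1) (ltn_ord c2); rewrite e1 e2 /= /DD; lia.
- by rewrite rev_ordK.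
by apply: val_inj; rewrite /= /ix inordK /NN; lia.
Qed.

Lemma seq_mxE (r : seqs n d) : seq_mx r = (mxof (ext_seq r))^T.
Proof. by apply/matrixP => i c; rewrite !mxE. Qed.

Lemma ext_seq_low (r : seqs n d) (c : 'I_D) (c' : 'I_d) :
  c = c' :> nat -> ext_seq r c = r c'.
Proof.
move=> e; rewrite /ext_seq; case: insubP => [c1 _ e1|]; last by rewrite e ltn_ord.
by congr (r _); apply: val_inj; rewrite /= e1 e.
Qed.

Lemma ext_seq_inj (r s : seqs n d) : ext_seq r =1 ext_seq s -> r = s.
Proof.
move=> h; apply/ffunP => c; have cD : (c < D)%N by have := ltn_ord c; rewrite /DD; lia.
by have := h (Ordinal cD); rewrite !(ext_seq_low _ (c' := c)).
Qed.

Lemma ext_seq_surj (t : 'I_D -> 'I_N) : symf t -> exists r : seqs n d, ext_seq r =1 t.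
Proof.
move=> st; have lD (c : 'I_d) : (c < D)%N by have := ltn_ord c; rewrite /DD; lia.
exists [ffun c : 'I_d => t (Ordinal (lD c))] => c; rewrite /ext_seq.
case: insubP => [c1 _ e1|n1]; first by rewrite ffunE; congr t; apply: val_inj.
case: insubP => [c2 _ e2|n2].
  by rewrite ffunE -st; congr t; apply: val_inj; rewrite /= e2 /= subnSK ?subKn // ltnW.
have cd : c = d :> nat by move: n1 n2; rewrite /= /DD; have := ltn_ord c; rewrite /DD; lia.
have := symf_mid st cd => e; apply: val_inj; rewrite /= /ix inordK; move: e; rewrite /NN; lia.
Qed.

Lemma weyl_mxE (w : weylB d) : weyl_mx w = mxof (fun c => val w c).
Proof. by apply/matrixP => i j; rewrite !mxE eq_sym. Qed.

Lemma weyl_sym (w : weylB d) : symf (fun c => val w c).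
Proof. by move=> c; apply/eqP; have /forallP := valP w; apply. Qed.

Lemma weyl_surj (t : 'I_D -> 'I_D) : injective t -> symf t ->
  exists w : weylB d, (fun c => val w c) =1 t.
Proof.
move=> ti st; have h : [forall i, perm ti (rev_ord i) == rev_ord (perm ti i)].
  by apply/forallP => i; rewrite !permE st.
by exists (exist _ (perm ti) h) => c; rewrite /= permE.
Qed.

Lemma indexed_XX : indexed (@flagsX n d) (@flagsX n d) (@xi_nat n d).
Proof.
split=> [A B /matrixP h|F Q [_ symQ unitQ] x z hx hz|C l pl ol].
- apply: val_inj; apply/matrixP => i j; apply: val_inj.
  by have := h i j; rewrite !mxE.
- have le i j : (relpos x z i j < D.+1)%N.
    rewrite ltnS -[X in (_ <= X)%N](relpos_sum hx hz) (bigD1 i) //= (bigD1 j) //=.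
    by rewrite -addnA leq_addr.
  pose A : 'M['I_D.+1]_N := \matrix_(i, j) Ordinal (le i j).
  have AE i j : A i j = Ordinal (le i j) by rewrite [LHS]mxE.
  have hA : in_Xi A.
    apply/andP; split.
      apply/eqP; rewrite -[RHS](relpos_sum hx hz).
      by apply: eq_bigr => i _; apply: eq_bigr => j _; rewrite AE.
    apply/forallP => i; apply/forallP => j; apply/eqP; rewrite !AE; apply: val_inj.
    by rewrite [RHS](relpos_rev symQ unitQ).
  by exists (exist _ A hA); apply/matrixP => i j; rewrite [RHS]mxE AE.
have [sumA symA] := andP (valP C).
have [t [u [st su e]]] : exists t u : 'I_D -> 'I_N,
    [/\ symf t, symf u & coarse t u = xi_nat C].
  apply: coarse_surj => [|i b]; last first.
    rewrite !mxE; have /forallP/(_ i)/forallP/(_ b)/eqP := symA.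
    by move=> ->.
  rewrite -[RHS](eqP sumA).
  by apply: eq_bigr => i _; apply: eq_bigr => j _; rewrite mxE.
have oF : odd #|'F_l| by rewrite card_Fp.
exists 'F_l, (antidiag 'F_l d), (cflag _ t), (cflag _ u); split.
- by rewrite card_Fp.
- exact: antidiag_nondeg.
- exact: cflag_flags.
- exact: cflag_flags.
by rewrite relpos_cflag.
Qed.

Lemma coarse_id m (t : 'I_D -> 'I_m) : coarse id t = mxof t.
Proof.
apply/matrixP => c b; rewrite !mxE (bigD1 c) //= eqxx /= big1 ?addn0 1?eq_sym //.
by move=> c' nc; rewrite (negbTE nc).
Qed.

Lemma coarse_tr m k (t : 'I_D -> 'I_m) (u : 'I_D -> 'I_k) :
  (coarse t u)^T = coarse u t.
Proof. by apply/matrixP => i b; rewrite !mxE; apply: eq_bigr => c _; rewrite andbC. Qed.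

Lemma symf_id : symf (@id 'I_D). Proof. by []. Qed.

Lemma indexed_XY : indexed (@flagsX n d) (@flagsY d) (@seq_mx n d).
Proof.
split=> [r s|F Q [_ symQ unitQ] x z hx hz|r l pl ol].
- by rewrite !seq_mxE => /trmx_inj/mxof_inj; apply: ext_seq_inj.
- have [t e st] := posP symQ unitQ hz hx; have [r er] := ext_seq_surj st.
  exists r; rewrite seq_mxE (relpos_tr (complete_flagW hz) hx) e; congr trmx.
  by apply: eq_mxof => c; rewrite er.
have oF : odd #|'F_l| by rewrite card_Fp.
exists 'F_l, (antidiag 'F_l d), (cflag _ (ext_seq r)), (cflag _ id); split.
- by rewrite card_Fp.
- exact: antidiag_nondeg.
- exact/cflag_flags/ext_seq_sym.
- exact: cflag_complete.
by rewrite relpos_cflag //; [rewrite -coarse_tr coarse_id seq_mxE | exact: ext_seq_sym].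
Qed.

Lemma indexed_YY : indexed (@flagsY d) (@flagsY d) (@weyl_mx d).
Proof.
split=> [r s|F Q [_ symQ unitQ] x z hx hz|w l pl ol].
- rewrite !weyl_mxE => /mxof_inj h; apply: val_inj; exact/permP.
- have [t e st] := posP symQ unitQ hx (complete_flagW hz).
  have ti : injective t.
    have [u eu su] := posP symQ unitQ hz (complete_flagW hx).
    have : mxof t = (mxof u)^T by rewrite -e -eu -(relpos_tr (complete_flagW hz) (complete_flagW hx)).
    move=> /matrixP h; apply: (can_inj (g := u)) => c.
    by have := h c (t c); rewrite !mxE eqxx; case: eqP.
  have [w ew] := weyl_surj ti st; exists w.
  by rewrite e weyl_mxE; apply: eq_mxof => c; rewrite ew.
have oF : odd #|'F_l| by rewrite card_Fp.
exists 'F_l, (antidiag 'F_l d), (cflag _ id), (cflag _ (fun c => val w c)); split.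
- by rewrite card_Fp.
- exact: antidiag_nondeg.
- exact: cflag_complete.
- by apply: cflag_complete; [exact: weyl_sym | exact: perm_inj].
by rewrite relpos_cflag ?coarse_id ?weyl_mxE //; exact: weyl_sym.
Qed.

(** Completeness of y can be read off its position to any x, since a column sum is the growth of
    rank in one step of y. Counts over Y thus become counts over all flags. *)
Lemma complete_of_relpos (F : finFieldType) (Q : 'M[F]_D) m (x : flag F D m)
    (y : flag F D D) : x \in flags Q m -> y \in flags Q D ->
  (forall c, (\sum_i relpos x y i c = 1)%N) -> y \in complete_flags Q D.
Proof.
move=> hx hy h; rewrite [y \in complete_flags Q D]finset.in_set hy /=.
apply/forallP => c; rewrite belowE aboveE ltmxErank.
apply/andP; split; first by apply: (fl_mono hy); rewrite leqnSn ltn_ord.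
have := relpos_row_sum c hy hx; rewrite (relpos_tr hx hy).
rewrite (eq_bigr (fun i => relpos x y i c)); last by move=> i _; rewrite mxE.
by rewrite h => <-; rewrite add1n.
Qed.

Lemma counts_X m1 m3 (P1 : flag_family D m1) (P3 : flag_family D m3) A B C :
  (forall F Q, P1 F Q \subset flags Q m1) -> (forall F Q, P3 F Q \subset flags Q m3) ->
  exists p, counts P1 (@flagsX n d) P3 A B C p.
Proof.
move=> s1 s3; have [p hp] := counts_flags d A B C; exists p => F Q nd x z hx hz.
exact: hp (fintype.subsetP (s1 F Q) _ hx) (fintype.subsetP (s3 F Q) _ hz).
Qed.

Lemma counts_Y m1 m3 (P1 : flag_family D m1) (P3 : flag_family D m3)
    (A : 'M[nat]_(m1, D)) B C :
  (forall F Q, P1 F Q \subset flags Q m1) -> (forall F Q, P3 F Q \subset flags Q m3) ->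
  (forall c, (\sum_i A i c = 1)%N) -> exists p, counts P1 (@flagsY d) P3 A B C p.
Proof.
move=> s1 s3 hA; have [p hp] := counts_flags d A B C; exists p => F Q nd x z hx hz e.
have hx' := fintype.subsetP (s1 F Q) _ hx.
rewrite (hp F Q nd x z hx' (fintype.subsetP (s3 F Q) _ hz) e); congr Posz.
apply: eq_card => y; rewrite [LHS]finset.in_set [RHS]finset.in_set; case: eqP => [eA|]; rewrite ?andbF //=.
congr (_ && _); apply/idP/idP; last exact: complete_flagW.
by move=> hy; apply: (complete_of_relpos hx' hy) => c; rewrite eA.
Qed.

End Systems.

(** * The characteristic functions T_j *)

Section SimpleReflections.
Variable d : nat.
Notation D := (DD d).

Lemma refl_low (j : 'I_d) (c : 'I_D) i : (i <= d)%N -> i != j.+1 -> (c < i)%N ->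
  (refl j c < i)%N.
Proof.
move=> id ij ci; have jd := ltn_ord j; rewrite reflE /refl_fun.
move: id ij ci; rewrite -!val_eqE /= /DD.
by repeat (case: ifP => //=; rewrite -?val_eqE /= /DD); lia.
Qed.

Section Fixed.
Variables (F : finFieldType) (Q : 'M[F]_D).
Hypothesis ndQ : nondeg_form Q.

(** The position [refl j] forces equality of all members of index at most d except the one of index
    j.+1. Conversely a flag of the pencil has the position of the identity or of [refl j], and the
    former means y = z. *)
Lemma relpos_refl j (y z : flag F D D) : y \in complete_flags Q D ->
  z \in complete_flags Q D ->
  (relpos y z == mxof (refl j)) = (y \in pencil Q j z :\ z).
Proof.
have [oddF symQ unitQ] := ndQ => cy cz.
have [hy ry] := complete_flagsP symQ unitQ _ cy.
have [hz rz] := complete_flagsP symQ unitQ _ cz.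
have eid : relpos z z = mxof (@id 'I_D).
  have cid : relpos z z == mxof (@id 'I_D).
    rewrite (coarsenP symQ unitQ) //; apply/eqP/eq_flag => i iD.
    by rewrite fl_coarsen // /cut sum_lt.
  exact/eqP.
have neq : refl j =1 id -> False.
  move=> h; have := h (pen1 j); rewrite refl_pen1 => e.
  by have := pen1_lt_pen2 j; rewrite e ltnn.
apply/eqP/idP => [e|].
  rewrite in_setD1; apply/andP; split.
    by apply/eqP => yz; apply: neq; apply: mxof_inj; rewrite -e yz eid.
  apply/pencilP; split=> // i /andP[_ id] ij.
  have iD : (i <= D)%N by rewrite /DD; lia.
  have rki : rk y z i i = i.
    rewrite (rk_pos hy hz e) // -[RHS](sum_lt iD) big_mkcond /=.
    apply: eq_bigr => c _; case: ltnP => // ci.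
    by rewrite refl_low.
  by apply: (eq_fl hy hz) => //; rewrite rki ?ry ?rz.
rewrite in_setD1 => /andP[ne py].
have [t et st] := posP symQ unitQ cy hz.
have [E|E] := pencil_pos cz py hz eid et (symf_id (d:=d)) st; last first.
  by rewrite et; apply: eq_mxof => c; rewrite E.
have : relpos y z == mxof (@id 'I_D) by rewrite et (eq_mxof E).
rewrite (coarsenP symQ unitQ) // => /eqP ez; case/eqP: ne; apply/esym.
by rewrite ez; apply: eq_flag => i iD; rewrite fl_coarsen // /cut sum_lt.
Qed.

Lemma count_refl m j (x : flag F D m) (z : flag F D D)
    (phi psi : {ffun 'I_D -> 'I_m}) :
  x \in flags Q m -> z \in complete_flags Q D -> relpos x z = (mxof phi)^T ->
  symf phi ->
  (pen_poly j phi psi).[#|F|%:Z] = #|[set y in complete_flags Q D |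
    (relpos x y == (mxof psi)^T) && (relpos y z == mxof (refl j))]|%:Z.
Proof.
move=> hx cz e s; have ez : relpos z x = mxof phi.
  by rewrite (relpos_tr hx (complete_flagW cz)) e trmxK.
rewrite (@pencil_count d F Q ndQ m j z x phi psi cz hx ez s); congr Posz.
apply: eq_card => y; rewrite [LHS]finset.in_set [RHS]finset.in_set.
case: (boolP (y \in complete_flags Q D)) => [cy|ncy] /=.
  rewrite relpos_refl // andbC; congr (_ && _).
  rewrite (relpos_tr (complete_flagW cy) hx).
  by rewrite (inj_eq trmx_inj).
by apply/negbTE; apply: contra ncy => /andP[]; rewrite in_setD1 => /andP[_ /pencilP[]].
Qed.

Lemma count_sorted m k (t : 'I_D -> 'I_k) (x : flag F D m) (z : flag F D D)
    (phi : 'I_D -> 'I_m) (A : 'M[nat]_(m, k)) :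
  symf t -> mono (fun c => t c) -> x \in flags Q m -> z \in complete_flags Q D ->
  relpos x z = (mxof phi)^T ->
  #|[set y in flags Q k | (relpos x y == A) && (relpos y z == (mxof t)^T)]|
  = (coarse phi t == A) :> nat.
Proof.
have [oddF symQ unitQ] := ndQ => st mt hx cz e; have hz := complete_flagW cz.
have hc := coarsen_flags hz st.
have ez : relpos z x = mxof phi by rewrite (relpos_tr hx hz) e trmxK.
have ec : relpos x (coarsen t z) = coarse phi t.
  by rewrite (relpos_tr hc hx) (relpos_coarsen_pos hz hx st mt ez) coarse_tr.
transitivity #|if coarse phi t == A then [set coarsen t z] else finset.set0|.
  apply: eq_card => y; rewrite [LHS]finset.in_set.
  case: (boolP (y \in flags Q k)) => [hy|ny] /=.
    have -> : (relpos y z == (mxof t)^T) = (y == coarsen t z).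
      rewrite -(coarsenP symQ unitQ) // (relpos_tr hz hy).
      by apply/eqP/eqP => [/trmx_inj|->].
    have [->|ne] := eqVneq y (coarsen t z); last first.
      by rewrite andbF; case: ifP; rewrite ?finset.in_set1 ?finset.in_set0 ?(negbTE ne).
    by rewrite ec andbT; case: ifP; rewrite ?finset.in_set1 ?finset.in_set0 ?eqxx.
  apply/esym/negbTE; apply: contra ny; case: ifP => _.
    by rewrite finset.in_set1 => /eqP->.
  by rewrite finset.in_set0.
by case: ifP; rewrite ?cards1 ?cards0.
Qed.

End Fixed.

Fact reflW_subproof (j : 'I_d) : [forall i, refl j (rev_ord i) == rev_ord (refl j i)].
Proof. by apply/forallP => i; rewrite refl_rev. Qed.
Definition reflW (j : 'I_d) : weylB d := exist _ (refl j) (reflW_subproof j).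

Lemma genTE (j : 'I_d) : genT j = [ffun w => (w == reflW j)%:R].
Proof.
apply/ffunP => w; rewrite !ffunE; congr (_%:R); congr nat_of_bool.
apply/asboolP/eqP => [h|-> F Q nd x y cx cy].
  have [inj _ rea] := indexed_YY d.
  (* The universal condition in [genT] would hold vacuously for a position that never occurs;
     realizing w over F_3 rules this out. *)
  have [F [Q [x [y [cF nd cx cy e]]]]] := rea w 3 isT isT.
  have hw := h F Q nd x y cx cy e; apply: inj; rewrite -e.
  have [oddF symQ unitQ] := nd.
  rewrite weyl_mxE; apply/eqP; rewrite (relpos_refl nd) //.
  have jd := ltn_ord j; have jD : (j.+1 < D.+1)%N by rewrite ltnS /DD; lia.
  rewrite in_setD1; apply/andP; split.
    apply/eqP => xy; have := hw (Ordinal jD); rewrite /= jd => /(_ isT).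
    by rewrite xy !eqxx.
  apply/pencilP; split=> // i id ij; apply/eqP.
  have iD : (i < D.+1)%N by move: id; rewrite /DD; lia.
  have := hw (Ordinal iD) id; rewrite !flE /= => -> //.
move=> e; have := e; rewrite weyl_mxE => /eqP; rewrite (relpos_refl nd) //.
rewrite in_setD1 => /andP[ne px] i id; have [_ hp] := pencilP _ _ _ _ px.
rewrite !flE; have [ij|nij] := eqVneq (i : nat) j.+1; last by rewrite hp // eqxx.
apply/negbTE; apply: contra ne => /eqP ef; apply/eqP; apply: (pencil_eq cy px).
  exact: pencil_refl.
by rewrite -ij ef.
Qed.

End SimpleReflections.

Section StrcFormulas.
Variables (n d : nat).
Notation N := (NN n).
Notation D := (DD d).

Definition extf (r : seqs n d) : {ffun 'I_D -> 'I_N} := finfun (ext_seq r).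

Lemma extf_sym r : symf (extf r).
Proof. by move=> c; rewrite !ffunE ext_seq_sym. Qed.

Lemma extf_inj : injective extf.
Proof. by move=> r s /ffunP h; apply: ext_seq_inj => c; have := h c; rewrite !ffunE. Qed.

Lemma seq_mx_extf r : seq_mx r = (mxof (extf r))^T.
Proof. by rewrite seq_mxE; congr trmx; apply: eq_mxof => c; rewrite ffunE. Qed.

Lemma strc_refl (r s : seqs n d) j :
  strc (@flagsX n d) (@flagsY d) (@flagsY d) (seq_mx r) (weyl_mx (reflW j)) (seq_mx s)
  = evq (pen_poly j (extf s) (extf r)).
Proof.
apply: strcE; last by have [_ _] := indexed_XY n d; apply.
move=> F Q nd x z hx hz e.
rewrite !seq_mx_extf weyl_mxE in e *; rewrite (count_refl nd _ _ hx hz e) //.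
exact: extf_sym.
Qed.

Lemma strc_sorted (A : Xi n d) (r s : seqs n d) : mono (fun c => extf r c) ->
  strc (@flagsX n d) (@flagsX n d) (@flagsY d) (xi_nat A) (seq_mx r) (seq_mx s)
  = (coarse (extf s) (extf r) == xi_nat A)%:R.
Proof.
move=> mr; rewrite (strcE (p := (coarse (extf s) (extf r) == xi_nat A)%:R)).
- by case: eqP; rewrite ?evq1 ?raddf0.
- move=> F Q nd x z hx hz; rewrite !seq_mx_extf => e.
  by rewrite (count_sorted nd _ (@extf_sym r) mr hx hz e) -polyC_natr hornerC natz.
by have [_ _] := indexed_XY n d; apply.
Qed.

(** Right multiplication by T_j moves the second flag, so letters must be read along that flag; this
    inverts w. For H, [invf] plays the role that [extf] plays for T. *)
Definition invf (w : weylB d) : {ffun 'I_D -> 'I_D} := [ffun c => (val w)^-1%g c].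

Lemma invf_sym w : symf (invf w).
Proof.
move=> c; rewrite !ffunE; apply: (@perm_inj _ (val w)).
by rewrite permKV weyl_sym permKV.
Qed.

Lemma weyl_mx_invf w : weyl_mx w = (mxof (invf w))^T.
Proof.
apply/matrixP => i k; rewrite !mxE ffunE; congr nat_of_bool.
by apply/eqP/eqP => [<-|->]; rewrite ?permK ?permKV.
Qed.

Lemma strc_reflH (w u : weylB d) j :
  strc (@flagsY d) (@flagsY d) (@flagsY d) (weyl_mx w) (weyl_mx (reflW j)) (weyl_mx u)
  = evq (pen_poly j (invf u) (invf w)).
Proof.
apply: strcE; last by have [_ _] := indexed_YY d; apply.
move=> F Q nd x z hx hz e.
rewrite (weyl_mx_invf w) weyl_mxE; rewrite weyl_mx_invf in e.
rewrite (count_refl nd _ _ (complete_flagW hx) hz e) //; exact: invf_sym.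
Qed.

Lemma strc_one (r s : seqs n d) (w : weylB d) : val w = 1%g ->
  strc (@flagsX n d) (@flagsY d) (@flagsY d) (seq_mx r) (weyl_mx w) (seq_mx s)
  = (s == r)%:R.
Proof.
move=> w1; rewrite (strcE (p := (s == r)%:R)).
- by case: eqP; rewrite ?evq1 ?raddf0.
- move=> F Q nd x z hx hz; rewrite !seq_mx_extf => e; have [oddF symQ unitQ] := nd.
  rewrite -polyC_natr hornerC natz; congr Posz.
  transitivity #|if s == r then [set z] else finset.set0|.
    by case: ifP; rewrite ?cards1 ?cards0.
  have eid y : y \in complete_flags Q D -> (relpos y z == weyl_mx w) = (z == y).
    move=> cy; rewrite weyl_mxE (eq_mxof (psi := id)); last first.
      by move=> c; rewrite w1 perm1.
    rewrite (coarsenP symQ unitQ) ?complete_flagW //.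
    have -> // : coarsen id y = y.
    by apply: eq_flag => i iD; rewrite fl_coarsen // /cut sum_lt.
  apply: eq_card => y; rewrite [RHS]finset.in_set.
  have [cy|ncy] := boolP (y \in complete_flags Q D).
    rewrite eid // andTb; have [<-|ne] := eqVneq z y.
      rewrite e andbT (inj_eq trmx_inj) mxof_eq (inj_eq extf_inj).
      by case: ifP; rewrite ?finset.in_set1 ?finset.in_set0 ?eqxx.
    by rewrite andbF; case: ifP; rewrite ?finset.in_set1 ?finset.in_set0 // [y == z]eq_sym (negbTE ne).
  rewrite andFb.
  apply/negbTE; apply: contra ncy; case: ifP; rewrite ?finset.in_set1 ?finset.in_set0 //.
  by move=> _ /eqP->.
by have [_ _] := indexed_XY n d; apply.
Qed.

End StrcFormulas.

(** * The bimodule T and its normalized basis *)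

Section Convolution.
Variables (I J K : finType) (c : I -> J -> K -> Qv).

(** The common shape of [mulS], [actST], [actTH] and [mulH], which are convertible to it; linearity
    and associativity are then proved once. *)
Definition conv (f : {ffun I -> Qv^o}) (g : {ffun J -> Qv^o}) : {ffun K -> Qv^o} :=
  [ffun k => \sum_i \sum_j f i * g j * c i j k].

Lemma conv_linearr f : linear (conv f).
Proof.
move=> a g g'; apply/ffunP => k; rewrite !ffunE scaler_sumr -big_split /=.
apply: eq_bigr => i _; rewrite scaler_sumr -big_split /=; apply: eq_bigr => j _.
by rewrite !ffunE /GRing.scale /=; ring.
Qed.

Lemma conv_linearl g : linear (conv^~ g).
Proof.
move=> a f f'; apply/ffunP => k; rewrite !ffunE scaler_sumr -big_split /=.
apply: eq_bigr => i _; rewrite scaler_sumr -big_split /=; apply: eq_bigr => j _.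
by rewrite !ffunE /GRing.scale /=; ring.
Qed.

End Convolution.

Lemma conv_assoc (I1 I2 I3 I12 I23 J : finType) (c1 : I1 -> I2 -> I12 -> Qv)
    (c2 : I12 -> I3 -> J -> Qv) (c3 : I2 -> I3 -> I23 -> Qv) (c4 : I1 -> I23 -> J -> Qv)
    f g h :
  (forall a b e z, \sum_C c1 a b C * c2 C e z = \sum_G c3 b e G * c4 a G z) ->
  conv c2 (conv c1 f g) h = conv c4 f (conv c3 g h).
Proof.
move=> ass; apply/ffunP => z; rewrite !ffunE.
transitivity (\sum_a \sum_b \sum_e f a * g b * h e * \sum_C c1 a b C * c2 C e z).
  transitivity (\sum_C \sum_a \sum_b \sum_e f a * g b * h e * (c1 a b C * c2 C e z)).
    apply: eq_bigr => C _.
    transitivity (\sum_e \sum_a \sum_b f a * g b * h e * (c1 a b C * c2 C e z)).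
      apply: eq_bigr => e _; rewrite ffunE -mulrA mulr_suml; apply: eq_bigr => a _.
      by rewrite mulr_suml; apply: eq_bigr => b _; ring.
    by rewrite exchange_big; apply: eq_bigr => a _; rewrite exchange_big.
  rewrite exchange_big; apply: eq_bigr => a _; rewrite exchange_big.
  apply: eq_bigr => b _; rewrite exchange_big; apply: eq_bigr => e _ /=.
  by rewrite mulr_sumr.
apply: eq_bigr => a _; symmetry.
transitivity (\sum_G \sum_b \sum_e f a * g b * h e * (c3 b e G * c4 a G z)).
  apply: eq_bigr => G _; rewrite ffunE -mulrA mulr_suml mulr_sumr.
  apply: eq_bigr => b _; rewrite mulr_suml mulr_sumr; apply: eq_bigr => e _; ring.
rewrite exchange_big; apply: eq_bigr => b _; rewrite exchange_big.
by apply: eq_bigr => e _ /=; rewrite ass mulr_sumr.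
Qed.

Definition dirac (I : finType) (i : I) : {ffun I -> Qv^o} := [ffun k => (k == i)%:R].

Lemma dirac_sum (I : finType) (f : {ffun I -> Qv^o}) : f = \sum_i f i *: dirac i.
Proof.
apply/ffunP => k; rewrite sum_ffunE (bigD1 k) //= big1 ?addr0 => [|i nk].
  by rewrite !ffunE eqxx /GRing.scale /= mulr1.
by rewrite !ffunE eq_sym (negbTE nk) /GRing.scale /= mulr0.
Qed.

Lemma conv_diracr (I J K : finType) (c : I -> J -> K -> Qv) f j k :
  conv c f (dirac j) k = \sum_i f i * c i j k.
Proof.
rewrite ffunE; apply: eq_bigr => i _; rewrite (bigD1 j) //= big1 ?addr0 => [|j' nj].
  by rewrite ffunE eqxx mulr1.
by rewrite ffunE (negbTE nj) mulr0 mul0r.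
Qed.

Lemma conv_dirac2 (I J K : finType) (c : I -> J -> K -> Qv) i j k :
  conv c (dirac i) (dirac j) k = c i j k.
Proof.
rewrite conv_diracr (bigD1 i) //= big1 ?addr0 => [|i' ni].
  by rewrite ffunE eqxx mul1r.
by rewrite ffunE (negbTE ni) mul0r.
Qed.

Section LinearFacts.
Variables (V W : lmodType Qv) (g : V -> W).
Hypothesis lin_g : linear g.

Lemma linfun0 : g 0 = 0.
Proof.
by have := lin_g (-1) 0 0; rewrite scaler0 addr0 scaleN1r addNr.
Qed.

Lemma linfunZ a u : g (a *: u) = a *: g u.
Proof. by have := lin_g a u 0; rewrite !addr0 linfun0 addr0. Qed.

Lemma linfunD u w : g (u + w) = g u + g w.
Proof. by have := lin_g 1 u w; rewrite !scale1r. Qed.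

Lemma linfun_sum (I : Type) (r : seq I) (P : pred I) (F : I -> V) :
  g (\sum_(i <- r | P i) F i) = \sum_(i <- r | P i) g (F i).
Proof. by apply: big_morph; [exact: linfunD | exact: linfun0]. Qed.

End LinearFacts.

Section Bimodule.
Variables (n d : nat).
Notation N := (NN n).
Notation D := (DD d).

Lemma subset_X (F : finFieldType) (Q : 'M[F]_D) : @flagsX n d F Q \subset flags Q N.
Proof. by []. Qed.

Lemma subset_Y (F : finFieldType) (Q : 'M[F]_D) : @flagsY d F Q \subset flags Q D.
Proof. by apply/fintype.subsetP => x; apply: complete_flagW. Qed.

Lemma seq_mx_col (r : seqs n d) c : (\sum_i seq_mx r i c = 1)%N.
Proof.
rewrite (bigD1 (ext_seq r c)) //= big1 => [|i ni]; rewrite mxE ?eqxx //.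
by rewrite (negbTE ni).
Qed.

Lemma weyl_mx_col (w : weylB d) c : (\sum_i weyl_mx w i c = 1)%N.
Proof.
rewrite (bigD1 ((val w)^-1%g c)) //= big1 => [|i ni]; rewrite mxE ?permKV ?eqxx //.
by apply/eqP; rewrite eqb0; apply: contra ni => /eqP<-; rewrite permK.
Qed.

Lemma act_mulS (f g : QS n d) t : actST (mulS f g) t = actST f (actST g t).
Proof.
apply: conv_assoc => A B r s.
apply: (strc_assoc (indexed_XX n d) (indexed_XY n d) (indexed_XY n d)) => [C|C|G|G];
  apply: counts_X => *; try exact: subset_X; exact: subset_Y.
Qed.

Lemma act_comm (f : QS n d) t h : actTH (actST f t) h = actST f (actTH t h).
Proof.
apply: conv_assoc => A r w s.
apply: (strc_assoc (indexed_XY n d) (indexed_XY n d) (indexed_XY n d)) => [C|C|G|G].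
- by apply: counts_X => *; [exact: subset_X | exact: subset_Y].
- by apply: counts_Y => [*|*|c]; [exact: subset_X | exact: subset_Y | exact: seq_mx_col].
- by apply: counts_Y => [*|*|c]; [exact: subset_X | exact: subset_Y | exact: seq_mx_col].
by apply: counts_X => *; [exact: subset_X | exact: subset_Y].
Qed.

Lemma act_mulH (t : QT n d) g h : actTH t (mulH g h) = actTH (actTH t g) h.
Proof.
symmetry; apply: conv_assoc => r w w' s.
apply: (strc_assoc (indexed_XY n d) (indexed_YY d) (indexed_XY n d)) => [C|C|G|G].
- by apply: counts_Y => [*|*|c]; [exact: subset_X | exact: subset_Y | exact: seq_mx_col].
- by apply: counts_Y => [*|*|c]; [exact: subset_X | exact: subset_Y | exact: seq_mx_col].
- by apply: counts_Y => [*|*|c]; [exact: subset_Y | exact: subset_Y | exact: weyl_mx_col].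
by apply: counts_Y => [*|*|c]; [exact: subset_X | exact: subset_Y | exact: seq_mx_col].
Qed.

Lemma actST_linear (f : QS n d) : linear (actST f).
Proof. exact: conv_linearr. Qed.
Lemma actST_linearl (t : QT n d) : linear (fun f : QS n d => actST f t).
Proof. exact: conv_linearl. Qed.
Lemma actTH_linear (t : QT n d) : linear (actTH t).
Proof. exact: conv_linearr. Qed.
Lemma actTH_linearl (h : QH d) : linear (fun t : QT n d => actTH t h).
Proof. exact: conv_linearl. Qed.

Lemma weyl1_subproof : [forall i : 'I_D, (1%g : 'S_D) (rev_ord i) == rev_ord ((1%g : 'S_D) i)].
Proof. by apply/forallP => i; rewrite !perm1. Qed.
Definition weyl1 : weylB d := exist _ 1%g weyl1_subproof.

Lemma oneHE : oneH d = dirac weyl1.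
Proof. by apply/ffunP => w; rewrite !ffunE -val_eqE. Qed.

Lemma act_oneH (t : QT n d) : actTH t (oneH d) = t.
Proof.
rewrite oneHE; apply/ffunP => s; rewrite [LHS]conv_diracr.
rewrite (bigD1 s) //= big1 ?addr0 => [|r nr]; rewrite strc_one // ?eqxx ?mulr1 //.
by rewrite eq_sym (negbTE nr) mulr0.
Qed.

Lemma act_genT (t : QT n d) j s :
  actTH t (genT j) s = \sum_r t r * evq (pen_poly j (extf s) (extf r)).
Proof.
rewrite genTE -/(dirac (reflW j)) [LHS]conv_diracr.
by apply: eq_bigr => r _; rewrite strc_refl.
Qed.

Lemma dirac_genT (r s : seqs n d) j :
  actTH (dirac r) (genT j) s = evq (pen_poly j (extf s) (extf r)).
Proof. by rewrite genTE -/(dirac (reflW j)) [LHS]conv_dirac2 strc_refl. Qed.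

Definition reflr (j : 'I_d) (r : seqs n d) : seqs n d :=
  if insub j.+1 : option 'I_d is Some j' then swap_seq r j j' else flip_seq r j.

Lemma extf_pen1 (r : seqs n d) j : extf r (pen1 j) = r j.
Proof. by rewrite ffunE (ext_seq_low _ (c' := j)). Qed.

Lemma extf_pen2 (r : seqs n d) j :
  extf r (pen2 j) = if insub j.+1 : option 'I_d is Some j' then r j' else rev_ord (r j).
Proof.
case: insubP => [j' hj ej|hj].
  by rewrite ffunE (ext_seq_low _ (c' := j')) //= hj ej.
by rewrite -rev_pen1 // extf_sym extf_pen1.
Qed.

Lemma extf_reflr j (r : seqs n d) : extf (reflr j r) = reflf j (extf r).
Proof.
apply/ffunP; have sr := symf_reflf j (@extf_sym _ _ r).
have [s es] := ext_seq_surj sr; suff -> : reflr j r = s.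
  by move=> c; rewrite ffunE es.
have {}es (c : 'I_D) : ext_seq s c = extf r (refl j c) by rewrite es ffunE.
apply/ffunP => c; have cd := ltn_ord c; have jd := ltn_ord j.
have cD : (c < D)%N by rewrite /DD; lia.
have [c0 e0] : exists c0 : 'I_D, c0 = c :> nat by exists (Ordinal cD).
rewrite -(ext_seq_low s e0) es /reflr.
case: insubP => [j' hj ej|hj].
  rewrite /= in ej; rewrite ffunE; case: tpermP => [ec|ec|n1 n2].
  - have -> : c0 = pen1 j by apply: val_inj; rewrite /= e0 ec.
    by rewrite refl_pen1 extf_pen2; case: insubP => [j2 _ e2|]; rewrite ?hj //;
      congr (r _); apply: val_inj; rewrite /= e2 ej.
  - have -> : c0 = pen2 j by apply: val_inj; rewrite /= hj e0 ec ej.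
    by rewrite refl_pen2 extf_pen1.
  have -> : refl j c0 = c0.
    rewrite reflE /refl_fun -!val_eqE /= hj e0.
    have ncj : (c == j :> nat) = false by apply/negbTE/eqP => e; apply: n1; apply: val_inj.
    have ncj' : (c == j.+1 :> nat) = false.
      by apply/negbTE/eqP => e; apply: n2; apply: val_inj; rewrite /= ej.
    by rewrite ncj ncj' /DD; case: eqP => [|_]; [lia | case: eqP => [|_ //]; lia].
  by rewrite ffunE (ext_seq_low _ e0).
rewrite ffunE; case: eqP => [ec|nc].
  have -> : c0 = pen1 j by apply: val_inj; rewrite /= e0 ec.
  by rewrite refl_pen1 extf_pen2 insubN // ec.
have -> : refl j c0 = c0.
  have ncj : (c == j :> nat) = false by apply/negbTE/eqP => e; apply: nc; apply: val_inj.
  rewrite reflE /refl_fun -!val_eqE /= e0 ncj (negbTE hj) /DD.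
  by case: eqP => [|_]; [lia | case: eqP => [|_]; [lia | case: eqP => [|_ //]; lia]].
by rewrite ffunE (ext_seq_low _ e0).
Qed.

Lemma reflrK j : involutive (reflr j).
Proof. by move=> r; apply: extf_inj; rewrite !extf_reflr reflfK. Qed.

Lemma pen_poly_eq m j (phi t : {ffun 'I_D -> 'I_m}) :
  t (pen1 j) = t (pen2 j) -> pen_poly j phi t = 'X *+ (phi == t).
Proof.
move=> et; rewrite /pen_poly; case: eqVneq => [_|ne]; first by rewrite [t == phi]eq_sym.
have n1 : (phi == t) = false by apply/eqP => e; rewrite e et eqxx in ne.
have n2 : (t == reflf j phi) = false.
  apply/eqP => e; move: et; rewrite e reflf_pen1 reflf_pen2 => h.
  by rewrite h eqxx in ne.
by rewrite n2 [t == phi]eq_sym n1; case: ifP; rewrite ?mulr0n ?addr0.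
Qed.

Lemma pen_poly_desc m j (phi t : {ffun 'I_D -> 'I_m}) :
  (t (pen2 j) < t (pen1 j))%N ->
  pen_poly j phi t = ('X - 1) *+ (phi == t) + 'X *+ (phi == reflf j t).
Proof.
move=> ht; rewrite /pen_poly.
have E : (t == reflf j phi) = (phi == reflf j t).
  by apply/eqP/eqP => ->; rewrite reflfK.
have F1 : (phi (pen1 j) <= phi (pen2 j))%N -> (phi == t) = false.
  by move=> h; apply/eqP => e; move: h; rewrite e leqNgt ht.
have F2 : (phi (pen2 j) <= phi (pen1 j))%N -> (phi == reflf j t) = false.
  by move=> h; apply/eqP => e; move: h; rewrite e reflf_pen1 reflf_pen2 leqNgt ht.
case: eqVneq => [e|ne].
  by rewrite [t == phi]eq_sym F1 ?F2 ?e // !mulr0n addr0.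
case: ltnP => h; first by rewrite E F1 ?mulr0n ?add0r // ltnW.
by rewrite E F2 // [t == phi]eq_sym mulr0n add0r addr0.
Qed.

(** On an ascent T_j has a single term with coefficient 1: one moves from sequence to sequence
    without lower terms. *)
Lemma dirac_asc (r : seqs n d) j : (extf r (pen1 j) < extf r (pen2 j))%N ->
  actTH (dirac r) (genT j) = dirac (reflr j r).
Proof.
move=> h; apply/ffunP => s; rewrite dirac_genT pen_poly_sorted // ffunE.
by rewrite -extf_reflr (inj_eq (@extf_inj n d)); case: eqP; rewrite ?evq1 ?raddf0.
Qed.

(* T is generated over H by the dirac functions of sorted sequences. *)
Lemma sorted_generate (g g' : QT n d -> QT n d) : linear g -> linear g' ->
  (forall r j, (extf r (pen1 j) < extf r (pen2 j))%N ->
     g (actTH (dirac r) (genT j)) = actTH (g (dirac r)) (genT j)) ->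
  (forall r j, (extf r (pen1 j) < extf r (pen2 j))%N ->
     g' (actTH (dirac r) (genT j)) = actTH (g' (dirac r)) (genT j)) ->
  (forall r, mono (fun c => extf r c) -> g (dirac r) = g' (dirac r)) ->
  forall t, g t = g' t.
Proof.
move=> lg lg' cg cg' h t; rewrite (dirac_sum t) (linfun_sum lg) (linfun_sum lg').
apply: eq_bigr => r _; rewrite (linfunZ lg) (linfunZ lg'); congr (_ *: _).
suff H : forall u : {ffun 'I_D -> 'I_N}, symf u ->
    forall r, extf r = u -> g (dirac r) = g' (dirac r).
  exact: (H _ (@extf_sym _ _ r) r erefl).
apply: (refl_ind (P := fun u => forall r, extf r = u -> g (dirac r) = g' (dirac r)))
  => [u su mu r' eu|u j su hu IH r' eu].
  by apply: h; rewrite eu.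
have e' : extf (reflr j r') = reflf j u by rewrite extf_reflr eu.
have asc : (extf (reflr j r') (pen1 j) < extf (reflr j r') (pen2 j))%N.
  by rewrite e' reflf_pen1 reflf_pen2.
by rewrite -(reflrK j r') -dirac_asc // cg // cg' // IH.
Qed.

End Bimodule.

Lemma v_neq0 : v != 0.
Proof. by rewrite tofrac_eq0 polyX_eq0. Qed.

Lemma v_expD (a b : int) : v ^ (a + b) = v ^ a * v ^ b.
Proof. by rewrite expfzDr // v_neq0. Qed.

Lemma scaleffE (I : finType) (a : Qv) (x : {ffun I -> Qv^o}) i : (a *: x) i = a * x i.
Proof. by rewrite ffunE. Qed.

Lemma addffE (I : finType) (x y : {ffun I -> Qv^o}) i : (x + y) i = x i + y i.
Proof. by rewrite ffunE. Qed.

Lemma lin2ffE (I : finType) (a b : Qv) (x y : {ffun I -> Qv^o}) i :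
  (a *: x + b *: y) i = a * x i + b * y i.
Proof. by rewrite addffE !scaleffE. Qed.

Lemma linffE (I : finType) (a : Qv) (x y : {ffun I -> Qv^o}) i :
  (a *: x + y) i = a * x i + y i.
Proof. by rewrite addffE scaleffE. Qed.

(** * The normalized basis and the transport along Omega *)

Section OmegaMap.
Variables (n d : nat).
Notation N := (NN n).
Notation D := (DD d).

Lemma OmegaE (x : VT n d) s : Omega x s = x s * v ^+ texp s.
Proof.
rewrite /Omega sum_ffunE (bigD1 s) //= big1 ?addr0 => [|r nr].
  by rewrite !ffunE eqxx.
by rewrite !ffunE eq_sym (negbTE nr) scaler0.
Qed.

Lemma Omega_linear : linear (@Omega n d).
Proof.
move=> a x y; apply/ffunP => s.
apply: (etrans (OmegaE _ s)); apply: (etrans (congr1 ( *%R^~ _) (linffE _ _ _ _))).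
apply: (etrans _ (esym (linffE _ _ _ _))); rewrite mulrDl -mulrA.
exact: (f_equal2 (fun y z => a * y + z) (esym (OmegaE x s)) (esym (OmegaE y s))).
Qed.

Definition Omega_inv (t : QT n d) : VT n d := [ffun s => t s / v ^+ texp s].

Lemma OmegaK : cancel (@Omega n d) Omega_inv.
Proof.
move=> x; apply/ffunP => s.
by rewrite ffunE OmegaE mulfK // expf_neq0 // v_neq0.
Qed.

Lemma Omega_invK : cancel Omega_inv (@Omega n d).
Proof.
move=> t; apply/ffunP => s.
by rewrite OmegaE ffunE divfK // expf_neq0 // v_neq0.
Qed.

Lemma Omega_bij : bijective (@Omega n d).
Proof. exact: Bijective OmegaK Omega_invK. Qed.

Lemma vten_dirac (r : seqs n d) : vten r = dirac r.
Proof. by []. Qed.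

Lemma Omega_vten (r : seqs n d) : Omega (vten r) = v ^+ texp r *: dirac r.
Proof.
apply/ffunP => s; rewrite OmegaE !ffunE /GRing.scale /=.
by case: eqP => [->|]; rewrite ?mul1r ?mulr1 ?mul0r ?mulr0.
Qed.

(** An adjacent transposition permutes the ordered pairs of positions, apart from the pair (j, j')
    which it reverses. *)
Lemma sum_pairs_swap (g : 'I_d -> 'I_d -> nat) (j j' : 'I_d) : j' = j.+1 :> nat ->
  (\sum_(c < d) \sum_(c' < d | c < c') g (tperm j j' c) (tperm j j' c') + g j j'
   = \sum_(c < d) \sum_(c' < d | c < c') g c c' + g j' j)%N.
Proof.
move=> ej; pose tt (p : 'I_d * 'I_d) := (tperm j j' p.1, tperm j j' p.2).
have ttK : involutive tt by case=> a b; rewrite /tt /= !tpermK.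
have jj : j != j' by rewrite -val_eqE /= ej neq_ltn ltnSn.
pose G (p : 'I_d * 'I_d) := g p.1 p.2.
have E (h : 'I_d -> 'I_d -> nat) : (\sum_(c < d) \sum_(c' < d | c < c') h c c'
    = \sum_(p : 'I_d * 'I_d) (p.1 < p.2) * h p.1 p.2)%N.
  rewrite -(pair_bigA _ (fun c c' : 'I_d => (c < c') * h c c')%N) /=.
  apply: eq_bigr => c _; rewrite big_mkcond; apply: eq_bigr => c' _.
  by case: ltnP; rewrite ?mul1n.
rewrite !E [X in (X + _)%N](reindex_inj (inv_inj ttK)) /=.
under eq_bigr => p _ do rewrite !tpermK.
have one (q : 'I_d * 'I_d) : G q = (\sum_(p : 'I_d * 'I_d) (p == q) * G p)%N.
  rewrite (bigD1 q) //= eqxx mul1n big1 ?addn0 // => p np.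
  by rewrite (negbTE np).
rewrite -[g j j']/(G (j, j')) -[g j' j]/(G (j', j)) !one -!big_split /=.
apply: eq_bigr => -[a b] _; rewrite -!mulnDl; congr (_ * _)%N; rewrite !xpair_eqE /=.
by case: tpermP => [->|->|n1 n2]; case: tpermP => [->|->|n3 n4];
  rewrite ?eqxx ?(negbTE jj) 1?[j' == j]eq_sym ?(negbTE jj) /= ?ltnn; move: ej jj;
  rewrite -!val_eqE /=; try (move/eqP: n1; move/eqP: n2); try (move/eqP: n3; move/eqP: n4);
  rewrite -?val_eqE /=; lia.
Qed.

Definition inv1 (r : seqs n d) : nat :=
  (\sum_(c < d) \sum_(c' < d | c < c') (r c < r c')%N)%N.
Definition inv2 (r : seqs n d) : nat :=
  (\sum_(c < d) \sum_(c' < d | c < c') ((r c).+1 + (r c').+1 < N.+1)%N)%N.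
Definition inv3 (r : seqs n d) : nat := (\sum_(c < d) ((r c).+1 < n.+1)%N)%N.

Lemma texpE r : texp r = (inv1 r + inv2 r + inv3 r)%N.
Proof. by []. Qed.

(** An ascent at j accounts for exactly one of the roots counted by [texp]. This drop by 1 is the
    factor v in the action of T_j on the v_r. *)
Lemma texp_reflr (r : seqs n d) j : (extf r (pen1 j) < extf r (pen2 j))%N ->
  texp r = (texp (reflr j r)).+1.
Proof.
rewrite extf_pen1 extf_pen2 /reflr !texpE; case: insubP => [j' hj ej|hj] hlt.
  have {}ej : j' = j.+1 :> nat by [].
  have E1 := sum_pairs_swap (fun c c' => (r c < r c')%N) ej.
  have E2 := sum_pairs_swap (fun c c' => ((r c).+1 + (r c').+1 < N.+1)%N) ej.
  rewrite hlt [(r j' < r j)%N]ltnNge (ltnW hlt) /= addn0 addn1 in E1.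
  rewrite [in X in _ = X]addnC [((r j').+1 + _)%N]addnC addnC in E2; move/addnI: E2 => E2.
  have H1 : inv1 r = (inv1 (swap_seq r j j')).+1.
    rewrite /inv1 -E1; congr S; apply: eq_bigr => c _; apply: eq_bigr => c' _.
    by rewrite !ffunE.
  have H2 : inv2 r = inv2 (swap_seq r j j').
    rewrite /inv2 -E2; apply: eq_bigr => c _; apply: eq_bigr => c' _.
    by rewrite !ffunE.
  have H3 : inv3 r = inv3 (swap_seq r j j').
    rewrite /inv3 (reindex_inj (@perm_inj _ (tperm j j'))); apply: eq_bigr => c _.
    by rewrite ffunE.
  by rewrite H1 H2 H3 !addSn.
have last (c' : 'I_d) (c : 'I_d) : (c < c')%N -> (c == j) = false.
  move=> cc; apply/eqP => e; move: hj cc; rewrite e.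
  by have := ltn_ord c'; lia.
(* Replacing r_d by N + 1 - r_d exchanges the conditions r_c < r_d and r_c + r_d < N + 1, so only
   the sum of the two counts is preserved. *)
have H12 : (inv1 r + inv2 r = inv1 (flip_seq r j) + inv2 (flip_seq r j))%N.
  rewrite /inv1 /inv2 -!big_split /=; apply: eq_bigr => c _.
  rewrite -!big_split /=; apply: eq_bigr => c' cc; rewrite !ffunE (last _ _ cc).
  case: eqP => [->|] //=; have := ltn_ord (r c); have := ltn_ord (r j).
  by rewrite /NN; lia.
have H3 : inv3 r = (inv3 (flip_seq r j)).+1.
  rewrite /inv3 (bigD1 j) //= [in RHS](bigD1 j) //= ffunE eqxx.
  have -> : ((r j).+1 < n.+1)%N = true by move: hlt; rewrite /= /NN; lia.
  have -> : ((rev_ord (r j)).+1 < n.+1)%N = false by move: hlt; rewrite /= /NN; lia.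
  by rewrite add1n add0n; congr S; apply: eq_bigr => c /negbTE nc; rewrite ffunE nc.
by rewrite H12 H3 addnS.
Qed.

Lemma actT_basisE (r : seqs n d) j : actT_basis r j =
  if (extf r (pen1 j) < extf r (pen2 j))%N then v *: vten (reflr j r)
  else if extf r (pen1 j) == extf r (pen2 j) then v ^+ 2 *: vten r
  else (v ^+ 2 - 1) *: vten r + v *: vten (reflr j r).
Proof.
rewrite /actT_basis /reflr extf_pen1 extf_pen2; case: insubP => [j' hj ej|hj] //.
have -> : ((r j).+1 < n.+1)%N = (r j < rev_ord (r j))%N.
  by have := ltn_ord (r j); rewrite /= /NN; lia.
have -> // : ((r j).+1 == n.+1) = (r j == rev_ord (r j)).
by rewrite -val_eqE /= /NN; have := ltn_ord (r j); rewrite /NN; lia.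
Qed.

Lemma Omega_actT (x : VT n d) j : Omega (actT x j) = actTH (Omega x) (genT j).
Proof.
have evB (p : {poly int}) (b : bool) : evq (p *+ b) = evq p * b%:R.
  by rewrite raddfMn mulr_natr.
rewrite /actT (linfun_sum Omega_linear) {2}(dirac_sum x) (linfun_sum Omega_linear).
rewrite (linfun_sum (actTH_linearl _)); apply: eq_bigr => r _.
rewrite !(linfunZ Omega_linear) (linfunZ (actTH_linearl _)); congr (_ *: _).
rewrite -vten_dirac Omega_vten (linfunZ (actTH_linearl _)) actT_basisE.
apply/ffunP => s; rewrite [RHS]scaleffE dirac_genT.
have inj_s : (extf s == reflf j (extf r)) = (s == reflr j r).
  by rewrite -extf_reflr (inj_eq (@extf_inj n d)).
have injs : (extf s == extf r) = (s == r) by rewrite (inj_eq (@extf_inj n d)).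
case: ltngtP => h.
- rewrite (linfunZ Omega_linear) Omega_vten scalerA -exprS -texp_reflr //.
  rewrite pen_poly_sorted // inj_s scaleffE ffunE; congr (_ * _).
  by case: eqP; rewrite ?evq1 ?raddf0.
- have h' : (extf (reflr j r) (pen1 j) < extf (reflr j r) (pen2 j))%N.
    by rewrite extf_reflr reflf_pen1 reflf_pen2.
  have := texp_reflr h'; rewrite reflrK => et.
  have -> : (extf r (pen1 j) == extf r (pen2 j)) = false.
    by rewrite -val_eqE gtn_eqF.
  rewrite (linfunD Omega_linear) !(linfunZ Omega_linear) !Omega_vten et.
  rewrite pen_poly_desc // inj_s injs raddfD /= !evB raddfB /= evqX evq1.
  rewrite lin2ffE !scaleffE !ffunE [v ^+ (texp r).+1]exprS.
  have E (R : comPzRingType) (a w b1 b2 : R) :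
    (a ^+ 2 - 1) * (w * b1) + a * (a * w * b2) = w * ((a ^+ 2 - 1) * b1 + a ^+ 2 * b2).
    by ring.
  exact: E.
move/ord_inj: h => h; rewrite h eqxx (linfunZ Omega_linear) Omega_vten pen_poly_eq //.
by rewrite injs evB evqX !scaleffE ffunE mulrCA.
Qed.

Lemma actT_linear j : linear (fun x : VT n d => actT x j).
Proof.
move=> a x y; rewrite /actT scaler_sumr -big_split; apply: eq_bigr => r _ /=.
by rewrite scalerA -scalerDl addffE scaleffE.
Qed.

Lemma act_words (t : QT n d) l (ws : seq 'I_d) :
  actTH t (foldl (fun g j => mulH g (genT j)) l ws)
  = foldl (fun t j => actTH t (genT j)) (actTH t l) ws.
Proof.
elim/last_ind: ws => // ws j IH; rewrite -!cats1 !foldl_cat /= -IH.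
exact: act_mulH.
Qed.

Lemma Omega_words (x : VT n d) (ws : seq 'I_d) :
  Omega (foldl (@actT n d) x ws) = foldl (fun t j => actTH t (genT j)) (Omega x) ws.
Proof.
elim/last_ind: ws => // ws j IH; rewrite -!cats1 !foldl_cat /= -IH.
exact: Omega_actT.
Qed.

End OmegaMap.

Section HeckeWords.
Variable d : nat.
Notation D := (DD d).
Notation wordH := (foldl (fun g j => mulH g (genT j)) (oneH d)).

Lemma invf_inj : injective (@invf d).
Proof.
move=> w w' /ffunP h; apply: val_inj; apply: invg_inj; apply/permP => c.
by have := h c; rewrite !ffunE.
Qed.

(** Induction on the descents of the inverse of w: removing one gives w2 with e_w = e_w2 T_j by
    [pen_poly_sorted], and the only sorted permutation is the identity. *)
Lemma dirac_word (w : weylB d) : exists l, dirac w = wordH l.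
Proof.
suff H : forall u : {ffun 'I_D -> 'I_D}, symf u ->
    forall w, invf w = u -> exists l, dirac w = wordH l.
  exact: (H _ (@invf_sym _ w) w erefl).
apply: (refl_ind (P := fun u => forall w, invf w = u -> exists l, dirac w = wordH l))
  => [u su mu w' eu|u j su hu IH w' eu].
  exists [::]; rewrite /= oneHE; congr dirac; apply: invf_inj.
  have ui : injective u by rewrite -eu => a b; rewrite !ffunE; apply: perm_inj.
  have E : (fun c => u c : nat) =1 (fun c => c : nat).
    apply: sorted_unique => // e; rewrite [RHS](reindex_inj ui).
    exact: eq_bigr.
  apply/ffunP => c; rewrite eu; apply: ord_inj; rewrite E ffunE.
  by rewrite invg1 perm1.
have ri : injective (fun c => refl j (val w' c)).
  by move=> a b /perm_inj/perm_inj.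
have [w2 e2] := weyl_surj ri (fun c => etrans (congr1 _ (weyl_sym w' c)) (refl_rev j _)).
have i2 : invf w2 = reflf j u.
  apply/ffunP => c; rewrite !ffunE -eu ffunE; apply: (@perm_inj _ (val w2)).
  by rewrite permKV e2 permKV reflK.
have [l el] := IH _ i2; exists (rcons l j).
rewrite -cats1 foldl_cat /= -el genTE -/(dirac (reflW j)); apply/ffunP => u'.
rewrite [RHS]conv_dirac2 strc_reflH i2 pen_poly_sorted ?reflf_pen1 ?reflf_pen2 //.
rewrite reflfK -eu (inj_eq invf_inj) ffunE.
by case: eqP; rewrite ?evq1 ?raddf0.
Qed.

Lemma words_ex (h : QH d) : exists ws : seq (Qv * seq 'I_d),
  h = \sum_(w <- ws) w.1 *: wordH w.2.
Proof.
have [l hl] := choice dirac_word.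
exists [seq (h w, l w) | w <- index_enum (weylB d)].
by rewrite big_map /= {1}(dirac_sum h); apply: eq_bigr => w _; rewrite -hl.
Qed.

Lemma wordsP (h : QH d) : h = \sum_(w <- words h) w.1 *: wordH w.2.
Proof.
have [ws hws] := words_ex h.
exact: (@xgetPex _ [::] [set ws | h = \sum_(w <- ws) w.1 *: wordH w.2]%classic
  (ex_intro _ ws hws)).
Qed.

End HeckeWords.

Section HeckeAction.
Variables (n d : nat).

(** The right-hand side does not involve [words], so [actVH] depends on h alone. *)
Lemma Omega_actVH (x : VT n d) (h : QH d) : Omega (actVH x h) = actTH (Omega x) h.
Proof.
rewrite /actVH (linfun_sum (@Omega_linear n d)) {2}(wordsP h).
rewrite (linfun_sum (actTH_linear _)); apply: eq_bigr => w _.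
rewrite (linfunZ (@Omega_linear n d)) (linfunZ (actTH_linear _)) Omega_words.
by rewrite act_words act_oneH.
Qed.

End HeckeAction.

(** * The double centralizer property of S and H *)

Lemma Qv_frac (x : Qv) : exists p q : {poly rat}, q != 0 /\ x * tofrac q = tofrac p.
Proof.
elim/quotW: x => r; exists \n_r, \d_r; split; first exact: denom_ratioP.
apply/eqP; rewrite -[_ * _]/(FracField.mul _ _) !piE /FracField.equivf /FracField.mulf.
by rewrite !numden_Ratio ?mulf_neq0 ?oner_eq0 ?denom_ratioP // !mulr1 mulrC.
Qed.

(** At each natural number a sum of squares of rationals vanishes, so every p i has infinitely many
    roots. Clearing denominators extends this to Q(v) in [Qv_sos]. *)
Lemma rat_poly_sos m (p : 'I_m -> {poly rat}) :
  \sum_i p i * p i = 0 -> forall i, p i = 0.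
Proof.
move=> h i; apply/eqP/negPn/negP => nz.
have z k : (p i).[k%:R] = 0.
  have := congr1 (fun q => q.[k%:R : rat]) h; rewrite horner_sum horner0 => /eqP.
  rewrite psumr_eq0 => [/allP/(_ i (mem_index_enum i))|i' _].
    by rewrite hornerM mulf_eq0 orbb => /eqP.
  by rewrite hornerM -expr2 sqr_ge0.
have : (size [seq k%:R : rat | k <- iota 0 (size (p i))] < size (p i))%N.
  apply: max_poly_roots => //.
    by apply/allP => _ /mapP[k _ ->]; rewrite rootE z.
  by rewrite map_inj_uniq ?iota_uniq // => a b /eqP; rewrite eqr_nat => /eqP.
by rewrite size_map size_iota ltnn.
Qed.

Lemma Qv_sos m (u : 'rV[Qv]_m) : u *m u^T = 0 -> u = 0.
Proof.
move=> h; have [p hp] := choice (fun i => Qv_frac (u 0 i)).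
have [q hq] := choice hp; pose Dn := \prod_i q i.
have D0 : Dn != 0 by apply/prodf_neq0 => i _; have [] := hq i.
pose P i := p i * \prod_(k | k != i) q k.
have eP i : u 0 i * tofrac Dn = tofrac (P i).
  rewrite /P tofracM; have [_ <-] := hq i; rewrite -mulrA -tofracM.
  by rewrite /Dn (bigD1 i).
have sP : \sum_i P i * P i = 0.
  apply/eqP; rewrite -tofrac_eq0 rmorph_sum /=.
  have /matrixP/(_ 0 0) := h; rewrite !mxE => e.
  rewrite (eq_bigr (fun i => (u 0 i * u^T i 0) * (tofrac Dn * tofrac Dn))).
    by rewrite -mulr_suml e mul0r.
  by move=> i _; rewrite tofracM -eP mxE mulrACA.
apply/rowP => i; rewrite mxE; apply: (mulIf (x := tofrac Dn)).
  by rewrite tofrac_eq0.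
by rewrite eP (rat_poly_sos sP) tofrac0 mul0r.
Qed.

Section Bicommutant.
Variables (K : fieldType) (k : nat) (J : Type) (T : J -> 'M[K]_k).
Hypothesis real_K : forall m (u : 'rV[K]_m), u *m u^T = 0 -> u = 0.
Hypothesis symT : forall j, (T j)^T = T j.

(** Turns a subspace given by a predicate into a row space: vectors are added while some are
    missing, with l bounding the codimension reached so far. *)
Lemma span_pred m (S : 'rV[K]_m -> Prop) :
  S 0 -> (forall a u w, S u -> S w -> S (a *: u + w)) ->
  exists R : 'M[K]_m, forall u, S u <-> (u <= R)%MS.
Proof.
move=> S0 SL.
have comb l (R : 'M[K]_(l, m)) u : (forall i, S (row i R)) -> (u <= R)%MS -> S u.
  move=> hR /submxP[X ->]; rewrite mulmx_sum_row.
  by elim/big_rec: _ => // i y _ hy; apply: SL.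
suff H l : (exists R : 'M[K]_m, (forall i, S (row i R)) /\ (m - \rank R <= l)%N) ->
    exists R : 'M[K]_m, forall u, S u <-> (u <= R)%MS.
  apply: (H m); exists 0; split; last by rewrite leq_subr.
  by move=> i; rewrite row0.
elim: l => [|l IH] [R [hR hl]].
  exists R => u; split=> [_|]; last exact: comb.
  by apply: submx_full; rewrite /row_full eqn_leq rank_leq_col -subn_eq0 -leqn0.
have [hu|hu] := pselect (forall u, S u -> (u <= R)%MS).
  by exists R => u; split; [exact: hu | exact: comb].
have [u [Su nu]] : exists u, S u /\ ~~ (u <= R)%MS.
  apply: contrapT => no; apply: hu => u Su; apply: contrapT => nu.
  by apply: no; exists u; split=> //; apply/negP.
apply: IH; exists (R + u)%MS; split.
  move=> i; have : (row i (R + u)%MS <= R + u)%MS by apply: row_sub.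
  rewrite addsmxE => hi; apply: comb hi => i'.
  by case: (split_ordP i') => c ->; rewrite ?rowKu ?rowKd ?hR // row_id.
by rewrite rank_add_vec //; lia.
Qed.

Definition mxword (l : seq J) : 'M[K]_k := foldl (fun M j => M *m T j) 1%:M l.

Definition in_alg (M : 'M[K]_k) : Prop := exists ws : seq (K * seq J),
  M = \sum_(w <- ws) w.1 *: mxword w.2.

Lemma in_alg1 : in_alg 1%:M.
Proof. by exists [:: (1, [::])]; rewrite big_seq1 /mxword /= scale1r. Qed.

Lemma in_alg_lin a M M' : in_alg M -> in_alg M' -> in_alg (a *: M + M').
Proof.
move=> [ws ->] [ws' ->]; exists ([seq (a * w.1, w.2) | w <- ws] ++ ws').
rewrite big_cat big_map scaler_sumr; congr (_ + _).
by apply: eq_bigr => w _; rewrite scalerA.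
Qed.

Lemma in_alg_mul M j : in_alg M -> in_alg (M *m T j).
Proof.
move=> [ws ->]; exists [seq (w.1, rcons w.2 j) | w <- ws].
rewrite big_map mulmx_suml; apply: eq_bigr => w _.
by rewrite -scalemxAl /mxword -[rcons _ _]cats1 foldl_cat.
Qed.

Let L j : 'M[K]_(k * k) := lin_mx (mulmxr (T j)).

Lemma lin_mulmxr_sym j : (L j)^T = L j.
Proof.
apply/matrixP => p q; rewrite mxE.
case/mxvec_indexP: p => a b; case/mxvec_indexP: q => a' b'.
have E i i' l l' : L j (mxvec_index i i') (mxvec_index l l') = (i == l)%:R * T j i' l'.
  rewrite mxE /= vec_mx_delta mxvecE mxE (bigD1 i') //= big1 ?addr0 => [|c nc].
    by rewrite mxE eqxx andbT [l == i]eq_sym.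
  by rewrite mxE (negbTE nc) andbF mul0r.
by rewrite !E eq_sym -{1}(symT j) mxE.
Qed.

(* The row space R of the algebra and its orthogonal C for the trace form are
   both stable under right multiplication by the symmetric T j, and R + C is
   everything because the form is anisotropic.  Hence the projection onto R
   along C is right multiplication by blocks in the commutant of T, and it fixes
   g because it fixes 1. *)
Lemma bicommutant (g : 'M[K]_k) :
  (forall X : 'M[K]_k, (forall j, X *m T j = T j *m X) -> X *m g = g *m X) ->
  in_alg g.
Proof.
move=> hg.
have [R hR] : exists R : 'M[K]_(k * k), forall u, in_alg (vec_mx u) <-> (u <= R)%MS.
  apply: (span_pred (S := fun u => in_alg (vec_mx u))).
    by exists [::]; rewrite big_nil linear0.
  by move=> a u w hu hw; rewrite linearP; apply: in_alg_lin.
have RL j : (R *m L j <= R)%MS.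
  apply/row_subP => p; rewrite row_mul; apply/hR.
  by rewrite mx_rV_lin /=; apply: in_alg_mul; apply/hR; apply: row_sub.
pose C := kermx R^T.
have CL j : (C *m L j <= C)%MS.
  rewrite sub_kermx; have /submxP[X eX] := RL j.
  have : (L j *m R^T) = R^T *m X^T.
    by rewrite -{1}(lin_mulmxr_sym j) -!trmx_mul eX.
  by rewrite -mulmxA => ->; rewrite mulmxA mulmx_ker mul0mx.
have RC0 : (R :&: C)%MS = 0.
  apply/eqP/rowV0P => u; rewrite sub_capmx => /andP[/submxP[X eX]].
  rewrite sub_kermx => /eqP uR; apply: real_K.
  by rewrite {2}eX trmx_mul mulmxA uR mul0mx.
have RC1 : (1%:M <= R + C)%MS.
  rewrite sub1mx /row_full; have := mxrank_sum_cap R C; rewrite RC0 mxrank0 addn0 => ->.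
  by rewrite mxrank_ker mxrank_tr subnKC // rank_leq_row.
pose P := proj_mx R C.
have PL j : P *m L j = L j *m P.
  have e1 : P *m L j = P *m L j *m P.
    rewrite [RHS]proj_mx_id //; apply: submx_trans (RL j); apply: submxMr.
    by rewrite -[P]mul1mx proj_mx_sub.
  have e2 : (1%:M - P) *m L j *m P = 0.
    apply: proj_mx_0 => //; apply: submx_trans (CL j); apply: submxMr.
    by rewrite -[X in _ - X]mul1mx; apply: proj_mx_compl_sub.
  by move: e2; rewrite !mulmxBl mul1mx -e1 => /eqP; rewrite subr_eq0 => /eqP.
pose PM M := vec_mx (mxvec M *m P).
have PMD : linear PM.
  by move=> a M M'; rewrite /PM linearP mulmxDl -scalemxAl linearP.
have PMT M j : PM (M *m T j) = PM M *m T j.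
  rewrite /PM -[M *m T j]/(mulmxr (T j) M) -(mul_vec_lin (mulmxr (T j))) -/(L j).
  by rewrite -mulmxA -PL mulmxA mx_rV_lin.
(* The blocks of the projection: row i of [PM M] is the sum over l of row l of M times [X l i]. *)
pose X l i : 'M[K]_k := \matrix_(a, b) PM (delta_mx l a) i b.
have PMsum (I : finType) (c : I -> K) (F : I -> 'M[K]_k) :
    PM (\sum_i c i *: F i) = \sum_i c i *: PM (F i).
  rewrite /PM linear_sum mulmx_suml linear_sum; apply: eq_bigr => i _.
  by rewrite linearZ -scalemxAl linearZ.
have PME M i b : PM M i b = \sum_l \sum_a M l a * X l i a b.
  rewrite {1}(matrix_sum_delta M) pair_bigA PMsum summxE [RHS]pair_bigA /=.
  by apply: eq_bigr => p _; rewrite !mxE.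
have XT l i j : X l i *m T j = T j *m X l i.
  apply/matrixP => a b; rewrite !mxE.
  have := PMT (delta_mx l a) j => /matrixP/(_ i b); rewrite [RHS]mxE PME.
  rewrite (bigD1 l) //= [X in _ + X]big1 ?addr0 => [|l' nl]; last first.
    rewrite big1 // => c _; rewrite mxE big1 ?mul0r // => c' _.
    by rewrite mxE (negbTE nl) mul0r.
  move=> e; transitivity (\sum_c PM (delta_mx l a) i c * T j c b).
    by apply: eq_bigr => c _; rewrite mxE.
  rewrite -e; apply: eq_bigr => c _; congr (_ * _).
  rewrite mxE (bigD1 a) //= big1 ?addr0 => [|c' nc]; rewrite mxE eqxx /=.
    by rewrite eqxx mul1r.
  by rewrite (negbTE nc) mul0r.
have P1 : PM 1%:M = 1%:M.
  by rewrite /PM proj_mx_id ?mxvecK //; apply/hR; rewrite mxvecK; apply: in_alg1.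
have Pg : PM g = g.
  apply/matrixP => i b; rewrite PME.
  transitivity (\sum_c PM 1%:M i c * g c b); last first.
    by rewrite P1; have := mul1mx g => /matrixP/(_ i b); rewrite mxE.
  transitivity (\sum_l (g *m X l i) l b).
    by apply: eq_bigr => l _; rewrite mxE.
  under eq_bigr => l _ do rewrite -hg // mxE.
  rewrite exchange_big; apply: eq_bigr => c _ /=; rewrite -mulr_suml; congr (_ * _).
  rewrite PME; apply: eq_bigr => l _; rewrite (bigD1 l) //= big1 ?addr0.
    by rewrite [1%:M _ _]mxE eqxx mul1r.
  by move=> a na; rewrite [1%:M _ _]mxE eq_sym (negbTE na) mul0r.
rewrite -[g]mxvecK; apply/hR; rewrite -[g in mxvec g]Pg /PM vec_mxK.
exact: proj_mx_sub.
Qed.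

End Bicommutant.

Section EndomorphismsS.
Variables (n d : nat).
Notation N := (NN n).
Notation D := (DD d).

Definition monob (th : 'I_D -> nat) : bool :=
  [forall c : 'I_D, forall c' : 'I_D, (c <= c')%N ==> (th c <= th c')%N].

Lemma monoP (th : 'I_D -> nat) : reflect (mono th) (monob th).
Proof.
apply: (iffP forallP) => h c.
  by move=> c' cc; have /forallP/(_ c')/implyP := h c; apply.
by apply/forallP => c'; apply/implyP; apply: h.
Qed.

Lemma coarse_Xi (t u : 'I_D -> 'I_N) : symf t -> symf u ->
  exists A : Xi n d, xi_nat A = coarse t u.
Proof.
move=> st su; have oF : odd #|'F_3| by rewrite card_Fp.
have [_ h _] := indexed_XX n d.
have [A eA] := h _ _ (antidiag_nondeg d oF) _ _ (cflag_flags _ st) (cflag_flags _ su).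
by exists A; rewrite -eA relpos_cflag.
Qed.

(* Sorting s inside the blocks of r leads to a sequence that is determined by
   the relative position of s and r. *)
Lemma sorted_invariant (m : QT n d) (r s s' : seqs n d) :
  mono (fun c => extf r c) ->
  (forall j, extf r (pen1 j) = extf r (pen2 j) -> forall u, m (reflr j u) = m u) ->
  coarse (extf s) (extf r) = coarse (extf s') (extf r) -> m s = m s'.
Proof.
move=> mr inv es.
have sortS u : exists w, [/\ m w = m u, coarse (extf r) (extf w) = coarse (extf r) (extf u)
    & mono (lex (extf r) (extf w))].
  pose S := [pred w | (m w == m u) &&
    (coarse (extf r) (extf w) == coarse (extf r) (extf u))].
  have Su : S u by rewrite /= !eqxx.
  have [w /andP[/eqP mw /eqP cw] maxw] := @arg_maxnP _ u S
    (fun w => level (fun c => extf w c)) Su.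
  exists w; split=> //; apply: mono_lex => //; [exact: extf_sym | exact: extf_sym |].
  move=> j ej; rewrite leqNgt; apply/negP => lt.
  have := maxw (reflr j w); rewrite /= inv // mw eqxx /=.
  have -> : coarse (extf r) (extf (reflr j w)) = coarse (extf r) (extf w).
    apply/matrixP => i b; rewrite !mxE (reindex_inj (@perm_inj _ (refl j))).
    apply: eq_bigr => c _; rewrite extf_reflr [reflf _ _ _]ffunE reflK.
    have := reflf_id (j := j) (@extf_sym _ _ r) ej => /ffunP/(_ c).
    by rewrite [LHS]ffunE => ->.
  rewrite cw eqxx => /(_ isT); rewrite leqNgt.
  have -> : level (fun c => extf (reflr j w) c) = level (fun c => extf w (refl j c)).
    by apply: eq_bigr => c _; rewrite extf_reflr ffunE.
  by rewrite level_refl //; apply: extf_sym.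
have [w [mw cw lw]] := sortS s; have [w' [mw' cw' lw']] := sortS s'.
rewrite -mw -mw'; congr (m _); apply: extf_inj; apply/ffunP => c.
have es' : coarse (extf r) (extf s) = coarse (extf r) (extf s').
  by rewrite -coarse_tr es coarse_tr.
by have [_] := lex_unique lw lw' (etrans cw (etrans es' (esym cw'))); apply.
Qed.

Lemma genT_eigen (m : QT n d) j : actTH m (genT j) = v ^+ 2 *: m ->
  forall u, m (reflr j u) = m u.
Proof.
move=> hm; have lt u : (extf u (pen1 j) < extf u (pen2 j))%N -> m (reflr j u) = m u.
  move=> hu; have := congr1 (fun x : QT n d => x u) hm; rewrite scaleffE act_genT.
  rewrite (bigD1 (reflr j u)) //= big1 ?addr0 => [|r nr].
    rewrite extf_reflr /pen_poly hu eqxx.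
    case: eqVneq hu => [->|_ _]; first by rewrite ltnn.
    by rewrite evqX mulrC; apply: mulfI; rewrite expf_neq0 // v_neq0.
  rewrite /pen_poly hu; case: eqVneq hu => [->|_ _]; first by rewrite ltnn.
  by rewrite -extf_reflr (inj_eq (@extf_inj n d)) (negbTE nr) raddf0 mulr0.
move=> u; case: (ltngtP (extf u (pen1 j)) (extf u (pen2 j))) => h; first exact: lt.
  by rewrite -[in RHS](reflrK j u) [RHS]lt // extf_reflr reflf_pen1 reflf_pen2.
congr (m _); apply: extf_inj; rewrite extf_reflr reflf_id //; first exact: extf_sym.
exact: ord_inj.
Qed.

Lemma actST_dirac (f : QS n d) (r s : seqs n d) (A : Xi n d) :
  mono (fun c => extf r c) -> xi_nat A = coarse (extf s) (extf r) ->
  actST f (dirac r) s = f A.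
Proof.
move=> mr eA; rewrite [LHS]conv_diracr (bigD1 A) //= big1 ?addr0 => [|B nB].
  by rewrite strc_sorted // eA eqxx mulr1.
have [injX _ _] := indexed_XX n d.
by rewrite strc_sorted // -eA (inj_eq injX) eq_sym (negbTE nB) mulr0.
Qed.

(** On sorted r the coefficient of f e_r at s is f at the position of (s, r), which dictates f. The
    value is independent of the pair: the position determines r, and s up to the stabilizer of r,
    under which g e_r is invariant. *)
Lemma end_H (g : QT n d -> QT n d) : linear g ->
  (forall t j, g (actTH t (genT j)) = actTH (g t) (genT j)) ->
  exists f : QS n d, forall t, g t = actST f t.
Proof.
move=> lg cg.
pose f : QS n d := [ffun A => if [pick p : seqs n d * seqs n d |
  monob (fun c => extf p.2 c) && (coarse (extf p.1) (extf p.2) == xi_nat A)] is Some p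
  then g (dirac p.2) p.1 else 0].
exists f; apply: sorted_generate => //; first exact: actST_linear.
  by move=> r j _; rewrite act_comm.
move=> r mr; apply/ffunP => s.
have [A eA] := coarse_Xi (@extf_sym _ _ s) (@extf_sym _ _ r).
rewrite (actST_dirac f mr eA) ffunE.
case: pickP => [[s' r'] /= /andP[/monoP mr' /eqP e']|/(_ (s, r))]; last first.
  by rewrite /= eA eqxx andbT => /monoP; case.
(* The column sums of a position are the multiplicities of the letters of its second sequence, which
   is sorted. *)
have er : r' = r.
  apply: extf_inj; apply/ffunP => c; apply: ord_inj.
  apply: (sorted_unique mr' mr) => e.
  have col (a b : seqs n d) (l : 'I_N) : (\sum_c (extf a c == l :> nat)
     = \sum_i coarse (extf b) (extf a) i l)%N.
    rewrite (eq_bigr (fun i => \sum_c ((extf b c == i) && (extf a c == l)))%N); last first.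
      by move=> i _; rewrite mxE.
    rewrite exchange_big; apply: eq_bigr => c' _ /=.
    rewrite (bigD1 (extf b c')) //= eqxx /= big1 ?addn0 // => i ni.
    by rewrite eq_sym (negbTE ni).
  have [el|el] := ltnP e N; last first.
    by rewrite !big1 // => c' _; apply/eqP; rewrite eqb0 neq_ltn (leq_trans _ el).
  by rewrite (col _ s' (Ordinal el)) (col _ s (Ordinal el)) e' eA.
rewrite er in e' *; apply: (sorted_invariant mr) => [j ej|]; last by rewrite e' eA.
(* If the letters of r at the pens of j agree then e_r T_j = v^2 e_r, and g carries this eigenvector
   to another one. *)
apply: genT_eigen; rewrite -cg -(linfunZ lg); congr g; apply/ffunP => u.
rewrite dirac_genT pen_poly_eq // (inj_eq (@extf_inj n d)) scaleffE ffunE.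
by rewrite raddfMn /= evqX mulr_natr.
Qed.

End EndomorphismsS.

Section Coordinates.
Variable I : finType.
Notation M := {ffun I -> Qv^o}.

Definition vec (x : M) : 'rV[Qv]_(#|I|) := \row_i x (enum_val i).
Definition unvec (u : 'rV[Qv]_(#|I|)) : M := [ffun s => u 0 (enum_rank s)].
(** Matrices act on row vectors from the right, so a word in the T_j acts by the product of its
    matrices in reading order. *)
Definition mxL (G : M -> M) : 'M[Qv]_(#|I|) :=
  \matrix_(i, j) G (dirac (enum_val i)) (enum_val j).
Definition opM (X : 'M[Qv]_(#|I|)) (x : M) : M := unvec (vec x *m X).

Lemma vecK : cancel vec unvec.
Proof. by move=> x; apply/ffunP => s; rewrite ffunE mxE enum_rankK. Qed.

Lemma unvecK : cancel unvec vec.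
Proof. by move=> u; apply/rowP => i; rewrite mxE ffunE enum_valK. Qed.

Lemma vec_linear : linear vec.
Proof. by move=> a x y; apply/rowP => i; rewrite !mxE linffE. Qed.

Lemma opM_linear X : linear (opM X).
Proof.
move=> a x y; apply: (can_inj vecK); rewrite vec_linear unvecK vec_linear mulmxDl -scalemxAl.
by rewrite !unvecK.
Qed.

Lemma vecL (G : M -> M) x : linear G -> vec (G x) = vec x *m mxL G.
Proof.
move=> lG; apply/rowP => j; rewrite !mxE {1}(dirac_sum x) (linfun_sum lG) sum_ffunE.
rewrite (reindex _ (onW_bij _ (enum_val_bij I))) /=; apply: eq_bigr => i _.
by rewrite (linfunZ lG) scaleffE !mxE.
Qed.

Lemma mxL_opM X : mxL (opM X) = X.
Proof.
apply/matrixP => i j; rewrite !mxE ffunE mxE enum_valK (bigD1 i) //= big1 ?addr0.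
  by rewrite mxE ffunE eqxx mul1r.
by move=> i' ni; rewrite mxE ffunE (inj_eq enum_val_inj) (negbTE ni) mul0r.
Qed.

End Coordinates.

Section EndomorphismsH.
Variables (n d : nat).

(** In the basis v_r, unlike in the basis e_r, both entries between r and its reflection are v. This
    is what the normalization is for in the double centralizer argument. *)
Lemma actT_sym j : (mxL (fun x : VT n d => actT x j))^T = mxL (fun x : VT n d => actT x j).
Proof.
apply/matrixP => p q; rewrite !mxE; set r := enum_val q; set s := enum_val p.
have E (a : seqs n d) : actT (dirac a) j = actT_basis a j.
  rewrite /actT (bigD1 a) //= big1 ?addr0 => [|b nb]; rewrite ffunE ?eqxx ?scale1r //.
  by rewrite (negbTE nb) scale0r.
have D1 (a b : seqs n d) : vten a b = vten b a by rewrite !ffunE eq_sym.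
have D2 (a b : seqs n d) : vten (reflr j a) b = vten (reflr j b) a.
  by rewrite !ffunE -{1}(reflrK j b) (inj_eq (inv_inj (reflrK j))) eq_sym.
have swp (a : seqs n d) : reflr j a = a -> extf a (pen1 j) = extf a (pen2 j).
  by move=> e; rewrite -{1}e extf_reflr reflf_pen1.
rewrite !E.
have [->//|nrs] := eqVneq r s.
have vt0 : vten r s = 0 by rewrite ffunE eq_sym (negbTE nrs).
have [ers|ners] := eqVneq s (reflr j r).
  have er : r = reflr j s by rewrite ers reflrK.
  have x1 : extf s (pen1 j) = extf r (pen2 j) by rewrite ers extf_reflr reflf_pen1.
  have x2 : extf s (pen2 j) = extf r (pen1 j) by rewrite ers extf_reflr reflf_pen2.
  rewrite !actT_basisE x1 x2; case: ltngtP => h.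
  - by rewrite -val_eqE gtn_eqF // lin2ffE !scaleffE (D1 s r) vt0 mulr0 add0r D2.
  - by rewrite -val_eqE gtn_eqF // lin2ffE !scaleffE vt0 mulr0 add0r D2.
  by move/ord_inj: h => h; rewrite h eqxx !scaleffE D1.
have vr0 : vten (reflr j r) s = 0 by rewrite ffunE (negbTE ners).
have F (a b : seqs n d) : vten a b = 0 -> vten (reflr j a) b = 0 ->
actT_basis a j b = 0.
  move=> h1 h2; rewrite actT_basisE; case: ifP => _; first by rewrite scaleffE h2 mulr0.
  by case: ifP => _; rewrite ?lin2ffE ?scaleffE h1 ?h2 !mulr0 ?addr0.
exact: etrans (F _ _ vt0 vr0) (esym (F _ _ (etrans (D1 s r) vt0) (etrans (D2 s r) vr0))).
Qed.

Lemma vec_words (x : VT n d) l :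
  vec (foldl (@actT n d) x l) = vec x *m mxword (fun j => mxL (fun y : VT n d => actT y j)) l.
Proof.
elim/last_ind: l => [|l j IH]; first by rewrite mulmx1.
rewrite /mxword -!cats1 !foldl_cat /= -/(mxword _ l) (vecL _ (actT_linear j)) IH.
by rewrite mulmxA.
Qed.

(** A matrix that commutes with all T_j comes from S by [end_H], so it commutes with g. Hence g,
    transported to the tensor space, lies in the bicommutant of the T_j, and [bicommutant] writes it
    as a combination of words. *)
Lemma end_S (g : QT n d -> QT n d) : linear g ->
  (forall f t, g (actST f t) = actST f (g t)) ->
  exists h : QH d, forall t, g t = actTH t h.
Proof.
move=> lg cg; pose Tm j := mxL (fun y : VT n d => actT y j).
have linv : linear (@Omega_inv n d).
  by move=> a x y; apply: (can_inj (@OmegaK n d)); rewrite Omega_linear !Omega_invK.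
pose g' x := Omega_inv (g (Omega x)).
have lg' : linear g' by move=> a x y; rewrite /g' Omega_linear lg linv.
have comm (X : 'M[Qv]_(#|{: seqs n d}|)) :
    (forall j, X *m Tm j = Tm j *m X) -> X *m mxL g' = mxL g' *m X.
  move=> hX; pose G t := Omega (opM X (Omega_inv t)).
  have lG : linear G by move=> a x y; rewrite /G linv opM_linear Omega_linear.
  have [f hf] : exists f : QS n d, forall t, G t = actST f t.
    apply: end_H => // t j; rewrite /G -[in RHS]Omega_actT; congr Omega.
    have -> : Omega_inv (actTH t (genT j)) = actT (Omega_inv t) j.
      by apply: (can_inj (@OmegaK n d)); rewrite Omega_actT !Omega_invK.
    apply: (can_inj (@vecK _)); rewrite (vecL _ (actT_linear j)) !unvecK.
    by rewrite (vecL _ (actT_linear j)) -!mulmxA hX.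
  have gG x : g' (opM X x) = opM X (g' x).
    apply: (can_inj (@OmegaK n d)); rewrite /g' Omega_invK.
    have e : Omega (opM X x) = G (Omega x).
      by rewrite /G; congr (Omega (opM X _)); rewrite OmegaK.
    apply: (etrans (congr1 g e)); rewrite hf cg -hf.
    by [].
  rewrite -{1}(mxL_opM X); apply/row_matrixP => i; rewrite !row_mul.
  have rowE (A : VT n d -> VT n d) : row i (mxL A) = vec (A (dirac (enum_val i))).
    by apply/rowP => q; rewrite !mxE.
  rewrite !rowE -(vecL _ lg') gG (vecL _ (opM_linear X)).
  by rewrite mxL_opM.
have [ws ews] := bicommutant Qv_sos actT_sym comm.
pose h : QH d := \sum_(w <- ws) w.1 *: foldl (fun g j => mulH g (genT j)) (oneH d) w.2.
exists h => t; rewrite -(Omega_invK t); set x := Omega_inv t.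
have -> : g (Omega x) = Omega (g' x) by rewrite /g' Omega_invK.
rewrite /h (linfun_sum (actTH_linear _)).
have -> : g' x = \sum_(w <- ws) w.1 *: foldl (@actT n d) x w.2.
  apply: (can_inj (@vecK _)); rewrite (vecL _ lg') ews mulmx_sumr (linfun_sum (@vec_linear _)).
  by apply: eq_bigr => w _; rewrite (linfunZ (@vec_linear _)) vec_words -scalemxAr.
rewrite (linfun_sum (@Omega_linear n d)); apply: eq_bigr => w _.
rewrite (linfunZ (@Omega_linear n d)) (linfunZ (actTH_linear _)) Omega_words.
by rewrite act_words act_oneH.
Qed.

End EndomorphismsH.

(** * The generators of the coideal algebra on the tensor space *)

Section TensorGenerators.
Variables (n d : nat).
Notation N := (NN n).
Notation D := (DD d).

Fact mid_subproof : (d < D)%N. Proof. by rewrite /DD; lia. Qed.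
Definition mid : 'I_D := Ordinal mid_subproof.

Lemma rev_mid : rev_ord mid = mid.
Proof. by apply: val_inj; rewrite /= /DD; lia. Qed.

Variant pos_spec : 'I_D -> Type :=
| PosLow c : pos_spec (pen1 c)
| PosMid : pos_spec mid
| PosHigh c : pos_spec (rev_ord (pen1 c)).

Lemma positionP c : pos_spec c.
Proof.
have cD := ltn_ord c; have DE : DD d = d.*2.+1 by [].
case: (ltngtP c d) => h.
- have -> : c = pen1 (Ordinal h) by apply: val_inj.
  exact: PosLow.
- have h' : (d.*2 - c < d)%N by lia.
  have -> : c = rev_ord (pen1 (Ordinal h')) by apply: val_inj; rewrite /=; lia.
  exact: PosHigh.
have -> : c = mid by apply: val_inj.
exact: PosMid.
Qed.

Lemma pen1_inj : injective (@pen1 d).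
Proof. by move=> a b /(congr1 val)/= e; apply: val_inj. Qed.

Lemma low_high (a b : 'I_d) : (pen1 a == rev_ord (pen1 b)) = false.
Proof. by rewrite -val_eqE /= /DD; have := ltn_ord a; have := ltn_ord b; lia. Qed.

Lemma low_mid (a : 'I_d) : (pen1 a == mid) = false.
Proof. by rewrite -val_eqE /= ltn_eqF. Qed.

Lemma high_mid (a : 'I_d) : (rev_ord (pen1 a) == mid) = false.
Proof. by rewrite -{1}rev_mid (inj_eq rev_ord_inj) low_mid. Qed.

Lemma big_pos (A : nmodType) (F : 'I_D -> A) : \sum_p F p =
  \sum_(c < d) F (pen1 c) + F mid + \sum_(c < d) F (rev_ord (pen1 c)).
Proof.
have dD : (d <= D)%N by rewrite /DD; lia.
have E (G : 'I_D -> A) : \sum_(p : 'I_D | (p < d)%N) G p = \sum_(c < d) G (pen1 c).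
  rewrite (big_ord_narrow dD); apply: eq_bigr => c _; congr G; exact: val_inj.
rewrite (bigID (fun p : 'I_D => (p < d)%N)) /= E -addrA; congr (_ + _).
rewrite (bigD1 mid) /= ?ltnn //; congr (_ + _).
rewrite (reindex_inj rev_ord_inj) -(E (fun p => F (rev_ord p))); apply: eq_bigl => p.
by have DE : DD d = d.*2.+1 by []; rewrite -val_eqE /=; have := ltn_ord p; lia.
Qed.

Lemma extf_low (r : seqs n d) c : extf r (pen1 c) = r c.
Proof. exact: extf_pen1. Qed.

Lemma extf_high (r : seqs n d) c : extf r (rev_ord (pen1 c)) = rev_ord (r c).
Proof. by rewrite extf_sym extf_low. Qed.

Lemma extf_mid (r : seqs n d) : extf r mid = n :> nat.
Proof.
have := congr1 val (extf_sym r mid); rewrite rev_mid /= /NN.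
by have := ltn_ord (extf r mid); rewrite /NN; lia.
Qed.

(* r with the letter a at position p, hence rev a at position rev p. *)
Definition upd (p : 'I_D) (a : 'I_N) (r : seqs n d) : seqs n d :=
  [ffun c => if pen1 c == p then a else if rev_ord (pen1 c) == p then rev_ord a else r c].

Lemma rev_eq (m : nat) (a b : 'I_m) : (rev_ord a == b) = (a == rev_ord b).
Proof. by rewrite -{1}(rev_ordK b) (inj_eq rev_ord_inj). Qed.

Lemma extf_upd p a (r : seqs n d) c : p != mid ->
  extf (upd p a r) c = if c == p then a else if c == rev_ord p then rev_ord a else extf r c.
Proof.
move=> pm; have low c' : extf (upd p a r) (pen1 c') =
    if pen1 c' == p then a else if pen1 c' == rev_ord p then rev_ord a else r c'.
  by rewrite extf_low ffunE [rev_ord _ == p]rev_eq.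
case: (positionP c) => [c'||c'].
- by rewrite low extf_low.
- rewrite ![mid == _]eq_sym (negbTE pm) rev_eq rev_mid (negbTE pm).
  by apply: ord_inj; rewrite !extf_mid.
rewrite extf_sym low extf_high !rev_eq rev_ordK.
have [e1|_] := eqVneq (pen1 c') p; last by case: eqP; rewrite ?rev_ordK.
have [e2|//] := eqVneq (pen1 c') (rev_ord p).
by have := low_high c' c'; rewrite {1}e2 -e1 eqxx.
Qed.

Definition upd1 (r : seqs n d) (c : 'I_d) (a : 'I_N) : seqs n d :=
  [ffun b => if b == c then a else r b].

Lemma upd_low (r : seqs n d) c a : upd (pen1 c) a r = upd1 r c a.
Proof.
apply/ffunP => b; rewrite !ffunE (inj_eq pen1_inj).
by case: eqP => // _; rewrite eq_sym low_high.
Qed.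

Lemma upd_high (r : seqs n d) c a : upd (rev_ord (pen1 c)) a r = upd1 r c (rev_ord a).
Proof.
by apply/ffunP => b; rewrite !ffunE low_high (inj_eq rev_ord_inj) (inj_eq pen1_inj).
Qed.

Lemma prod_vz (I : finType) (P : pred I) (e : I -> int) :
  \prod_(b | P b) v ^ e b = v ^ (\sum_(b | P b) e b).
Proof.
apply: (big_ind2 (fun x y => x = v ^ y)) => // a b a' b' -> ->.
by rewrite v_expD.
Qed.

Lemma tensop_linear g : linear (@tensop n d g).
Proof.
move=> a x y; apply/ffunP => s; rewrite linffE !ffunE mulr_sumr -big_split.
by apply: eq_bigr => r _; rewrite linffE mulrDr mulrCA.
Qed.

Lemma tensop_vten (g : 'I_d -> 'M[Qv]_N) (r s0 : seqs n d) (z : 'I_d -> Qv) :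
  (forall c x, g c x (r c) = z c * (x == s0 c)%:R) ->
  tensop g (vten r) = (\prod_c z c) *: vten s0.
Proof.
move=> h; apply/ffunP => s; rewrite scaleffE !ffunE (bigD1 r) //= [X in _ + X]big1 ?addr0.
  rewrite ffunE eqxx mulr1.
  have -> : \prod_c g c (s c) (r c) = \prod_c (z c * (s c == s0 c)%:R) by apply: eq_bigr.
  rewrite big_split /=; congr (_ * _).
  case: eqP => [->|ne]; first by rewrite big1 // => c _; rewrite eqxx.
  have [c hc] : exists c, s c != s0 c.
    apply: contrapT => no; apply: ne; apply/ffunP => c; apply/eqP.
    by apply: contrapT => nc; apply: no; exists c; apply/negP.
  by rewrite (bigD1 c) //= (negbTE hc) mul0r.
by move=> r' nr; rewrite ffunE (negbTE nr) mulr0.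
Qed.

Lemma mKE a z x y : (mK n a z) x y = v ^ (z * (y == ix n a)) * (x == y)%:R.
Proof.
rewrite !mxE; have [->|_] := eqVneq x y; last by rewrite mulr0.
by rewrite mulr1 mulr1n; case: (y == ix n a); rewrite ?mulr1 ?mulr0.
Qed.

Lemma mKKE a z b w x y : (mK n a z *m mK n b w) x y =
  v ^ (z * (y == ix n a) + w * (y == ix n b)) * (x == y)%:R.
Proof.
rewrite mxE (bigD1 y) //= big1 ?addr0 => [|c nc].
  by rewrite !mKE eqxx mulr1 v_expD mulrAC.
by rewrite [X in _ * X]mKE (negbTE nc) !mulr0.
Qed.

Lemma opK_vten a z (r : seqs n d) :
  opK a z (vten r) = v ^ (\sum_b z * (r b == ix n a)) *: vten r.
Proof. by rewrite -prod_vz; apply: tensop_vten => c x; rewrite mKE. Qed.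

Lemma opE_vten k (r : seqs n d) : opE k (vten r) =
  \sum_(c | r c == ix n k.+1)
    v ^ (\sum_(b : 'I_d | (c < b)%N) ((r b == ix n k)%:Z - (r b == ix n k.+1)%:Z))
    *: vten (upd1 r c (ix n k)).
Proof.
rewrite /opE [RHS]big_mkcond /=; apply: eq_bigr => c _.
rewrite (tensop_vten (s0 := upd1 r c (ix n k)) (z := fun b => if (b < c)%N then 1 else
  if b == c then (r c == ix n k.+1)%:R else v ^ ((r b == ix n k)%:Z - (r b == ix n k.+1)%:Z))).
  rewrite (bigD1 c) //= ltnn eqxx; case: eqP => _; last by rewrite mul0r scale0r.
  rewrite mul1r -prod_vz; congr (_ *: _); rewrite big_mkcond [RHS]big_mkcond /=.
  apply: eq_bigr => b _; rewrite -val_eqE /=.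
  by case: (ltngtP (b : nat) c).
move=> b x; rewrite ffunE; case: ltnP => h.
  have -> : (b == c) = false by rewrite -val_eqE ltn_eqF.
  by rewrite mul1r mxE.
case: eqP => [->|_]; first by rewrite mxE -natrM mulnb andbC.
by rewrite mKKE mul1r mulN1r.
Qed.

Lemma opF_vten k (r : seqs n d) : opF k (vten r) =
  \sum_(c | r c == ix n k)
    v ^ (\sum_(b : 'I_d | (b < c)%N) ((r b == ix n k.+1)%:Z - (r b == ix n k)%:Z))
    *: vten (upd1 r c (ix n k.+1)).
Proof.
rewrite /opF [RHS]big_mkcond /=; apply: eq_bigr => c _.
rewrite (tensop_vten (s0 := upd1 r c (ix n k.+1)) (z := fun b => if (b < c)%N then
  v ^ ((r b == ix n k.+1)%:Z - (r b == ix n k)%:Z) else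
  if b == c then (r c == ix n k)%:R else 1)).
  rewrite (bigD1 c) //= ltnn eqxx; case: eqP => _; last by rewrite mul0r scale0r.
  rewrite mul1r -prod_vz; congr (_ *: _); rewrite big_mkcond [RHS]big_mkcond /=.
  apply: eq_bigr => b _; rewrite -val_eqE /=.
  by case: (ltngtP (b : nat) c).
move=> b x; rewrite ffunE; case: ltnP => h.
  have -> : (b == c) = false by rewrite -val_eqE ltn_eqF.
  by rewrite mKKE mul1r mulN1r addrC.
case: eqP => [->|_]; first by rewrite mxE -natrM mulnb andbC.
by rewrite mxE mul1r.
Qed.

End TensorGenerators.

(** * The generators e_i and f_i as raising operators *)

Section Raising.
Variables (n d : nat).
Notation N := (NN n).
Notation D := (DD d).

(* e_i and f_i both move a letter k to k + 1 in r_1 ... r_D: e_i with k = i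
   and f_i with k = N - i. *)
Definition hh (k k' : 'I_N) (r : seqs n d) (b : 'I_D) : int :=
  (extf r b == k')%:Z - ((b != mid d) && (extf r b == k))%:Z.

(** The exponent collected from the factors K in the coproduct: occurrences of k' minus occurrences
    of k before p. The middle step counts for k' only, as it is never moved. *)
Definition om (k k' : 'I_N) (r : seqs n d) (p : 'I_D) : int :=
  \sum_(b : 'I_D | (b < p)%N) hh k k' r b.

Definition raise (k k' : 'I_N) (r : seqs n d) : VT n d :=
  \sum_(p | (p != mid d) && (extf r p == k)) v ^ om k k' r p *: vten (upd p k' r).

Lemma om_low k k' (r : seqs n d) c : om k k' r (pen1 c) =
  \sum_(b : 'I_d | (b < c)%N) ((r b == k')%:Z - (r b == k)%:Z).
Proof.
rewrite /om big_mkcond big_pos /= ltnNge ltnW //= addr0 [X in _ + X]big1 => [|b _].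
  rewrite addr0 [RHS]big_mkcond; apply: eq_bigr => b _.
  by rewrite /hh extf_low low_mid.
rewrite ifN // -leqNgt /DD; have := ltn_ord b; have := ltn_ord c; lia.
Qed.

Lemma om_high k k' (r : seqs n d) c : om k k' r (rev_ord (pen1 c)) =
  \sum_b ((r b == k')%:Z - (r b == k)%:Z) + (k' == n :> nat)%:Z
  + \sum_(b : 'I_d | (c < b)%N) ((rev_ord (r b) == k')%:Z - (rev_ord (r b) == k)%:Z).
Proof.
have DE : DD d = d.*2.+1 by [].
rewrite /om big_mkcond big_pos; congr (_ + _ + _).
- apply: eq_bigr => b _; rewrite /hh extf_low low_mid ifT //=.
  by have := ltn_ord b; have := ltn_ord c; lia.
- rewrite ifT /=; last by have := ltn_ord c; lia.
  by rewrite /hh eqxx /= subr0 -val_eqE /= extf_mid eq_sym.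
rewrite [RHS]big_mkcond; apply: eq_bigr => b _; rewrite /hh extf_high high_mid /=.
have -> // : (D - b.+1 < D - c.+1)%N = (c < b)%N.
by have := ltn_ord b; have := ltn_ord c; lia.
Qed.

Lemma raise_pos k k' (r : seqs n d) : raise k k' r =
  \sum_(c | r c == k) v ^ om k k' r (pen1 c) *: vten (upd1 r c k') +
  \sum_(c | rev_ord (r c) == k) v ^ om k k' r (rev_ord (pen1 c)) *: vten (upd1 r c (rev_ord k')).
Proof.
rewrite /raise big_mkcond big_pos eqxx /= addr0 [in RHS]big_mkcond /=.
rewrite [X in _ = _ + X]big_mkcond /=; congr (_ + _); apply: eq_bigr => c _.
  by rewrite low_mid extf_low upd_low.
by rewrite high_mid extf_high upd_high.
Qed.

Lemma rev_ix a : (0 < a <= N)%N -> rev_ord (ix n a) = ix n (N.+1 - a).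
Proof.
by move=> h; apply: val_inj; rewrite /ix /= !inordK /NN; move: h; rewrite /NN; lia.
Qed.

Lemma ixE a : (0 < a <= N)%N -> ix n a = a.-1 :> nat.
Proof. by rewrite /NN => h; rewrite inordK; lia. Qed.

Lemma opK_linear a z : linear (@opK n d a z).
Proof. exact: tensop_linear. Qed.

Lemma opE_linear k : linear (@opE n d k).
Proof.
move=> a x y; rewrite /opE scaler_sumr -big_split; apply: eq_bigr => c _.
exact: tensop_linear.
Qed.

Lemma opF_linear k : linear (@opF n d k).
Proof.
move=> a x y; rewrite /opF scaler_sumr -big_split; apply: eq_bigr => c _.
exact: tensop_linear.
Qed.

Lemma opd_linear a z : linear (@opd n d a z).
Proof.
move=> c x y; rewrite /opd; case: (a.+1 <= n)%N.
  by rewrite (opK_linear _ _ c x y) opK_linear.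
by rewrite (opK_linear _ _ c x y) scalerDr !scalerA mulrC.
Qed.

Lemma actgen_linear g : linear (@actgen n d g).
Proof.
move=> a x y; case: g => [[i|i]|[b|b]] /=; try exact: opd_linear.
  by rewrite opF_linear opE_linear !opK_linear scalerDr addrACA.
by rewrite !opK_linear opE_linear opF_linear scalerDr addrACA.
Qed.

(** F_i raises the letters i of r_1 ... r_d, the lower half of the positions. E_(N-i) lowers a
    letter N + 1 - i, which raises its mirror image in the upper half. *)
Lemma e_raise (i : 'I_n) (r : seqs n d) :
  actgen (inl (inl i)) (vten r) = raise (ix n i.+1) (ix n i.+2) r.
Proof.
have iN := ltn_ord i; have NE : N = n.*2.+1 by [].
rewrite -[actgen _ _]/(opF i.+1 (vten r) + opK i.+1 (-1) (opK i.+2 1 (opE (N - i.+1) (vten r)))).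
rewrite opF_vten opE_vten raise_pos; apply: (f_equal2 +%R).
  by apply: eq_bigr => c _; rewrite om_low.
rewrite 2!(linfun_sum (@opK_linear _ _)).
have E1 : rev_ord (ix n i.+1) = ix n (N - i.+1).+1.
  by rewrite rev_ix; [congr ix | ]; lia.
have E2 : rev_ord (ix n i.+2) = ix n (N - i.+1) by rewrite rev_ix; [congr ix | ]; lia.
rewrite -E1 -E2 -!/(rev_ord _); apply: eq_big => [c|c /eqP rc]; first by rewrite rev_eq.
rewrite 2!(linfunZ (@opK_linear _ _)) opK_vten (linfunZ (@opK_linear _ _)) opK_vten.
rewrite !scalerA -!v_expD; congr (v ^ _ *: _).
rewrite om_high -addrA [RHS]addrC; congr (_ + _).
  by apply: eq_bigr => b _; rewrite !rev_eq.
rewrite -big_split /= (bigD1 c) //= [in RHS](bigD1 c) //= !ffunE eqxx rc.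
have q1 : (rev_ord (ix n i.+1) == ix n i.+2) = false.
  by rewrite -val_eqE /= !ixE; lia.
have q2 : (rev_ord (ix n i.+1) == ix n i.+1) = false.
  by rewrite -val_eqE /= !ixE; lia.
have q3 : (rev_ord (ix n i.+2) == ix n i.+1) = false.
  by rewrite -val_eqE /= !ixE; lia.
(* The factor K_i^-1 K_(i+1) is applied after E_(N-i), hence also to the new letter. That letter
   equals i + 1 only if i = n, and it then supplies the term of the middle step in [om]. *)
have q4 : (rev_ord (ix n i.+2) == ix n i.+2) = (ix n i.+2 == n :> nat).
  by rewrite -val_eqE /= !ixE; lia.
rewrite q1 q2 q3 q4 subrr add0r mulr0 addr0 mul1r addrC; congr (_ + _).
by apply: eq_bigr => b /negbTE nb; rewrite !ffunE nb mul1r mulN1r.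
Qed.

Lemma f_raise (i : 'I_n) (r : seqs n d) :
  actgen (inl (inr i)) (vten r) = raise (ix n (N - i.+1)) (ix n (N.+1 - i.+1)) r.
Proof.
have iN := ltn_ord i; have NE : N = n.*2.+1 by [].
rewrite -[actgen _ _]/(opE i.+1 (opK (N - i.+1) (-1) (opK (N.+1 - i.+1) 1 (vten r))) + opF (N - i.+1) (vten r)).
rewrite opK_vten (linfunZ (@opK_linear _ _)) opK_vten opF_vten (linfunZ (@opE_linear _)).
rewrite (linfunZ (@opE_linear _)) opE_vten raise_pos addrC.
have ek' : (N.+1 - i.+1 = (N - i.+1).+1)%N by lia.
rewrite ek'; apply: (f_equal2 +%R).
  by apply: eq_bigr => c _; rewrite om_low.
have E1 : ix n i.+1 = rev_ord (ix n (N - i.+1).+1).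
  by rewrite rev_ix; [congr ix | ]; lia.
have E2 : ix n i.+2 = rev_ord (ix n (N - i.+1)) by rewrite rev_ix; [congr ix | ]; lia.
rewrite E1 E2 !scaler_sumr; apply: eq_big => [c|c /eqP rc]; first by rewrite rev_eq.
rewrite !scalerA -!v_expD; congr (v ^ _ *: _).
rewrite om_high; congr (_ + _); last by apply: eq_bigr => b _; rewrite !rev_eq.
have -> : (ix n (N - i.+1).+1 == n :> nat) = false by rewrite ixE; lia.
rewrite addr0 -big_split /=; apply: eq_bigr => b _.
by rewrite mul1r mulN1r.
Qed.

End Raising.

(** * Commutation of the raising operators with T_j on ascents *)

Section RaisingCommutes.
Variables (n d : nat) (k k' : 'I_(NN n)).
Notation N := (NN n).
Notation D := (DD d).

Lemma refl_val (j : 'I_d) (b : 'I_D) : refl j b = (if (j.+1 < d)%N then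
    if b == j :> nat then j.+1 else if b == j.+1 :> nat then (j : nat)
    else if b == (d.*2 - j)%N :> nat then (d.*2 - j).-1
    else if b == (d.*2 - j).-1 :> nat then (d.*2 - j)%N else b
  else if b == j :> nat then j.+2 else if b == j.+2 :> nat then (j : nat) else b) :> nat.
Proof.
have DE : DD d = d.*2.+1 by [].
have := ltn_ord j; have := ltn_ord b; rewrite reflE /refl_fun -!val_eqE /= => hb hj.
case L: (j.+1 < d)%N; repeat (case: eqP => /= ?); rewrite ?L; move/idP: L; lia.
Qed.

Lemma refl_mid (j : 'I_d) : refl j (mid d) = mid d.
Proof.
apply: val_inj; rewrite /= refl_val /=; have := ltn_ord j.
by case: (ltnP j.+1 d) => h; repeat (case: eqP => /= ?); lia.
Qed.

Lemma reflr_upd j (p : 'I_D) a (r : seqs n d) : p != mid d ->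
  reflr j (upd p a r) = upd (refl j p) a (reflr j r).
Proof.
move=> pm; apply: extf_inj; apply/ffunP => c.
have pm' : refl j p != mid d by rewrite -(inj_eq (@perm_inj _ (refl j))) reflK refl_mid.
rewrite extf_reflr extf_upd // [LHS]ffunE extf_upd // extf_reflr [reflf _ _ _]ffunE.
rewrite -refl_rev -(inj_eq (@perm_inj _ (refl j)) c) reflK.
by rewrite -[in RHS](inj_eq (@perm_inj _ (refl j)) c) reflK.
Qed.

Lemma asc_refl (r : seqs n d) j (p : 'I_D) : (extf r (pen1 j) < extf r (pen2 j))%N ->
  (p < refl j p)%N -> (extf r p < extf r (refl j p))%N.
Proof.
move=> asc; have p12 := pen1_lt_pen2 j; have DE : DD d = d.*2.+1 by [].
rewrite reflE /refl_fun.
case: eqP => [-> //|_]; case: eqP => [->|_]; first by rewrite ltnNge ltnW.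
case: eqP => [->|_]; first by rewrite /= ltnNge leq_sub2l // ltnW.
case: eqP => [->|_]; last by rewrite ltnn.
rewrite !extf_sym /= => _; have := ltn_ord (extf r (pen2 j)).
by have := ltn_ord (extf r (pen1 j)); lia.
Qed.

Hypothesis hk : k' = k.+1 :> nat.

(** The reflection carries letters along, so [om] changes only by the steps that change sides of p:
    [refl j p], and the middle step when j.+1 = d. If p moves left they contribute nothing, because
    the letter passed is smaller than k. *)
Lemma om_reflr (r : seqs n d) j (p : 'I_D) : p != mid d -> extf r p = k ->
  (extf r (pen1 j) < extf r (pen2 j))%N ->
  om k k' (reflr j r) (refl j p) = om k k' r p +
    (if (p < refl j p)%N then (extf r (refl j p) == k')%:Z
       + (~~ (j.+1 < d)%N && (k' == n :> nat))%:Z else 0).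
Proof.
move=> pm rp asc.
(* Records whether b comes to lie before p (1), ceases to (-1), or stays on its side (0) under the
   reflection. *)
pose z (b : 'I_D) : int := (refl j b < refl j p)%N%:Z - (b < p)%N%:Z.
have jd := ltn_ord j; have pD := ltn_ord p; have DE : DD d = d.*2.+1 by [].
have pd : p <> d :> nat by move=> e; case/eqP: pm; apply: val_inj.
have E : om k k' (reflr j r) (refl j p) = om k k' r p + \sum_b z b * hh k k' r b.
  rewrite /om [in LHS]big_mkcond [X in _ = X + _]big_mkcond -big_split.
  rewrite (reindex_inj (@perm_inj _ (refl j))) /=; apply: eq_bigr => b _.
  have -> : hh k k' (reflr j r) (refl j b) = hh k k' r b.
    rewrite /hh extf_reflr [reflf _ _ _]ffunE reflK; congr (_ - (_ && _)%:Z).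
    by rewrite -(refl_mid j) (inj_eq (@perm_inj _ (refl j))) refl_mid.
  by rewrite /z; case: ltnP => _; case: ltnP => _ /=; rewrite ?subrr ?mul0r ?mul1r ?sub0r ?subr0
    ?mul1r ?mulN1r ?add0r ?addr0 ?addrN.
rewrite E; congr (_ + _); pose L := (j.+1 < d)%N.
have hmid : hh k k' r (mid d) = (k' == n :> nat)%:Z.
  by rewrite /hh eqxx /= subr0 -val_eqE /= extf_mid eq_sym.
have Z (s : int) : (forall b, z b = s * ((b == refl j p)%:Z + (~~ L && (b == mid d))%:Z)) ->
    \sum_b z b * hh k k' r b
      = s * (hh k k' r (refl j p) + (~~ L)%:Z * (k' == n :> nat)%:Z).
  move=> hz; rewrite -hmid mulrDr.
  transitivity (\sum_b (s * ((b == refl j p)%:Z * hh k k' r b)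
      + s * ((~~ L && (b == mid d))%:Z * hh k k' r b))).
    by apply: eq_bigr => b _; rewrite hz; ring.
  rewrite big_split -!mulr_sumr /=; congr (_ * _ + _ * _).
    rewrite (bigD1 (refl j p)) //= eqxx mul1r big1 ?addr0 // => b /negbTE ->.
    by rewrite mul0r.
  rewrite (bigD1 (mid d)) //= eqxx andbT big1 ?addr0 // => b /negbTE ->.
  by rewrite andbF mul0r.
case: (ltngtP p (refl j p)) => hp.
- have hr := asc_refl asc hp; rewrite (Z 1).
    have -> : hh k k' r (refl j p) = (extf r (refl j p) == k')%:Z.
      rewrite /hh; have -> : (extf r (refl j p) == k) = false.
        by apply/eqP => e; rewrite e rp ltnn in hr.
      by rewrite andbF subr0.
    by rewrite mul1r -/L; case: (~~ L); rewrite /= ?mul1r ?mul0r.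
  move=> b; rewrite /z /L mul1r -!val_eqE /= !refl_val; move: hp; rewrite refl_val.
  have := ltn_ord b.
  by case: (ltnP j.+1 d) => h; repeat (case: eqP => /= ?); lia.
- have hr : (extf r (refl j p) < extf r p)%N.
    by rewrite -{2}(reflK j p); apply: asc_refl => //; rewrite reflK.
  rewrite (Z (-1)).
    have -> : hh k k' r (refl j p) = 0.
      rewrite /hh.
      have -> : (extf r (refl j p) == k) = false.
        by apply/eqP => e; rewrite e rp ltnn in hr.
      have -> : (extf r (refl j p) == k') = false.
        by apply/eqP => e; move: hr; rewrite e rp hk; lia.
      by rewrite andbF.
    rewrite add0r mulN1r; case: (boolP L) => hL; rewrite ?mul0r ?oppr0 //.
    have e : refl j p = rev_ord p.
      apply: val_inj; move: hp hL; rewrite /L /= !refl_val.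
      by case: (ltnP j.+1 d) => h; repeat (case: eqP => /= ?); lia.
    move: hr; rewrite e extf_sym rp /= mul1r.
    by case: eqP => // hn; have NE : NN n = n.*2.+1 by []; lia.
  move=> b; rewrite /z /L mulN1r -!val_eqE /= !refl_val; move: hp; rewrite refl_val.
  have := ltn_ord b.
  by case: (ltnP j.+1 d) => h; repeat (case: eqP => /= ?); lia.
rewrite big1 // => b _; rewrite /z; move: hp (ltn_ord b); rewrite !refl_val.
by case: (ltnP j.+1 d) => h; repeat (case: eqP => /= ?); lia.
Qed.

End RaisingCommutes.

Section RaisingCommutes2.
Variables (n d : nat) (k k' : 'I_(NN n)).
Notation N := (NN n).
Notation D := (DD d).

Lemma rev_ltn m (a b : 'I_m) : (rev_ord a < rev_ord b)%N = (b < a)%N.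
Proof. by have := ltn_ord a; have := ltn_ord b; rewrite /=; lia. Qed.

Lemma actT_vten (r : seqs n d) j : actT (vten r) j = actT_basis r j.
Proof.
rewrite /actT (bigD1 r) //= big1 ?addr0 => [|b nb]; rewrite ffunE ?eqxx ?scale1r //.
by rewrite (negbTE nb) scale0r.
Qed.

Hypothesis hk : k' = k.+1 :> nat.

(** Raising one letter by 1 turns an ascent into an ascent or an equality, and equality occurs
    exactly when [om_reflr] shifts the exponent by 1. On equal letters T_j gives v^2 instead of v,
    which is the compensation needed in [raise_asc]. *)
Lemma upd_pens (r : seqs n d) j (p : 'I_D) : p != mid d -> extf r p = k ->
  (extf r (pen1 j) < extf r (pen2 j))%N ->
  (extf (upd p k' r) (pen1 j) <= extf (upd p k' r) (pen2 j))%N /\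
  (extf (upd p k' r) (pen1 j) == extf (upd p k' r) (pen2 j))%:Z =
    (if (p < refl j p)%N then (extf r (refl j p) == k')%:Z
       + (~~ (j.+1 < d)%N && (k' == n :> nat))%:Z else 0).
Proof.
move=> pm rp asc; rewrite !extf_upd //.
have p12 : pen1 j != pen2 j by rewrite -val_eqE ltn_eqF // pen1_lt_pen2.
have p21 : pen2 j != pen1 j by rewrite eq_sym.
have lt12 := pen1_lt_pen2 j; have NE : NN n = n.*2.+1 by [].
have L1 := ltn_ord (extf r (pen1 j)); have L2 := ltn_ord (extf r (pen2 j)).
have h11 : (pen1 j == rev_ord (pen1 j)) = false by apply: low_high.
have sw (a b : 'I_D) : (a == rev_ord b) = (rev_ord a == b) by rewrite rev_eq.
have h22 : (pen2 j == rev_ord (pen2 j)) = false.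
  apply/eqP => e; have := refl_pen2 j; rewrite {1}e refl_rev refl_pen2 => e'.
  by have := h11; rewrite -{1}e' eqxx.
have [e|ne1] := eqVneq p (pen1 j).
  rewrite e refl_pen1 lt12 (negbTE p21) /=; rewrite e in rp.
  case hL: (j.+1 < d)%N.
    have -> : (pen2 j == rev_ord (pen1 j)) = false.
      by apply/eqP => e2; have := pen_rev hL; rewrite {2}e2 rev_ordK ltnNge ltnW.
    rewrite addr0 eq_sym; split=> //; move: asc; rewrite rp; lia.
  have er := rev_pen1 (negbT hL); rewrite er eqxx.
  move: asc L2; rewrite -er extf_sym rp -!val_eqE /= => asc L2.
  by split; lia.
have [e|ne2] := eqVneq p (pen2 j).
  rewrite e refl_pen2 ltnNge (ltnW lt12) /=; rewrite e in rp.
  case: eqP => [er|_].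
    move: asc; rewrite er extf_sym rp -!val_eqE /= => asc.
    by split; lia.
  by move: asc; rewrite rp -val_eqE /= => asc; split; lia.
rewrite !sw; have [e|ne3] := eqVneq (rev_ord (pen1 j)) p.
  have lt : (p < refl j p)%N = false.
    by rewrite -e refl_rev refl_pen1 rev_ltn ltnNge ltnW.
  rewrite lt; have -> : (rev_ord (pen2 j) == p) = false.
    by rewrite -e (inj_eq rev_ord_inj) (negbTE p21).
  have er : extf r (pen1 j) = rev_ord k by rewrite -(rev_ordK (pen1 j)) extf_sym e rp.
  move: asc; rewrite er -val_eqE /= => asc; have := ltn_ord k => kN.
  by split; lia.
have [e|ne4] := eqVneq (rev_ord (pen2 j)) p.
  have lt : (p < refl j p)%N.
    by rewrite -e refl_rev refl_pen2 rev_ltn.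
  have er : extf r (pen2 j) = rev_ord k by rewrite -(rev_ordK (pen2 j)) extf_sym e rp.
  have -> : extf r (refl j p) = rev_ord (extf r (pen1 j)).
    by rewrite -e refl_rev refl_pen2 extf_sym.
  have -> : ~~ (j.+1 < d)%N && (k' == n :> nat) = false.
    apply/negP => /andP[/rev_pen1 er1 _]; move: ne1; rewrite -e -er1 rev_ordK.
    by rewrite eqxx.
  move: asc; rewrite lt er -!val_eqE /= => asc; have := ltn_ord k => kN.
  by split; lia.
have fx : refl j p = p.
  by rewrite reflE /refl_fun (negbTE ne1) (negbTE ne2) ![p == rev_ord _]eq_sym (negbTE ne3)
     (negbTE ne4).
by rewrite fx ltnn ltnW //; split=> //; rewrite -val_eqE ltn_eqF.
Qed.

Lemma raise_asc (r : seqs n d) j : (extf r (pen1 j) < extf r (pen2 j))%N ->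
  actT (raise k k' r) j = v *: raise k k' (reflr j r).
Proof.
move=> asc; rewrite /raise (linfun_sum (@actT_linear n d j)).
rewrite [in RHS](reindex_inj (@perm_inj _ (refl j))) scaler_sumr.
apply: eq_big => [p|p /andP[pm /eqP rp]].
  rewrite extf_reflr [reflf _ _ _]ffunE reflK; congr (~~ _ && _).
  by rewrite -[in RHS](refl_mid j) (inj_eq (@perm_inj _ (refl j))).
rewrite (linfunZ (@actT_linear n d j)) actT_vten actT_basisE.
have [le1 eq1] := upd_pens pm rp asc; rewrite (om_reflr hk pm rp asc) -eq1 -reflr_upd //.
rewrite scalerA -[v in RHS]expr1z -v_expD.
move: le1; rewrite leq_eqVlt => /orP[/eqP e|lt].
  have {}e := ord_inj e; rewrite e ltnn eqxx.
  have -> : reflr j (upd p k' r) = upd p k' r.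
    by apply: extf_inj; rewrite extf_reflr reflf_id //; apply: extf_sym.
  rewrite scalerA -[v ^+ 2]/(v ^ 2) -v_expD; congr (v ^ _ *: _).
  by rewrite addrCA addrA.
rewrite lt -val_eqE (ltn_eqF lt) addr0 scalerA -[v in _ * v]expr1z -v_expD.
by rewrite addrC.
Qed.

(** The contribution to [texp] of two letters in this order. The terms r_c + 1 + r_c' + 1 < N + 1
    use the 0-based values of the letters. *)
Definition pairG (x y : nat) : nat := ((x < y) + (x.+1 + y.+1 < N.+1))%N.
Definition pairP (r : seqs n d) (c b : 'I_d) (x : nat) : nat :=
  if (b < c)%N then pairG (r b) x else pairG x (r b).

Lemma texp_upd1 (r : seqs n d) c a :
  (texp r)%:Z - (texp (upd1 r c a))%:Z =
  \sum_(b | b != c) ((pairP r c b (r c))%:Z - (pairP r c b a)%:Z)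
  + ((r c < n)%N%:Z - (a < n)%N%:Z).
Proof.
pose rest (s : seqs n d) : int := \sum_(b | b != c)
   ((\sum_(b' | (b' != c) && (b < b')%N) (pairG (s b) (s b'))%:Z) + (s b < n)%N%:Z).
have E (s : seqs n d) : (forall b, b != c -> s b = r b) -> (texp s)%:Z =
    \sum_(b | b != c) (pairP r c b (s c))%:Z + (s c < n)%N%:Z + rest s.
  move=> hs; have -> : texp s =
      (\sum_(b < d) (\sum_(b' : 'I_d | (b < b')%N) pairG (s b) (s b') + (s b < n)))%N.
    rewrite /texp -!big_split /=; apply: eq_bigr => b _; rewrite -big_split /=.
    by congr (_ + _)%N; rewrite ltnS.
  rewrite (bigD1 c) //= PoszD PoszD; rewrite /rest.
  rewrite !(big_morph Posz PoszD (erefl 0%:Z)).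
  have -> : \sum_(b < d | b != c) Posz (\sum_(b' : 'I_d | (b < b')%N)
      pairG (s b) (s b') + (s b < n))%N
    = \sum_(b | b != c) ((b < c)%N%:Z * (pairG (s b) (s c))%:Z) + rest s.
    rewrite /rest -big_split; apply: eq_bigr => b nb /=.
    rewrite PoszD (big_morph Posz PoszD (erefl 0%:Z)) addrA; congr (_ + _).
    rewrite (bigID (fun b' => b' == c)) /=; congr (_ + _).
      rewrite big_mkcond (bigD1 c) //= eqxx andbT big1 ?addr0 => [|b' /negbTE ->].
        by case: (b < c)%N; rewrite ?mul1r ?mul0r.
      by rewrite andbF.
    by apply: eq_bigl => b'; rewrite andbC.
  rewrite addrA; congr (_ + _); rewrite addrAC; congr (_ + _).
  rewrite big_mkcond (bigD1 c) //= ltnn add0r -big_split /=.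
  apply: eq_bigr => b nb; rewrite (hs b nb) /pairP.
  have nb' : (b != c :> nat) by [].
  by case: (ltngtP (b : nat) c) nb' => // _ _; rewrite ?mul1r ?mul0r ?add0r ?addr0.
rewrite (E r) // (E (upd1 r c a)) => [|b /negbTE nb]; last by rewrite ffunE nb.
have -> : rest (upd1 r c a) = rest r.
  apply: eq_bigr => b /negbTE nb; rewrite !ffunE nb; congr (_ + _).
  by apply: eq_bigr => b' /andP[/negbTE nb' _]; rewrite ffunE nb'.
rewrite ffunE eqxx sumrB; ring.
Qed.

End RaisingCommutes2.

(** * Comparison with the standard basis of S on sorted sequences *)

Section RaisingSorted.
Variables (n d : nat) (k k' : 'I_(NN n)).
Notation N := (NN n).
Notation D := (DD d).

Definition Ez (a b : 'I_N) : 'M[int]_N := delta_mx a b + delta_mx (rev_ord a) (rev_ord b).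

Lemma EzE (M : 'M[int]_N) a i j : (M - Ez k k + Ez a k) i j = M i j
    - ((i == k) && (j == k))%:Z - ((i == rev_ord k) && (j == rev_ord k))%:Z
    + ((i == a) && (j == k))%:Z + ((i == rev_ord a) && (j == rev_ord k))%:Z.
Proof. by rewrite !mxE -!natz opprD !addrA. Qed.

Definition cM (s r : seqs n d) : 'M[int]_N :=
  \matrix_(i, j) (coarse (extf s) (extf r) i j)%:Z.

Lemma cME s r i j : cM s r i j = \sum_c ((extf s c == i) && (extf r c == j))%:Z.
Proof. by rewrite mxE mxE (big_morph Posz PoszD (erefl 0%:Z)). Qed.

Lemma cM_upd (r : seqs n d) (p : 'I_D) a : p != mid d -> extf r p = k ->
  cM (upd p a r) r = cM r r - Ez k k + Ez a k.
Proof.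
move=> pm rp; apply/matrixP => i j; rewrite EzE !cME.
have np : rev_ord p != p.
  apply: contraNN pm; rewrite -!val_eqE /= => /eqP e.
  by apply/eqP; have := ltn_ord p; have DE : DD d = d.*2.+1 by []; lia.
rewrite (bigD1 p) //= (bigD1 (rev_ord p)) //= [in RHS](bigD1 p) //=.
rewrite [in RHS](bigD1 (rev_ord p)) //=.
rewrite !extf_upd // eqxx (negbTE np) eqxx extf_sym rp.
rewrite (eq_bigr (fun c => ((extf r c == i) && (extf r c == j))%:Z)) => [|c /andP[c1 c2]].
  rewrite [k == i]eq_sym [k == j]eq_sym [a == i]eq_sym [rev_ord k == i]eq_sym.
  rewrite [rev_ord k == j]eq_sym [rev_ord a == i]eq_sym.
  by set S := \sum_(c | _) _; lia.
by rewrite extf_upd // (negbTE c1) (negbTE c2).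
Qed.

Hypothesis hk : k' = k.+1 :> nat.

Lemma kk_facts : [/\ k != k', rev_ord k != k' & rev_ord k' != k].
Proof.
have NE : NN n = n.*2.+1 by []; have := ltn_ord k; have := ltn_ord k'.
by split; rewrite -val_eqE /=; lia.
Qed.

Lemma upd_inj (r : seqs n d) (p p' : 'I_D) : p != mid d -> p' != mid d ->
  extf r p = k -> extf r p' = k -> upd p k' r = upd p' k' r -> p = p'.
Proof.
move=> pm pm' rp rp' e; have [h1 h2 h3] := kk_facts.
have NE : NN n = n.*2.+1 by [].
have := congr1 (fun u => extf u p) e; rewrite !extf_upd // eqxx.
case: eqP => // _; case: eqP => [ep|_]; last by rewrite rp => /eqP; rewrite eq_sym (negbTE h1).
move=> /(congr1 val) /= e1; have := rp; rewrite ep extf_sym rp' => /(congr1 val) /= e2.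
by have := ltn_ord k; have := ltn_ord k'; lia.
Qed.

(** Every step c makes the entry (s c, r c) positive, so s and r can differ only in the two
    off-diagonal cells; these have entry 1, so the difference is one step p and its mirror image. *)
Lemma cM_raise (r s : seqs n d) : cM s r = cM r r - Ez k k + Ez k' k ->
  exists p : 'I_D, [/\ p != mid d, extf r p = k & s = upd p k' r].
Proof.
move=> e; have [h1 h2 h3] := kk_facts; have NE : NN n = n.*2.+1 by [].
have ent i j := congr1 (fun M : 'M_N => M i j) e; rewrite /= in ent.
have {}ent i j := etrans (ent i j) (EzE _ _ _ _).
have diag i j : i != j -> cM r r i j = 0.
  move=> nij; rewrite cME big1 // => c _; case: (extf r c =P i) => [->|//].
  by rewrite (negbTE nij).
have pos (c : 'I_D) : (0 < cM s r (extf s c) (extf r c)).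
  by rewrite cME (bigD1 c) //= !eqxx /= ltr_pwDl // sumr_ge0.
have off c : extf s c != extf r c -> extf s c = k' /\ extf r c = k \/
    extf s c = rev_ord k' /\ extf r c = rev_ord k.
  move=> nc; have := pos c; rewrite ent diag //.
  case: (boolP ((extf s c == k') && (extf r c == k))) => [/andP[/eqP -> /eqP ->]|_].
    by left.
  case: (boolP ((extf s c == rev_ord k') && (extf r c == rev_ord k))) => [/andP[/eqP -> /eqP ->]|_].
    by right.
  by lia.
have one : cM s r k' k = 1.
  have a1 : (k' == k) = false by rewrite eq_sym; apply/negbTE.
  have a2 : (k' == rev_ord k) = false by rewrite eq_sym; apply/negbTE.
  have a3 : (k == rev_ord k) && (k' == rev_ord k') = false.
    by rewrite -!val_eqE /=; have := ltn_ord k; lia.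
  have := ent k' k; rewrite (diag k' k (negbT a1)) a1 a2 !eqxx => ->.
  by rewrite andbC; move: a3; lia.
have [p /andP[/eqP sp /eqP rp]] : exists p, (extf s p == k') && (extf r p == k).
  apply: contrapT => no; move: one; rewrite cME big1 // => c _.
  by case: (boolP (_ && _)) => // h; case: no; exists c.
have uniq_p c : extf s c = k' -> extf r c = k -> c = p.
  move=> sc rc; apply/eqP/negPn/negP => ncp; move: one; rewrite cME.
  rewrite (bigD1 p) //= (bigD1 c) //= sp rp sc rc !eqxx /=.
  by set S := \sum_(_ | _) _; have : 0 <= S by [apply: sumr_ge0]; lia.
have pm : p != mid d.
  apply: contraNneq h1 => pm; rewrite -sp -rp pm; apply/eqP/ord_inj.
  by rewrite !extf_mid.
exists p; split=> //; apply: extf_inj; apply/ffunP => c; rewrite extf_upd //.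
case: eqP => [->//|np]; case: eqP => [->|nrp]; first by rewrite extf_sym sp.
apply/eqP/negPn/negP => /off[[s1 r1]|[s1 r1]]; first by apply: np; apply: uniq_p.
apply: nrp; rewrite -(uniq_p (rev_ord c)) ?rev_ordK // extf_sym ?s1 ?r1 rev_ordK //.
Qed.

Section Exponents.
Variables (r : seqs n d) (p : 'I_D).
Hypotheses (pm : p != mid d) (rp : extf r p = k).
Hypothesis before : forall b : 'I_D, (b < p)%N -> extf r b != k'.

(** The balance of exponents: the multiplicity of k' in r is [dA] of the raised matrix by
    [dA_raise], so this says that the coefficient v^om becomes v^(- dA) after renormalizing both
    basis vectors. No k' stands before p, as is the case for sorted r. *)
Lemma om_texp : om k k' r p + (texp (upd p k' r))%:Z + \sum_b (extf r b == k')%:Z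
  = (texp r)%:Z.
Proof.
have DE : DD d = d.*2.+1 by []; have NE : NN n = n.*2.+1 by [].
have sub2 (x y z w : int) : z - y = x + w -> x + y + w = z by lia.
have cnt : \sum_b (extf r b == k')%:Z = \sum_b (r b == k')%:Z + (k' == n :> nat)%:Z
    + \sum_b (rev_ord (r b) == k')%:Z.
  rewrite big_pos; congr (_ + _ + _).
  - by apply: eq_bigr => b _; rewrite extf_low.
  - by rewrite -val_eqE /= extf_mid eq_sym.
  by apply: eq_bigr => b _; rewrite extf_high.
have kN := ltn_ord k; have kN' := ltn_ord k'.
move: pm rp before; case: (positionP p) => [c|/eqP//|c] _; rewrite ?extf_low ?extf_high => rc bef;
  apply: sub2.
  rewrite upd_low texp_upd1 om_low cnt rc [in RHS]big_mkcond.
  have -> : (k < n)%N%:Z - (k' < n)%N%:Z = (k' == n :> nat)%:Z by rewrite hk; lia.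
  have ar (a e f s t : int) : a = f + s + t -> a + e = f + (s + e + t) by lia.
  apply: ar; rewrite -!big_split /=.
  rewrite [RHS](bigD1 c) //= ltnn rc (negbTE (let: And3 h _ _ := kk_facts in h)).
  rewrite (negbTE (let: And3 _ h _ := kk_facts in h)) !add0r; apply: eq_bigr => b nb.
  have hb : (b < c)%N -> r b != k'.
    by move=> bc; have := bef (pen1 b) bc; rewrite extf_low.
  have := ltn_ord (r b); rewrite /pairP /pairG -!val_eqE /=.
  have nb' : (b != c :> nat) by [].
  move: hb; rewrite -!val_eqE /=.
  by case: (ltngtP (b : nat) c) nb' => // _ _; lia.
have rlow b : r b != k'.
  have := bef (pen1 b); rewrite extf_low; apply; rewrite /=.
  by have := ltn_ord b; have := ltn_ord c; lia.
have nk' : (k' == n :> nat) = false.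
  have := bef (mid d); rewrite -val_eqE /= extf_mid eq_sym => h; apply/negbTE/h.
  by have := ltn_ord c; lia.
have rhigh (b : 'I_d) : (c < b)%N -> rev_ord (r b) != k'.
  move=> cb; have := bef (rev_ord (pen1 b)); rewrite extf_high; apply.
  by rewrite rev_ltn.
have {}rc : r c = rev_ord k by rewrite -rc rev_ordK.
rewrite upd_high texp_upd1 om_high cnt rc nk' !addr0 [X in _ + X + _]big_mkcond.
have -> : (rev_ord k < n)%N%:Z - (rev_ord k' < n)%N%:Z = - (k == n :> nat)%:Z.
  by rewrite /=; lia.
have ar (a e f g s t : int) : f + g + s + t = a - e -> a - e = f + g + (s + t) by lia.
apply: ar; rewrite -!big_split /= (bigD1 c) //= ltnn rc rev_ordK.
rewrite (negbTE (let: And3 h _ _ := kk_facts in h)).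
rewrite (negbTE (let: And3 _ h _ := kk_facts in h)) addrC; congr (_ + _); last first.
  by rewrite -val_eqE /=; lia.
apply: eq_bigr => b nb; have := rlow b; have := @rhigh b.
have := ltn_ord (r b); rewrite /pairP /pairG -!val_eqE /=.
have nb' : (b != c :> nat) by [].
case: (ltngtP (b : nat) c) nb' => // _ _; move: hk kN kN' NE; clear;
  move: (nat_of_ord k) (nat_of_ord k') (nat_of_ord (r b)) => a a' x;
  move: (NN n) => M -> + + eM; rewrite {M}eM => h h' hx.
  by move=> _; case: (x =P a.+1) => // _ _; case: (x =P a) => [->|ne] /=; lia.
move=> /(_ isT); case: (_ =P _) => // n1 _; case: (x =P a.+1) => // n2 _.
by case: (x =P a) => [->|ne] /=; lia.
Qed.

End Exponents.
End RaisingSorted.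

Section RaisingMatrix.
Variables (n : nat) (k k' : 'I_(NN n)).
Notation N := (NN n).
Hypothesis hk : k' = k.+1 :> nat.

(** Off the diagonal the matrix has just two mirror entries 1. No product in the first sum of [dA]
    and no term of the third is nonzero, and one product in the second sum survives. *)
Lemma dA_raise (l : 'M[int]_N) : (forall i j, i != j -> l i j = 0) ->
  (forall i, l (rev_ord i) (rev_ord i) = l i i) ->
  dA (l - Ez k k + Ez k' k) = l k' k'.
Proof.
move=> dl sl; set A := (_ + _ : 'M_N); have NE : NN n = n.*2.+1 by [].
have kN := ltn_ord k; have kN' := ltn_ord k'.
have ent := EzE k l k'; rewrite -/A in ent.
have nz i j : A i j <> 0 -> [\/ i = j :> nat, i = k.+1 :> nat /\ j = k :> nat
    | (i + k.+1)%N = n.*2 /\ (j + k)%N = n.*2].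
  move=> h; have [e|ne] := eqVneq i j; first by apply: Or31; rewrite e.
  apply: contrapT => no; apply: h; rewrite ent dl //.
  have -> : (i == k) && (j == k) = false by apply/negP => /andP[/eqP e /eqP e']; rewrite e e' eqxx in ne.
  have -> : (i == rev_ord k) && (j == rev_ord k) = false.
    by apply/negP => /andP[/eqP e /eqP e']; rewrite e e' eqxx in ne.
  have -> : (i == k') && (j == k) = false.
    by apply/negP => /andP[/eqP e /eqP e']; apply: no; apply: Or32; rewrite e e'.
  have -> // : (i == rev_ord k') && (j == rev_ord k) = false.
  apply/negP => /andP[/eqP e /eqP e']; apply: no; apply: Or33; rewrite e e' /= hk.
  by lia.
have zz i j a b : (A i j <> 0 -> A a b <> 0 -> False) -> A i j * A a b = 0.
  move=> h; apply/eqP; rewrite mulf_eq0; apply/orP.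
  case: (A i j =P 0) => [|h1]; first by left.
  by case: (A a b =P 0) => [|h2]; [right | case: (h h1 h2)].
have z1 : \sum_(i : 'I_N) \sum_(j : 'I_N) \sum_(a : 'I_N)
     \sum_(b : 'I_N | [&& a < i, j < b & i.+1 + a.+1 < N.+1]%N) A i j * A a b = 0.
  rewrite big1 // => i _; rewrite big1 // => j _; rewrite big1 // => a _; rewrite big1 // => b.
  move=> /and3P[h1 h2 h3]; apply: zz => /nz g1 /nz g2.
  have := ltn_ord i; have := ltn_ord b; move=> hi hb.
  by case: g1 => [g1|[g1 g1']|[g1 g1']]; case: g2 => [g2|[g2 g2']|[g2 g2']]; lia.
have z3 : \sum_(i : 'I_N | (n.+1 <= i.+1)%N) \sum_(j : 'I_N | (j.+1 < n.+1)%N)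
       (A i j * (A i j - 1) %/ 2)%Z = 0.
  rewrite big1 // => i hi; rewrite big1 // => j hj.
  have nij : i != j by rewrite -val_eqE /=; lia.
  have -> : A i j * (A i j - 1) = 0; last by rewrite div0z.
  have -> : A i j = ((i == k') && (j == k))%:Z + ((i == rev_ord k') && (j == rev_ord k))%:Z.
    rewrite ent dl //.
    have -> : (i == k) && (j == k) = false.
      by apply/negP => /andP[/eqP e /eqP e']; rewrite e e' eqxx in nij.
    have -> // : (i == rev_ord k) && (j == rev_ord k) = false.
    by apply/negP => /andP[/eqP e /eqP e']; rewrite e e' eqxx in nij.
  have : ((i == k') && (j == k)) && ((i == rev_ord k') && (j == rev_ord k)) = false.
    by apply/negP => /andP[/andP[/eqP -> /eqP ->]]; rewrite -!val_eqE /=; lia.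
  by move: ((i == k') && (j == k)) ((i == rev_ord k') && (j == rev_ord k)) => [] [].
rewrite /dA z1 z3 add0r addr0.
(* The surviving product: entries (k', k) and (k', k') when k is below the middle, their mirror
   images otherwise. *)
pose i0 : 'I_N := if (k < n)%N then k' else rev_ord k'.
pose j0 : 'I_N := if (k < n)%N then k else rev_ord k'.
pose l0 : 'I_N := if (k < n)%N then k' else rev_ord k.
have out i j b : (i, j, b) <> (i0, j0, l0) -> (j < b)%N ->
    (i.+1 < n.+1)%N || (j.+1 < N.+1 - b.+1)%N -> A i j * A i b = 0.
  move=> no jb cond; apply: zz => /nz g1 /nz g2; apply: no.
  have := ltn_ord i; have := ltn_ord b; move=> hi hb.
  have E (x y : 'I_N) : x = y :> nat -> x = y by apply: ord_inj.
  rewrite /i0 /j0 /l0; case: (ltnP k n) => hkn; congr (_, _, _); apply: ord_inj => /=;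
    by case: g1 => [g1|[g1 g1']|[g1 g1']]; case: g2 => [g2|[g2 g2']|[g2 g2']]; lia.
rewrite (bigD1 i0) //= [X in _ + X]big1 ?addr0 => [|i ni]; last first.
  rewrite big1 // => j _; rewrite big1 // => b /andP[jb cond]; apply: out => //.
  by case=> e; rewrite e eqxx in ni.
rewrite (bigD1 j0) //= [X in _ + X]big1 ?addr0 => [|j nj]; last first.
  rewrite big1 // => b /andP[jb cond]; apply: out => //.
  by case=> e; rewrite e eqxx in nj.
have c0 : (j0 < l0)%N && ((i0.+1 < n.+1)%N || (j0.+1 < N.+1 - l0.+1)%N).
  by rewrite /i0 /j0 /l0; case: (ltnP k n) => hkn /=; lia.
rewrite (bigD1 l0) //= big1 ?addr0 => [|b /andP[/andP[jb cond] nb]]; last first.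
  by apply: out => //; case=> e; rewrite e eqxx in nb.
rewrite !ent /i0 /j0 /l0; case: (ltnP k n) => hkn.
  rewrite (dl k' k); last by rewrite -val_eqE /=; lia.
  by rewrite -!val_eqE /=; do 6 (case: eqP => /=; try lia).
rewrite sl (dl (rev_ord k') (rev_ord k)); last by rewrite -val_eqE /=; lia.
by rewrite -!val_eqE /=; do 6 (case: eqP => /=; try lia).
Qed.

End RaisingMatrix.

Section Weights.
Variables (n d : nat).
Notation N := (NN n).
Notation D := (DD d).

Lemma cM_off (r : seqs n d) i j : i != j -> cM r r i j = 0.
Proof.
move=> nij; rewrite cME big1 // => c _; case: (extf r c =P i) => [->|//].
by rewrite (negbTE nij).
Qed.

Lemma cM_diag (r : seqs n d) i : cM r r i i = \sum_c (extf r c == i)%:Z.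
Proof. by rewrite cME; apply: eq_bigr => c _; rewrite andbb. Qed.

Lemma cM_rev (r : seqs n d) i : cM r r (rev_ord i) (rev_ord i) = cM r r i i.
Proof.
rewrite !cM_diag (reindex_inj rev_ord_inj); apply: eq_bigr => c _.
by rewrite extf_sym (inj_eq rev_ord_inj).
Qed.

Lemma cM_reflr j (r : seqs n d) : cM (reflr j r) (reflr j r) = cM r r.
Proof.
apply/matrixP => a b; rewrite !cME (reindex_inj (@perm_inj _ (refl j))).
by apply: eq_bigr => c _; rewrite extf_reflr [reflf _ _ _]ffunE reflK.
Qed.

Lemma cM_col (s r : seqs n d) j : \sum_i cM s r i j = cM r r j j.
Proof.
rewrite cM_diag; under eq_bigr => i _ do rewrite cME.
rewrite exchange_big; apply: eq_bigr => c _ /=.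
rewrite (bigD1 (extf s c)) //= eqxx /= big1 ?addr0 // => i ni.
by rewrite eq_sym (negbTE ni).
Qed.

Lemma cM_pos (s r : seqs n d) c : 0 < cM s r (extf s c) (extf r c).
Proof. by rewrite cME (bigD1 c) //= !eqxx /= ltr_pwDl // sumr_ge0. Qed.

Lemma stdS_dirac (A : 'M[int]_N) (r s : seqs n d) : mono (fun c => extf r c) ->
  actST (stdS d A) (dirac r) s = if cM s r == A then v ^ (- dA A) else 0.
Proof.
move=> mr; have [B eB] := coarse_Xi (@extf_sym _ _ s) (@extf_sym _ _ r).
rewrite (actST_dirac _ mr eB) ffunE; congr (if _ == _ then _ else _).
apply/matrixP => i j; rewrite [RHS]mxE -eB !mxE; congr Posz.
Qed.

Lemma dA_diag (l : 'M[int]_N) : (forall i j, i != j -> l i j = 0) -> dA l = 0.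
Proof.
move=> dl; rewrite /dA big1 => [|i _]; last first.
  rewrite big1 // => j _; rewrite big1 // => a _; rewrite big1 // => b /and3P[h1 h2 h3].
  have [e|ne] := eqVneq i j; last by rewrite dl ?mul0r.
  by rewrite (dl a b) ?mulr0 // -val_eqE /=; move: h2; rewrite -e; lia.
rewrite big1 => [|i _]; last first.
  rewrite big1 // => j _; rewrite big1 // => b /andP[h1 _].
  have [e|ne] := eqVneq i j; last by rewrite dl ?mul0r.
  by rewrite (dl i b) ?mulr0 // -val_eqE /= e neq_ltn h1.
rewrite big1 // => i hi; rewrite big1 // => j hj.
by rewrite dl ?mul0r ?div0z // -val_eqE /=; lia.
Qed.

Definition prj (A : 'M[int]_N) (x : VT n d) : VT n d :=
  [ffun r => if cM r r == A then x r else 0].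

Lemma prj_linear A : linear (prj A).
Proof.
move=> a x y; apply/ffunP => r; rewrite linffE !ffunE.
by case: ifP => _; rewrite ?mulr0 ?addr0 ?linffE.
Qed.

Lemma prj_vten A r : prj A (vten r) = if cM r r == A then vten r else 0.
Proof.
apply/ffunP => s; rewrite [LHS]ffunE; case: (s =P r) => [->|/eqP ns].
  by case: ifP => _; rewrite ?ffunE.
have -> : vten r s = 0 by rewrite ffunE (negbTE ns).
rewrite if_same; case: ifP => _; last by rewrite ffunE.
by rewrite ffunE (negbTE ns).
Qed.

Lemma dirac_Omega (r : seqs n d) : dirac r = v ^- texp r *: Omega (vten r).
Proof. by rewrite Omega_vten scalerA mulVf ?scale1r // expf_neq0 // v_neq0. Qed.

Lemma Omega_inv_linear : linear (@Omega_inv n d).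
Proof. by move=> a x y; apply: (can_inj (@OmegaK n d)); rewrite Omega_linear !Omega_invK. Qed.

(* Both sides commute with the T_j, hence the comparison reduces to sorted r. *)
Section Intertwine.
Variables (G : VT n d -> VT n d) (A l : 'M[int]_N).
Hypothesis linG : linear G.
Hypothesis ascG : forall r j, (extf r (pen1 j) < extf r (pen2 j))%N ->
  actT (G (vten r)) j = v *: G (vten (reflr j r)).
Hypothesis sortG : forall r : seqs n d, mono (fun c => extf r c) ->
  actST (stdS d A) (Omega (vten r)) = if cM r r == l then Omega (G (vten r)) else 0.

Lemma intertwine (x : VT n d) : Omega (G (prj l x)) = actST (stdS d A) (Omega x).
Proof.
pose g t := Omega (G (prj l (Omega_inv t))).
have lg : linear g by move=> a y z; rewrite /g Omega_inv_linear prj_linear linG Omega_linear.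
suff H t : g t = actST (stdS d A) t.
  by rewrite -H /g; congr (Omega (G (prj l _))); rewrite OmegaK.
have gd r : g (dirac r) = v ^- texp r *: (if cM r r == l then Omega (G (vten r)) else 0).
  rewrite dirac_Omega (linfunZ lg); congr (_ *: _); rewrite /g OmegaK prj_vten.
  by case: (cM r r == l) => //; rewrite (linfun0 linG) (linfun0 (@Omega_linear n d)).
apply: sorted_generate => //; first exact: actST_linear.
- move=> r j asc; rewrite dirac_asc // !gd cM_reflr (linfunZ (actTH_linearl _)).
  have vE : v ^- texp (reflr j r) = v ^- texp r * v.
    by rewrite (texp_reflr asc) exprS invfM mulrC mulVKf ?v_neq0.
  case: (cM r r == l); last by rewrite (linfun0 (actTH_linearl _)) !scaler0.
  by rewrite -Omega_actT (ascG asc) (linfunZ (@Omega_linear n d)) scalerA vE.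
- by move=> r j _; rewrite act_comm.
by move=> r mr; rewrite gd -sortG // dirac_Omega (linfunZ (actST_linear _)).
Qed.

End Intertwine.

Lemma proj_act (l : 'M[int]_N) (x : VT n d) : (forall i j, i != j -> l i j = 0) ->
  Omega (prj l x) = actST (stdS d l) (Omega x).
Proof.
move=> dl; apply: (@intertwine id) => //.
  by move=> r j asc; rewrite actT_vten actT_basisE asc.
move=> r mr; rewrite Omega_vten (linfunZ (actST_linear _)); apply/ffunP => s.
rewrite [LHS]scaleffE stdS_dirac // dA_diag // oppr0 expr0z.
have [e|ne] := eqVneq (cM s r) l.
  have es : s = r.
    apply: extf_inj; apply/ffunP => c; apply/eqP/negPn/negP => nc.
    by have := cM_pos s r c; rewrite e dl.
  by rewrite -e es eqxx scaleffE ffunE eqxx.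
case: ifP => [/eqP e|_]; last by rewrite ffunE mulr0.
have ns : s != r by apply: contraNneq ne => ->; rewrite e.
by rewrite scaleffE ffunE (negbTE ns) !mulr0.
Qed.

Section RaiseAct.
Variables k k' : 'I_N.
Hypothesis hk : k' = k.+1 :> nat.

Definition raiseL (x : VT n d) : VT n d := \sum_r x r *: raise k k' r.

Lemma raiseL_linear : linear raiseL.
Proof.
move=> a x y; rewrite /raiseL scaler_sumr -big_split; apply: eq_bigr => r _ /=.
by rewrite scalerA -scalerDl linffE.
Qed.

Lemma raiseL_vten r : raiseL (vten r) = raise k k' r.
Proof.
rewrite /raiseL (bigD1 r) //= big1 ?addr0 => [|b nb]; rewrite ffunE ?eqxx ?scale1r //.
by rewrite (negbTE nb) scale0r.
Qed.

(** By [intertwine] the check is on sorted r. There the coefficient of e_s is nonzero exactly when s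
    arises from r by raising one step p, and [om_texp] gives the power of v. *)
Lemma raise_act (l : 'M[int]_N) (x : VT n d) : (forall i j, i != j -> l i j = 0) ->
  Omega (raiseL (prj l x)) = actST (stdS d (l - Ez k k + Ez k' k)) (Omega x).
Proof.
move=> dl; apply: intertwine; first exact: raiseL_linear.
  by move=> r j asc; rewrite !raiseL_vten raise_asc.
move=> r mr; rewrite Omega_vten (linfunZ (actST_linear _)) raiseL_vten.
have [h1 h2 h3] := kk_facts hk.
apply/ffunP => s; rewrite [LHS]scaleffE stdS_dirac //.
(* The column sums of the position of (s, r) form the weight of r, so a nonzero coefficient forces
   this weight to be l. *)
case: (cM r r =P l) => [er|ner]; last first.
  rewrite [RHS]ffunE; case: (cM s r =P _) => [e|_]; last by rewrite mulr0.
  case: ner; apply/matrixP => i j; have [<-|nij] := eqVneq i j; last by rewrite cM_off // dl.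
  rewrite -(cM_col s) e; under eq_bigr => b _ do rewrite EzE.
  rewrite !(big_split, sumrB) /=.
  have one (a b : 'I_N) : \sum_(c : 'I_N) ((c == a) && (i == b))%:Z = (i == b)%:Z.
    rewrite (bigD1 a) //= eqxx big1 ?addr0 // => c /negbTE -> //.
  rewrite !sumrN !one (bigD1 i) //= big1 ?addr0 => [|b nb]; last by rewrite dl.
  by lia.
rewrite -er; rewrite /raise (linfun_sum (@Omega_linear n d)) sum_ffunE.
case: (cM s r =P _) => [e|ne].
  have [p [pm rp es]] := cM_raise hk e.
  rewrite (bigD1 p) /=; last by rewrite pm rp eqxx.
  rewrite big1 ?addr0 => [|p' /andP[/andP[pm' /eqP rp'] np]]; last first.
    rewrite (linfunZ (@Omega_linear n d)) Omega_vten !scaleffE ffunE es.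
    case: (upd p k' r =P _) => [eu|_]; last by rewrite !mulr0.
    by rewrite (upd_inj hk pm pm' rp rp' eu) eqxx in np.
  rewrite (linfunZ (@Omega_linear n d)) Omega_vten !scaleffE ffunE es eqxx mulr1.
  rewrite -[v ^+ _]/(v ^ Posz _) -[v ^+ texp (upd _ _ _)]/(v ^ Posz _) -!v_expD.
  congr (v ^ _); rewrite dA_raise //; [|exact: cM_off|exact: cM_rev].
  rewrite cM_diag -(om_texp hk pm rp) ?addrK // => b bp.
  have := mr b p (ltnW bp); rewrite rp => le; apply/eqP => eb.
  by move: le; rewrite eb; lia.
rewrite mulr0 big1 // => p /andP[pm /eqP rp].
rewrite (linfunZ (@Omega_linear n d)) Omega_vten !scaleffE ffunE.
case: (s =P _) => [es|_]; last by rewrite !mulr0.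
by case: ne; rewrite es (cM_upd _ pm rp).
Qed.

End RaiseAct.
End Weights.

(** * The modified form *)

Lemma v_exp_inj (x y : int) : v ^ x = v ^ y -> x = y.
Proof.
have pos (m : nat) : v ^+ m = 1 -> m = 0%N.
  rewrite /v -tofracXn -tofrac1 => /eqP; rewrite tofrac_eq => /eqP /(congr1 (fun p => size (polyseq p))).
  by rewrite size_polyXn size_poly1; case.
have H (a : int) : v ^ a = 1 -> a = 0.
  case: a => m; first by move/pos => ->.
  rewrite NegzE -exprnN => /(congr1 (@GRing.inv _)); rewrite invrK invr1.
  by move/pos.
move=> e; apply/eqP; rewrite -subr_eq0; apply/eqP/H.
by rewrite v_expD e -v_expD subrr expr0z.
Qed.

(** * Weights and the projections D_lambda *)

Section Weights2.
Variables (n : nat).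
Notation N := (NN n).

Lemma Ez_E (a b i j : 'I_N) : Ez a b i j =
  ((i == a) && (j == b))%:Z + ((i == rev_ord a) && (j == rev_ord b))%:Z.
Proof. by rewrite !mxE -!natz. Qed.

Lemma Ez_rev (a b : 'I_N) : Ez (rev_ord a) (rev_ord b) = Ez a b.
Proof. by rewrite /Ez !rev_ordK addrC. Qed.

Definition dsym (A : 'M[int]_N) : Prop :=
  (forall i j, i != j -> A i j = 0) /\ forall i, A (rev_ord i) (rev_ord i) = A i i.

(** The d_a see the diagonal entries up to n + 1 only; symmetry determines the others. *)
Lemma dsym_eq (A B : 'M[int]_N) : dsym A -> dsym B ->
  (forall a : 'I_n.+1, A (ix n a.+1) (ix n a.+1) = B (ix n a.+1) (ix n a.+1)) -> A = B.
Proof.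
move=> [dA1 sA] [dB sB] h; apply/matrixP => i j.
have [<-|nij] := eqVneq i j; last by rewrite dA1 ?dB.
have low (c : 'I_N) : (c <= n)%N -> A c c = B c c.
  rewrite -ltnS => cn; have := h (Ordinal cn).
  by have -> : ix n (Ordinal cn).+1 = c by apply: ord_inj; rewrite ixE //= ltn_ord.
have [/low//|hi] := leqP i n; rewrite -(sA i) -(sB i); apply: low.
by have NE : NN n = n.*2.+1 by []; rewrite /=; lia.
Qed.

Lemma Lam_dsym (l : Lam n) : dsym (val l).
Proof.
have /andP[/and3P[_ _ /forallP sl] /is_diag_mxP dl] := valP l; split=> // i.
by have /forallP/(_ i)/eqP <- := sl i.
Qed.

Lemma Lam_odd (l : Lam n) : ~~ (2 %| val l (ix n n.+1) (ix n n.+1))%Z.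
Proof. by have /andP[/and3P[_ ]] := valP l. Qed.

Lemma add_Lam (l : Lam n) k (z : int) : in_Xit_diag (val l + z *: Ez k k).
Proof.
have [dl sl] := Lam_dsym l; have E i j : (val l + z *: Ez k k) i j =
    val l i j + z * Ez k k i j by rewrite mxE [X in _ + X]mxE.
have off i j : i != j -> (val l + z *: Ez k k) i j = 0.
  move=> nij; rewrite E dl // Ez_E.
  have F (a : 'I_N) : (i == a) && (j == a) = false.
    by apply/negP => /andP[/eqP e /eqP e']; rewrite e e' eqxx in nij.
  by rewrite !F mulr0.
rewrite /in_Xit_diag; apply/andP; split; last by apply/is_diag_mxP => i j; apply: off.
apply/and3P; split.
- by apply/forallP => i; apply/forallP => j; apply/implyP => /off ->.
(* The parity of the middle entry is preserved: E^theta_kk has middle entry 2 if k is the middle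
   index and 0 otherwise. *)
- have := Lam_odd l; rewrite E Ez_E !andbb.
  have sw (a : 'I_N) : (ix n n.+1 == rev_ord a) = (ix n n.+1 == a).
    rewrite -rev_eq; congr (_ == _); apply: ord_inj; rewrite /= ixE /NN; lia.
  by rewrite !sw; case: (_ == k); rewrite ?mulr0 ?addr0 //; lia.
apply/forallP => i; apply/forallP => j; apply/eqP.
have [<-|nij] := eqVneq i j; last by rewrite !off // (inj_eq rev_ord_inj).
by rewrite !E sl !Ez_E !andbb !(inj_eq rev_ord_inj) !rev_eq addrC [in X in _ = _ + _ * X]addrC addrC.
Qed.

Lemma sub_Lam (l : Lam n) k : in_Xit_diag (val l - Ez k k).
Proof. by rewrite -scaleN1r add_Lam. Qed.

Lemma shift_Lam (l : Lam n) k k' : in_Xit_diag (val l - Ez k k + Ez k' k').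
Proof. by have := add_Lam (Sub _ (sub_Lam l k)) k' 1; rewrite SubK scale1r. Qed.

Definition shL (l : Lam n) k k' : Lam n := Sub _ (shift_Lam l k k').

Lemma Lam_eq (l l' : Lam n) : lam l =1 lam l' -> l = l'.
Proof.
by move=> h; apply: val_inj; apply: dsym_eq; [exact: Lam_dsym | exact: Lam_dsym | exact: h].
Qed.

Variable d : nat.

Lemma cM_dsym (r : seqs n d) : dsym (cM r r).
Proof. by split; [exact: cM_off | exact: cM_rev]. Qed.

Lemma cM_low (r : seqs n d) i : cM r r i i =
  \sum_b (r b == i)%:Z + (i == n :> nat)%:Z + \sum_b (rev_ord (r b) == i)%:Z.
Proof.
rewrite cM_diag big_pos; congr (_ + _ + _).
- by apply: eq_bigr => b _; rewrite extf_low.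
- by rewrite -val_eqE /= extf_mid eq_sym.
by apply: eq_bigr => b _; rewrite extf_high.
Qed.

Lemma opd_vten (a : 'I_n.+1) z (r : seqs n d) :
  opd a z (vten r) = v ^ (- z * cM r r (ix n a.+1) (ix n a.+1)) *: vten r.
Proof.
have an := ltn_ord a; have NE : NN n = n.*2.+1 by [].
rewrite cM_low /opd ixE /=; last by lia.
case: (leqP a.+1 n) => h.
  rewrite !opK_vten (linfunZ (@opK_linear _ _ _ _)) opK_vten scalerA -v_expD.
  congr (v ^ _ *: _); have -> : (a == n :> nat) = false by lia.
  rewrite addr0 mulrDr !mulr_sumr addrC; congr (_ + _).
  apply: eq_bigr => c _; congr (_ * _%:Z); rewrite rev_eq rev_ix; last lia.
  by congr (_ == ix n _).
(* The middle letter occurs equally often in both halves and once more at the middle step, which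
   accounts for the exponent -2 and the factor v^-1 in d_(n+1). *)
have ea : a = n :> nat by lia.
rewrite opK_vten scalerA -v_expD; congr (v ^ _ *: _).
rewrite ea eqxx; have -> : \sum_(c < d) (rev_ord (r c) == ix n n.+1)%:Z = \sum_(c < d) (r c == ix n n.+1)%:Z.
  apply: eq_bigr => c _; rewrite rev_eq rev_ix; last lia.
  by congr (_ == ix n _)%:Z; lia.
rewrite -mulr_sumr -[Posz true]/(1 : int); set S := \sum_(_ < _) _; ring.
Qed.

Lemma projDE (l : Lam n) (x : VT n d) : projD l x = prj (val l) x.
Proof.
apply/ffunP => r; rewrite !ffunE; congr (if _ then _ else _).
apply/forallP/eqP => [h|e a]; last by rewrite opd_vten mulN1r e.
apply: dsym_eq; [exact: cM_dsym | exact: Lam_dsym | move=> a].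
have /eqP := h a; rewrite opd_vten mulN1r => /(congr1 (fun f : VT n d => f r)).
rewrite !scaleffE ffunE eqxx !mulr1 => /v_exp_inj/oppr_inj ->.
by [].
Qed.

End Weights2.

Section ModifiedForm.
Variable n : nat.
Notation N := (NN n).
Local Notation U := (aquot (@relatorU n)).
Local Notation ap := (api (@relatorU n)).
Implicit Types (l : Lam n) (u w : U).

Lemma apiM (x y : freeU n) : ap (x * y) = ap x * ap y.
Proof. by rewrite [ap x * ap y]qmul_pi. Qed.

Lemma apiZ c (x : freeU n) : ap (c *: x) = c *: ap x.
Proof. exact/esym/qscale_pi. Qed.

Lemma api_rel (x y : freeU n) : Defs.relU x y -> ap x = ap y.
Proof.
move=> h; apply/lpi_eqP => /= J hJ _ _; apply: hJ.
by exists x, y.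
Qed.

Lemma dV a : Ud a * UdV a = 1 :> U.
Proof. by rewrite -[LHS]apiM (api_rel (rel_dV a)). Qed.

Lemma Vd a : UdV a * Ud a = 1 :> U.
Proof. by rewrite -[LHS]apiM (api_rel (rel_Vd a)). Qed.

Lemma homog_comm l l' u a : homog l l' u ->
  Ud a * u = v ^ (lam l' a - lam l a) *: (u * Ud a) :> U.
Proof.
move=> h; rewrite qscaleAl -[v ^ _ *: u]h -[RHS]mulrA.
by rewrite [UdV a * Ud a]Vd [RHS]mulr1.
Qed.

Lemma homogM l1 l2 l3 u w : homog l1 l2 u -> homog l2 l3 w -> homog l1 l3 (u * w).
Proof.
move=> hu hw a; have -> : Ud a * (u * w) * UdV a = (Ud a * u * UdV a) * (Ud a * w * UdV a) :> U.
  rewrite -!mulrA; congr (_ * (_ * _)); rewrite !mulrA [UdV a * Ud a]Vd.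
  by rewrite mul1r.
rewrite [Ud a * u * _]hu [Ud a * w * _]hw -qscaleAl -qscaleAr scalerA -v_expD.
by congr (v ^ _ *: _); lia.
Qed.

Lemma homog1 l : homog l l (1 : U).
Proof. by move=> a; rewrite subrr expr0z scale1r [Ud a * 1]mulr1 dV. Qed.

(* No decomposition of the first factor is needed: a homogeneous w commutes with
   the d_a up to scalars, so that (d_a - v^(-l2_a)) w is proportional to
   w (d_a - v^(-l3_a)). *)
Lemma inJ_mulr l1 l2 l3 u w : inJ l1 l2 u -> homog l2 l3 w -> inJ l1 l3 (u * w).
Proof.
move=> [s [t ->]] hw.
exists (fun a => s a * w), (fun a => v ^ (lam l3 a - lam l2 a) *: (t a * w)).
rewrite mulrDl !mulr_suml; congr (_ + _); apply: eq_bigr => a _; first by rewrite mulrA.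
rewrite -mulrA -qscaleAl -[in RHS]mulrA [RHS]qscaleAr; congr (_ * _).
rewrite /shiftd mulrBl mulrBr [Ud a * w](homog_comm a hw) scalerBr; congr (_ - _).
rewrite -qscaleAl -qscaleAr mul1r mulr1 scalerA -v_expD.
by congr (v ^ _ *: _); lia.
Qed.

Lemma inJ_mull l1 l2 l3 u w : homog l1 l2 u -> inJ l2 l3 w -> inJ l1 l3 (u * w).
Proof.
move=> hu [s [t ->]].
exists (fun a => v ^ (lam l1 a - lam l2 a) *: (u * s a)), (fun a => u * t a).
rewrite mulrDr !mulr_sumr; congr (_ + _); apply: eq_bigr => a _; last by rewrite mulrA.
rewrite [LHS]mulrA -[RHS]qscaleAr [in RHS]mulrA [RHS]qscaleAl; congr (_ * _).
rewrite /shiftd mulrBl mulrBr [Ud a * u](homog_comm a hu) scalerBr scalerA.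
rewrite -v_expD -qscaleAl -qscaleAr mul1r mulr1 scalerA -v_expD.
have -> : (lam l1 a - lam l2 a + (lam l2 a - lam l1 a))%R = 0 :> int by lia.
by rewrite expr0z scale1r; congr (_ - v ^ _ *: _); lia.
Qed.

(** For some a the weights l1 and l2 differ. Then (d_a - v^(-l1_a)) u minus a multiple of u (d_a -
    v^(-l3_a)) is a nonzero scalar times u. *)
Lemma inJ_homog l1 l2 l3 u : homog l2 l3 u -> l1 <> l2 -> inJ l1 l3 u.
Proof.
move=> hu ne.
have [a na] : exists a, lam l1 a <> lam l2 a.
  apply: contrapT => no; apply: ne; apply: Lam_eq => a.
  by apply: contrapT => na; apply: no; exists a.
pose c := v ^ (- lam l2 a) - v ^ (- lam l1 a).
have c0 : c != 0 by rewrite subr_eq0; apply/eqP => /v_exp_inj/oppr_inj/esym.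
pose e := lam l3 a - lam l2 a.
have key : shiftd l1 a * u - v ^ e *: (u * shiftd l3 a) = c *: u.
  have ee : e - lam l3 a = - lam l2 a by rewrite /e addrAC subrr sub0r.
  have E1 : shiftd l1 a * u = v ^ e *: (u * Ud a) - v ^ (- lam l1 a) *: u.
    by rewrite mulrBl (homog_comm a hu) -qscaleAl mul1r.
  have E2 : v ^ e *: (u * shiftd l3 a) = v ^ e *: (u * Ud a) - v ^ (- lam l2 a) *: u.
    by rewrite mulrBr scalerBr -qscaleAr mulr1 scalerA -v_expD ee.
  by rewrite E1 E2 opprB addrC addrA subrK -scalerBl.
exists (fun b => if b == a then c^-1 *: u else 0).
exists (fun b => if b == a then - (c^-1 *: (v ^ e *: u)) else 0).
rewrite (bigD1 a) //= eqxx [X in _ + X + _]big1 => [|b /negbTE ->]; last exact: mulr0.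
rewrite [X in _ + X](bigD1 a) //= eqxx [X in _ + (_ + X)]big1 => [|b /negbTE ->]; last exact: mul0r.
rewrite !addr0 -qscaleAr mulNr -!qscaleAl -scalerBr key.
by rewrite scalerA mulVf // scale1r.
Qed.

End ModifiedForm.

Lemma lpi0 (K : comNzRingType) (V : lmodType K) (W : submodule V) : lpi W 0 = 0.
Proof. by apply: (addrI (lpi W 0)); rewrite -lpiD !addr0. Qed.

Section ModifiedProduct.
Variable n : nat.
Notation N := (NN n).
Local Notation U := (aquot (@relatorU n)).
Local Notation ap := (api (@relatorU n)).
Implicit Types (l : Lam n) (u w : U).

Lemma dpi0P l1 l2 u : inJ l1 l2 u -> dpi l1 l2 u = 0.
Proof.
move=> h; rewrite -(lpi0 (Submodule (@sumJ0 n) (@sumJ_linear n))).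
apply/lpi_eqP => p /=; rewrite subr0 mcoeffU.
by case: eqP => [<-|_] //; apply: lr_span0.
Qed.

Lemma dsum_linE (x y : sumU n) c p : (c *: x + y)@_p = c *: x@_p + y@_p.
Proof. by rewrite mcoeffD [(c *: x)@_p]dscaleE. Qed.

Lemma dpi_linear l1 l2 : linear (dpi l1 l2).
Proof.
move=> c u w; rewrite /dpi [RHS]/= [c *: lpi _ _]qscale_pi -lpiD; congr lpi.
apply/malgP => p; apply: etrans (esym (dsum_linE _ _ _ _)).
have E (x : U) : (<< x *g (l1, l2) >> : sumU n)@_p = if (l1, l2) == p then x else 0.
  by apply: (etrans (mcoeffU _ _ _)); case: ((l1, l2) == p).
apply: (etrans (E _)).
apply: (etrans _ (esym (f_equal2 (fun a b : U => c *: a + b) (E u) (E w)))).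
by case: ((l1, l2) == p); rewrite ?scaler0 ?addr0.
Qed.

Lemma lpi_sum (f : sumU n) :
  lpi (Submodule (@sumJ0 n) (@sumJ_linear n)) f = \sum_(p <- msupp f) dpi p.1 p.2 f@_p.
Proof.
rewrite {1}(monalgE f) (big_morph _ (@lpiD _ _ _) (lpi0 _)).
by apply: eq_bigr => -[l1 l2] _.
Qed.

Lemma hreprP l1 l2 u : homog l1 l2 u ->
  lpi (Submodule (@sumJ0 n) (@sumJ_linear n)) (hrepr (dpi l1 l2 u)) = dpi l1 l2 u /\
  forall p, homog p.1 p.2 (hrepr (dpi l1 l2 u))@_p.
Proof.
move=> hu; apply: (@xgetPex _ (0 : sumU n) [set f : sumU n |
  lpi (Submodule (@sumJ0 n) (@sumJ_linear n)) f = dpi l1 l2 u /\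
  forall p, homog p.1 p.2 f@_p]%classic).
exists << u *g (l1, l2) >>; split=> // p a; rewrite mcoeffU.
case: eqP => [<-|_]; first exact: hu.
by rewrite mulr0n scaler0 [Ud a * 0]mulr0 mul0r.
Qed.

Lemma hrepr_diff l1 l2 u p : homog l1 l2 u ->
  inJ p.1 p.2 ((hrepr (dpi l1 l2 u))@_p - u *+ ((l1, l2) == p)).
Proof.
move=> hu; have [e _] := hreprP hu; move/lpi_eqP: e => /(_ p) /=.
by rewrite mcoeffB mcoeffU.
Qed.

Lemma sum_one (V : zmodType) (I : eqType) (s : seq I) (F : I -> V) i0 :
  uniq s -> (forall i, i != i0 -> F i = 0) -> (i0 \notin s -> F i0 = 0) ->
  \sum_(i <- s) F i = F i0.
Proof.
move=> us h0 h1; have [si|ni] := boolP (i0 \in s).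
  by rewrite (bigD1_seq i0) //= big1 ?addr0.
rewrite h1 // big_seq big1 // => i si; apply: h0.
by apply: contraNneq ni => <-.
Qed.

(** The product is independent of the homogeneous representatives: a component of X or Y other than
    the expected one lies in the submodule by which one divides, and so do its products with
    homogeneous elements. One pair (p, q) survives. *)
Lemma muldot_repr (X Y : sumU n) l1 l2 l3 u w :
  (forall p, homog p.1 p.2 X@_p) -> (forall p, homog p.1 p.2 Y@_p) ->
  (forall p, inJ p.1 p.2 (X@_p - u *+ ((l1, l2) == p))) ->
  (forall p, inJ p.1 p.2 (Y@_p - w *+ ((l2, l3) == p))) ->
  homog l1 l2 u ->
  \sum_(p <- msupp X) \sum_(q <- msupp Y | p.2 == q.1) dpi p.1 q.2 (X@_p * Y@_q)
  = dpi l1 l3 (u * w).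
Proof.
move=> Hu Hw Du Dw hu.
have dpiB a b (x y : U) : dpi a b (x + y) = dpi a b x + dpi a b y.
  exact: (@linfunD U (dotU n) _ (@dpi_linear a b) x y).
have lX p (z : U) c : p != (l1, l2) -> homog p.2 c z -> dpi p.1 c (X@_p * z) = 0.
  move=> np hz; apply: dpi0P; apply: inJ_mulr hz.
  by have := Du p; rewrite eq_sym (negbTE np) mulr0n subr0.
have lY q (z : U) c : q != (l2, l3) -> homog c q.1 z -> dpi c q.2 (z * Y@_q) = 0.
  move=> nq hz; apply: dpi0P; apply: (inJ_mull hz).
  by have := Dw q; rewrite eq_sym (negbTE nq) mulr0n subr0.
rewrite (sum_one (i0 := (l1, l2))) //=; first last.
- by move/mcoeff_outdom => ->; rewrite big1 // => q _; rewrite mul0r (linfun0 (@dpi_linear _ _)).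
- by move=> p np; rewrite big1 // => q /eqP pq; apply: lX => //; rewrite pq; apply: Hw.
- exact: fset_uniq.
rewrite big_mkcond (sum_one (i0 := (l2, l3))) //= ?eqxx; first last.
- by move/mcoeff_outdom => ->; rewrite mulr0 (linfun0 (@dpi_linear _ _)).
- by move=> q nq; case: eqP => // e; apply: lY => //=; rewrite -e; apply: Hu (l1, l2).
- exact: fset_uniq.
have := Du (l1, l2); have := Dw (l2, l3); rewrite !eqxx !mulr1n /= => dw du.
have -> : X@_(l1, l2) * Y@_(l2, l3) = (X@_(l1, l2) - u) * Y@_(l2, l3)
    + (u * (Y@_(l2, l3) - w) + u * w) :> U.
  by rewrite -mulrDr subrK mulrBl subrK.
rewrite !dpiB dpi0P ?add0r; last exact: inJ_mulr du (Hw (l2, l3)).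
by rewrite dpi0P ?add0r //; apply: inJ_mull hu dw.
Qed.


Lemma muldot_dpi l1 l2 l3 u w : homog l1 l2 u -> homog l2 l3 w ->
  muldot (dpi l1 l2 u) (dpi l2 l3 w) = dpi l1 l3 (u * w).
Proof.
move=> hu hw; have [_ Hu] := hreprP hu; have [_ Hw] := hreprP hw.
exact: (muldot_repr Hu Hw (fun p => hrepr_diff p hu) (fun p => hrepr_diff p hw) hu).
Qed.

End ModifiedProduct.

Lemma conj_comm (R : pzRingType) (x y xi : R) : x * y = y * x -> x * xi = 1 -> x * y * xi = y.
Proof. by move=> -> e; rewrite -mulrA e mulr1. Qed.

Lemma comm_inv (R : pzRingType) (x y yi : R) :
  x * y = y * x -> yi * y = 1 -> y * yi = 1 -> x * yi = yi * x.
Proof.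
move=> c e1 e2; rewrite -[LHS]mul1r -e1 -!mulrA; congr (_ * _).
by rewrite [RHS](esym (mulr1 _)) -e2 !mulrA c.
Qed.

(** * Words in the generators and their weights *)

Section Generators.
Variable n : nat.
Notation N := (NN n).
Local Notation U := (aquot (@relatorU n)).
Local Notation ap := (api (@relatorU n)).
Implicit Types (l : Lam n).

Definition word (s : seq (genU n)) : freeU n := << FMonom s >>.

Lemma word_nil : word [::] = 1.
Proof. by rewrite /word -fmoneE. Qed.

Lemma word_cons g s : word (g :: s) = letter g * word s.
Proof.
rewrite /word /letter [RHS]malgM_def fgmulUU mulr1 -[mmul _ _]/(fmmul _ _) fmmulE fmuE.
by [].
Qed.

(** The weight of g x for x of weight l, so that every word applied to D_l is homogeneous with a
    computable left index. *)
Definition tgt (g : genU n) l : Lam n :=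
  match g with
  | inl (inl i) => shL l (ix n i.+1) (ix n i.+2)
  | inl (inr i) => shL l (ix n i.+2) (ix n i.+1)
  | inr _ => l
  end.

Lemma lam_shL l k k' a : lam l a - lam (shL l k k') a =
  Ez k k (ix n a.+1) (ix n a.+1) - Ez k' k' (ix n a.+1) (ix n a.+1).
Proof.
have E (A B C : 'M[int]_N) i : A i i - (A - B + C) i i = B i i - C i i.
  by rewrite !mxE; ring.
by rewrite /lam SubK E.
Qed.

Lemma wt_shL l (j : 'I_n) (a : 'I_n.+1) :
  lam l a - lam (shL l (ix n j.+1) (ix n j.+2)) a = Defs.wt a j.
Proof.
have an := ltn_ord a; have jn := ltn_ord j; have NE : NN n = n.*2.+1 by [].
have ea : ix n a.+1 = a :> nat by rewrite ixE //; lia.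
have ej : ix n j.+1 = j :> nat by rewrite ixE //; lia.
have ej1 : ix n j.+2 = j.+1 :> nat by rewrite ixE //; lia.
have q1 : (ix n a.+1 == ix n j.+1) = (a.+1 == j.+1 :> nat) by rewrite -val_eqE /= ea ej.
have q2 : (ix n a.+1 == rev_ord (ix n j.+1)) = false by rewrite -val_eqE /= ea ej; lia.
have q3 : (ix n a.+1 == ix n j.+2) = (a.+1 == j.+2 :> nat) by rewrite -val_eqE /= ea ej1.
have q4 : (ix n a.+1 == rev_ord (ix n j.+2)) = (N.+1 - a.+1 == j.+2)%N.
  by rewrite -val_eqE /= ea ej1; lia.
rewrite lam_shL !Ez_E !andbb q1 q2 q3 q4 /Defs.wt addr0 opprD addrCA addrA addrC.
by rewrite addrCA addrA.
Qed.

Lemma homog_letter l g : homog (tgt g l) l (ap (letter g)).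
Proof.
move=> a; case: g => [[i|i]|[b|b]] /=.
- rewrite wt_shL -apiZ -(api_rel (rel_de a i)).
  by rewrite [in RHS]apiM apiM.
- have -> : lam l a - lam (shL l (ix n i.+2) (ix n i.+1)) a = - Defs.wt a i.
    by rewrite -(wt_shL l) !lam_shL; lia.
  rewrite -apiZ -(api_rel (rel_df a i)).
  by rewrite [in RHS]apiM apiM.
- rewrite subrr expr0z scale1r; apply: (@conj_comm U); last exact: dV.
  exact: etrans (esym (apiM _ _)) (etrans (api_rel (rel_dd a b)) (apiM _ _)).
rewrite subrr expr0z scale1r; apply: (@conj_comm U); last exact: dV.
apply: (@comm_inv U _ (Ud b)); [|exact: Vd | exact: dV].
exact: etrans (esym (apiM _ _)) (etrans (api_rel (rel_dd a b)) (apiM _ _)).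
Qed.

Fixpoint wtgt (s : seq (genU n)) l : Lam n := if s is g :: s' then tgt g (wtgt s' l) else l.

Lemma homog_word l s : homog (wtgt s l) l (ap (word s)).
Proof.
elim: s => [|g s IH]; first by rewrite word_nil; apply: homog1.
by rewrite word_cons apiM /=; apply: homogM IH; apply: homog_letter.
Qed.

Lemma dpi_word_cons l g s : dpi (wtgt (g :: s) l) l (ap (word (g :: s)))
  = muldot (dpi (wtgt (g :: s) l) (wtgt s l) (ap (letter g))) (dpi (wtgt s l) l (ap (word s))).
Proof.
rewrite word_cons apiM muldot_dpi //; [exact: homog_letter | exact: homog_word].
Qed.

Lemma dpi_word_proj l s : muldot (dpi (wtgt s l) (wtgt s l) 1) (dpi (wtgt s l) l (ap (word s)))
  = dpi (wtgt s l) l (ap (word s)).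
Proof.
rewrite muldot_dpi; [by rewrite mul1r | exact: homog1 | exact: homog_word].
Qed.

Lemma DuDE l l' (u : U) : DuD (val l) (val l') u = dpi l l' u.
Proof. by rewrite /DuD !valK. Qed.

Lemma dpi_Ud l a : dpi l l (ap (fd a)) = v ^ (- lam l a) *: dpi l l 1.
Proof.
have h : inJ l l (ap (fd a) - v ^ (- lam l a) *: (1 : U)).
  exists (fun b => if b == a then 1 else 0), (fun=> 0).
  rewrite (bigD1 a) //= eqxx big1 => [|b /negbTE ->]; last exact: mulr0.
  by rewrite big1 ?addr0 ?mulr1 // => b _; exact: mul0r.
have e : ap (fd a) = v ^ (- lam l a) *: (1 : U) + (ap (fd a) - v ^ (- lam l a) *: (1 : U)).
  by rewrite addrC subrK.
by rewrite e dpi_linear (dpi0P h) addr0.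
Qed.

(** From d_a^-1 - v^(l_a) = - v^(l_a) d_a^-1 (d_a - v^(-l_a)). *)
Lemma dpi_UdV l a : dpi l l (ap (fdV a)) = v ^ (lam l a) *: dpi l l 1.
Proof.
have h : inJ l l (ap (fdV a) - v ^ (lam l a) *: (1 : U)).
  exists (fun=> 0), (fun b => if b == a then - (v ^ lam l a) *: ap (fdV a) else 0).
  rewrite big1 => [|b _]; last exact: mulr0.
  rewrite add0r (bigD1 a) //= eqxx big1 => [|b /negbTE ->]; last exact: mul0r.
  rewrite addr0 -qscaleAl /shiftd mulrBr [X in _ *: (X - _)]Vd -qscaleAr mulr1 scalerBr.
  rewrite scaleNr scalerA mulNr -v_expD subrr expr0z scaleN1r opprK.
  by rewrite addrC.
have e : ap (fdV a) = v ^ (lam l a) *: (1 : U) + (ap (fdV a) - v ^ (lam l a) *: (1 : U)).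
  by rewrite addrC subrK.
by rewrite e dpi_linear (dpi0P h) addr0.
Qed.

End Generators.

(** * The intertwining property *)

Section Intertwining.
Variables (n d : nat) (hn : (0 < n)%N).
Variables (phi : {linear QK n -> QS n d}) (hphi : is_phi phi).
Variables (aleph : {linear dotU n -> QK n}) (haleph : is_aleph aleph).
Notation N := (NN n).
Local Notation U := (aquot (@relatorU n)).
Local Notation ap := (api (@relatorU n)).
Implicit Types (l : Lam n).

Definition Phi (u : dotU n) : QS n d := phi (aleph u).

Lemma Phi_linear : linear Phi.
Proof. by move=> a x y; rewrite /Phi !linearP. Qed.

Lemma PhiM u w : Phi (muldot u w) = mulS (Phi u) (Phi w).
Proof. by have [h _ _ _] := hphi; have [_ h' _ _ _] := haleph; rewrite /Phi h' h. Qed.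

Lemma Phi_one l : Phi (dpi l l 1) = stdS d (val l).
Proof.
have [_ _ h _] := hphi; have [_ _ h' _ _] := haleph.
rewrite -DuDE /Phi h'; last exact: valP.
(* [l] is the case R = 0, i = 1 of the condition on [phi]; this index exists because n > 0. *)
by have := h (val l) 0%N 1%N (valP l) hn; rewrite mulr0n addr0.
Qed.

Lemma Phi_e l (i : 'I_n) :
  Phi (dpi (tgt (inl (inl i)) l) l (ap (letter (inl (inl i)))))
  = stdS d (val l - Ez (ix n i.+1) (ix n i.+1) + Ez (ix n i.+2) (ix n i.+1)).
Proof.
have [_ _ _ h] := hphi; have [_ _ _ h' _] := haleph.
rewrite -DuDE SubK /Phi (h' _ _ (valP l)).
exact: (h (val l - Ez (ix n i.+1) (ix n i.+1)) 1%N i.+1 (sub_Lam l _) (ltn_ord i)).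
Qed.

Lemma Phi_f l (i : 'I_n) :
  Phi (dpi (tgt (inl (inr i)) l) l (ap (letter (inl (inr i)))))
  = stdS d (val l - Ez (ix n i.+2) (ix n i.+2) + Ez (ix n i.+1) (ix n i.+2)).
Proof.
have [_ _ h _] := hphi; have [_ _ _ _ h'] := haleph.
rewrite -DuDE SubK /Phi (h' _ _ (valP l)).
exact: (h (val l - Ez (ix n i.+2) (ix n i.+2)) 1%N i.+1 (sub_Lam l _) (ltn_ord i)).
Qed.

Lemma linear_vten (G G' : VT n d -> VT n d) : linear G -> linear G' ->
  (forall r, G (vten r) = G' (vten r)) -> G =1 G'.
Proof.
move=> lG lG' h x; rewrite (dirac_sum x) (linfun_sum lG) (linfun_sum lG').
by apply: eq_bigr => r _; rewrite (linfunZ lG) (linfunZ lG') -vten_dirac h.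
Qed.

Lemma opd_prj l a z (x : VT n d) :
  opd a z (prj (val l) x) = v ^ (- z * lam l a) *: prj (val l) x.
Proof.
pose G (y : VT n d) := opd a z (prj (val l) y); pose G' (y : VT n d) := v ^ (- z * lam l a) *: prj (val l) y.
suff h : G =1 G' by exact: h.
apply: linear_vten.
- by move=> c y y'; rewrite /G prj_linear opd_linear.
- by move=> c y y'; rewrite /G' prj_linear scalerDr !scalerA mulrC.
move=> r; rewrite /G /G' prj_vten; case: (cM r r =P val l) => [e|_].
  by rewrite opd_vten e.
by rewrite scaler0 (linfun0 (@opd_linear _ _ _ _)).
Qed.

Lemma Omega_letter g l (x : VT n d) : Omega (actgen g (prj (val l) x))
  = actST (Phi (dpi (tgt g l) l (ap (letter g)))) (Omega x).
Proof.
have dl : forall i j, i != j -> val l i j = 0 by have [] := Lam_dsym l.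
have NE : NN n = n.*2.+1 by [].
case: g => [[i|i]|[a|a]].
- have iN := ltn_ord i; rewrite Phi_e -(raise_act _ _ dl); last by rewrite !ixE; lia.
  congr Omega; apply: (linear_vten (@actgen_linear _ _ _) (raiseL_linear _ _)) => r.
  by rewrite raiseL_vten e_raise.
(* E^theta_(i,i+1) is rewritten as E^theta_(N+1-i,N-i), the form in which f_i raises the letter N -
   i. *)
- have iN := ltn_ord i; rewrite Phi_f -[Ez (ix n i.+2) _]Ez_rev -[Ez (ix n i.+1) _]Ez_rev.
  have E1 : rev_ord (ix n i.+1) = ix n (N.+1 - i.+1) by rewrite rev_ix //; lia.
  have E2 : rev_ord (ix n i.+2) = ix n (N - i.+1) by rewrite rev_ix; [congr ix | ]; lia.
  rewrite E1 E2 -(raise_act _ _ dl); last by rewrite !ixE; lia.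
  congr Omega; apply: (linear_vten (@actgen_linear _ _ _) (raiseL_linear _ _)) => r.
  by rewrite raiseL_vten f_raise.
- rewrite /= opd_prj mulN1r dpi_Ud (linfunZ Phi_linear) Phi_one.
  by rewrite (linfunZ (@Omega_linear n d)) (proj_act _ dl) (linfunZ (actST_linearl _)).
rewrite /= opd_prj opprK mul1r dpi_UdV (linfunZ Phi_linear) Phi_one.
by rewrite (linfunZ (@Omega_linear n d)) (proj_act _ dl) (linfunZ (actST_linearl _)).
Qed.

Lemma Phi_proj l s t :
  actST (stdS d (val (wtgt s l))) (actST (Phi (dpi (wtgt s l) l (ap (word s)))) t)
  = actST (Phi (dpi (wtgt s l) l (ap (word s)))) t.
Proof.
have e : mulS (stdS d (val (wtgt s l))) (Phi (dpi (wtgt s l) l (ap (word s))))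
    = Phi (dpi (wtgt s l) l (ap (word s))).
  by rewrite -(Phi_one (wtgt s l)) -PhiM dpi_word_proj.
by rewrite -[LHS]act_mulS e.
Qed.

Lemma Omega_word l s (x : VT n d) : Omega (foldr (@actgen n d) (prj (val l) x) s)
  = actST (Phi (dpi (wtgt s l) l (ap (word s)))) (Omega x).
Proof.
elim: s => [|g s IH].
  by rewrite word_nil /= Phi_one proj_act //; have [] := Lam_dsym l.
have dl : forall i j, i != j -> val (wtgt s l) i j = 0 by have [] := Lam_dsym (wtgt s l).
pose y := foldr (@actgen n d) (prj (val l) x) s.
have py : prj (val (wtgt s l)) y = y.
  apply: (can_inj (@OmegaK n d)); apply: (etrans (proj_act _ dl)).
  by rewrite IH Phi_proj.
have H := Omega_letter g (wtgt s l) y; rewrite py in H.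
rewrite dpi_word_cons PhiM; apply: (etrans H).
exact: etrans (congr1 _ IH) (esym (act_mulS _ _ _)).
Qed.

(** If l1 is not the weight reached by the word, both sides vanish: on the left two distinct weight
    projections are composed, on the right [inJ_homog] applies. *)
Lemma Omega_word_proj l1 l s (x : VT n d) :
  Omega (prj (val l1) (foldr (@actgen n d) (prj (val l) x) s))
  = actST (Phi (dpi l1 l (ap (word s)))) (Omega x).
Proof.
have dl1 : forall i j, i != j -> val l1 i j = 0 by have [] := Lam_dsym l1.
have [e|/eqP ne] := eqVneq l1 (wtgt s l).
  by rewrite (proj_act _ dl1) Omega_word {l1 dl1}e Phi_proj.
rewrite (dpi0P (inJ_homog (homog_word l s) ne)) (linfun0 Phi_linear).
rewrite (linfun0 (actST_linearl _)).
have dl : forall i j, i != j -> val (wtgt s l) i j = 0 by have [] := Lam_dsym (wtgt s l).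
set y := foldr _ _ s.
have py : prj (val (wtgt s l)) y = y.
  apply: (can_inj (@OmegaK n d)); rewrite (proj_act _ dl) /y Omega_word.
  by rewrite Phi_proj.
have -> : prj (val l1) y = 0.
  rewrite -py; apply/ffunP => r; rewrite !ffunE.
  case: (cM r r =P val l1) => // e; case: (cM r r =P val (wtgt s l)) => // e'.
  by case: ne; apply: val_inj; rewrite -e -e'.
exact: (linfun0 (@Omega_linear n d)).
Qed.

End Intertwining.

Section ActDot.
Variables (n d : nat) (hn : (0 < n)%N).
Variables (phi : {linear QK n -> QS n d}) (hphi : is_phi phi).
Variables (aleph : {linear dotU n -> QK n}) (haleph : is_aleph aleph).
Local Notation Phi := (Phi phi aleph).

Lemma freeU_sum (a : freeU n) : a = \sum_(m <- msupp a) a@_m *: word m.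
Proof.
rewrite {1}(monalgE a); apply: eq_bigr => m _; apply/malgP => k.
rewrite /word fmK mcoeffZ !mcoeffU; case: (m == k); first by rewrite !mulr1n mulr1.
by rewrite !mulr0n mulr0.
Qed.

(** [actU] expands an arbitrary representative into words, while the right-hand side depends on the
    class of w only. This is what makes the action on the tensor space well defined between weight
    spaces. *)
Lemma Omega_actU l1 l (w : Uj n) (x : VT n d) :
  Omega (projD l1 (actU w (projD l x))) = actST (Phi (dpi l1 l w)) (Omega x).
Proof.
rewrite !projDE /actU /actfree; set a : freeU n := generic_quotient.repr w.
have ew : w = \sum_(m <- msupp a) a@_m *: api (@relatorU n) (word m).
  rewrite -{1}[w](apiK) -/a {1}(freeU_sum a).
  rewrite (big_morph (api (@relatorU n)) (@apiD _ _ _) (lpi0 _)); apply: eq_bigr => m _.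
  exact: apiZ.
rewrite [in RHS]ew (linfun_sum (@dpi_linear _ _ _)) (linfun_sum (Phi_linear phi aleph)).
rewrite (linfun_sum (actST_linearl _)) (linfun_sum (@prj_linear _ _ _)).
rewrite (linfun_sum (@Omega_linear n d)); apply: eq_bigr => m _.
rewrite (linfunZ (@dpi_linear _ _ _)) (linfunZ (Phi_linear phi aleph)).
rewrite (linfunZ (actST_linearl _)) (linfunZ (@prj_linear _ _ _)).
by rewrite (linfunZ (@Omega_linear n d)) (Omega_word_proj hn hphi haleph).
Qed.

Lemma Omega_actdot (u : dotU n) (x : VT n d) : Omega (actdot u x) = actST (Phi u) (Omega x).
Proof.
rewrite /actdot -{3}[u]lpiK; set f : sumU n := generic_quotient.repr u.
rewrite [lpi _ f]lpi_sum (linfun_sum (Phi_linear phi aleph)) (linfun_sum (actST_linearl _)).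
rewrite (linfun_sum (@Omega_linear n d)); apply: eq_bigr => p _.
exact: Omega_actU.
Qed.

End ActDot.

Lemma linear_comp (A B C : lmodType Qv) (f : A -> B) (g : B -> C) :
  linear f -> linear g -> linear (fun x => g (f x)).
Proof. by move=> lf lg a x y; rewrite lf lg. Qed.

Lemma Omega_lift_linear n d (A : lmodType Qv) (f : A -> VT n d) (g : A -> QT n d) :
  (forall x, Omega (f x) = g x) -> linear g -> linear f.
Proof.
move=> e lg a x y; apply: (can_inj (@OmegaK n d)).
by rewrite Omega_linear !e lg.
Qed.

Theorem theorem4p12 (n d : nat) (hn : (0 < n)%N) (hd : (0 < d)%N)
    (phi : {linear QK n -> QS n d}) (hphi : is_phi phi)
    (aleph : {linear dotU n -> QK n}) (haleph : is_aleph aleph) :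
  [/\ linear (@Omega n d) /\ bijective (@Omega n d),
      (forall (u : dotU n) (x : VT n d),
         Omega (actdot u x) = actQK phi (aleph u) (Omega x))
      /\ (forall (x : VT n d) (T : QH d),
         Omega (actVH x T) = actTH (Omega x) T),
      (left_action (@mulK n) (@actQK n d phi)
       /\ right_action (@mulH d) (oneH d) (@actTH n d))
      /\ (left_action (@muldot n) (@actdot n d)
       /\ right_action (@mulH d) (oneH d) (@actVH n d)),
      double_centralizer (@actQK n d phi) (@actTH n d)
    & double_centralizer (@actdot n d) (@actVH n d)].
Proof.
have OI := can_inj (@OmegaK n d); have OL := @Omega_linear n d.
have Od := @Omega_actdot n d hn phi hphi aleph haleph.
have OH := @Omega_actVH n d.
have [phiM phiS _ _] := hphi; have [[aleph' aK Ka] alephM _ _ _] := haleph.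
(* Surjectivity of [phi] lets K replace S in both centralizer statements. *)
have endS (g : QT n d -> QT n d) : linear g -> (forall t h, g (actTH t h) = actTH (g t) h) ->
    exists x, forall t, g t = actST (phi x) t.
  move=> lg cg; have [f hf] := end_H lg (fun t j => cg t (genT j)).
  by have [x ex] := phiS f; exists x => t; rewrite hf ex.
have endH (g : QT n d -> QT n d) : linear g ->
    (forall x t, g (actST (phi x) t) = actST (phi x) (g t)) ->
    exists h, forall t, g t = actTH t h.
  by move=> lg cg; apply: end_S => // f t; have [x <-] := phiS f; apply: cg.
(* Endomorphisms of the tensor space are conjugated by [Omega], so that the lower row inherits its
   double centralizer property from the upper one. *)
have conj (g : VT n d -> VT n d) : linear g ->
    linear (fun t => Omega (g (Omega_inv t))).
  by move=> lg a x y; rewrite Omega_inv_linear lg OL.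
split; [by split; [exact: OL | exact: Omega_bij] | by split | | |].
- split; split.
  + split; [split=> [x|t] |]; first exact: actST_linear.
      by move=> a x y; rewrite /actQK linearP; apply: actST_linearl.
    by move=> x y t; rewrite /actQK phiM; apply: act_mulS.
  + split; [split=> [t|h] | |]; [exact: actTH_linear | exact: actTH_linearl | |].
      by move=> t g h; apply: act_mulH.
    exact: act_oneH.
  + split; [split=> [u|x] |].
    * exact: Omega_lift_linear (Od u) (linear_comp OL (actST_linear _)).
    * apply: Omega_lift_linear (fun u => Od u x) _.
      exact: linear_comp (Phi_linear phi aleph) (actST_linearl _).
    move=> u w x; apply: OI; apply: (etrans (Od _ _)); rewrite (PhiM hphi haleph).
    apply: (etrans (act_mulS _ _ _)); apply: (etrans (congr1 _ (esym (Od w x)))).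
    exact: esym (Od _ _).
  split; [split=> [x|h] | |].
  + exact: Omega_lift_linear (OH x) (actTH_linear _).
  + exact: Omega_lift_linear (fun x => OH x h) (linear_comp OL (actTH_linearl h)).
  + move=> x g h; apply: OI; apply: (etrans (OH _ _)); apply: (etrans (act_mulH _ _ _)).
    by rewrite -(OH x g) -(OH (actVH x g) h).
  by move=> x; apply: OI; apply: (etrans (OH _ _)); apply: act_oneH.
- split=> [x t h|g cg|g cg]; first exact: act_comm.
    by apply: (endS g) => //; apply: linearP.
  by apply: (endH g) => //; apply: linearP.
split=> [u x h|g cg|g cg].
- apply: OI; apply: (etrans (OH _ _)); apply: (etrans (congr1 ((@actTH n d)^~ h) (Od u x))).
  apply: (etrans (act_comm _ _ _)); apply: (etrans (congr1 _ (esym (OH x h)))).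
  exact: esym (Od u (actVH x h)).
- have [t h|x hx] := endS _ (conj g (@linearP _ _ _ _ g)).
    have -> : Omega_inv (actTH t h) = actVH (Omega_inv t) h.
      by apply: OI; rewrite OH !Omega_invK.
    by rewrite cg OH.
  (* An element of K that realizes the transported map is lifted to the modified form by the inverse
     of [aleph]. *)
  exists (aleph' x) => m; apply: OI; rewrite Od /Phi Ka -hx.
  by rewrite OmegaK.
have [x t|h hh] := endH _ (conj g (@linearP _ _ _ _ g)).
  have -> : Omega_inv (actST (phi x) t) = actdot (aleph' x) (Omega_inv t).
    by apply: OI; rewrite Od /Phi Ka !Omega_invK.
  by rewrite cg Od /Phi Ka.
exists h => m; apply: OI; rewrite OH -hh.
by rewrite OmegaK.
Qed.
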